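(* Let $n\ge 1$ and let $(0,0,b_1),\ldots,(0,0,b_n)\in B_1\subset\mathbb{R}^3$ be $n$ points with $b_1<\cdots<b_n$. Then there is a sequence of compact embedded minimal disks $\Sigma_i\subset B_1\subset\mathbb{R}^3$ with $0\in\Sigma_i$, $\partial\Sigma_i\subset\partial B_1$, and $\{(0,0,t):|t|<1\}\subset\Sigma_i$ for every $i$, such that the following hold: (i) $\lim_{i\to\infty}|A_{\Sigma_i}|^2(0,0,b_j)=\infty$ for $j=1,\ldots,n$. (ii) $\sup_i\ \sup_{\Sigma_i\setminus\bigcup_{j}B_{\delta_j}(0,0,b_j)}|A_{\Sigma_i}|^2<\infty$ for all $\delta_1,\ldots,\delta_n>0$. (iii) For every $i$, $\Sigma_i\setminus\{x_3\text{-axis}\}=\Sigma_{1,i}\cup\Sigma_{2,i}$ for multi-valued graphs $\Sigma_{1,i}$ and $\Sigma_{2,i}$. (iv) $\Sigma_i\setminus\bigcup_{j=1}^n\{x_3=b_j\}$ converges, as $i\to\infty$, to $n+1$ embedded minimal disks $\Sigma^1,\ldots,\Sigma^{n+1}$ satisfying the following: (a) $\Sigma^k\subset\{x_3<b_k\}$ for $k=1,\ldots,n$, and $\Sigma^{n+1}\subset\{x_3>b_n\}$. (b) $\overline{\Sigma^1}\setminus\Sigma^1=B_1\cap\{x_3=b_1\}$, $\overline{\Sigma^{n+1}}\setminus\Sigma^{n+1}=B_1\cap\{x_3=b_n\}$, and for $k=2,\ldots,n$, $\overline{\Sigma^k}\setminus\Sigma^k=B_1\cap(\{x_3=b_{k-1}\}\cup\{x_3=b_k\})$.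 (c) For each $k=1,\ldots,n+1$, $\Sigma^k\setminus\{x_3\text{-axis}\}=\Sigma^k_1\cup\Sigma^k_2$ for multi-valued graphs $\Sigma_1^k$ and $\Sigma_2^k$, where each of $\Sigma^1_1,\Sigma^1_2$ spirals into $\{x_3=b_1\}$; each of $\Sigma^{n+1}_1,\Sigma^{n+1}_2$ spirals into $\{x_3=b_n\}$; and for $k=2,\ldots,n$, each of $\Sigma^k_1,\Sigma^k_2$ spirals into both $\{x_3=b_{k-1}\}$ and $\{x_3=b_k\}$.
   Context: $B_r(p)$ denotes the ball of radius $r$ centered at $p$ in $\mathbb{R}^3$, and $B_1=B_1(0)$ is the unit ball; the prescribed points are interior points of the ball, so $|b_j|<1$. For a compact surface with boundary, ''$\Sigma_i\subset B_1$ with $\partial\Sigma_i\subset\partial B_1$'' means that the boundary lies on the unit sphere and the rest of the surface in the open ball. In (iv) the limit disks are considered in the open ball and closures are taken relative to it. $(x_1,x_2,x_3)$ are the coordinates of $\mathbb{R}^3$. $A_\Sigma$ is the second fundamental form of $\Sigma$ and $|A_\Sigma|^2$ is its squared norm. A minimal disk is a minimal surface (zero mean curvature) that is topologically a disk. Multi-valued graphs: let $\mathcal{P}=\{(\rho,\theta):\rho>0,\ \theta\in\mathbb{R}\}$ be the universal cover of the punctured plane $\mathbb{R}^2\setminus\{0\}$ with global polar coordinates. A multi-valued graph is a surface of the form $\{(\rho\cos\theta,\rho\sin\theta,u(\rho,\theta))\}$ for a function $u$ on a connected domain in $\mathcal{P}$. It is an $N$-valued graph when the domain is of the form $\{r\le\rho\le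 s,\ |\theta-\theta_0|\le N\pi\}$ for some $\theta_0$. A multi-valued graph spirals into the plane $\{x_3=c\}$ if it is $\infty$-valued near that plane and accumulates on it: for each $\varepsilon>0$ its part in $\{0<|x_3-c|<\varepsilon\}$ contains $N$-valued graphs for arbitrarily large $N$, and it winds around the $x_3$-axis infinitely many times as $x_3\to c$. Convergence of surfaces is uniform $C^2$ convergence on compact subsets (of the complement of the planes $\{x_3=b_j\}$). *)

(* Defs.v *)
(* Stdlib real numbers with Coquelicot. *)
From Stdlib Require Import Reals List ClassicalEpsilon.
From Coquelicot Require Import Coquelicot.
Open Scope R_scope.

(* Coquelicot's [norm] on a product is the Euclidean norm, so that [norm] on
   [R2] and [R3] is the usual one and [norm (minus p q)] the usual distance. *)
Notation R2 := (R * R)%type.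
Notation R3 := (R * R * R)%type.

Definition x1 (p : R3) : R := fst (fst p).
Definition x2 (p : R3) : R := snd (fst p).
Definition x3 (p : R3) : R := snd p.

Definition dot (p q : R3) : R := x1 p * x1 q + x2 p * x2 q + x3 p * x3 q.

Definition cross (p q : R3) : R3 :=
  (x2 p * x3 q - x3 p * x2 q,
   x3 p * x1 q - x1 p * x3 q,
   x1 p * x2 q - x2 p * x1 q).

Definition unit_ball (p : R3) : Prop := norm p < 1.
Definition ball3 (r : R) (c p : R3) : Prop := norm (minus p c) < r.
Definition x3_axis (p : R3) : Prop := x1 p = 0 /\ x2 p = 0.

Definition closure3 (S : R3 -> Prop) (p : R3) : Prop :=
  forall eps : R, 0 < eps -> exists q : R3, S q /\ ball3 eps p q.

Definition compact3 (K : R3 -> Prop) : Prop :=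
  forall F : (R3 -> Prop) -> Prop,
    (forall U : R3 -> Prop, F U -> open U) ->
    (forall p : R3, K p -> exists U, F U /\ U p) ->
    exists l : list (R3 -> Prop),
      (forall U, In U l -> F U) /\
      (forall p : R3, K p -> exists U, In U l /\ U p).

Definition connected2 (D : R2 -> Prop) : Prop :=
  forall U V : R2 -> Prop,
    open U -> open V ->
    (forall q, D q -> U q \/ V q) ->
    (exists q, D q /\ U q) -> (exists q, D q /\ V q) ->
    exists q, D q /\ U q /\ V q.

Definition pd1 (f : R -> R -> R) (s t : R) : R := Derive (fun s' => f s' t) s.
Definition pd2 (f : R -> R -> R) (s t : R) : R := Derive (fun t' => f s t') t.

(* Only meant for open [U]. *)
Fixpoint Ck (k : nat) (U : R2 -> Prop) (f : R -> R -> R) : Prop :=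
  (forall s t, U (s, t) -> continuity_2d_pt f s t) /\
  match k with
  | O => True
  | S k' =>
      (forall s t, U (s, t) ->
         ex_derive (fun s' => f s' t) s /\ ex_derive (fun t' => f s t') t) /\
      Ck k' U (pd1 f) /\ Ck k' U (pd2 f)
  end.

Definition smooth (U : R2 -> Prop) (f : R -> R -> R) : Prop :=
  forall k : nat, Ck k U f.

Definition patch : Type := R -> R -> R3.

Definition smooth_patch (U : R2 -> Prop) (X : patch) : Prop :=
  smooth U (fun s t => x1 (X s t)) /\
  smooth U (fun s t => x2 (X s t)) /\
  smooth U (fun s t => x3 (X s t)).

Definition PD1 (X : patch) : patch := fun s t =>
  (pd1 (fun s t => x1 (X s t)) s t,
   pd1 (fun s t => x2 (X s t)) s t,
   pd1 (fun s t => x3 (X s t)) s t).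
Definition PD2 (X : patch) : patch := fun s t =>
  (pd2 (fun s t => x1 (X s t)) s t,
   pd2 (fun s t => x2 (X s t)) s t,
   pd2 (fun s t => x3 (X s t)) s t).

Definition regular_at (X : patch) (s t : R) : Prop :=
  cross (PD1 X s t) (PD2 X s t) <> (0, 0, 0).

Definition unit_normal (X : patch) (s t : R) : R3 :=
  scal (/ norm (cross (PD1 X s t) (PD2 X s t))) (cross (PD1 X s t) (PD2 X s t)).

(* Coefficients g11, g12, g22 of the first and h11, h12, h22 of the second
   fundamental form. *)
Definition g11 (X : patch) s t := dot (PD1 X s t) (PD1 X s t).
Definition g12 (X : patch) s t := dot (PD1 X s t) (PD2 X s t).
Definition g22 (X : patch) s t := dot (PD2 X s t) (PD2 X s t).
Definition h11 (X : patch) s t := dot (PD1 (PD1 X) s t) (unit_normal X s t).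
Definition h12 (X : patch) s t := dot (PD1 (PD2 X) s t) (unit_normal X s t).
Definition h22 (X : patch) s t := dot (PD2 (PD2 X) s t) (unit_normal X s t).
Definition gdet (X : patch) s t := g11 X s t * g22 X s t - g12 X s t ^ 2.

(* Entries of the shape operator a = g^-1 h. *)
Definition a11 (X : patch) s t :=
  (g22 X s t * h11 X s t - g12 X s t * h12 X s t) / gdet X s t.
Definition a12 (X : patch) s t :=
  (g22 X s t * h12 X s t - g12 X s t * h22 X s t) / gdet X s t.
Definition a21 (X : patch) s t :=
  (g11 X s t * h12 X s t - g12 X s t * h11 X s t) / gdet X s t.
Definition a22 (X : patch) s t :=
  (g11 X s t * h22 X s t - g12 X s t * h12 X s t) / gdet X s t.

Definition mean_curvature (X : patch) (s t : R) : R :=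
  (a11 X s t + a22 X s t) / 2.

(* |A|^2 = g^{ik} g^{jl} h_ij h_kl = tr (a^2). *)
Definition sqnorm_A (X : patch) (s t : R) : R :=
  a11 X s t ^ 2 + 2 * a12 X s t * a21 X s t + a22 X s t ^ 2.

Definition image (K : R2 -> Prop) (X : patch) (p : R3) : Prop :=
  exists s t, K (s, t) /\ X s t = p.

Definition injective_on (K : R2 -> Prop) (X : patch) : Prop :=
  forall s t s' t', K (s, t) -> K (s', t') -> X s t = X s' t' ->
    s = s' /\ t = t'.

Definition inverse_continuous_on (K : R2 -> Prop) (X : patch) : Prop :=
  forall s t, K (s, t) -> forall eps : R, 0 < eps ->
    exists delta : R, 0 < delta /\
      forall s' t', K (s', t') -> norm (minus (X s' t') (X s t)) < delta ->
        norm (minus (s', t') (s, t)) < eps.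

Definition minimal_immersion_on (K : R2 -> Prop) (X : patch) : Prop :=
  forall s t, K (s, t) -> regular_at X s t /\ mean_curvature X s t = 0.

Definition open_disk (q : R2) : Prop := norm q < 1.
Definition closed_disk (q : R2) : Prop := norm q <= 1.
Definition circle (q : R2) : Prop := norm q = 1.

(* [X] parametrizes a compact embedded minimal disk, smooth up to its boundary;
   the disk is [image closed_disk X], with boundary [image circle X].  Injectivity
   suffices for an embedding, the closed disk being compact. *)
Definition compact_embedded_minimal_disk (X : patch) : Prop :=
  (exists U : R2 -> Prop,
     open U /\ (forall q, closed_disk q -> U q) /\ smooth_patch U X) /\
  minimal_immersion_on closed_disk X /\
  injective_on closed_disk X.

(* [X] parametrizes an embedded minimal disk without boundary,
   [image open_disk X]. *)
Definition open_embedded_minimal_disk (X : patch) : Prop :=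
  smooth_patch open_disk X /\
  minimal_immersion_on open_disk X /\
  injective_on open_disk X /\
  inverse_continuous_on open_disk X.

(* |A|^2 of the compact disk [image closed_disk X] at its point [p], that is, at
   the unique parameter of [p]; meaningless if [p] is not on the disk. *)
Definition sqnorm_A_at (X : patch) (p : R3) : R :=
  let q := epsilon (inhabits (0, 0))
             (fun q : R2 => closed_disk q /\ X (fst q) (snd q) = p) in
  sqnorm_A X (fst q) (snd q).

(* [(rho, theta)], with [rho > 0], are the coordinates of the universal cover of
   the punctured plane. *)
Definition mv_point (u : R -> R -> R) (rho theta : R) : R3 :=
  (rho * cos theta, rho * sin theta, u rho theta).

Definition mv_surface (D : R2 -> Prop) (u : R -> R -> R) (p : R3) : Prop :=
  exists rho theta, D (rho, theta) /\ mv_point u rho theta = p.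

(* A domain need not be open (compact surfaces have boundary points), but it is
   required to have dense interior, and [u] to extend smoothly to an open set.
   As all the graphs considered are parts of embedded surfaces, they are required
   to be embedded themselves: distinct sheets are disjoint. *)
Definition multivalued_graph (D : R2 -> Prop) (u : R -> R -> R) : Prop :=
  (exists q, D q) /\
  connected2 D /\
  (forall rho theta, D (rho, theta) -> 0 < rho) /\
  (forall q, D q -> forall V : R2 -> Prop, open V -> V q ->
     exists W : R2 -> Prop, open W /\ (forall q', W q' -> D q') /\
       exists q', V q' /\ W q') /\
  (exists W : R2 -> Prop, open W /\ (forall q, D q -> W q) /\ smooth W u) /\
  injective_on D (mv_point u).

(* The part of the graph in 0 < |x3 - c| < eps contains an N-valued graph. *)
Definition contains_N_valued (D : R2 -> Prop) (u : R -> R -> R)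
    (N : nat) (c eps : R) : Prop :=
  exists r s theta0 : R, 0 < r < s /\
    forall rho theta, r <= rho <= s -> Rabs (theta - theta0) <= INR N * PI ->
      D (rho, theta) /\ 0 < Rabs (u rho theta - c) < eps.

(* Winding infinitely often: theta tends to +oo, or to -oo, as x3 tends to c. *)
Definition winds_infinitely (D : R2 -> Prop) (u : R -> R -> R) (c : R) : Prop :=
  (forall M : R, exists eps : R, 0 < eps /\ forall rho theta,
     D (rho, theta) -> 0 < Rabs (u rho theta - c) < eps -> M < theta) \/
  (forall M : R, exists eps : R, 0 < eps /\ forall rho theta,
     D (rho, theta) -> 0 < Rabs (u rho theta - c) < eps -> theta < M).

(* Spiralling inside the open unit ball. *)
Definition spirals_into (D : R2 -> Prop) (u : R -> R -> R) (c : R) : Prop :=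
  (forall eps : R, 0 < eps -> forall N : nat, contains_N_valued D u N c eps) /\
  (forall p : R3, unit_ball p -> x3 p = c -> closure3 (mv_surface D u) p) /\
  winds_infinitely D u c.

Definition off_axis_two_graphs (S : R3 -> Prop)
    (E1 : R2 -> Prop) (u1 : R -> R -> R)
    (E2 : R2 -> Prop) (u2 : R -> R -> R) : Prop :=
  multivalued_graph E1 u1 /\ multivalued_graph E2 u2 /\
  forall p : R3,
    (S p /\ ~ x3_axis p) <-> (mv_surface E1 u1 p \/ mv_surface E2 u2 p).

(* A box with orthonormal axes: the points [ctr + s ax1 + t ax2 + z ax3] with
   |s|, |t| < wid and |z| < hei. *)
Record box : Type := Box {
  ctr : R3; ax1 : R3; ax2 : R3; ax3 : R3; wid : posreal; hei : posreal }.

Definition orthonormal_box (Q : box) : Prop :=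
  dot (ax1 Q) (ax1 Q) = 1 /\ dot (ax2 Q) (ax2 Q) = 1 /\ dot (ax3 Q) (ax3 Q) = 1 /\
  dot (ax1 Q) (ax2 Q) = 0 /\ dot (ax1 Q) (ax3 Q) = 0 /\ dot (ax2 Q) (ax3 Q) = 0.

Definition box_point (Q : box) (s t z : R) : R3 :=
  plus (ctr Q) (plus (scal s (ax1 Q)) (plus (scal t (ax2 Q)) (scal z (ax3 Q)))).

Definition base (Q : box) (q : R2) : Prop :=
  Rabs (fst q) < wid Q /\ Rabs (snd q) < wid Q.

Definition in_box (Q : box) (p : R3) : Prop :=
  exists s t z, base Q (s, t) /\ Rabs z < hei Q /\ p = box_point Q s t z.

Definition C2_graph_in_box (Q : box) (S : R3 -> Prop) (w : R -> R -> R) : Prop :=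
  Ck 2 (base Q) w /\
  (forall s t, base Q (s, t) -> Rabs (w s t) < hei Q) /\
  (forall s t z, base Q (s, t) -> Rabs z < hei Q ->
     (S (box_point Q s t z) <-> z = w s t)).

Definition C2_close (Q : box) (eps : R) (w w' : R -> R -> R) : Prop :=
  forall s t, base Q (s, t) ->
    Rabs (w s t - w' s t) < eps /\
    Rabs (pd1 w s t - pd1 w' s t) < eps /\
    Rabs (pd2 w s t - pd2 w' s t) < eps /\
    Rabs (pd1 (pd1 w) s t - pd1 (pd1 w') s t) < eps /\
    Rabs (pd1 (pd2 w) s t - pd1 (pd2 w') s t) < eps /\
    Rabs (pd2 (pd2 w) s t - pd2 (pd2 w') s t) < eps.

Definition C2_converges_in_box (Q : box)
    (Sigma : nat -> R3 -> Prop) (S : R3 -> Prop) : Prop :=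
  exists (w_ : nat -> R -> R -> R) (w : R -> R -> R),
    C2_graph_in_box Q S w /\
    eventually (fun i => C2_graph_in_box Q (Sigma i) (w_ i)) /\
    forall eps : R, 0 < eps -> eventually (fun i => C2_close Q eps (w_ i) w).

(* Uniform C^2 convergence of surfaces on compact subsets of the open set [O]:
   every compact K in O is, as far as the surfaces are concerned, covered by
   finitely many boxes in each of which the limit and almost all the surfaces are
   graphs over the same square, the graph functions converging uniformly with
   their derivatives of order at most 2. *)
Definition C2_converges_on_compacts (O : R3 -> Prop)
    (Sigma : nat -> R3 -> Prop) (S : R3 -> Prop) : Prop :=
  forall K : R3 -> Prop, compact3 K -> (forall p, K p -> O p) ->
    exists l : list box,
      (forall Q, In Q l -> orthonormal_box Q /\ C2_converges_in_box Q Sigma S) /\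
      eventually (fun i => forall p, K p -> S p \/ Sigma i p ->
        exists Q, In Q l /\ in_box Q p).

Definition off_planes (n : nat) (b : nat -> R) (p : R3) : Prop :=
  forall j : nat, (1 <= j <= n)%nat -> x3 p <> b j.

(* [c] is the height of one of the planes among x3 = b_1, ..., x3 = b_n that bound
   the k-th limit disk: b_1 for k = 1, b_n for k = n+1, and both b_(k-1) and b_k
   for 2 <= k <= n. *)
Definition bounding_height (n : nat) (b : nat -> R) (k : nat) (c : R) : Prop :=
  ((k <= n)%nat /\ c = b k) \/ ((2 <= k)%nat /\ c = b (k - 1)%nat).

(* Main.v *)
Require Import Defs.
From Stdlib Require Import ZArith Reals Ranalysis5 Lra Lia List Classical ClassicalEpsilon FunctionalExtensionality.
From Coquelicot Require Import Coquelicot.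
Open Scope R_scope.

(** For a holomorphic function [h = u + i v] that is real on the real axis, the
    map [(x, y) |-> (int_0^y cosh v cos u dy, int_0^y cosh v sin u dy, x)] is a
    minimal immersion with [|A|^2 = 2 |h'|^2 / cosh^4 v].  The segment [y = 0] is
    mapped to the x3-axis, and the slice at height [x] is a curve through the
    axis whose tangent has the angle [u (x, y)].  If [u] varies little along the
    slices, each slice is nearly straight, so that the surface consists of nearly
    straight lines that rotate about the axis as the height grows, at the rate
    [h' (x)].

    The surfaces of the theorem belong to
      [h' (z) = L * sum_j 1 / ((z - b_j)^2 + a^2)], with [a = 1 / (4 (i + 1))],
    and their limit to [a = 0].  Let [mu (x)^4 = sum_j 1 / ((x - b_j)^2 + a^2)].
    On the strip where [|y| < c / mu (x)^3] the variation of [u] along a slice is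
    at most of order [mu^6 y^2], hence small, while [v] grows to the order of
    [mu]; since [cosh v >= v^3 / 54], the slices reach the unit sphere if [L] is
    large ([family_data]).  No slice has to be continued further, because the
    signed distance [t] to the axis increases along it: the height [s] and [t]
    are parameters of the surface ([polar_patch]), its point with parameters
    [(s, t)] has the norm of [(s, t)], and the closed unit disk of parameters is
    mapped into the closed ball, circle to sphere.  This is the compact disk.

    At [(0, 0, b_j)] the curvature is of order [a^-4] ([fam_curv_pole]).  At
    distance [d] from the axis [cosh v] is at least of order [d mu^3], which
    beats [|h'|^2], of order [mu^8]; and away from the heights [b_j] the function
    [h'] is bounded ([fam_curv_off_axis], [fam_curv_off_heights]).

    The Jacobian determinant of the horizontal components of the immersion has
    the sign of [- y], so off the axis the polar angle of the point with
    parameters [(s, t)] increases with [s] ([polar_angle_increasing]), and each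
    of the halves [t > 0] and [t < 0] is a multi-valued graph
    ([multivalued_graph_polar]).  For [a = 0] the real primitive of [h'] is
    [- L * sum_j 1 / (x - b_j)], which diverges on both sides of each [b_j]; the
    polar angle stays close to it, and the graphs spiral into the planes
    ([polar_spirals]).  The limit disks are the parts of this surface between
    consecutive planes, parametrized over the open disk by means of [lens_s] and
    [lens_t].

    For [a > 0] the real primitive is [L / a * sum_j atan ((x - b_j) / a)].  It
    has no limit as [a] tends to 0, but for [a = 1 / (4 k)] with an integer [k] it
    differs by a multiple of [2 PI], on both sides of each [b_j], from a function
    that tends to the primitive for [a = 0] ([axis_term_mod]).  As only [cos u]
    and [sin u] matter, the surfaces converge off the planes.  Near a point of the
    limit all of them are graphs over one square in a vertical plane, whose
    derivatives up to the second order are explicit in [u], [v], [h']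
    ([sheet_graphs]).  Near any other point none of them passes, because a point
    of a surface is determined up to two candidates by its height and its
    distance to the axis ([empty_near]). *)

(** * Functions of class C^k of two variables *)

Lemma open_locally_2d (U : R2 -> Prop) s t :
  open U -> U (s, t) -> locally_2d (fun x y => U (x, y)) s t.
Proof.
  intros HU H. apply locally_2d_locally.
  generalize (HU _ H). apply filter_imp. intros [x y]; exact (fun h => h).
Qed.

Lemma locally_2d_open (U : R2 -> Prop) :
  (forall s t, U (s, t) -> locally_2d (fun x y => U (x, y)) s t) -> open U.
Proof.
  intros H [s t] Hst. specialize (H s t Hst).
  apply locally_2d_locally in H. revert H. apply filter_imp.
  intros [x y]; exact (fun h => h).
Qed.

Lemma is_derive_const_R (c x : R) : is_derive (fun _ : R => c) x 0.
Proof. apply (is_derive_const (K := R_AbsRing) (V := R_NormedModule)). Qed.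

Lemma is_derive_id_R (x : R) : is_derive (fun y : R => y) x 1.
Proof. apply (is_derive_id (K := R_AbsRing)). Qed.

Lemma is_derive_plus_R (f g : R -> R) x a b :
  is_derive f x a -> is_derive g x b ->
  is_derive (fun x => f x + g x) x (a + b).
Proof. apply (is_derive_plus (K := R_AbsRing) (V := R_NormedModule)). Qed.

Definition has_pds (f : R -> R -> R) s t (l1 l2 : R) : Prop :=
  is_derive (fun x => f x t) s l1 /\ is_derive (fun y => f s y) t l2.

Lemma has_pds_ext_loc (U : R2 -> Prop) f g s t l1 l2 :
  open U -> U (s, t) -> (forall x y, U (x, y) -> f x y = g x y) ->
  has_pds f s t l1 l2 -> has_pds g s t l1 l2.
Proof.
  intros HU H E [H1 H2]. pose proof (open_locally_2d _ _ _ HU H) as L.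
  split.
  - apply (is_derive_ext_loc (fun x => f x t)); [|exact H1].
    apply locally_2d_1d_const_y in L. revert L. apply filter_imp; auto.
  - apply (is_derive_ext_loc (fun y => f s y)); [|exact H2].
    apply locally_2d_1d_const_x in L. revert L. apply filter_imp; auto.
Qed.

Lemma has_pds_eq f s t l1 l2 :
  has_pds f s t l1 l2 -> pd1 f s t = l1 /\ pd2 f s t = l2.
Proof.
  intros [H1 H2]. split; apply is_derive_unique; assumption.
Qed.

Lemma has_pds_val f s t l1 l2 m1 m2 :
  has_pds f s t l1 l2 -> l1 = m1 -> l2 = m2 -> has_pds f s t m1 m2.
Proof. intros H -> ->; exact H. Qed.

Lemma Ck_continuity k U f s t : Ck k U f -> U (s, t) -> continuity_2d_pt f s t.
Proof. destruct k; intros [H _]; apply H. Qed.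

Lemma Ck_has_pds k U f s t :
  Ck (S k) U f -> U (s, t) -> has_pds f s t (pd1 f s t) (pd2 f s t).
Proof.
  intros (_ & H & _) Hst. destruct (H s t Hst).
  split; apply Derive_correct; assumption.
Qed.

Lemma Ck_ext k : forall U f g, open U ->
  (forall s t, U (s, t) -> f s t = g s t) -> Ck k U f -> Ck k U g.
Proof.
  induction k as [|k IH]; intros U f g HU E Hf.
  - split; [|exact I]. intros s t H.
    apply continuity_2d_pt_ext_loc with f.
    + generalize (open_locally_2d _ _ _ HU H). intros [d Hd]; exists d; auto.
    + destruct Hf as [Hf _]; auto.
  - assert (P : forall s t, U (s, t) -> has_pds g s t (pd1 f s t) (pd2 f s t)).
    { intros s t H. apply has_pds_ext_loc with U f; auto.
      eapply Ck_has_pds; eauto. }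
    destruct Hf as (Hc & Hd & H1 & H2).
    split; [|split; [|split]].
    + intros s t H. apply continuity_2d_pt_ext_loc with f; auto.
      generalize (open_locally_2d _ _ _ HU H). intros [d Hd']; exists d; auto.
    + intros s t H. destruct (P s t H) as [P1 P2]. split; eexists; eassumption.
    + apply (IH U (pd1 f)); auto. intros s t H.
      destruct (has_pds_eq _ _ _ _ _ (P s t H)); auto.
    + apply (IH U (pd2 f)); auto. intros s t H.
      destruct (has_pds_eq _ _ _ _ _ (P s t H)); auto.
Qed.

(** One continuous partial derivative is enough for differentiability. *)
Lemma differentiable_of_pds U f f1 f2 s t :
  open U -> U (s, t) ->
  (forall x y, U (x, y) -> has_pds f x y (f1 x y) (f2 x y)) ->
  continuity_2d_pt f1 s t ->
  differentiable_pt_lim f s t (f1 s t) (f2 s t).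
Proof.
  intros HU H Hd Hc. apply filterdiff_differentiable_pt_lim.
  apply (is_derive_filterdiff f s t f1 (f2 s t)).
  - apply (filter_imp (fun q : R2 => U q)).
    + intros [x y] Hxy. apply (Hd x y Hxy).
    + apply HU, H.
  - apply (Hd s t H).
  - apply (continuity_2d_pt_filterlim f1 s t). exact Hc.
Qed.

(** [Ck] refers to the functions [pd1 f] and [pd2 f], which are arbitrary outside
    [U]; formulas for the derivatives that are valid in [U] suffice. *)
Lemma Ck_S_intro k U f f1 f2 :
  open U ->
  (forall s t, U (s, t) -> has_pds f s t (f1 s t) (f2 s t)) ->
  Ck k U f1 -> Ck k U f2 -> Ck (S k) U f.
Proof.
  intros HU Hd H1 H2. split; [|split; [|split]].
  - intros s t H. apply differentiable_continuity_pt.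
    exists (f1 s t), (f2 s t).
    apply differentiable_of_pds with U; auto.
    apply Ck_continuity with k U; auto.
  - intros s t H. destruct (Hd s t H). split; eexists; eassumption.
  - apply Ck_ext with f1; auto. intros s t H.
    destruct (has_pds_eq _ _ _ _ _ (Hd s t H)); auto.
  - apply Ck_ext with f2; auto. intros s t H.
    destruct (has_pds_eq _ _ _ _ _ (Hd s t H)); auto.
Qed.

Lemma Ck_pred k : forall U f, Ck (S k) U f -> Ck k U f.
Proof.
  induction k as [|k IH]; intros U f (Hc & Hd & H1 & H2); split; auto.
Qed.

Lemma Ck_le k m U f : (k <= m)%nat -> Ck m U f -> Ck k U f.
Proof. induction 1; auto. intros H'. apply IHle, Ck_pred, H'. Qed.

Lemma Ck_sub k : forall (U V : R2 -> Prop) f,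
  (forall q, U q -> V q) -> Ck k V f -> Ck k U f.
Proof.
  induction k as [|k IH]; intros U V f S [Hc H]; split; auto.
  destruct H as (Hd & H1 & H2). eauto 10.
Qed.

Lemma Ck_differentiable k U f s t :
  open U -> Ck (S k) U f -> U (s, t) ->
  differentiable_pt_lim f s t (pd1 f s t) (pd2 f s t).
Proof.
  intros HU Hf H. apply differentiable_of_pds with U; auto.
  - intros x y Hxy. apply Ck_has_pds with k U; auto.
  - destruct Hf as (_ & _ & H1 & _). apply Ck_continuity with k U; auto.
Qed.

Lemma smooth_has_pds U f s t :
  smooth U f -> U (s, t) -> has_pds f s t (pd1 f s t) (pd2 f s t).
Proof. intros H. apply Ck_has_pds with (k := 0%nat). apply H. Qed.

Lemma smooth_pd U f : smooth U f -> smooth U (pd1 f) /\ smooth U (pd2 f).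
Proof. intros H. split; intros k; apply (H (S k)). Qed.

Lemma smooth_intro U f f1 f2 :
  open U ->
  (forall s t, U (s, t) -> has_pds f s t (f1 s t) (f2 s t)) ->
  smooth U f1 -> smooth U f2 -> smooth U f.
Proof.
  intros HU Hd H1 H2 k. apply Ck_pred. apply Ck_S_intro with f1 f2; auto.
Qed.

Lemma smooth_continuity U f s t :
  smooth U f -> U (s, t) -> continuity_2d_pt f s t.
Proof. intros H. apply Ck_continuity with 0%nat. apply H. Qed.

Lemma Ck_const k : forall U c, Ck k U (fun _ _ => c).
Proof.
  assert (E : forall c, pd1 (fun _ _ => c) = (fun _ _ => 0) /\
                        pd2 (fun _ _ => c) = (fun _ _ => 0)).
  { intros c; split; do 2 (apply functional_extensionality; intro);
      unfold pd1, pd2; apply Derive_const. }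
  induction k as [|k IH]; intros U c; split;
    try (intros; apply continuity_2d_pt_const); auto.
  destruct (E c) as [-> ->]. repeat split; auto; apply ex_derive_const.
Qed.

Lemma Ck_fst k U : open U -> Ck k U (fun s _ => s).
Proof.
  intros HU. destruct k.
  - split; auto. intros; apply continuity_2d_pt_id1.
  - apply Ck_S_intro with (fun _ _ => 1) (fun _ _ => 0); auto using Ck_const.
    intros; split; [apply is_derive_id_R|apply is_derive_const_R].
Qed.

Lemma Ck_snd k U : open U -> Ck k U (fun _ t => t).
Proof.
  intros HU. destruct k.
  - split; auto. intros; apply continuity_2d_pt_id2.
  - apply Ck_S_intro with (fun _ _ => 0) (fun _ _ => 1); auto using Ck_const.
    intros; split; [apply is_derive_const_R|apply is_derive_id_R].
Qed.

Lemma has_pds_plus f g s t a1 a2 b1 b2 :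
  has_pds f s t a1 a2 -> has_pds g s t b1 b2 ->
  has_pds (fun s t => f s t + g s t) s t (a1 + b1) (a2 + b2).
Proof.
  intros [H1 H2] [H3 H4]. split.
  - apply (is_derive_plus_R (fun x => f x t) (fun x => g x t)); auto.
  - apply (is_derive_plus_R (fun y => f s y) (fun y => g s y)); auto.
Qed.

Lemma is_derive_mult_R (f g : R -> R) x a b :
  is_derive f x a -> is_derive g x b ->
  is_derive (fun x => f x * g x) x (a * g x + f x * b).
Proof.
  intros Ha Hb. apply (is_derive_mult (K := R_AbsRing) f g); auto.
  intros; apply Rmult_comm.
Qed.

Lemma has_pds_mult f g s t a1 a2 b1 b2 :
  has_pds f s t a1 a2 -> has_pds g s t b1 b2 ->
  has_pds (fun s t => f s t * g s t) s t
    (a1 * g s t + f s t * b1) (a2 * g s t + f s t * b2).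
Proof.
  intros [H1 H2] [H3 H4]. split.
  - apply (is_derive_mult_R (fun x => f x t) (fun x => g x t)); auto.
  - apply (is_derive_mult_R (fun y => f s y) (fun y => g s y)); auto.
Qed.

Lemma Ck_plus k : forall U f g, open U -> Ck k U f -> Ck k U g ->
  Ck k U (fun s t => f s t + g s t).
Proof.
  induction k as [|k IH]; intros U f g HU Hf Hg.
  - split; auto. intros. apply continuity_2d_pt_plus;
      eapply Ck_continuity; eauto.
  - pose proof Hf as (_ & _ & ? & ?). pose proof Hg as (_ & _ & ? & ?).
    apply Ck_S_intro with (fun s t => pd1 f s t + pd1 g s t)
      (fun s t => pd2 f s t + pd2 g s t); auto.
    intros. apply has_pds_plus; eapply Ck_has_pds; eauto.
Qed.

Lemma Ck_mult k : forall U f g, open U -> Ck k U f -> Ck k U g ->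
  Ck k U (fun s t => f s t * g s t).
Proof.
  induction k as [|k IH]; intros U f g HU Hf Hg.
  - split; auto. intros. apply continuity_2d_pt_mult;
      eapply Ck_continuity; eauto.
  - pose proof Hf as (_ & _ & ? & ?). pose proof Hg as (_ & _ & ? & ?).
    apply Ck_S_intro with (fun s t => pd1 f s t * g s t + f s t * pd1 g s t)
      (fun s t => pd2 f s t * g s t + f s t * pd2 g s t); auto.
    + intros. apply has_pds_mult; eapply Ck_has_pds; eauto.
    + apply Ck_plus; auto; apply IH; auto; apply Ck_pred; auto.
    + apply Ck_plus; auto; apply IH; auto; apply Ck_pred; auto.
Qed.

Lemma Ck_opp k U f : open U -> Ck k U f -> Ck k U (fun s t => - f s t).
Proof.
  intros HU Hf. apply Ck_ext with (fun s t => (-1) * f s t); auto.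
  - intros; ring.
  - apply Ck_mult; auto using Ck_const.
Qed.

Lemma Ck_minus k U f g : open U -> Ck k U f -> Ck k U g ->
  Ck k U (fun s t => f s t - g s t).
Proof. intros. apply Ck_plus; auto. apply Ck_opp; auto. Qed.

Lemma Ck_inv k : forall U f, open U -> (forall s t, U (s, t) -> f s t <> 0) ->
  Ck k U f -> Ck k U (fun s t => / f s t).
Proof.
  induction k as [|k IH]; intros U f HU H0 Hf.
  - split; auto. intros. apply continuity_2d_pt_inv; auto.
    eapply Ck_continuity; eauto.
  - pose proof Hf as (_ & _ & ? & ?).
    pose proof (IH U f HU H0 (Ck_pred _ _ _ Hf)) as Hi.
    apply Ck_S_intro with (fun s t => - pd1 f s t * (/ f s t * / f s t))
      (fun s t => - pd2 f s t * (/ f s t * / f s t)); auto.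
    + intros s t Hst. destruct (Ck_has_pds _ _ _ _ _ Hf Hst) as [D1 D2].
      specialize (H0 _ _ Hst).
      split.
      * replace (- pd1 f s t * (/ f s t * / f s t))
          with (- pd1 f s t / (f s t) ^ 2) by (field; auto).
        apply (is_derive_inv (fun x => f x t)); auto.
      * replace (- pd2 f s t * (/ f s t * / f s t))
          with (- pd2 f s t / (f s t) ^ 2) by (field; auto).
        apply (is_derive_inv (fun x => f s x)); auto.
    + apply Ck_mult; auto. apply Ck_opp; auto. apply Ck_mult; auto.
    + apply Ck_mult; auto. apply Ck_opp; auto. apply Ck_mult; auto.
Qed.

Lemma has_pds_comp f g h s t a b g1 g2 h1 h2 :
  differentiable_pt_lim f (g s t) (h s t) a b ->
  has_pds g s t g1 g2 -> has_pds h s t h1 h2 ->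
  has_pds (fun s t => f (g s t) (h s t)) s t
    (a * g1 + b * h1) (a * g2 + b * h2).
Proof.
  intros Hf [G1 G2] [H1 H2]. split; apply is_derive_Reals.
  - apply (derivable_pt_lim_comp_2d f (fun x => g x t) (fun x => h x t));
      auto; apply is_derive_Reals; auto.
  - apply (derivable_pt_lim_comp_2d f (fun x => g s x) (fun x => h s x));
      auto; apply is_derive_Reals; auto.
Qed.

Lemma continuity_2d_comp f g h s t :
  continuity_2d_pt f (g s t) (h s t) ->
  continuity_2d_pt g s t -> continuity_2d_pt h s t ->
  continuity_2d_pt (fun s t => f (g s t) (h s t)) s t.
Proof.
  intros Hf Hg Hh eps. destruct (Hf eps) as [d Hd].
  destruct (Hg d) as [d1 H1]. destruct (Hh d) as [d2 H2].
  exists (mkposreal _ (Rmin_pos _ _ (cond_pos d1) (cond_pos d2))). simpl.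
  intros u v Hu Hv. apply Hd.
  - apply H1; eapply Rlt_le_trans; eauto using Rmin_l.
  - apply H2; eapply Rlt_le_trans; eauto using Rmin_r.
Qed.

Lemma Ck_comp k : forall (U W : R2 -> Prop) f g h, open U -> open W ->
  (forall s t, U (s, t) -> W (g s t, h s t)) ->
  Ck k W f -> Ck k U g -> Ck k U h -> Ck k U (fun s t => f (g s t) (h s t)).
Proof.
  induction k as [|k IH]; intros U W f g h HU HW M Hf Hg Hh.
  - split; auto. intros s t H. apply continuity_2d_comp.
    + apply Ck_continuity with 0%nat W; auto.
    + apply Ck_continuity with 0%nat U; auto.
    + apply Ck_continuity with 0%nat U; auto.
  - pose proof Hf as (_ & _ & F1 & F2). pose proof Hg as (_ & _ & G1 & G2).
    pose proof Hh as (_ & _ & H1 & H2).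
    pose proof (Ck_pred _ _ _ Hg). pose proof (Ck_pred _ _ _ Hh).
    apply Ck_S_intro with
      (fun s t => pd1 f (g s t) (h s t) * pd1 g s t +
                  pd2 f (g s t) (h s t) * pd1 h s t)
      (fun s t => pd1 f (g s t) (h s t) * pd2 g s t +
                  pd2 f (g s t) (h s t) * pd2 h s t); auto.
    + intros s t Hst. apply has_pds_comp.
      * apply Ck_differentiable with k W; auto.
      * eapply Ck_has_pds; eauto.
      * eapply Ck_has_pds; eauto.
    + apply Ck_plus; auto; apply Ck_mult; auto; apply (IH U W); auto.
    + apply Ck_plus; auto; apply Ck_mult; auto; apply (IH U W); auto.
Qed.

Lemma open_true : open (fun _ : R2 => True).
Proof. intros q _. apply filter_true. Qed.

Lemma open_fst (P : R -> Prop) :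
  open P -> open (fun q : R2 => P (fst q)).
Proof.
  intros HP. apply (open_comp (fst : R2 -> R)); auto.
  intros. apply continuous_fst.
Qed.

(** One-variable functions as functions of two variables that ignore the second
    one, so that the composition of smooth functions applies to them. *)
Definition smooth1 (P : R -> Prop) (phi : R -> R) : Prop :=
  smooth (fun q => P (fst q)) (fun s _ => phi s).

Lemma smooth1_comp (P : R -> Prop) phi U f :
  open U -> open P -> smooth1 P phi -> (forall s t, U (s, t) -> P (f s t)) ->
  smooth U f -> smooth U (fun s t => phi (f s t)).
Proof.
  intros HU HP Hphi M Hf k.
  apply (Ck_comp k U (fun q => P (fst q)) (fun s _ => phi s) f (fun _ _ => 0));
    auto using Ck_const, open_fst.
Qed.

(** [phi'] may be an expression in [phi], as for [exp] and [sqrt]: the induction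
    on the order of differentiability bootstraps. *)
Lemma smooth1_intro (P : R -> Prop) phi phi' :
  open P -> (forall x, P x -> is_derive phi x (phi' x)) ->
  (forall k, Ck k (fun q => P (fst q)) (fun s _ => phi s) ->
             Ck k (fun q => P (fst q)) (fun s _ => phi' s)) ->
  smooth1 P phi.
Proof.
  intros HP Hd Hk k. induction k as [|k IH].
  - split; auto. intros s t Hs.
    apply (continuity_1d_2d_pt_comp phi (fun s _ => s)).
    + apply derivable_continuous_pt. exists (phi' s).
      apply is_derive_Reals. apply Hd, Hs.
    + apply continuity_2d_pt_id1.
  - apply Ck_S_intro with (fun s _ => phi' s) (fun _ _ => 0);
      auto using open_fst, Ck_const.
    intros s t Hs. split; [apply Hd, Hs|apply is_derive_const_R].
Qed.

Lemma open_R_true : open (fun _ : R => True).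
Proof. intros q _. apply filter_true. Qed.

Lemma smooth1_exp : smooth1 (fun _ => True) exp.
Proof.
  apply smooth1_intro with exp; auto using open_R_true, is_derive_exp.
Qed.

Lemma is_derive_sin_R x : is_derive sin x (cos x).
Proof. apply is_derive_Reals, derivable_pt_lim_sin. Qed.
Lemma is_derive_cos_R x : is_derive cos x (- sin x).
Proof. apply is_derive_Reals, derivable_pt_lim_cos. Qed.
Lemma is_derive_sinh_R x : is_derive sinh x (cosh x).
Proof. apply is_derive_Reals, derivable_pt_lim_sinh. Qed.
Lemma is_derive_cosh_R x : is_derive cosh x (sinh x).
Proof. apply is_derive_Reals, derivable_pt_lim_cosh. Qed.
Lemma is_derive_atan_R x : is_derive atan x (/ (1 + x ^ 2)).
Proof. apply is_derive_Reals, derivable_pt_lim_atan. Qed.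

Lemma smooth1_sin_cos :
  smooth1 (fun _ => True) sin /\ smooth1 (fun _ => True) cos.
Proof.
  assert (H : forall k, Ck k (fun _ => True) (fun s _ => sin s) /\
                        Ck k (fun _ => True) (fun s _ => cos s)).
  { induction k as [|k [IH1 IH2]].
    - split; (split; [|exact I]); intros s t _;
        [apply (continuity_1d_2d_pt_comp sin (fun s _ => s))
        |apply (continuity_1d_2d_pt_comp cos (fun s _ => s))];
        try apply continuity_2d_pt_id1; [apply continuity_sin|apply continuity_cos].
    - split.
      + apply Ck_S_intro with (fun s _ => cos s) (fun _ _ => 0);
          auto using open_true, Ck_const.
        intros; split; [apply is_derive_sin_R|apply is_derive_const_R].
      + apply Ck_S_intro with (fun s _ => - sin s) (fun _ _ => 0);
          auto using open_true, Ck_const.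
        * intros; split; [apply is_derive_cos_R|apply is_derive_const_R].
        * apply Ck_opp; auto using open_true. }
  split; intros k; apply H.
Qed.

Lemma smooth1_atan : smooth1 (fun _ => True) atan.
Proof.
  apply smooth1_intro with (fun x => / (1 + x ^ 2)); auto using open_R_true, is_derive_atan_R.
  intros k _. apply (Ck_inv k (fun _ => True) (fun s _ => 1 + s ^ 2));
    auto using open_true.
  - intros s t _. nra.
  - apply Ck_plus; auto using open_true, Ck_const.
    apply Ck_mult; auto using open_true, Ck_fst.
    apply Ck_mult; auto using open_true, Ck_fst, Ck_const.
Qed.

Lemma smooth1_sqrt : smooth1 (fun x => 0 < x) sqrt.
Proof.
  apply smooth1_intro with (fun x => / (2 * sqrt x)).
  - apply open_gt.
  - intros x Hx. replace (/ (2 * sqrt x)) with (1 / (2 * sqrt x)).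
    + apply (is_derive_sqrt (fun x => x)); auto. apply is_derive_id_R.
    + unfold Rdiv; ring.
  - intros k Hk. pose proof (open_fst _ (open_gt 0)) as HO.
    apply (Ck_inv k _ (fun s _ => 2 * sqrt s)); auto.
    + intros s t Hs. simpl in Hs. pose proof (sqrt_lt_R0 _ Hs). lra.
    + apply Ck_mult; auto using Ck_const.
Qed.

Section SmoothOps.
Variables (U : R2 -> Prop) (f g : R -> R -> R).
Hypotheses (HU : open U) (Hf : smooth U f).

Lemma smooth_const c : smooth U (fun _ _ => c).
Proof. intros k; apply Ck_const. Qed.
Lemma smooth_fst : smooth U (fun s _ => s).
Proof. intros k; apply Ck_fst; auto. Qed.
Lemma smooth_snd : smooth U (fun _ t => t).
Proof. intros k; apply Ck_snd; auto. Qed.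
Lemma smooth_opp : smooth U (fun s t => - f s t).
Proof. intros k; apply Ck_opp; auto. Qed.
Lemma smooth_exp : smooth U (fun s t => exp (f s t)).
Proof. apply smooth1_comp with (fun _ => True); auto using open_R_true, smooth1_exp. Qed.
Lemma smooth_sin : smooth U (fun s t => sin (f s t)).
Proof. apply smooth1_comp with (fun _ => True); auto using open_R_true. apply smooth1_sin_cos. Qed.
Lemma smooth_cos : smooth U (fun s t => cos (f s t)).
Proof. apply smooth1_comp with (fun _ => True); auto using open_R_true. apply smooth1_sin_cos. Qed.
Lemma smooth_atan : smooth U (fun s t => atan (f s t)).
Proof. apply smooth1_comp with (fun _ => True); auto using open_R_true, smooth1_atan. Qed.
Lemma smooth_sqrt : (forall s t, U (s, t) -> 0 < f s t) ->
  smooth U (fun s t => sqrt (f s t)).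
Proof. intros H. apply smooth1_comp with (fun x => 0 < x); auto using smooth1_sqrt. apply open_gt. Qed.

Hypothesis Hg : smooth U g.

Lemma smooth_plus : smooth U (fun s t => f s t + g s t).
Proof. intros k; apply Ck_plus; auto. Qed.
Lemma smooth_mult : smooth U (fun s t => f s t * g s t).
Proof. intros k; apply Ck_mult; auto. Qed.
Lemma smooth_minus : smooth U (fun s t => f s t - g s t).
Proof. intros k; apply Ck_minus; auto. Qed.
Lemma smooth_div : (forall s t, U (s, t) -> g s t <> 0) ->
  smooth U (fun s t => f s t / g s t).
Proof. intros H k; apply Ck_mult; auto. apply Ck_inv; auto. Qed.

End SmoothOps.

Lemma smooth_comp (U W : R2 -> Prop) f g h : open U -> open W ->
  (forall s t, U (s, t) -> W (g s t, h s t)) ->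
  smooth W f -> smooth U g -> smooth U h ->
  smooth U (fun s t => f (g s t) (h s t)).
Proof. intros HU HW M Hf Hg Hh k. apply (Ck_comp k U W); auto. Qed.

Lemma smooth_pow2 U f : open U -> smooth U f -> smooth U (fun s t => f s t ^ 2).
Proof.
  intros HU Hf. apply smooth_mult; auto.
  apply smooth_mult; auto. apply smooth_const.
Qed.

Lemma smooth_cosh U f : open U -> smooth U f -> smooth U (fun s t => cosh (f s t)).
Proof.
  intros HU Hf. unfold cosh. apply smooth_div; auto using smooth_const.
  apply smooth_plus; auto; apply smooth_exp; auto. apply smooth_opp; auto.
Qed.

Lemma smooth_sinh U f : open U -> smooth U f -> smooth U (fun s t => sinh (f s t)).
Proof.
  intros HU Hf. unfold sinh. apply smooth_div; auto using smooth_const.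
  apply smooth_minus; auto; apply smooth_exp; auto. apply smooth_opp; auto.
Qed.

(** * Inverting one variable *)

Lemma is_derive_eps f x l :
  is_derive f x l <->
  forall eps, 0 < eps -> exists d, 0 < d /\ forall u, Rabs (u - x) < d ->
    Rabs (f u - f x - l * (u - x)) <= eps * Rabs (u - x).
Proof.
  split.
  - intros H eps Heps. apply is_derive_Reals in H.
    apply (differentiable_pt_lim_proj1_0 f x 0 l) in H.
    destruct (H (mkposreal _ Heps)) as [d Hd]. exists d. split; [apply cond_pos|].
    intros u Hu. specialize (Hd u 0 Hu). simpl in Hd.
    rewrite Rminus_diag, Rabs_R0 in Hd.
    rewrite Rmult_0_r, Rplus_0_r in Hd.
    rewrite (Rmax_left (Rabs (u - x)) 0) in Hd by apply Rabs_pos.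
    apply Hd, cond_pos.
  - intros H. apply is_derive_Reals. apply (differentiable_pt_lim_proj1_1 f x 0 l).
    intros eps. destruct (H eps (cond_pos eps)) as (d & Hd0 & Hd).
    exists (mkposreal _ Hd0). simpl. intros u v Hu _.
    rewrite Rmult_0_l, Rplus_0_r.
    eapply Rle_trans; [apply Hd, Hu|]. apply Rmult_le_compat_l.
    + left; apply cond_pos.
    + apply Rmax_l.
Qed.

(** If [f] is differentiable along a continuous curve [(xi, g)] and
    [f (xi r, g r) = h r], the chain rule can be solved for the derivative of
    [g]; continuity of [g] replaces the differentiability that is to be shown. *)
Lemma implicit_is_derive f (xi g h : R -> R) r0 l1 l2 dx dh :
  differentiable_pt_lim f (xi r0) (g r0) l1 l2 -> l2 <> 0 ->
  continuity_pt g r0 -> is_derive xi r0 dx -> is_derive h r0 dh ->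
  locally r0 (fun r => f (xi r) (g r) = h r) ->
  is_derive g r0 ((dh - l1 * dx) / l2).
Proof.
  intros Hf Hl Hg Hx Hh [dE HE].
  set (m := (dh - l1 * dx) / l2).
  assert (Hm : l2 * m = dh - l1 * dx) by (unfold m; field; auto).
  assert (Hl0 : 0 < Rabs l2) by (apply Rabs_pos_lt; auto).
  apply is_derive_eps. intros eps Heps.
  (* With all expansions accurate to [e], the error of [g] times [|l2|] is at most
     [e * K] times the increment of [r], plus [e] times the error of [g] itself,
     which is absorbed on the left since [e <= |l2| / 2]. *)
  set (K := 2 + Rabs l1 + Rabs dx + Rabs m).
  assert (HK : 2 <= K).
  { unfold K. pose proof (Rabs_pos l1). pose proof (Rabs_pos dx).
    pose proof (Rabs_pos m). lra. }
  set (e := Rmin 1 (Rmin (Rabs l2 / 2) (eps * Rabs l2 / (2 * K)))).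
  assert (He : 0 < e).
  { unfold e. apply Rmin_pos; [lra|apply Rmin_pos; [lra|]].
    apply Rdiv_lt_0_compat; nra. }
  assert (He1 : e <= 1) by apply Rmin_l.
  assert (He2 : e <= Rabs l2 / 2)
    by (eapply Rle_trans; [apply Rmin_r|apply Rmin_l]).
  assert (He3 : 2 * e * K <= eps * Rabs l2).
  { assert (H : e <= eps * Rabs l2 / (2 * K))
      by (eapply Rle_trans; [apply Rmin_r|apply Rmin_r]).
    apply Rmult_le_compat_r with (r := 2 * K) in H; [|lra].
    replace (eps * Rabs l2 / (2 * K) * (2 * K)) with (eps * Rabs l2) in H
      by (field; lra). lra. }
  destruct (Hf (mkposreal _ He)) as [d1 H1]; simpl in H1.
  destruct (proj1 (is_derive_eps _ _ _) Hx e He) as (d2 & Hd2 & H2).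
  destruct (proj1 (is_derive_eps _ _ _) Hh e He) as (d3 & Hd3 & H3).
  assert (Hxc : continuity_pt xi r0).
  { apply derivable_continuous_pt. exists dx. apply is_derive_Reals; auto. }
  destruct (Hg d1 (cond_pos d1)) as (d4 & Hd4 & H4).
  destruct (Hxc d1 (cond_pos d1)) as (d5 & Hd5 & H5).
  assert (NB : forall (k : R -> R) d, (forall x, D_x no_cond r0 x /\ Rabs (x - r0) < d ->
    Rabs (k x - k r0) < d1) -> forall u, Rabs (u - r0) < d -> Rabs (k u - k r0) < d1).
  { intros k d Hk u Hu. destruct (Req_dec u r0) as [->|Hne].
    - rewrite Rminus_diag, Rabs_R0. apply cond_pos.
    - apply Hk. repeat split; auto. }
  exists (Rmin dE (Rmin (Rmin d2 d3) (Rmin d4 d5))). split.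
  { repeat apply Rmin_pos; auto. apply cond_pos. }
  intros u Hu.
  assert (Hu0 : Rabs (u - r0) < dE) by (eapply Rlt_le_trans; [exact Hu|apply Rmin_l]).
  assert (Hu' : Rabs (u - r0) < Rmin (Rmin d2 d3) (Rmin d4 d5))
    by (eapply Rlt_le_trans; [exact Hu|apply Rmin_r]).
  pose proof (Rmin_l (Rmin d2 d3) (Rmin d4 d5)).
  pose proof (Rmin_r (Rmin d2 d3) (Rmin d4 d5)).
  pose proof (Rmin_l d2 d3). pose proof (Rmin_r d2 d3).
  pose proof (Rmin_l d4 d5). pose proof (Rmin_r d4 d5).
  specialize (H2 u ltac:(lra)). specialize (H3 u ltac:(lra)).
  assert (G : Rabs (g u - g r0) < d1) by (apply (NB g d4); auto; lra).
  assert (X : Rabs (xi u - xi r0) < d1) by (apply (NB xi d5); auto; lra).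
  specialize (H1 _ _ X G).
  rewrite (HE u Hu0) in H1.
  rewrite (HE r0) in H1 by apply ball_center.
  set (D := u - r0) in *. set (Dg := g u - g r0) in *.
  set (Dx := xi u - xi r0) in *. set (Dh := h u - h r0) in *.
  assert (H1' : Rabs (Dh - (l1 * Dx + l2 * Dg)) <= e * (Rabs Dx + Rabs Dg)).
  { eapply Rle_trans; [exact H1|]. apply Rmult_le_compat_l; [lra|].
    pose proof (Rabs_pos Dx). pose proof (Rabs_pos Dg).
    apply Rmax_lub; lra. }
  assert (HDx : Rabs Dx <= (1 + Rabs dx) * Rabs D).
  { replace Dx with ((Dx - dx * D) + dx * D) by ring.
    eapply Rle_trans; [apply Rabs_triang|]. rewrite Rabs_mult.
    pose proof (Rabs_pos D). nra. }
  assert (HDg : Rabs Dg <= Rabs (Dg - m * D) + Rabs m * Rabs D).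
  { replace Dg with ((Dg - m * D) + m * D) at 1 by ring.
    eapply Rle_trans; [apply Rabs_triang|]. rewrite Rabs_mult. lra. }
  assert (Hmain : Rabs l2 * Rabs (Dg - m * D) <=
     e * (Rabs Dx + Rabs Dg) + e * Rabs D + Rabs l1 * (e * Rabs D)).
  { rewrite <- Rabs_mult.
    replace (l2 * (Dg - m * D)) with
      (- (Dh - (l1 * Dx + l2 * Dg)) + ((Dh - dh * D) + - (l1 * (Dx - dx * D))))
      by (replace (l2 * (Dg - m * D)) with (l2 * Dg - (l2 * m) * D) by ring;
          rewrite Hm; ring).
    eapply Rle_trans; [apply Rabs_triang|]. rewrite Rabs_Ropp.
    rewrite Rplus_assoc. apply Rplus_le_compat; [exact H1'|].
    eapply Rle_trans; [apply Rabs_triang|]. rewrite Rabs_Ropp, Rabs_mult.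
    apply Rplus_le_compat; [exact H3|].
    apply Rmult_le_compat_l; [apply Rabs_pos|exact H2]. }
  assert (Hmain2 : Rabs l2 / 2 * Rabs (Dg - m * D) <= e * K * Rabs D).
  { pose proof (Rabs_pos (Dg - m * D)). pose proof (Rabs_pos D).
    assert (e * Rabs Dx <= e * ((1 + Rabs dx) * Rabs D)) by (apply Rmult_le_compat_l; lra).
    assert (e * Rabs Dg <= e * (Rabs (Dg - m * D) + Rabs m * Rabs D)) by (apply Rmult_le_compat_l; lra).
    assert (e * Rabs (Dg - m * D) <= Rabs l2 / 2 * Rabs (Dg - m * D)) by (apply Rmult_le_compat_r; lra).
    unfold K. nra. }
  apply Rmult_le_reg_l with (Rabs l2 / 2); [lra|].
  eapply Rle_trans; [exact Hmain2|].
  pose proof (Rabs_pos D). nra.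
Qed.

(** A continuous solution [psi] of [f (s, psi (s, t)) = t] is as smooth as [f],
    because its partial derivatives are smooth expressions in [psi] itself. *)
Lemma smooth_inverse (Om W : R2 -> Prop) f psi :
  open Om -> open W -> smooth Om f ->
  (forall s y, Om (s, y) -> pd2 f s y <> 0) ->
  (forall s t, W (s, t) -> Om (s, psi s t) /\ f s (psi s t) = t) ->
  (forall s t, W (s, t) -> continuity_2d_pt psi s t) ->
  (forall s t, W (s, t) ->
    has_pds psi s t (- pd1 f s (psi s t) / pd2 f s (psi s t))
      (/ pd2 f s (psi s t))) /\
  smooth W psi.
Proof.
  intros HO HW Hf Hn Hp Hc.
  destruct (smooth_pd _ _ Hf) as [Hf1 Hf2].
  assert (P : forall s t, W (s, t) ->
    has_pds psi s t (- pd1 f s (psi s t) / pd2 f s (psi s t))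
      (/ pd2 f s (psi s t))).
  { intros s t H. destruct (Hp _ _ H) as [H1 H2].
    pose proof (Ck_differentiable 0 Om f s (psi s t) HO (Hf 1%nat) H1) as Hd.
    pose proof (open_locally_2d _ _ _ HW H) as L.
    assert (C1 : continuity_pt (fun x => psi x t) s).
    { intros eps Heps. destruct (Hc _ _ H (mkposreal _ Heps)) as [d Hd'].
      exists d. split; [apply cond_pos|]. intros x [_ Hx].
      apply Hd'; auto. rewrite Rminus_diag, Rabs_R0. apply cond_pos. }
    assert (C2 : continuity_pt (fun x => psi s x) t).
    { intros eps Heps. destruct (Hc _ _ H (mkposreal _ Heps)) as [d Hd'].
      exists d. split; [apply cond_pos|]. intros x [_ Hx].
      apply Hd'; auto. rewrite Rminus_diag, Rabs_R0. apply cond_pos. }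
    split.
    - replace (- pd1 f s (psi s t) / pd2 f s (psi s t))
        with ((0 - pd1 f s (psi s t) * 1) / pd2 f s (psi s t))
        by (unfold Rdiv; ring).
      apply (implicit_is_derive f (fun x => x) (fun x => psi x t) (fun _ => t)); auto.
      + apply is_derive_id_R.
      + apply is_derive_const_R.
      + apply locally_2d_1d_const_y in L. revert L. apply filter_imp.
        intros x Hx. apply Hp, Hx.
    - replace (/ pd2 f s (psi s t))
        with ((1 - pd1 f s (psi s t) * 0) / pd2 f s (psi s t))
        by (unfold Rdiv; ring).
      apply (implicit_is_derive f (fun x => s) (fun x => psi s x) (fun t => t)); auto.
      + apply is_derive_const_R.
      + apply is_derive_id_R.
      + apply locally_2d_1d_const_x in L. revert L. apply filter_imp.
        intros x Hx. apply Hp, Hx. }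
  split; auto.
  intros k. induction k as [|k IH]; [split; auto|].
  assert (E : Ck k W (fun s t => / pd2 f s (psi s t))).
  { apply Ck_inv; auto.
    - intros s t H. apply Hn, Hp, H.
    - apply (Ck_comp k W Om (pd2 f) (fun s _ => s) psi); auto using Ck_fst.
      intros s t H; apply Hp, H. }
  apply Ck_S_intro with
    (fun s t => - pd1 f s (psi s t) / pd2 f s (psi s t))
    (fun s t => / pd2 f s (psi s t)); auto.
  apply (Ck_mult k W (fun s t => - pd1 f s (psi s t))); auto.
  apply Ck_opp; auto.
  apply (Ck_comp k W Om (pd1 f) (fun s _ => s) psi); auto using Ck_fst.
  intros s t H; apply Hp, H.
Qed.

(** * Limits *)

Lemma filterlim_R {T} (F : (T -> Prop) -> Prop) {FF : Filter F} (f : T -> R) l :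
  filterlim f F (locally l) <->
  forall eps, 0 < eps -> F (fun x => Rabs (f x - l) < eps).
Proof.
  rewrite filterlim_locally. split.
  - intros H eps Heps. apply (H (mkposreal _ Heps)).
  - intros H eps. apply (H eps (cond_pos eps)).
Qed.

Section Limits.
Context {T : Type} {F : (T -> Prop) -> Prop} {FF : Filter F}.

Lemma lim_comp2 (f : R -> R -> R) (X Y : T -> R) x y :
  continuity_2d_pt f x y -> filterlim X F (locally x) -> filterlim Y F (locally y) ->
  filterlim (fun z => f (X z) (Y z)) F (locally (f x y)).
Proof.
  intros Hf HX HY. apply filterlim_R; auto. intros eps Heps.
  destruct (Hf (mkposreal _ Heps)) as [d Hd].
  generalize (filter_and _ _ (proj1 (filterlim_R F X x) HX d (cond_pos d))
    (proj1 (filterlim_R F Y y) HY d (cond_pos d))).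
  apply filter_imp. intros z [H1 H2]. apply Hd; auto.
Qed.

Lemma lim_comp1 (f : R -> R) (X : T -> R) x :
  continuity_pt f x -> filterlim X F (locally x) ->
  filterlim (fun z => f (X z)) F (locally (f x)).
Proof.
  intros Hf HX. apply (lim_comp2 (fun u _ => f u) X X x x); auto.
  apply (continuity_1d_2d_pt_comp f (fun u _ => u)); auto.
  apply continuity_2d_pt_id1.
Qed.

Lemma lim_const (c : R) : filterlim (fun _ : T => c) F (locally c).
Proof. apply filterlim_const. Qed.

Lemma lim_plus (X Y : T -> R) x y :
  filterlim X F (locally x) -> filterlim Y F (locally y) ->
  filterlim (fun z => X z + Y z) F (locally (x + y)).
Proof.
  apply (lim_comp2 Rplus).
  apply continuity_2d_pt_plus; [apply continuity_2d_pt_id1|apply continuity_2d_pt_id2].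
Qed.

Lemma lim_minus (X Y : T -> R) x y :
  filterlim X F (locally x) -> filterlim Y F (locally y) ->
  filterlim (fun z => X z - Y z) F (locally (x - y)).
Proof.
  apply (lim_comp2 Rminus).
  apply continuity_2d_pt_minus; [apply continuity_2d_pt_id1|apply continuity_2d_pt_id2].
Qed.

Lemma lim_mult (X Y : T -> R) x y :
  filterlim X F (locally x) -> filterlim Y F (locally y) ->
  filterlim (fun z => X z * Y z) F (locally (x * y)).
Proof.
  apply (lim_comp2 Rmult).
  apply continuity_2d_pt_mult; [apply continuity_2d_pt_id1|apply continuity_2d_pt_id2].
Qed.

Lemma lim_opp (X : T -> R) x :
  filterlim X F (locally x) -> filterlim (fun z => - X z) F (locally (- x)).
Proof. apply (lim_comp1 Ropp). apply continuity_pt_opp, derivable_continuous_pt, derivable_pt_id. Qed.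

Lemma lim_inv (X : T -> R) x : x <> 0 ->
  filterlim X F (locally x) -> filterlim (fun z => / X z) F (locally (/ x)).
Proof.
  intros Hx. apply (lim_comp1 Rinv).
  apply (continuity_pt_inv (fun u => u)); auto. apply derivable_continuous_pt, derivable_pt_id.
Qed.

Lemma lim_div (X Y : T -> R) x y : y <> 0 ->
  filterlim X F (locally x) -> filterlim Y F (locally y) ->
  filterlim (fun z => X z / Y z) F (locally (x / y)).
Proof. intros Hy HX HY. apply lim_mult; auto. apply lim_inv; auto. Qed.

Lemma lim_pow (X : T -> R) x k :
  filterlim X F (locally x) -> filterlim (fun z => X z ^ k) F (locally (x ^ k)).
Proof. apply (lim_comp1 (fun u => u ^ k)). apply derivable_continuous_pt, derivable_pt_pow. Qed.

End Limits.

(** * Limits of parametric integrals *)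

(** Compactness of the segment, for a property that holds eventually near each
    of its points; proved by taking a supremum.  With a filter in place of a
    neighbourhood it turns pointwise into uniform convergence. *)
Lemma filter_forall_segment {T} (F : (T -> Prop) -> Prop) {FF : Filter F}
    (P : T -> R -> Prop) a b :
  (forall t, a <= t <= b ->
     filter_prod F (locally t) (fun z => P (fst z) (snd z))) ->
  F (fun x => forall t, a <= t <= b -> P x t).
Proof.
  intros H.
  destruct (Rlt_le_dec b a) as [Hab|Hab].
  { apply filter_forall. intros x t Ht. lra. }
  set (E := fun x => a <= x <= b /\ F (fun z => forall t, a <= t <= x -> P z t)).
  assert (Ea : E a).
  { split; [lra|]. destruct (H a ltac:(lra)) as [Q S HQ HS HP].
    revert HQ. apply filter_imp. intros z Hz t Ht.
    replace t with a by lra. apply (HP z a); auto. apply locally_singleton, HS. }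
  destruct (completeness E) as [m [Hm1 Hm2]].
  { exists b. intros x [Hx _]; lra. }
  { exists a; auto. }
  assert (Hm : a <= m <= b).
  { split; [apply Hm1, Ea|]. apply Hm2. intros x [Hx _]; lra. }
  destruct (H m Hm) as [Q S HQ [d Hd] HP].
  assert (Hx : exists x, E x /\ m - d < x).
  { apply NNPP. intros Hn. assert (m <= m - d).
    { apply Hm2. intros x Hx. apply Rnot_lt_le. intros Hlt. apply Hn. exists x; auto. }
    pose proof (cond_pos d). lra. }
  destruct Hx as (x & [Hxab Hx] & Hmx).
  assert (Hxm : x <= m) by (apply Hm1; split; auto).
  assert (G : F (fun z => forall t, a <= t -> t < m + d -> t <= b -> P z t)).
  { generalize (filter_and _ _ Hx HQ). apply filter_imp.
    intros z [Hz1 Hz2] t Ht1 Ht2 Ht3. destruct (Rle_dec t x) as [Htx|Htx].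
    - apply Hz1; lra.
    - apply (HP z t); auto. apply Hd. change (Rabs (t - m) < d).
      apply Rabs_def1; lra. }
  pose proof (cond_pos d).
  destruct (Rlt_dec b (m + d)) as [Hb|Hb].
  - revert G. apply filter_imp. intros z Hz t Ht. apply Hz; lra.
  - exfalso. assert (m + d / 2 <= m); [|lra].
    apply Hm1. split; [lra|]. revert G. apply filter_imp.
    intros z Hz t Ht. apply Hz; lra.
Qed.

(** Convergence of [f x] to [g] that is continuous at every point of the
    segment is uniform on it, so integrals converge; [F] may be a filter of
    neighbourhoods or run along a sequence as well. *)
Lemma filterlim_RInt_01 {T} (F : (T -> Prop) -> Prop) {FF : Filter F}
    (f : T -> R -> R) (g : R -> R) :
  F (fun x => ex_RInt (f x) 0 1) ->
  (forall t, 0 <= t <= 1 -> continuous g t) ->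
  (forall t, 0 <= t <= 1 ->
    filterlim (fun z => f (fst z) (snd z)) (filter_prod F (locally t)) (locally (g t))) ->
  filterlim (fun x => RInt (f x) 0 1) F (locally (RInt g 0 1)).
Proof.
  intros Hex Hg H. apply filterlim_R; auto. intros eps Heps.
  assert (U : F (fun x => forall t, 0 <= t <= 1 -> Rabs (f x t - g t) < eps / 2)).
  { apply filter_forall_segment; auto. intros t Ht.
    assert (H1 := proj1 (filterlim_R _ _ _) (H t Ht) (eps / 4) ltac:(lra)).
    assert (H2 : filter_prod F (locally t) (fun z => Rabs (g (snd z) - g t) < eps / 4)).
    { apply (Filter_prod F (locally t) _ (fun _ => True) (fun x => Rabs (g x - g t) < eps / 4)).
      - apply filter_true.
      - apply (proj1 (filterlim_R (locally t) g (g t)) (Hg t Ht)). lra.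
      - auto. }
    generalize (filter_and _ _ H1 H2). apply filter_imp. intros [x u] [K1 K2]; simpl in *.
    replace (f x u - g u) with ((f x u - g t) + - (g u - g t)) by ring.
    eapply Rle_lt_trans; [apply Rabs_triang|]. rewrite Rabs_Ropp. lra. }
  assert (Eg : ex_RInt g 0 1).
  { apply (ex_RInt_continuous (V := R_CompleteNormedModule)). intros z Hz.
    rewrite Rmin_left, Rmax_right in Hz by lra. apply Hg, Hz. }
  generalize (filter_and _ _ Hex U). apply filter_imp. intros x [Ex Ux].
  replace (RInt (f x) 0 1 - RInt g 0 1) with (RInt (fun t => f x t - g t) 0 1)
    by (apply (RInt_minus (V := R_CompleteNormedModule)); auto).
  eapply Rle_lt_trans.
  - apply (abs_RInt_le_const _ 0 1 (eps / 2)); [lra| |].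
    + apply (ex_RInt_minus (V := R_NormedModule)); auto.
    + intros t Ht. left. apply Ux, Ht.
  - lra.
Qed.

(** * The mean of a function over a vertical segment *)

(** [y * mean f x y] is the integral of [f x] from 0 to [y]; dividing by [y]
    first keeps the mean smooth and nonzero at [y = 0]. *)
Definition mean (f : R -> R -> R) (x y : R) : R := RInt (fun r => f x (y * r)) 0 1.

(** On such a domain [mean f] depends only on the values of [f] inside it. *)
Definition star (U : R2 -> Prop) : Prop :=
  forall x y r, U (x, y) -> 0 <= r <= 1 -> U (x, y * r).

Section Mean.
Variable U : R2 -> Prop.
Hypotheses (HU : open U) (HS : star U).

Lemma star_segment x y z : U (x, y) -> Rmin 0 y <= z <= Rmax 0 y -> U (x, z).
Proof.
  intros H Hz. destruct (Req_dec y 0) as [->|Hy].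
  - replace z with (0 * 0); [apply HS; auto; lra|].
    rewrite Rmin_left, Rmax_left in Hz by lra. lra.
  - replace z with (y * (z / y)) by (field; auto). apply HS; auto.
    unfold Rmin, Rmax in Hz. destruct (Rle_dec 0 y) as [Hy'|Hy'].
    + split; [apply Rle_div_r|apply Rle_div_l]; lra.
    + replace (z / y) with ((- z) / (- y)) by (field; auto).
      split; [apply Rle_div_r|apply Rle_div_l]; lra.
Qed.

Lemma continuity_2d_slice f s t :
  continuity_2d_pt f s t -> continuous (f s) t.
Proof.
  intros H. apply (filterlim_R (locally t)). intros eps Heps.
  destruct (H (mkposreal _ Heps)) as [d Hd].
  exists d. intros y Hy. apply Hd; auto.
  rewrite Rminus_diag, Rabs_R0. apply cond_pos.
Qed.

Lemma continuous_along f x y r : (forall s t, U (s, t) -> continuity_2d_pt f s t) ->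
  U (x, y) -> 0 <= r <= 1 -> continuous (fun r => f x (y * r)) r.
Proof.
  intros Hf H Hr. apply (continuous_comp (fun r => y * r) (f x)).
  - apply (continuous_mult (fun _ => y) (fun r => r)).
    apply continuous_const. apply continuous_id.
  - apply continuity_2d_slice. apply Hf, HS; auto.
Qed.

Lemma ex_RInt_along f x y : (forall s t, U (s, t) -> continuity_2d_pt f s t) ->
  U (x, y) -> ex_RInt (fun r => f x (y * r)) 0 1.
Proof.
  intros Hf H. apply (ex_RInt_continuous (V := R_CompleteNormedModule)).
  intros r Hr. rewrite Rmin_left, Rmax_right in Hr by lra.
  apply continuous_along; auto.
Qed.

(** Differentiating [f x (y * r)] in [y] brings out the factor [r], whence the
    weights [r ^ k]. *)
Definition wmean k (f : R -> R -> R) (x y : R) : R :=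
  RInt (fun r => r ^ k * f x (y * r)) 0 1.

Lemma continuity_2d_weighted k f x y r :
  continuity_2d_pt f x (y * r) ->
  filterlim (fun z : R2 * R => snd z ^ k * f (fst (fst z)) (snd (fst z) * snd z))
    (filter_prod (locally (x, y)) (locally r)) (locally (r ^ k * f x (y * r))).
Proof.
  intros Hf.
  assert (L2 : filterlim (fun z : R2 * R => fst z)
    (filter_prod (locally (x, y)) (locally r)) (locally (x, y))) by apply filterlim_fst.
  apply lim_mult; [apply lim_pow, filterlim_snd|].
  apply lim_comp2; auto; [|apply lim_mult; [|apply filterlim_snd]].
  - eapply filterlim_comp; [exact L2|].
    apply (continuous_fst (U := R_UniformSpace) (V := R_UniformSpace) x y).
  - eapply filterlim_comp; [exact L2|].
    apply (continuous_snd (U := R_UniformSpace) (V := R_UniformSpace) x y).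
Qed.

Lemma continuity_wmean k f x y : (forall s t, U (s, t) -> continuity_2d_pt f s t) ->
  U (x, y) -> continuity_2d_pt (wmean k f) x y.
Proof.
  intros Hf H. apply continuity_2d_pt_filterlim. unfold wmean.
  apply (filterlim_RInt_01 (locally (x, y))
    (fun z r => r ^ k * f (fst z) (snd z * r)) (fun r => r ^ k * f x (y * r))).
  - apply (filter_imp U); [|apply HU, H]. intros [s t] Hst.
    apply (ex_RInt_continuous (V := R_CompleteNormedModule)).
    intros r Hr. rewrite Rmin_left, Rmax_right in Hr by lra.
    apply (continuous_mult (fun r => r ^ k) (fun r => f s (t * r))).
    + apply (ex_derive_continuous (V := R_NormedModule) (fun u => u ^ k)).
      exists (INR k * 1 * r ^ pred k). apply (is_derive_pow (fun u => u)).
      apply is_derive_id_R.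
    + apply continuous_along; auto.
  - intros r Hr. apply (continuous_mult (fun r => r ^ k) (fun r => f x (y * r))).
    + apply (ex_derive_continuous (V := R_NormedModule) (fun u => u ^ k)).
      exists (INR k * 1 * r ^ pred k). apply (is_derive_pow (fun u => u)).
      apply is_derive_id_R.
    + apply continuous_along; auto.
  - intros r Hr. apply continuity_2d_weighted. apply Hf, HS; auto.
Qed.

Lemma ex_RInt_weighted k f x y : (forall s t, U (s, t) -> continuity_2d_pt f s t) ->
  U (x, y) -> ex_RInt (fun r => r ^ k * f x (y * r)) 0 1.
Proof.
  intros Hf H. apply (ex_RInt_continuous (V := R_CompleteNormedModule)).
  intros r Hr. rewrite Rmin_left, Rmax_right in Hr by lra.
  apply (continuous_mult (fun r => r ^ k) (fun r => f x (y * r))).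
  - apply (ex_derive_continuous (V := R_NormedModule) (fun u => u ^ k)).
    exists (INR k * 1 * r ^ pred k). apply (is_derive_pow (fun u => u)).
    apply is_derive_id_R.
  - apply continuous_along; auto.
Qed.

Lemma has_pds_wmean k f x y : Ck 1 U f -> U (x, y) ->
  has_pds (wmean k f) x y (wmean k (pd1 f) x y) (wmean (S k) (pd2 f) x y).
Proof.
  intros Hf H. pose proof Hf as (Hc & Hd & [H1 _] & [H2 _]).
  pose proof (open_locally_2d _ _ _ HU H) as L.
  pose proof (Ck_has_pds 0 U f) as Hp.
  split.
  - unfold wmean. rewrite (RInt_ext (fun r => r ^ k * pd1 f x (y * r))
      (fun r => Derive (fun z => r ^ k * f z (y * r)) x))
      by (intros; rewrite Derive_scal; reflexivity).
    apply (is_derive_RInt_param (fun z r => r ^ k * f z (y * r)) 0 1 x).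
    + apply locally_2d_1d_const_y in L. revert L. apply filter_imp.
      intros z Hz r Hr. rewrite Rmin_left, Rmax_right in Hr by lra.
      apply (ex_derive_scal (fun z => f z (y * r))). apply (Hd z (y * r)). apply HS; auto.
    + intros r Hr. rewrite Rmin_left, Rmax_right in Hr by lra.
      apply continuity_2d_pt_ext with (fun u v => v ^ k * pd1 f u (y * v)).
      { intros; rewrite Derive_scal; reflexivity. }
      apply continuity_2d_pt_mult.
      * apply (continuity_1d_2d_pt_comp (fun v => v ^ k) (fun _ v => v)).
        -- apply derivable_continuous_pt, derivable_pt_pow.
        -- apply continuity_2d_pt_id2.
      * apply (continuity_2d_comp (pd1 f) (fun u _ => u) (fun _ v => y * v)).
        -- apply H1, HS; auto.
        -- apply continuity_2d_pt_id1.
        -- apply continuity_2d_pt_mult; [apply continuity_2d_pt_const|apply continuity_2d_pt_id2].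
    + apply locally_2d_1d_const_y in L. revert L. apply filter_imp.
      intros z Hz. apply ex_RInt_weighted; auto.
  - assert (D : forall u r, U (x, u * r) ->
      is_derive (fun z => r ^ k * f x (z * r)) u (r ^ S k * pd2 f x (u * r))).
    { intros u r Hu.
      replace (r ^ S k * pd2 f x (u * r)) with (r ^ k * (r * pd2 f x (u * r))) by (simpl; ring).
      apply (is_derive_scal (fun z => f x (z * r))).
      apply (is_derive_comp (K := R_AbsRing) (V := R_NormedModule) (f x) (fun z => z * r)).
      - apply (Hp x (u * r)); auto.
      - auto_derive; auto; ring. }
    unfold wmean. rewrite (RInt_ext (fun r => r ^ S k * pd2 f x (y * r))
      (fun r => Derive (fun z => r ^ k * f x (z * r)) y)).
    2:{ intros r Hr. rewrite Rmin_left, Rmax_right in Hr by lra.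
        symmetry. apply is_derive_unique, D, HS; auto; lra. }
    apply (is_derive_RInt_param (fun z r => r ^ k * f x (z * r)) 0 1 y).
    + apply locally_2d_1d_const_x in L. revert L. apply filter_imp.
      intros z Hz r Hr. rewrite Rmin_left, Rmax_right in Hr by lra.
      eexists. apply D, HS; auto.
    + intros r Hr. rewrite Rmin_left, Rmax_right in Hr by lra.
      assert (M : continuity_2d_pt (fun u v => u * v) y r)
        by (apply continuity_2d_pt_mult; [apply continuity_2d_pt_id1|apply continuity_2d_pt_id2]).
      apply continuity_2d_pt_ext_loc with (fun u v => v ^ S k * pd2 f x (u * v)).
      { destruct (open_locally_2d _ _ _ HU (HS x y r H Hr)) as [d Hd'].
        destruct (M d) as [e He]. exists e. intros u v Hu Hv.
        symmetry. apply is_derive_unique, D, Hd'; auto.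
        rewrite Rminus_diag, Rabs_R0. apply cond_pos. }
      apply continuity_2d_pt_mult.
      * apply (continuity_1d_2d_pt_comp (fun v => v ^ S k) (fun _ v => v)).
        -- apply derivable_continuous_pt, derivable_pt_pow.
        -- apply continuity_2d_pt_id2.
      * apply (continuity_2d_comp (pd2 f) (fun _ _ => x) (fun u v => u * v)).
        -- apply H2, HS; auto.
        -- apply continuity_2d_pt_const.
        -- exact M.
    + apply locally_2d_1d_const_x in L. revert L. apply filter_imp.
      intros z Hz. apply ex_RInt_weighted; auto.
Qed.

Lemma Ck_wmean m : forall k f, Ck m U f -> Ck m U (wmean k f).
Proof.
  induction m as [|m IH]; intros k f Hf.
  - split; auto. intros. apply continuity_wmean; auto. apply Hf.
  - pose proof Hf as (_ & _ & H1 & H2).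
    apply Ck_S_intro with (wmean k (pd1 f)) (wmean (S k) (pd2 f)); auto.
    intros. apply has_pds_wmean; auto. apply Ck_le with (S m); auto. lia.
Qed.

Lemma mean_wmean f : mean f = wmean 0 f.
Proof.
  do 2 (apply functional_extensionality; intro).
  apply RInt_ext. intros; simpl; ring.
Qed.

Lemma smooth_mean f : smooth U f -> smooth U (mean f).
Proof. intros Hf k. rewrite mean_wmean. apply Ck_wmean, Hf. Qed.

Lemma mean_RInt f x y : (forall s t, U (s, t) -> continuity_2d_pt f s t) ->
  U (x, y) -> y * mean f x y = RInt (f x) 0 y.
Proof.
  intros Hf H. unfold mean.
  replace (RInt (f x) 0 y) with (RInt (f x) (y * 0 + 0) (y * 1 + 0)) by (f_equal; ring).
  rewrite <- (RInt_comp_lin (V := R_CompleteNormedModule) (f x) y 0 0 1).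
  - rewrite <- (RInt_scal (V := R_CompleteNormedModule)) by (apply ex_RInt_along; auto).
    apply RInt_ext. intros r _. rewrite Rplus_0_r. reflexivity.
  - replace (y * 0 + 0) with 0 by ring. replace (y * 1 + 0) with y by ring.
    apply (ex_RInt_continuous (V := R_CompleteNormedModule)). intros z Hz.
    apply continuity_2d_slice, Hf. eapply star_segment; eauto.
Qed.

(** A closed form [f dy + g dx] that vanishes with [g] on the axis [y = 0] is
    the differential of the integral of [f] along vertical segments. *)
Lemma has_pds_primitive f g x y :
  Ck 1 U f -> Ck 1 U g -> (forall s t, U (s, t) -> pd1 f s t = pd2 g s t) ->
  (forall s t, U (s, t) -> g s 0 = 0) -> U (x, y) ->
  has_pds (fun x y => y * mean f x y) x y (g x y) (f x y).
Proof.
  intros Hf Hg E G0 H.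
  assert (Cf : forall s t, U (s, t) -> continuity_2d_pt f s t) by (intros; eapply Ck_continuity; eauto).
  split.
  - pose proof (has_pds_wmean 0 f x y Hf H) as [D _]. rewrite <- mean_wmean in D.
    replace (g x y) with (0 * mean f x y + y * wmean 0 (pd1 f) x y).
    { apply (is_derive_mult_R (fun _ => y) (fun x => mean f x y)); auto.
      apply is_derive_const_R. }
    rewrite <- mean_wmean.
    pose proof Hf as (_ & _ & [C1 _] & _).
    rewrite mean_RInt by auto.
    rewrite (RInt_ext (pd1 f x) (Derive (g x))).
    + rewrite RInt_Derive.
      * rewrite (G0 x y H). ring.
      * intros z Hz. pose proof Hg as (_ & Dg & _). apply (Dg x z), star_segment with y; auto.
      * intros z Hz. pose proof Hg as (_ & _ & _ & [C2 _]).
        apply (continuity_2d_slice (pd2 g)), C2, star_segment with y; auto.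
    + intros z Hz. apply E, star_segment with y; auto; lra.
  - apply (is_derive_ext_loc (fun y => RInt (f x) 0 y)).
    + pose proof (locally_2d_1d_const_x _ _ _ (open_locally_2d _ _ _ HU H)) as L.
      revert L. apply filter_imp. intros z Hz. symmetry. apply mean_RInt; auto.
    + apply (is_derive_RInt (V := R_NormedModule) (f x) _ 0).
      * pose proof (locally_2d_1d_const_x _ _ _ (open_locally_2d _ _ _ HU H)) as L.
        revert L. apply filter_imp. intros z Hz.
        apply (RInt_correct (V := R_CompleteNormedModule)).
        apply (ex_RInt_continuous (V := R_CompleteNormedModule)). intros w Hw.
        apply continuity_2d_slice, Cf, star_segment with z; auto.
      * apply continuity_2d_slice, Cf, H.
Qed.

End Mean.

(** * Reparametrization of patches *)

Lemma norm_R3 (p : R3) : norm p = sqrt (x1 p ^ 2 + x2 p ^ 2 + x3 p ^ 2).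
Proof.
  destruct p as [[a b] c]. unfold x1, x2, x3; simpl fst; simpl snd.
  change (norm ((a, b, c) : R3)) with
    (sqrt ((sqrt ((Rabs a) ^ 2 + (Rabs b) ^ 2)) ^ 2 + (Rabs c) ^ 2)).
  rewrite pow2_sqrt by (pose proof (pow2_ge_0 (Rabs a)); pose proof (pow2_ge_0 (Rabs b)); lra).
  rewrite !pow2_abs. reflexivity.
Qed.

Lemma norm_R2 (p : R2) : norm p = sqrt (fst p ^ 2 + snd p ^ 2).
Proof.
  destruct p as [a b]. simpl fst; simpl snd.
  change (norm ((a, b) : R2)) with (sqrt ((Rabs a) ^ 2 + (Rabs b) ^ 2)).
  rewrite !pow2_abs. reflexivity.
Qed.

Lemma smooth_schwarz (U : R2 -> Prop) f s t :
  open U -> smooth U f -> U (s, t) -> pd2 (pd1 f) s t = pd1 (pd2 f) s t.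
Proof.
  intros HU Hf H. destruct (smooth_pd _ _ Hf) as [H1 H2].
  symmetry. apply Schwarz.
  - destruct (open_locally_2d _ _ _ HU H) as [d Hd]. exists d.
    intros x y Hx Hy. specialize (Hd x y Hx Hy).
    destruct (smooth_has_pds _ _ _ _ Hf Hd). destruct (smooth_has_pds _ _ _ _ H1 Hd).
    destruct (smooth_has_pds _ _ _ _ H2 Hd).
    repeat split; eexists; eassumption.
  - apply (smooth_continuity U (pd1 (pd2 f))); auto. apply smooth_pd; auto.
  - apply (smooth_continuity U (pd2 (pd1 f))); auto. apply smooth_pd; auto.
Qed.

Section Reparam.
Variables (Om W : R2 -> Prop) (g h : R -> R -> R).
Hypotheses (HO : open Om) (HW : open W).
Hypotheses (Hg : smooth W g) (Hh : smooth W h).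
Hypothesis Hmap : forall s t, W (s, t) -> Om (g s t, h s t).

Lemma reparam_has_pds f s t : smooth Om f -> W (s, t) ->
  has_pds (fun s t => f (g s t) (h s t)) s t
    (pd1 f (g s t) (h s t) * pd1 g s t + pd2 f (g s t) (h s t) * pd1 h s t)
    (pd1 f (g s t) (h s t) * pd2 g s t + pd2 f (g s t) (h s t) * pd2 h s t).
Proof.
  intros Hf H. apply has_pds_comp.
  - apply Ck_differentiable with 0%nat Om; auto.
  - apply smooth_has_pds with W; auto.
  - apply smooth_has_pds with W; auto.
Qed.

Lemma reparam_second_pds f s t : smooth Om f -> W (s, t) ->
  let F := fun s t => f (g s t) (h s t) in
  let f1 := pd1 f (g s t) (h s t) in let f2 := pd2 f (g s t) (h s t) in
  let f11 := pd1 (pd1 f) (g s t) (h s t) in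
  let f12 := pd1 (pd2 f) (g s t) (h s t) in
  let f22 := pd2 (pd2 f) (g s t) (h s t) in
  let g1 := pd1 g s t in let g2 := pd2 g s t in
  let h1 := pd1 h s t in let h2 := pd2 h s t in
  pd1 (pd1 F) s t = f11 * g1 ^ 2 + 2 * f12 * g1 * h1 + f22 * h1 ^ 2
    + f1 * pd1 (pd1 g) s t + f2 * pd1 (pd1 h) s t /\
  pd1 (pd2 F) s t = f11 * g1 * g2 + f12 * (g1 * h2 + g2 * h1) + f22 * h1 * h2
    + f1 * pd1 (pd2 g) s t + f2 * pd1 (pd2 h) s t /\
  pd2 (pd2 F) s t = f11 * g2 ^ 2 + 2 * f12 * g2 * h2 + f22 * h2 ^ 2
    + f1 * pd2 (pd2 g) s t + f2 * pd2 (pd2 h) s t.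
Proof.
  intros Hf H F f1 f2 f11 f12 f22 g1 g2 h1 h2.
  destruct (smooth_pd _ _ Hf) as [Hf1 Hf2].
  destruct (smooth_pd _ _ Hg) as [Hg1 Hg2]. destruct (smooth_pd _ _ Hh) as [Hh1 Hh2].
  pose proof (smooth_schwarz Om f _ _ HO Hf (Hmap _ _ H)) as Sz.
  pose proof (reparam_has_pds (pd1 f) s t Hf1 H) as P1.
  pose proof (reparam_has_pds (pd2 f) s t Hf2 H) as P2.
  assert (E1 : has_pds (pd1 F) s t
    ((f11 * g1 + pd2 (pd1 f) (g s t) (h s t) * h1) * g1 + f1 * pd1 (pd1 g) s t +
     ((f12 * g1 + f22 * h1) * h1 + f2 * pd1 (pd1 h) s t))
    ((f11 * g2 + pd2 (pd1 f) (g s t) (h s t) * h2) * g1 + f1 * pd2 (pd1 g) s t +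
     ((f12 * g2 + f22 * h2) * h1 + f2 * pd2 (pd1 h) s t))).
  { apply has_pds_ext_loc with W (fun s t =>
      pd1 f (g s t) (h s t) * pd1 g s t + pd2 f (g s t) (h s t) * pd1 h s t); auto.
    - intros x y Hxy. symmetry. apply (has_pds_eq _ _ _ _ _ (reparam_has_pds f x y Hf Hxy)).
    - apply (has_pds_plus (fun s t => pd1 f (g s t) (h s t) * pd1 g s t)
        (fun s t => pd2 f (g s t) (h s t) * pd1 h s t)).
      + apply (has_pds_mult (fun s t => pd1 f (g s t) (h s t)) (pd1 g)); auto.
        apply smooth_has_pds with W; auto.
      + apply (has_pds_mult (fun s t => pd2 f (g s t) (h s t)) (pd1 h)); auto.
        apply smooth_has_pds with W; auto. }
  assert (E2 : has_pds (pd2 F) s t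
    ((f11 * g1 + pd2 (pd1 f) (g s t) (h s t) * h1) * g2 + f1 * pd1 (pd2 g) s t +
     ((f12 * g1 + f22 * h1) * h2 + f2 * pd1 (pd2 h) s t))
    ((f11 * g2 + pd2 (pd1 f) (g s t) (h s t) * h2) * g2 + f1 * pd2 (pd2 g) s t +
     ((f12 * g2 + f22 * h2) * h2 + f2 * pd2 (pd2 h) s t))).
  { apply has_pds_ext_loc with W (fun s t =>
      pd1 f (g s t) (h s t) * pd2 g s t + pd2 f (g s t) (h s t) * pd2 h s t); auto.
    - intros x y Hxy. symmetry. apply (has_pds_eq _ _ _ _ _ (reparam_has_pds f x y Hf Hxy)).
    - apply (has_pds_plus (fun s t => pd1 f (g s t) (h s t) * pd2 g s t)
        (fun s t => pd2 f (g s t) (h s t) * pd2 h s t)).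
      + apply (has_pds_mult (fun s t => pd1 f (g s t) (h s t)) (pd2 g)); auto.
        apply smooth_has_pds with W; auto.
      + apply (has_pds_mult (fun s t => pd2 f (g s t) (h s t)) (pd2 h)); auto.
        apply smooth_has_pds with W; auto. }
  destruct (has_pds_eq _ _ _ _ _ E1) as [-> _].
  destruct (has_pds_eq _ _ _ _ _ E2) as [-> ->].
  rewrite Sz. fold f12. repeat split; ring.
Qed.

Lemma smooth_patch_reparam G : smooth_patch Om G ->
  smooth_patch W (fun s t => G (g s t) (h s t)).
Proof.
  intros (G1 & G2 & G3). repeat split.
  - apply (smooth_comp W Om (fun s t => x1 (G s t)) g h); auto.
  - apply (smooth_comp W Om (fun s t => x2 (G s t)) g h); auto.
  - apply (smooth_comp W Om (fun s t => x3 (G s t)) g h); auto.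
Qed.

End Reparam.

Lemma lagrange_identity (a b : R3) :
  dot (cross a b) (cross a b) = dot a a * dot b b - dot a b ^ 2.
Proof. unfold dot, cross, x1, x2, x3; simpl; ring. Qed.

Lemma dot_pos (a : R3) : a <> (0, 0, 0) -> 0 < dot a a.
Proof.
  destruct a as [[a b] c]. unfold dot, x1, x2, x3; simpl. intros H.
  destruct (Req_dec a 0) as [->|]; [|nra].
  destruct (Req_dec b 0) as [->|]; [|nra].
  destruct (Req_dec c 0) as [->|]; [|nra]. congruence.
Qed.

Lemma norm_dot (a : R3) : norm a = sqrt (dot a a).
Proof. rewrite norm_R3. f_equal. unfold dot; ring. Qed.

Lemma scal_R3 (k : R) (n : R3) : scal k n = (k * x1 n, k * x2 n, k * x3 n).
Proof. destruct n as [[? ?] ?]; reflexivity. Qed.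

Lemma triple_eq (a b c a' b' c' : R) :
  a = a' -> b = b' -> c = c' -> (a, b, c) = (a', b', c').
Proof. intros -> -> ->; reflexivity. Qed.

(** The shape operator is conjugated by the Jacobian of the change of
    parameters, up to the sign of its determinant; trace zero and the trace of
    the square survive. *)
Lemma reparam_curvature (Om W : R2 -> Prop) g h (G : patch) s t :
  open Om -> open W -> smooth W g -> smooth W h ->
  (forall s t, W (s, t) -> Om (g s t, h s t)) ->
  smooth_patch Om G -> W (s, t) ->
  pd1 g s t * pd2 h s t - pd2 g s t * pd1 h s t <> 0 ->
  regular_at G (g s t) (h s t) ->
  let X := fun s t => G (g s t) (h s t) in
  regular_at X s t /\
  (mean_curvature G (g s t) (h s t) = 0 -> mean_curvature X s t = 0) /\
  sqnorm_A X s t = sqnorm_A G (g s t) (h s t).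
Proof.
  intros HO HW Hg Hh Hm (S1 & S2 & S3) H HJ HR X.
  pose proof (has_pds_eq _ _ _ _ _ (reparam_has_pds Om W g h HO Hg Hh Hm _ s t S1 H)) as [A1 B1].
  pose proof (has_pds_eq _ _ _ _ _ (reparam_has_pds Om W g h HO Hg Hh Hm _ s t S2 H)) as [A2 B2].
  pose proof (has_pds_eq _ _ _ _ _ (reparam_has_pds Om W g h HO Hg Hh Hm _ s t S3 H)) as [A3 B3].
  pose proof (reparam_second_pds Om W g h HO HW Hg Hh Hm _ s t S1 H) as (C1 & D1 & E1).
  pose proof (reparam_second_pds Om W g h HO HW Hg Hh Hm _ s t S2 H) as (C2 & D2 & E2).
  pose proof (reparam_second_pds Om W g h HO HW Hg Hh Hm _ s t S3 H) as (C3 & D3 & E3).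
  set (a := PD1 G (g s t) (h s t)) in *. set (b := PD2 G (g s t) (h s t)) in *.
  set (c11 := PD1 (PD1 G) (g s t) (h s t)) in *.
  set (c12 := PD1 (PD2 G) (g s t) (h s t)) in *.
  set (c22 := PD2 (PD2 G) (g s t) (h s t)) in *.
  set (j11 := pd1 g s t) in *. set (j12 := pd2 g s t) in *.
  set (j21 := pd1 h s t) in *. set (j22 := pd2 h s t) in *.
  set (J := j11 * j22 - j12 * j21) in *.
  unfold regular_at in HR. fold a b in HR.
  assert (Hn : 0 < dot (cross a b) (cross a b)) by (apply dot_pos; auto).
  assert (XA : PD1 X s t = (x1 a * j11 + x1 b * j21, x2 a * j11 + x2 b * j21, x3 a * j11 + x3 b * j21))
    by (unfold PD1, X; rewrite A1, A2, A3; reflexivity).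
  assert (XB : PD2 X s t = (x1 a * j12 + x1 b * j22, x2 a * j12 + x2 b * j22, x3 a * j12 + x3 b * j22))
    by (unfold PD2, X; rewrite B1, B2, B3; reflexivity).
  assert (XC : cross (PD1 X s t) (PD2 X s t) = (J * x1 (cross a b), J * x2 (cross a b), J * x3 (cross a b))).
  { rewrite XA, XB. unfold cross, J, x1, x2, x3; simpl. f_equal; [f_equal|]; ring. }
  assert (XD : dot (cross (PD1 X s t) (PD2 X s t)) (cross (PD1 X s t) (PD2 X s t))
     = J ^ 2 * dot (cross a b) (cross a b)).
  { rewrite XC. unfold dot, x1, x2, x3; simpl; ring. }
  assert (HJ2 : 0 < J ^ 2) by nra.
  assert (XR : regular_at X s t).
  { unfold regular_at. intros E0. rewrite E0 in XD.
    unfold dot at 1, x1, x2, x3 in XD; simpl in XD. nra. }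
  split; auto.
  set (r := sqrt (dot (cross a b) (cross a b))).
  assert (Hr : 0 < r) by (apply sqrt_lt_R0; auto).
  (* The unit normals agree up to this sign. *)
  set (sg := J / Rabs J).
  assert (HaJ : Rabs J <> 0) by (apply Rabs_no_R0; auto).
  assert (Hsg : sg ^ 2 = 1).
  { unfold sg. replace ((J / Rabs J) ^ 2) with (J ^ 2 / Rabs J ^ 2) by (field; auto).
    rewrite <- pow2_abs. field; auto. }
  assert (XN : unit_normal X s t =
     (sg * (x1 (cross a b) / r), sg * (x2 (cross a b) / r), sg * (x3 (cross a b) / r))).
  { unfold unit_normal. rewrite norm_dot, XD, sqrt_mult by nra.
    replace (J ^ 2) with (Rsqr J) by (unfold Rsqr; ring). rewrite sqrt_Rsqr_abs. fold r. rewrite XC.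
    rewrite scal_R3. unfold sg, x1, x2, x3; simpl. f_equal; [f_equal|]; field; lra. }
  assert (GN : unit_normal G (g s t) (h s t) =
     (x1 (cross a b) / r, x2 (cross a b) / r, x3 (cross a b) / r)).
  { unfold unit_normal. rewrite norm_dot. fold a b r.
    rewrite scal_R3. f_equal; [f_equal|]; field; lra. }
  set (N := unit_normal G (g s t) (h s t)) in *.
  assert (aN : dot a N = 0) by (rewrite GN; unfold dot, cross, x1, x2, x3; simpl; field; lra).
  assert (bN : dot b N = 0) by (rewrite GN; unfold dot, cross, x1, x2, x3; simpl; field; lra).
  assert (XN' : unit_normal X s t = (sg * x1 N, sg * x2 N, sg * x3 N)) by (rewrite XN, GN; reflexivity).
  (* The second derivatives of [g] and [h] contribute tangential terms only. *)
  assert (H11 : h11 X s t = sg * (dot c11 N * j11 ^ 2 + 2 * dot c12 N * j11 * j21 + dot c22 N * j21 ^ 2)).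
  { unfold h11. rewrite XN'.
    replace (dot (PD1 (PD1 X) s t) _) with
      (sg * ((dot c11 N * j11 ^ 2 + 2 * dot c12 N * j11 * j21 + dot c22 N * j21 ^ 2)
        + dot a N * pd1 (pd1 g) s t + dot b N * pd1 (pd1 h) s t)).
    - rewrite aN, bN; ring.
    - replace (PD1 (PD1 X) s t) with
        (x1 c11 * j11 ^ 2 + 2 * x1 c12 * j11 * j21 + x1 c22 * j21 ^ 2 + x1 a * pd1 (pd1 g) s t + x1 b * pd1 (pd1 h) s t,
         x2 c11 * j11 ^ 2 + 2 * x2 c12 * j11 * j21 + x2 c22 * j21 ^ 2 + x2 a * pd1 (pd1 g) s t + x2 b * pd1 (pd1 h) s t,
         x3 c11 * j11 ^ 2 + 2 * x3 c12 * j11 * j21 + x3 c22 * j21 ^ 2 + x3 a * pd1 (pd1 g) s t + x3 b * pd1 (pd1 h) s t)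
        by (symmetry; apply triple_eq; [exact C1|exact C2|exact C3]).
      clearbody c11 c12 c22 a b N. unfold dot, x1, x2, x3; cbn [fst snd]. ring. }
  assert (H12 : h12 X s t = sg * (dot c11 N * j11 * j12 + dot c12 N * (j11 * j22 + j12 * j21) + dot c22 N * j21 * j22)).
  { unfold h12. rewrite XN'.
    replace (dot (PD1 (PD2 X) s t) _) with
      (sg * ((dot c11 N * j11 * j12 + dot c12 N * (j11 * j22 + j12 * j21) + dot c22 N * j21 * j22)
        + dot a N * pd1 (pd2 g) s t + dot b N * pd1 (pd2 h) s t)).
    - rewrite aN, bN; ring.
    - replace (PD1 (PD2 X) s t) with
        (x1 c11 * j11 * j12 + x1 c12 * (j11 * j22 + j12 * j21) + x1 c22 * j21 * j22 + x1 a * pd1 (pd2 g) s t + x1 b * pd1 (pd2 h) s t,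
         x2 c11 * j11 * j12 + x2 c12 * (j11 * j22 + j12 * j21) + x2 c22 * j21 * j22 + x2 a * pd1 (pd2 g) s t + x2 b * pd1 (pd2 h) s t,
         x3 c11 * j11 * j12 + x3 c12 * (j11 * j22 + j12 * j21) + x3 c22 * j21 * j22 + x3 a * pd1 (pd2 g) s t + x3 b * pd1 (pd2 h) s t)
        by (symmetry; apply triple_eq; [exact D1|exact D2|exact D3]).
      clearbody c11 c12 c22 a b N. unfold dot, x1, x2, x3; cbn [fst snd]. ring. }
  assert (H22 : h22 X s t = sg * (dot c11 N * j12 ^ 2 + 2 * dot c12 N * j12 * j22 + dot c22 N * j22 ^ 2)).
  { unfold h22. rewrite XN'.
    replace (dot (PD2 (PD2 X) s t) _) with
      (sg * ((dot c11 N * j12 ^ 2 + 2 * dot c12 N * j12 * j22 + dot c22 N * j22 ^ 2)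
        + dot a N * pd2 (pd2 g) s t + dot b N * pd2 (pd2 h) s t)).
    - rewrite aN, bN; ring.
    - replace (PD2 (PD2 X) s t) with
        (x1 c11 * j12 ^ 2 + 2 * x1 c12 * j12 * j22 + x1 c22 * j22 ^ 2 + x1 a * pd2 (pd2 g) s t + x1 b * pd2 (pd2 h) s t,
         x2 c11 * j12 ^ 2 + 2 * x2 c12 * j12 * j22 + x2 c22 * j22 ^ 2 + x2 a * pd2 (pd2 g) s t + x2 b * pd2 (pd2 h) s t,
         x3 c11 * j12 ^ 2 + 2 * x3 c12 * j12 * j22 + x3 c22 * j22 ^ 2 + x3 a * pd2 (pd2 g) s t + x3 b * pd2 (pd2 h) s t)
        by (symmetry; apply triple_eq; [exact E1|exact E2|exact E3]).
      clearbody c11 c12 c22 a b N. unfold dot, x1, x2, x3; cbn [fst snd]. ring. }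
  assert (G11 : g11 X s t = dot a a * j11 ^ 2 + 2 * dot a b * j11 * j21 + dot b b * j21 ^ 2).
  { unfold g11. rewrite XA. unfold dot, x1, x2, x3; simpl; ring. }
  assert (G12 : g12 X s t = dot a a * j11 * j12 + dot a b * (j11 * j22 + j12 * j21) + dot b b * j21 * j22).
  { unfold g12. rewrite XA, XB. unfold dot, x1, x2, x3; simpl; ring. }
  assert (G22 : g22 X s t = dot a a * j12 ^ 2 + 2 * dot a b * j12 * j22 + dot b b * j22 ^ 2).
  { unfold g22. rewrite XB. unfold dot, x1, x2, x3; simpl; ring. }
  rewrite lagrange_identity in Hn.
  unfold mean_curvature, sqnorm_A, a11, a12, a21, a22, gdet.
  rewrite H11, H12, H22, G11, G12, G22.
  unfold h11, h12, h22, g11, g12, g22. fold a b c11 c12 c22 N.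
  set (e := dot a a) in *. set (f := dot a b) in *. set (k := dot b b) in *.
  set (l := dot c11 N). set (m := dot c12 N). set (n := dot c22 N).
  assert (DJ : (e * j11 ^ 2 + 2 * f * j11 * j21 + k * j21 ^ 2) *
     (e * j12 ^ 2 + 2 * f * j12 * j22 + k * j22 ^ 2) -
     (e * j11 * j12 + f * (j11 * j22 + j12 * j21) + k * j21 * j22) ^ 2
     = J ^ 2 * (e * k - f ^ 2)) by (unfold J; ring).
  rewrite !DJ.
  split.
  - intros H0.
    assert (H0' : k * l - 2 * f * m + e * n = 0).
    { replace (k * l - 2 * f * m + e * n) with
        (((k * l - f * m) / (e * k - f ^ 2) + (e * n - f * m) / (e * k - f ^ 2)) / 2 * (2 * (e * k - f ^ 2)))
        by (field; lra).
      rewrite H0; ring. }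
    match goal with |- (?p / ?d + ?q / ?d) / 2 = 0 =>
      replace ((p / d + q / d) / 2) with ((p + q) / (2 * d)) by (field; lra);
      replace (p + q) with (sg * J ^ 2 * (k * l - 2 * f * m + e * n)) by (unfold J; ring)
    end.
    rewrite H0'. field. split; [lra|auto].
  - match goal with |- (?p / ?d) ^ 2 + 2 * (?q / ?d) * (?r / ?d) + (?w / ?d) ^ 2 = _ =>
      replace ((p / d) ^ 2 + 2 * (q / d) * (r / d) + (w / d) ^ 2) with
        ((p ^ 2 + 2 * q * r + w ^ 2) / d ^ 2) by (field; lra);
      replace (p ^ 2 + 2 * q * r + w ^ 2) with
        (sg ^ 2 * (J ^ 4 * ((k * l - f * m) ^ 2 + 2 * (k * m - f * n) * (e * m - f * l) + (e * n - f * m) ^ 2)))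
        by (unfold J; ring)
    end.
    rewrite Hsg. field. split; [lra|auto].
Qed.

(** * The minimal surface of a holomorphic function *)

Section Weierstrass.
Variables u v : R -> R -> R.

Definition hcos x y := cosh (v x y) * cos (u x y).
Definition hsin x y := cosh (v x y) * sin (u x y).

(** The minimal immersion with Weierstrass data [exp (i (u + i v))] and [dz],
    rotated by a right angle about the x3-axis. *)
Definition weier : patch := fun x y => (y * mean hcos x y, y * mean hsin x y, x).

(** The signed distance of [weier x y] to the x3-axis. *)
Definition radius x y := y * sqrt (mean hcos x y ^ 2 + mean hsin x y ^ 2).

(** The polar angle of [weier x y], or of its antipode when [y < 0]; measuring
    it from the direction [u x 0] makes it a single-valued smooth function. *)
Definition angle x y :=
  u x 0 + atan ((cos (u x 0) * mean hsin x y - sin (u x 0) * mean hcos x y) /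
                (cos (u x 0) * mean hcos x y + sin (u x 0) * mean hsin x y)).

End Weierstrass.

Definition strip (I : R -> Prop) (eta : R -> R) (q : R2) : Prop :=
  I (fst q) /\ Rabs (snd q) < eta (fst q).

(** What the construction needs of [h = u + i v]: it is holomorphic and real on
    the real axis (whence the two symmetries in [y]), [u] varies little along
    the vertical segments, and [v] grows enough along them for the surface to
    leave the unit ball. *)
Record spiral_data (I : R -> Prop) (eta : R -> R) (u v : R -> R -> R) : Prop := {
  sd_open_I : open I;
  sd_open : open (strip I eta);
  sd_eta : forall x, I x -> 0 < eta x;
  sd_u : smooth (strip I eta) u;
  sd_v : smooth (strip I eta) v;
  sd_cr1 : forall x y, strip I eta (x, y) -> pd1 u x y = pd2 v x y;
  sd_cr2 : forall x y, strip I eta (x, y) -> pd2 u x y = - pd1 v x y;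
  sd_v0 : forall x, v x 0 = 0;
  sd_even : forall x y, strip I eta (x, y) -> u x (- y) = u x y;
  sd_odd : forall x y, strip I eta (x, y) -> v x (- y) = - v x y;
  sd_osc : forall x y, strip I eta (x, y) -> Rabs (u x y - u x 0) <= 1 / 4;
  sd_vpos : forall x y, strip I eta (x, y) -> 0 < y -> 0 < v x y;
  sd_reach : forall x, I x -> exists y, 0 < y < eta x /\ 2 <= radius u v x y }.

Lemma strip_star I eta : star (strip I eta).
Proof.
  intros x y r [H1 H2] Hr. split; auto. simpl in *. rewrite Rabs_mult.
  rewrite (Rabs_pos_eq r) by lra. pose proof (Rabs_pos y). nra.
Qed.

Lemma cos_ge_half x : Rabs x <= 1 -> 1 / 2 <= cos x.
Proof.
  intros H. rewrite <- cos_PI3.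
  assert (1 <= PI / 3) by (pose proof PI2_3_2; lra).
  assert (E : cos x = cos (Rabs x)).
  { unfold Rabs. destruct (Rcase_abs x); auto. symmetry; apply cos_neg. }
  rewrite E. pose proof (Rabs_pos x). pose proof PI_RGT_0.
  apply cos_decr_1; lra.
Qed.

Lemma cosh_ge_1 x : 1 <= cosh x.
Proof.
  unfold cosh. assert (H : exp x * exp (- x) = 1) by (rewrite <- exp_plus, Rplus_opp_r; apply exp_0).
  pose proof (exp_pos x). pose proof (exp_pos (- x)).
  pose proof (pow2_ge_0 (exp x - exp (- x))). nra.
Qed.

Lemma cosh_sinh x : cosh x ^ 2 = 1 + sinh x ^ 2.
Proof.
  unfold cosh, sinh.
  assert (H : exp x * exp (- x) = 1) by (rewrite <- exp_plus, Rplus_opp_r; apply exp_0).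
  field_simplify. replace (exp x ^ 2 + 2 * exp x * exp (- x) + exp (- x) ^ 2) with
    (exp x ^ 2 + 2 * (exp x * exp (- x)) + exp (- x) ^ 2) by ring.
  replace (exp x ^ 2 - 2 * exp x * exp (- x) + exp (- x) ^ 2 + 4) with
    (exp x ^ 2 - 2 * (exp x * exp (- x)) + exp (- x) ^ 2 + 4) by ring.
  rewrite H. field.
Qed.

Lemma sinh_pos x : 0 < x -> 0 < sinh x.
Proof.
  intros H. unfold sinh. assert (exp (- x) < exp x) by (apply exp_increasing; lra). lra.
Qed.

Section Surface.
Variables (I : R -> Prop) (eta : R -> R) (u v : R -> R -> R).
Hypothesis SD : spiral_data I eta u v.
Let Om := strip I eta.
Let p x y := y * mean (hcos u v) x y.
Let q x y := y * mean (hsin u v) x y.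

Let HO : open Om := sd_open _ _ _ _ SD.
Let HS : star Om := strip_star I eta.

Lemma strip_axis x : I x -> Om (x, 0).
Proof. intros H. split; auto. simpl. rewrite Rabs_R0. apply (sd_eta _ _ _ _ SD), H. Qed.

Lemma smooth_hcos : smooth Om (hcos u v).
Proof.
  apply smooth_mult; auto.
  - apply smooth_cosh; auto. apply (sd_v _ _ _ _ SD).
  - apply smooth_cos; auto. apply (sd_u _ _ _ _ SD).
Qed.

Lemma smooth_hsin : smooth Om (hsin u v).
Proof.
  apply smooth_mult; auto.
  - apply smooth_cosh; auto. apply (sd_v _ _ _ _ SD).
  - apply smooth_sin; auto. apply (sd_u _ _ _ _ SD).
Qed.

Lemma has_pds_comp1 (phi : R -> R) f s t l a b :
  is_derive phi (f s t) l -> has_pds f s t a b ->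
  has_pds (fun s t => phi (f s t)) s t (l * a) (l * b).
Proof.
  intros H [H1 H2]. split.
  - replace (l * a) with (scal a l) by (apply Rmult_comm).
    apply (is_derive_comp (K := R_AbsRing) (V := R_NormedModule) phi (fun x => f x t)); auto.
  - replace (l * b) with (scal b l) by (apply Rmult_comm).
    apply (is_derive_comp (K := R_AbsRing) (V := R_NormedModule) phi (fun y => f s y)); auto.
Qed.

Lemma uv_has_pds x y : Om (x, y) ->
  has_pds u x y (pd1 u x y) (pd2 u x y) /\
  has_pds v x y (- pd2 u x y) (pd1 u x y).
Proof.
  intros H. split.
  - apply smooth_has_pds with Om; auto. apply (sd_u _ _ _ _ SD).
  - assert (P : has_pds v x y (pd1 v x y) (pd2 v x y))
      by (apply smooth_has_pds with Om; auto; apply (sd_v _ _ _ _ SD)).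
    rewrite <- (sd_cr1 _ _ _ _ SD) in P by auto.
    replace (pd1 v x y) with (- pd2 u x y) in P; auto.
    rewrite (sd_cr2 _ _ _ _ SD) by auto. ring.
Qed.

(** By the Cauchy-Riemann equations [hcos dy - sinh v sin u dx] and
    [hsin dy + sinh v cos u dx] are closed. *)
Lemma weier_has_pds x y : Om (x, y) ->
  has_pds p x y (- (sinh (v x y) * sin (u x y))) (hcos u v x y) /\
  has_pds q x y (sinh (v x y) * cos (u x y)) (hsin u v x y).
Proof.
  intros H.
  assert (Su := sd_u _ _ _ _ SD). assert (Sv := sd_v _ _ _ _ SD).
  assert (S1 : smooth Om (fun x y => - (sinh (v x y) * sin (u x y)))).
  { apply smooth_opp; auto. apply smooth_mult; auto. apply smooth_sinh; auto.
    apply smooth_sin; auto. }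
  assert (S2 : smooth Om (fun x y => sinh (v x y) * cos (u x y))).
  { apply smooth_mult; auto. apply smooth_sinh; auto. apply smooth_cos; auto. }
  assert (D : forall x y, Om (x, y) ->
    has_pds (fun x y => cosh (v x y)) x y (sinh (v x y) * - pd2 u x y) (sinh (v x y) * pd1 u x y) /\
    has_pds (fun x y => sinh (v x y)) x y (cosh (v x y) * - pd2 u x y) (cosh (v x y) * pd1 u x y) /\
    has_pds (fun x y => cos (u x y)) x y (- sin (u x y) * pd1 u x y) (- sin (u x y) * pd2 u x y) /\
    has_pds (fun x y => sin (u x y)) x y (cos (u x y) * pd1 u x y) (cos (u x y) * pd2 u x y)).
  { intros s t Hst. destruct (uv_has_pds s t Hst) as [Pu Pv].
    refine (conj _ (conj _ (conj _ _))).
    - apply (has_pds_comp1 cosh); [apply is_derive_cosh_R|exact Pv].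
    - apply (has_pds_comp1 sinh); [apply is_derive_sinh_R|exact Pv].
    - apply (has_pds_comp1 cos); [apply is_derive_cos_R|exact Pu].
    - apply (has_pds_comp1 sin); [apply is_derive_sin_R|exact Pu]. }
  split.
  - apply (has_pds_primitive Om HO HS (hcos u v) (fun x y => - (sinh (v x y) * sin (u x y)))); auto.
    + apply smooth_hcos.
    + intros s t Hst. destruct (D s t Hst) as (D1 & D2 & D3 & D4).
      destruct (has_pds_eq _ _ _ _ _ (has_pds_mult _ _ _ _ _ _ _ _ D1 D3)) as [E1 _].
      unfold hcos. rewrite E1.
      destruct (has_pds_mult _ _ _ _ _ _ _ _ D2 D4) as [_ E2].
      symmetry. apply is_derive_unique.
      match type of E2 with is_derive _ _ ?l => replace (_ + _) with (- l) by ring end.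
      apply (is_derive_opp (K := R_AbsRing) (V := R_NormedModule) (fun y => sinh (v s y) * sin (u s y))).
      exact E2.
    + intros s t Hst. rewrite (sd_v0 _ _ _ _ SD). rewrite sinh_0; ring.
  - apply (has_pds_primitive Om HO HS (hsin u v) (fun x y => sinh (v x y) * cos (u x y))); auto.
    + apply smooth_hsin.
    + intros s t Hst. destruct (D s t Hst) as (D1 & D2 & D3 & D4).
      destruct (has_pds_eq _ _ _ _ _ (has_pds_mult _ _ _ _ _ _ _ _ D1 D4)) as [E1 _].
      destruct (has_pds_eq _ _ _ _ _ (has_pds_mult _ _ _ _ _ _ _ _ D2 D3)) as [_ E2].
      unfold hsin. rewrite E1, E2. ring.
    + intros s t Hst. rewrite (sd_v0 _ _ _ _ SD). rewrite sinh_0; ring.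
Qed.

Lemma smooth_weier : smooth_patch Om (weier u v).
Proof.
  repeat split; unfold weier, x1, x2, x3; simpl.
  - apply smooth_mult; auto using smooth_snd. apply smooth_mean; auto. apply smooth_hcos.
  - apply smooth_mult; auto using smooth_snd. apply smooth_mean; auto. apply smooth_hsin.
  - apply smooth_fst; auto.
Qed.

(** The parameters are isothermal with conformal factor [cosh v], the unit
    normal is [(- sin u, cos u, - sinh v) / cosh v], and the second fundamental
    form has entries [v_x, u_x, u_y]. *)
Lemma weier_curvature x y : Om (x, y) ->
  regular_at (weier u v) x y /\ mean_curvature (weier u v) x y = 0 /\
  sqnorm_A (weier u v) x y = 2 * (pd1 u x y ^ 2 + pd2 u x y ^ 2) / cosh (v x y) ^ 4.
Proof.
  intros H.
  destruct (weier_has_pds x y H) as [P Q].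
  destruct (uv_has_pds x y H) as [Pu Pv].
  assert (Pz : forall x y : R, has_pds (fun x _ => x) x y 1 0).
  { intros; split; [apply is_derive_id_R|apply is_derive_const_R]. }
  set (C := cosh (v x y)). set (S := sinh (v x y)).
  set (co := cos (u x y)). set (si := sin (u x y)).
  assert (HC : 1 <= C) by apply cosh_ge_1.
  assert (HCS : C ^ 2 = 1 + S ^ 2) by apply cosh_sinh.
  assert (Hsc : si ^ 2 + co ^ 2 = 1).
  { pose proof (sin2_cos2 (u x y)). unfold Rsqr in *. unfold si, co. lra. }
  assert (E1 : forall s t, Om (s, t) -> PD1 (weier u v) s t =
     (- (sinh (v s t) * sin (u s t)), sinh (v s t) * cos (u s t), 1)).
  { intros s t Hst. destruct (weier_has_pds s t Hst) as [P' Q'].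
    apply triple_eq; [exact (proj1 (has_pds_eq _ _ _ _ _ P'))
      |exact (proj1 (has_pds_eq _ _ _ _ _ Q'))|exact (proj1 (has_pds_eq _ _ _ _ _ (Pz s t)))]. }
  assert (E2 : forall s t, Om (s, t) -> PD2 (weier u v) s t =
     (hcos u v s t, hsin u v s t, 0)).
  { intros s t Hst. destruct (weier_has_pds s t Hst) as [P' Q'].
    apply triple_eq; [exact (proj2 (has_pds_eq _ _ _ _ _ P'))
      |exact (proj2 (has_pds_eq _ _ _ _ _ Q'))|exact (proj2 (has_pds_eq _ _ _ _ _ (Pz s t)))]. }
  assert (D1 : has_pds (fun x y => cosh (v x y)) x y (S * - pd2 u x y) (S * pd1 u x y))
    by (apply (has_pds_comp1 cosh); [apply is_derive_cosh_R|exact Pv]).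
  assert (D2 : has_pds (fun x y => sinh (v x y)) x y (C * - pd2 u x y) (C * pd1 u x y))
    by (apply (has_pds_comp1 sinh); [apply is_derive_sinh_R|exact Pv]).
  assert (D3 : has_pds (fun x y => cos (u x y)) x y (- si * pd1 u x y) (- si * pd2 u x y))
    by (apply (has_pds_comp1 cos); [apply is_derive_cos_R|exact Pu]).
  assert (D4 : has_pds (fun x y => sin (u x y)) x y (co * pd1 u x y) (co * pd2 u x y))
    by (apply (has_pds_comp1 sin); [apply is_derive_sin_R|exact Pu]).
  pose proof (has_pds_mult _ _ _ _ _ _ _ _ (has_pds_mult (fun _ _ => -1) _ _ _ 0 0 _ _
    (conj (is_derive_const_R _ _) (is_derive_const_R _ _)) D2) D4) as M1.
  pose proof (has_pds_mult _ _ _ _ _ _ _ _ D2 D3) as M2.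
  pose proof (has_pds_mult _ _ _ _ _ _ _ _ D1 D3) as M3.
  pose proof (has_pds_mult _ _ _ _ _ _ _ _ D1 D4) as M4.
  assert (F11 : PD1 (PD1 (weier u v)) x y =
    (- (C * - pd2 u x y * si + S * (co * pd1 u x y)), C * - pd2 u x y * co + S * (- si * pd1 u x y), 0)).
  { apply triple_eq.
    - apply (has_pds_eq (fun s t => x1 (PD1 (weier u v) s t)) x y _
        (- (C * pd1 u x y * si + S * (co * pd2 u x y)))).
      apply has_pds_ext_loc with Om (fun s t => -1 * sinh (v s t) * sin (u s t)); auto.
      + intros s t Hst. rewrite E1 by auto. unfold x1; simpl. ring.
      + eapply has_pds_val; [exact M1| |]; unfold C, S, si, co; ring.
    - apply (has_pds_eq (fun s t => x2 (PD1 (weier u v) s t)) x y _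
        (C * pd1 u x y * co + S * (- si * pd2 u x y))).
      apply has_pds_ext_loc with Om (fun s t => sinh (v s t) * cos (u s t)); auto.
      intros s t Hst. rewrite E1 by auto. reflexivity.
    - apply (has_pds_eq (fun s t => x3 (PD1 (weier u v) s t)) x y 0 0).
      apply has_pds_ext_loc with Om (fun _ _ => 1); auto.
      + intros s t Hst. rewrite E1 by auto. reflexivity.
      + split; apply is_derive_const_R. }
  assert (F2 : has_pds (fun s t => x1 (PD2 (weier u v) s t)) x y
      (S * - pd2 u x y * co + C * (- si * pd1 u x y)) (S * pd1 u x y * co + C * (- si * pd2 u x y)) /\
    has_pds (fun s t => x2 (PD2 (weier u v) s t)) x y
      (S * - pd2 u x y * si + C * (co * pd1 u x y)) (S * pd1 u x y * si + C * (co * pd2 u x y)) /\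
    has_pds (fun s t => x3 (PD2 (weier u v) s t)) x y 0 0).
  { refine (conj _ (conj _ _)).
    - apply has_pds_ext_loc with Om (hcos u v); auto.
      intros s t Hst. rewrite E2 by auto. reflexivity.
    - apply has_pds_ext_loc with Om (hsin u v); auto.
      intros s t Hst. rewrite E2 by auto. reflexivity.
    - apply has_pds_ext_loc with Om (fun _ _ => 0); auto.
      + intros s t Hst. rewrite E2 by auto. reflexivity.
      + split; apply is_derive_const_R. }
  destruct F2 as (F2a & F2b & F2c).
  assert (F12 : PD1 (PD2 (weier u v)) x y =
    (S * - pd2 u x y * co + C * (- si * pd1 u x y), S * - pd2 u x y * si + C * (co * pd1 u x y), 0)).
  { apply triple_eq; [apply (has_pds_eq _ _ _ _ _ F2a)|apply (has_pds_eq _ _ _ _ _ F2b)|apply (has_pds_eq _ _ _ _ _ F2c)]. }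
  assert (F22 : PD2 (PD2 (weier u v)) x y =
    (S * pd1 u x y * co + C * (- si * pd2 u x y), S * pd1 u x y * si + C * (co * pd2 u x y), 0)).
  { apply triple_eq; [apply (has_pds_eq _ _ _ _ _ F2a)|apply (has_pds_eq _ _ _ _ _ F2b)|apply (has_pds_eq _ _ _ _ _ F2c)]. }
  assert (CR : cross (PD1 (weier u v) x y) (PD2 (weier u v) x y) = (- (C * si), C * co, - (S * C))).
  { rewrite E1, E2 by auto. unfold cross, hcos, hsin, x1, x2, x3; cbn [fst snd].
    fold C S co si. apply triple_eq; try ring.
    replace (- (S * si) * (C * si) - S * co * (C * co)) with (- (S * C) * (si ^ 2 + co ^ 2)) by ring.
    rewrite Hsc; ring. }
  assert (Hreg : regular_at (weier u v) x y).
  { unfold regular_at. rewrite CR. intros E0. injection E0 as K1 K2 K3. nra. }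
  assert (UN : unit_normal (weier u v) x y = (- si / C, co / C, - S / C)).
  { unfold unit_normal. rewrite norm_dot, CR.
    replace (dot _ _) with ((C ^ 2) ^ 2).
    - rewrite sqrt_pow2 by nra. rewrite scal_R3. unfold x1, x2, x3; cbn [fst snd].
      apply triple_eq; field; lra.
    - unfold dot, x1, x2, x3; cbn [fst snd].
      replace (- (C * si) * - (C * si) + C * co * (C * co) + - (S * C) * - (S * C))
        with (C ^ 2 * (si ^ 2 + co ^ 2 + S ^ 2)) by ring.
      rewrite Hsc, <- HCS. ring. }
  split; auto.
  assert (G11 : g11 (weier u v) x y = C ^ 2).
  { unfold g11. rewrite E1 by auto. unfold dot, x1, x2, x3; cbn [fst snd]. fold S si co.
    replace (_ + _) with (S ^ 2 * (si ^ 2 + co ^ 2) + 1) by ring. rewrite Hsc, HCS; ring. }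
  assert (G12 : g12 (weier u v) x y = 0).
  { unfold g12. rewrite E1, E2 by auto. unfold dot, hcos, hsin, x1, x2, x3; cbn [fst snd]. ring. }
  assert (G22 : g22 (weier u v) x y = C ^ 2).
  { unfold g22. rewrite E2 by auto. unfold dot, hcos, hsin, x1, x2, x3; cbn [fst snd]. fold C si co.
    replace (_ + _) with (C ^ 2 * (si ^ 2 + co ^ 2)) by ring. rewrite Hsc; ring. }
  assert (H11 : h11 (weier u v) x y = - pd2 u x y).
  { unfold h11. rewrite F11, UN. unfold dot, x1, x2, x3; cbn [fst snd].
    transitivity (- pd2 u x y * (si ^ 2 + co ^ 2)); [field; lra|rewrite Hsc; ring]. }
  assert (H12 : h12 (weier u v) x y = pd1 u x y).
  { unfold h12. rewrite F12, UN. unfold dot, x1, x2, x3; cbn [fst snd].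
    transitivity (pd1 u x y * (si ^ 2 + co ^ 2)); [field; lra|rewrite Hsc; ring]. }
  assert (H22 : h22 (weier u v) x y = pd2 u x y).
  { unfold h22. rewrite F22, UN. unfold dot, x1, x2, x3; cbn [fst snd].
    transitivity (pd2 u x y * (si ^ 2 + co ^ 2)); [field; lra|rewrite Hsc; ring]. }
  unfold mean_curvature, sqnorm_A, a11, a12, a21, a22, gdet.
  rewrite H11, H12, H22, G11, G12, G22.
  split; field; lra.
Qed.

(** ** Signed distance and angle *)

(** Along a vertical segment the curve [weier x] moves in directions close to
    [alpha] as long as [u] stays close to [alpha]. *)
Lemma mean_direction x y alpha : Om (x, y) ->
  (forall r, 0 <= r <= 1 -> Rabs (u x (y * r) - alpha) <= 1) ->
  1 / 2 <= cos alpha * mean (hcos u v) x y + sin alpha * mean (hsin u v) x y.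
Proof.
  intros H Ha.
  assert (C1 : forall s t, Om (s, t) -> continuity_2d_pt (hcos u v) s t)
    by (intros; apply smooth_continuity with Om; auto using smooth_hcos).
  assert (C2 : forall s t, Om (s, t) -> continuity_2d_pt (hsin u v) s t)
    by (intros; apply smooth_continuity with Om; auto using smooth_hsin).
  pose proof (ex_RInt_along Om HS _ _ _ C1 H) as X1.
  pose proof (ex_RInt_along Om HS _ _ _ C2 H) as X2.
  unfold mean.
  replace (cos alpha * _ + sin alpha * _) with
    (RInt (fun r => cos alpha * hcos u v x (y * r) + sin alpha * hsin u v x (y * r)) 0 1).
  - replace (1 / 2) with (RInt (fun _ => 1 / 2) 0 1)
      by (rewrite RInt_const; unfold scal; simpl; unfold mult; simpl; field).
    apply RInt_le; [lra|apply ex_RInt_const| |].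
    + apply (ex_RInt_plus (V := R_NormedModule)); apply (ex_RInt_scal (V := R_NormedModule)); auto.
    + intros r Hr. unfold hcos, hsin.
      replace (cos alpha * _ + _) with (cosh (v x (y * r)) * cos (u x (y * r) - alpha))
        by (rewrite cos_minus; ring).
      pose proof (cos_ge_half _ (Ha r ltac:(lra))). pose proof (cosh_ge_1 (v x (y * r))). nra.
  - rewrite (RInt_plus (V := R_CompleteNormedModule)).
    + rewrite !(RInt_scal (V := R_CompleteNormedModule)) by auto. reflexivity.
    + apply (ex_RInt_scal (V := R_NormedModule)); auto.
    + apply (ex_RInt_scal (V := R_NormedModule)); auto.
Qed.

Lemma osc_pair x y y' : Om (x, y) -> Om (x, y') -> Rabs (u x y - u x y') <= 1.
Proof.
  intros H H'. pose proof (sd_osc _ _ _ _ SD _ _ H). pose proof (sd_osc _ _ _ _ SD _ _ H').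
  replace (u x y - u x y') with ((u x y - u x 0) - (u x y' - u x 0)) by ring.
  eapply Rle_trans; [apply Rabs_triang|]. rewrite Rabs_Ropp. lra.
Qed.

Let n2 x y := mean (hcos u v) x y ^ 2 + mean (hsin u v) x y ^ 2.

Lemma n2_pos x y : Om (x, y) -> 0 < n2 x y.
Proof.
  intros H. pose proof (mean_direction x y (u x 0) H) as D.
  assert (1 / 2 <= cos (u x 0) * mean (hcos u v) x y + sin (u x 0) * mean (hsin u v) x y).
  { apply D. intros r Hr. apply osc_pair; [apply HS; auto|].
    apply strip_axis, H. }
  unfold n2. destruct (Req_dec (mean (hcos u v) x y) 0) as [E|E]; [|nra].
  destruct (Req_dec (mean (hsin u v) x y) 0) as [E'|E']; [|nra].
  rewrite E, E' in *. lra.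
Qed.

Lemma smooth_n2 : smooth Om n2.
Proof.
  apply smooth_plus; auto; apply smooth_pow2; auto; apply smooth_mean; auto.
  - apply smooth_hcos.
  - apply smooth_hsin.
Qed.

Lemma smooth_radius : smooth Om (radius u v).
Proof.
  apply smooth_mult; auto using smooth_snd. apply smooth_sqrt; auto using smooth_n2.
  intros; apply n2_pos; auto.
Qed.

Lemma radius_sq x y : radius u v x y ^ 2 = p x y ^ 2 + q x y ^ 2.
Proof.
  unfold radius, p, q. rewrite Rpow_mult_distr, pow2_sqrt; [ring|].
  apply Rplus_le_le_0_compat; apply pow2_ge_0.
Qed.

(** The factor [y] has been divided out of [radius * d radius = p dp + q dq]. *)
Lemma radius_pds x y : Om (x, y) ->
  sqrt (n2 x y) * pd1 (radius u v) x y =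
    sinh (v x y) * (cos (u x y) * mean (hsin u v) x y - sin (u x y) * mean (hcos u v) x y) /\
  sqrt (n2 x y) * pd2 (radius u v) x y =
    cosh (v x y) * (cos (u x y) * mean (hcos u v) x y + sin (u x y) * mean (hsin u v) x y).
Proof.
  intros H. pose proof (n2_pos x y H) as Hn.
  assert (Hs : 0 < sqrt (n2 x y)) by (apply sqrt_lt_R0; auto).
  destruct (weier_has_pds x y H) as [P Q].
  assert (Mc : smooth Om (mean (hcos u v))) by (apply smooth_mean; auto; apply smooth_hcos).
  assert (Ms : smooth Om (mean (hsin u v))) by (apply smooth_mean; auto; apply smooth_hsin).
  pose proof (smooth_has_pds _ _ _ _ Mc H) as DC. pose proof (smooth_has_pds _ _ _ _ Ms H) as DS.
  set (c := mean (hcos u v)) in *. set (s := mean (hsin u v)) in *.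
  assert (Y : has_pds (fun _ y => y) x y 0 1) by (split; [apply is_derive_const_R|apply is_derive_id_R]).
  destruct (has_pds_eq _ _ _ _ _ (has_pds_mult _ _ _ _ _ _ _ _ Y DC)) as [A1 A2].
  destruct (has_pds_eq _ _ _ _ _ (has_pds_mult _ _ _ _ _ _ _ _ Y DS)) as [B1 B2].
  destruct (has_pds_eq _ _ _ _ _ P) as [A1' A2']. destruct (has_pds_eq _ _ _ _ _ Q) as [B1' B2'].
  unfold p in A1', A2'. unfold q in B1', B2'. fold c in A1', A2'. fold s in B1', B2'.
  rewrite A1' in A1. rewrite A2' in A2. rewrite B1' in B1. rewrite B2' in B2.
  assert (DN : has_pds (fun x y => sqrt (c x y ^ 2 + s x y ^ 2)) x y
    (/ (2 * sqrt (n2 x y)) * (2 * (c x y * pd1 c x y + s x y * pd1 s x y)))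
    (/ (2 * sqrt (n2 x y)) * (2 * (c x y * pd2 c x y + s x y * pd2 s x y)))).
  { apply (has_pds_comp1 sqrt (fun x y => c x y ^ 2 + s x y ^ 2)).
    - apply is_derive_Reals. apply derivable_pt_lim_sqrt. exact Hn.
    - apply (has_pds_val (fun x y => c x y ^ 2 + s x y ^ 2) x y
        (pd1 c x y * (c x y * 1) + c x y * (pd1 c x y * 1 + c x y * 0) +
         (pd1 s x y * (s x y * 1) + s x y * (pd1 s x y * 1 + s x y * 0)))
        (pd2 c x y * (c x y * 1) + c x y * (pd2 c x y * 1 + c x y * 0) +
         (pd2 s x y * (s x y * 1) + s x y * (pd2 s x y * 1 + s x y * 0)))); try ring.
      assert (K : has_pds (fun _ _ => 1) x y 0 0) by (split; apply is_derive_const_R).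
      apply (has_pds_plus (fun x y => c x y ^ 2) (fun x y => s x y ^ 2)).
      + apply (has_pds_mult c (fun x y => c x y * 1)); auto.
        apply (has_pds_mult c (fun _ _ => 1)); auto.
      + apply (has_pds_mult s (fun x y => s x y * 1)); auto.
        apply (has_pds_mult s (fun _ _ => 1)); auto. }
  destruct (has_pds_eq _ _ _ _ _ (has_pds_mult _ _ _ _ _ _ _ _ Y DN)) as [R1 R2].
  assert (N2 : sqrt (n2 x y) * sqrt (n2 x y) = c x y ^ 2 + s x y ^ 2) by (apply sqrt_sqrt; left; exact Hn).
  unfold hcos in A2. unfold hsin in B2. cbv beta in *.
  change (sqrt (c x y ^ 2 + s x y ^ 2)) with (sqrt (n2 x y)) in *.
  split.
  - transitivity (sqrt (n2 x y) * (y * (/ (2 * sqrt (n2 x y)) * (2 * (c x y * pd1 c x y + s x y * pd1 s x y))))).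
    + f_equal. etransitivity; [exact R1|]. cbv beta. ring.
    + transitivity (c x y * (0 * c x y + y * pd1 c x y) + s x y * (0 * s x y + y * pd1 s x y)).
      * field. lra.
      * rewrite <- A1, <- B1. ring.
  - transitivity (c x y * (1 * c x y + y * pd2 c x y) + s x y * (1 * s x y + y * pd2 s x y)).
    + transitivity (sqrt (n2 x y) * (1 * sqrt (n2 x y) + y * (/ (2 * sqrt (n2 x y)) * (2 * (c x y * pd2 c x y + s x y * pd2 s x y))))).
      * f_equal. exact R2.
      * transitivity (sqrt (n2 x y) * sqrt (n2 x y) + y * (c x y * pd2 c x y + s x y * pd2 s x y)).
        -- field. lra.
        -- rewrite N2. ring.
    + rewrite <- A2, <- B2. ring.
Qed.

(** The directions along a slice differ by at most 1, so the direction at its end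
    makes an acute angle with the chord from the axis. *)
Lemma radius_pd2_pos x y : Om (x, y) -> 0 < pd2 (radius u v) x y.
Proof.
  intros H. destruct (radius_pds x y H) as [_ E].
  assert (D : 1 / 2 <= cos (u x y) * mean (hcos u v) x y + sin (u x y) * mean (hsin u v) x y).
  { apply mean_direction; auto. intros r Hr. apply osc_pair; auto. }
  pose proof (cosh_ge_1 (v x y)).
  assert (Hs : 0 < sqrt (n2 x y)) by (apply sqrt_lt_R0, n2_pos; auto).
  assert (0 < sqrt (n2 x y) * pd2 (radius u v) x y) by (rewrite E; nra). nra.
Qed.

Lemma radius_0 x : radius u v x 0 = 0.
Proof. unfold radius; ring. Qed.

Lemma mean_even f x y : (forall t, Om (x, t) -> f x (- t) = f x t) -> Om (x, y) ->
  mean f x (- y) = mean f x y.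
Proof.
  intros E H. apply RInt_ext. intros r Hr. rewrite Rmin_left, Rmax_right in Hr by lra.
  replace (- y * r) with (- (y * r)) by ring. apply E. apply HS; auto. lra.
Qed.

Lemma hcos_even x y : Om (x, y) -> hcos u v x (- y) = hcos u v x y.
Proof.
  intros H. unfold hcos. rewrite (sd_even _ _ _ _ SD), (sd_odd _ _ _ _ SD) by auto.
  unfold cosh. rewrite Ropp_involutive. lra.
Qed.

Lemma hsin_even x y : Om (x, y) -> hsin u v x (- y) = hsin u v x y.
Proof.
  intros H. unfold hsin. rewrite (sd_even _ _ _ _ SD), (sd_odd _ _ _ _ SD) by auto.
  unfold cosh. rewrite Ropp_involutive. lra.
Qed.

Lemma radius_odd x y : Om (x, y) -> radius u v x (- y) = - radius u v x y.
Proof.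
  intros H. unfold radius.
  rewrite !mean_even by (auto using hcos_even, hsin_even). ring.
Qed.

Lemma radius_increasing x y y' : Om (x, y) -> Om (x, y') -> y < y' ->
  radius u v x y < radius u v x y'.
Proof.
  intros H H' L.
  assert (K : forall z, y <= z <= y' -> Om (x, z)).
  { intros z Hz. split; [apply H|]. destruct H as [_ H], H' as [_ H']. simpl in *.
    apply Rabs_def2 in H. apply Rabs_def2 in H'. apply Rabs_def1; lra. }
  destruct (MVT_gen (radius u v x) y y' (pd2 (radius u v) x)) as (c & Hc & E).
  - intros z Hz. rewrite Rmin_left, Rmax_right in Hz by lra.
    apply (smooth_has_pds Om (radius u v)); auto using smooth_radius. apply K; lra.
  - intros z Hz. rewrite Rmin_left, Rmax_right in Hz by lra.
    apply continuity_pt_filterlim. apply continuity_2d_slice.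
    apply smooth_continuity with Om; auto using smooth_radius.
  - rewrite Rmin_left, Rmax_right in Hc by lra.
    pose proof (radius_pd2_pos x c (K c ltac:(lra))). nra.
Qed.

End Surface.

(** ** Parametrization by height and signed distance to the axis *)

(** Roots of increasing functions are trapped between two nearby arguments, so
    pointwise convergence of the functions is enough for the roots to converge. *)
Lemma lim_root {T} (F : (T -> Prop) -> Prop) {FF : Filter F}
    (dom : T -> R -> Prop) (f : T -> R -> R) (g : R -> R) (Y tau : T -> R) y0 e0 :
  0 < e0 ->
  F (fun z => dom z (Y z) /\ f z (Y z) = tau z /\
       forall y y', dom z y -> dom z y' -> y < y' -> f z y < f z y') ->
  (forall y, Rabs (y - y0) < e0 ->
     F (fun z => dom z y) /\ filterlim (fun z => f z y) F (locally (g y))) ->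
  (forall y y', Rabs (y - y0) < e0 -> Rabs (y' - y0) < e0 -> y < y' -> g y < g y') ->
  filterlim tau F (locally (g y0)) -> filterlim Y F (locally y0).
Proof.
  intros He HY Hd Hg Ht. apply filterlim_R; auto. intros eps Heps.
  set (e := Rmin eps e0 / 2).
  assert (H0 : 0 < e /\ e < eps /\ e < e0).
  { unfold e. pose proof (Rmin_l eps e0). pose proof (Rmin_r eps e0).
    pose proof (Rmin_pos _ _ Heps He). lra. }
  destruct (Hd (y0 - e)) as [D1 L1]; [apply Rabs_def1; lra|].
  destruct (Hd (y0 + e)) as [D2 L2]; [apply Rabs_def1; lra|].
  assert (G1 : g (y0 - e) < g y0) by (apply Hg; try apply Rabs_def1; lra).
  assert (G2 : g y0 < g (y0 + e)) by (apply Hg; try apply Rabs_def1; lra).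
  set (k := Rmin (g y0 - g (y0 - e)) (g (y0 + e) - g y0) / 2).
  assert (Hk : 0 < k) by (unfold k; pose proof (Rmin_pos (g y0 - g (y0 - e)) (g (y0 + e) - g y0) ltac:(lra) ltac:(lra)); lra).
  pose proof (Rmin_l (g y0 - g (y0 - e)) (g (y0 + e) - g y0)).
  pose proof (Rmin_r (g y0 - g (y0 - e)) (g (y0 + e) - g y0)).
  assert (A1 := proj1 (filterlim_R F _ _) L1 k Hk).
  assert (A2 := proj1 (filterlim_R F _ _) L2 k Hk).
  assert (A3 := proj1 (filterlim_R F _ _) Ht k Hk).
  generalize (filter_and _ _ HY (filter_and _ _ (filter_and _ _ D1 D2)
    (filter_and _ _ A1 (filter_and _ _ A2 A3)))).
  apply filter_imp. intros z ((Z1 & Z2 & Z3) & (Z4 & Z5) & Z6 & Z7 & Z8).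
  apply Rabs_def2 in Z6. apply Rabs_def2 in Z7. apply Rabs_def2 in Z8.
  unfold k in *. apply Rabs_def1.
  - apply Rnot_le_lt. intros N.
    destruct (Rle_lt_or_eq_dec (y0 + e) (Y z)) as [N'|N']; [lra| |].
    + specialize (Z3 _ _ Z5 Z1 N'). lra.
    + lra.
  - apply Rnot_le_lt. intros N.
    destruct (Rle_lt_or_eq_dec (Y z) (y0 - e)) as [N'|N']; [lra| |].
    + specialize (Z3 _ _ Z1 Z4 N'). lra.
    + lra.
Qed.

Lemma open_and_R2 (U V : R2 -> Prop) : open U -> open V -> open (fun q => U q /\ V q).
Proof. apply (open_and (T := prod_UniformSpace R_UniformSpace R_UniformSpace)). Qed.

Lemma open_Rabs_lt r : open (fun t : R => Rabs t < r).
Proof.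
  intros t Ht. assert (Hd : 0 < r - Rabs t) by lra. exists (mkposreal _ Hd).
  intros y Hy. change (Rabs (y - t) < r - Rabs t) in Hy.
  replace y with (y - t + t) by ring. eapply Rle_lt_trans; [apply Rabs_triang|]. lra.
Qed.

Lemma open_snd (P : R -> Prop) : open P -> open (fun q : R2 => P (snd q)).
Proof.
  intros HP. apply (open_comp (snd : R2 -> R)); auto.
  intros. apply continuous_snd.
Qed.

Lemma lim_fst (x y : R) :
  filterlim (fun z : R2 => fst z) (locally (x, y)) (locally x).
Proof. apply (continuous_fst (U := R_UniformSpace) (V := R_UniformSpace)). Qed.

Lemma lim_snd (x y : R) :
  filterlim (fun z : R2 => snd z) (locally (x, y)) (locally y).
Proof. apply (continuous_snd (U := R_UniformSpace) (V := R_UniformSpace)). Qed.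

(** The [y] at which the slice at height [s] has the signed distance [t] to the
    axis; [radius] increases in [y], so there is at most one. *)
Definition root_radius (eta : R -> R) (u v : R -> R -> R) (s t : R) : R :=
  epsilon (inhabits 0) (fun y => Rabs y < eta s /\ radius u v s y = t).

Definition polar_patch (eta : R -> R) (u v : R -> R -> R) : patch :=
  fun s t => weier u v s (root_radius eta u v s t).

Definition polar_angle (eta : R -> R) (u v : R -> R -> R) (s t : R) : R :=
  angle u v s (root_radius eta u v s t).

Section Polar.
Variables (I : R -> Prop) (eta : R -> R) (u v : R -> R -> R).
Hypothesis SD : spiral_data I eta u v.
Let Om := strip I eta.
Let psi := root_radius eta u v.
Let zeta := radius u v.
Let X := polar_patch eta u v.
Let Th := polar_angle eta u v.

Definition polar_dom (q : R2) : Prop := I (fst q) /\ Rabs (snd q) < 2.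

Lemma open_polar_dom : open polar_dom.
Proof.
  apply open_and_R2; [apply open_fst|apply (open_snd (fun t => Rabs t < 2)), open_Rabs_lt].
  apply (sd_open_I _ _ _ _ SD).
Qed.

Lemma root_radius_spec s t : polar_dom (s, t) ->
  Om (s, psi s t) /\ zeta s (psi s t) = t.
Proof.
  intros [Hs Ht]. simpl in *.
  assert (E : exists y, Rabs y < eta s /\ zeta s y = t).
  { destruct (sd_reach _ _ _ _ SD s Hs) as (y1 & Hy1 & Hr).
    apply Rabs_def2 in Ht.
    destruct (IVT_interv (fun y => zeta s y - t) (- y1) y1) as (y & Hy & E).
    - intros a Ha. apply continuity_pt_minus.
      + apply continuity_pt_filterlim. apply continuity_2d_slice.
        apply smooth_continuity with Om; [apply smooth_radius; auto|].
        split; auto. simpl. apply Rabs_def1; lra.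
      + apply continuity_pt_const. intros ? ?; reflexivity.
    - lra.
    - assert (Hy : Om (s, y1)) by (split; auto; simpl; rewrite Rabs_pos_eq; lra).
      unfold zeta. rewrite (radius_odd I eta u v SD) by auto. lra.
    - fold zeta in Hr. lra.
    - exists y. split; [apply Rabs_def1; lra|lra]. }
  pose proof (epsilon_spec (inhabits 0) _ E) as [E1 E2].
  split; [split|]; auto.
Qed.

Lemma root_radius_unique s y : Om (s, y) -> Rabs (zeta s y) < 2 ->
  psi s (zeta s y) = y.
Proof.
  intros H Hr.
  assert (D : polar_dom (s, zeta s y)) by (split; auto; apply H).
  destruct (root_radius_spec _ _ D) as [D1 D2].
  destruct (Rtotal_order (psi s (zeta s y)) y) as [L|[L|L]]; auto; exfalso.
  - pose proof (radius_increasing I eta u v SD s _ _ D1 H L). unfold zeta in *. lra.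
  - pose proof (radius_increasing I eta u v SD s _ _ H D1 L). unfold zeta in *. lra.
Qed.

Lemma root_radius_continuity s t : polar_dom (s, t) -> continuity_2d_pt psi s t.
Proof.
  intros H. apply continuity_2d_pt_filterlim.
  destruct (root_radius_spec _ _ H) as [D1 D2].
  destruct (open_locally_2d _ _ _ (sd_open _ _ _ _ SD) D1) as [e He].
  assert (K : forall y, Rabs (y - psi s t) < e -> Om (s, y)).
  { intros y Hy. apply He; auto. rewrite Rminus_diag, Rabs_R0. apply cond_pos. }
  apply (lim_root (locally (s, t)) (fun z y => Om (fst z, y)) (fun z y => zeta (fst z) y)
    (zeta s) _ (fun z => snd z) (psi s t) e (cond_pos e)).
  - apply (filter_imp polar_dom); [|apply open_polar_dom, H].
    intros [a c] Hz. destruct (root_radius_spec _ _ Hz) as [Z1 Z2]. simpl. split; [exact Z1|split].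
    + exact Z2.
    + intros y y' Hy Hy' L. apply (radius_increasing I eta u v SD); auto.
  - intros y Hy. split.
    + pose proof (open_locally_2d _ _ _ (sd_open _ _ _ _ SD) (K y Hy)) as L.
      apply locally_2d_1d_const_y in L. destruct L as [d Hd]. exists d.
      intros [a c] [Ha _]. apply Hd, Ha.
    + apply lim_comp2; [|apply lim_fst|apply lim_const].
      apply smooth_continuity with Om; auto. apply smooth_radius; auto.
  - intros y y' Hy Hy' L. apply (radius_increasing I eta u v SD); auto; apply K; auto.
  - rewrite D2. apply lim_snd.
Qed.

Lemma root_radius_smooth :
  (forall s t, polar_dom (s, t) ->
    has_pds psi s t (- pd1 zeta s (psi s t) / pd2 zeta s (psi s t))
      (/ pd2 zeta s (psi s t))) /\
  smooth polar_dom psi.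
Proof.
  apply (smooth_inverse Om).
  - apply (sd_open _ _ _ _ SD).
  - apply open_polar_dom.
  - apply smooth_radius; auto.
  - intros s y H. apply Rgt_not_eq. apply (radius_pd2_pos I eta u v SD); auto.
  - apply root_radius_spec.
  - apply root_radius_continuity.
Qed.

Lemma polar_patch_smooth : smooth_patch polar_dom X.
Proof.
  apply (smooth_patch_reparam Om polar_dom (fun s _ => s) psi (sd_open _ _ _ _ SD) open_polar_dom).
  - apply smooth_fst, open_polar_dom.
  - apply root_radius_smooth.
  - intros s t H. apply root_radius_spec; auto.
  - apply smooth_weier; auto.
Qed.

Lemma polar_patch_curvature s t : polar_dom (s, t) ->
  regular_at X s t /\ mean_curvature X s t = 0 /\
  sqnorm_A X s t = 2 * (pd1 u s (psi s t) ^ 2 + pd2 u s (psi s t) ^ 2) / cosh (v s (psi s t)) ^ 4.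
Proof.
  intros H. destruct (root_radius_spec _ _ H) as [D1 D2].
  destruct (weier_curvature I eta u v SD s (psi s t) D1) as (W1 & W2 & W3).
  destruct root_radius_smooth as [P S]. specialize (P s t H).
  destruct (has_pds_eq _ _ _ _ _ P) as [P1 P2].
  assert (E : has_pds (fun s _ : R => s) s t 1 0) by (split; [apply is_derive_id_R|apply is_derive_const_R]).
  destruct (has_pds_eq _ _ _ _ _ E) as [E1 E2].
  pose proof (radius_pd2_pos I eta u v SD s _ D1) as Hp.
  assert (J : pd1 (fun s _ : R => s) s t * pd2 psi s t - pd2 (fun s _ : R => s) s t * pd1 psi s t <> 0).
  { rewrite E1, E2, P2. replace (1 * _ - _) with (/ pd2 zeta s (psi s t)) by ring.
    apply Rinv_neq_0_compat. apply Rgt_not_eq. exact Hp. }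
  destruct (reparam_curvature Om polar_dom (fun s _ => s) psi (weier u v) s t
    (sd_open _ _ _ _ SD) open_polar_dom (smooth_fst _ open_polar_dom) S
    (fun a c Hac => proj1 (root_radius_spec a c Hac))
    (smooth_weier I eta u v SD) H J W1) as (R1 & R2 & R3).
  split; [exact R1|]. split; [apply R2, W2|]. rewrite <- W3. exact R3.
Qed.

Lemma polar_patch_dist s t : polar_dom (s, t) ->
  x1 (X s t) ^ 2 + x2 (X s t) ^ 2 = t ^ 2 /\ x3 (X s t) = s.
Proof.
  intros H. destruct (root_radius_spec _ _ H) as [D1 D2]. split; [|reflexivity].
  rewrite <- D2 at 3. unfold zeta. rewrite (radius_sq u v). reflexivity.
Qed.

Lemma polar_patch_norm s t : polar_dom (s, t) -> norm (X s t) = sqrt (s ^ 2 + t ^ 2).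
Proof.
  intros H. destruct (polar_patch_dist s t H) as [E1 E2].
  rewrite norm_R3, E1, E2. f_equal. ring.
Qed.

Lemma weier_odd x y : Om (x, y) -> weier u v x (- y) = (- x1 (weier u v x y), - x2 (weier u v x y), x).
Proof.
  intros H. unfold weier, x1, x2; cbn [fst snd].
  rewrite !(mean_even I eta) by
    (auto; intros; (apply (hcos_even I eta u v SD) || apply (hsin_even I eta u v SD)); auto).
  apply triple_eq; ring.
Qed.

Lemma polar_patch_odd s t : polar_dom (s, t) ->
  X s (- t) = (- x1 (X s t), - x2 (X s t), s).
Proof.
  intros H. destruct (root_radius_spec _ _ H) as [D1 D2].
  unfold X, polar_patch. fold psi. rewrite <- weier_odd by auto. f_equal.
  rewrite <- D2 at 1. unfold zeta. rewrite <- (radius_odd I eta u v SD) by auto.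
  apply root_radius_unique.
  - destruct D1 as [D1 D1']. split; auto. simpl. rewrite Rabs_Ropp. exact D1'.
  - unfold zeta. rewrite (radius_odd I eta u v SD), Rabs_Ropp by auto. fold zeta. rewrite D2. apply H.
Qed.

Lemma polar_patch_radius x y : Om (x, y) -> Rabs (zeta x y) < 2 ->
  X x (zeta x y) = weier u v x y.
Proof. intros H Hr. unfold X, polar_patch. fold psi. rewrite root_radius_unique; auto. Qed.

(** Height and distance to the axis determine [s] and [t] up to the sign of [t];
    the points for [t] and [- t] are antipodal in their horizontal plane. *)
Lemma polar_patch_inj s t s' t' : polar_dom (s, t) -> polar_dom (s', t') ->
  X s t = X s' t' -> s = s' /\ t = t'.
Proof.
  intros H H' E.
  destruct (polar_patch_dist s t H) as [E1 E2]. destruct (polar_patch_dist s' t' H') as [E1' E2'].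
  assert (s = s') by (rewrite <- E2, <- E2', E; reflexivity). subst s'.
  split; auto. rewrite <- E, E1 in E1'.
  destruct (Req_dec t t') as [|N]; auto.
  assert (t' = - t) by nra. subst t'.
  rewrite polar_patch_odd in E by auto.
  pose proof (f_equal x1 E) as F1. pose proof (f_equal x2 E) as F2.
  unfold x1 at 2 in F1. unfold x2 at 2 in F2. simpl in F1, F2.
  assert (t ^ 2 = 0) by (rewrite <- E1; nra). nra.
Qed.

Lemma polar_patch_axis s : I s -> X s 0 = (0, 0, s).
Proof.
  intros H. pose proof (strip_axis I eta u v SD s H) as H0.
  assert (E : zeta s 0 = 0) by apply radius_0.
  rewrite <- E at 1. rewrite polar_patch_radius; auto.
  - unfold weier. rewrite !Rmult_0_l. reflexivity.
  - rewrite E, Rabs_R0. lra.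
Qed.

(** ** The polar angle *)

(** The arctangent in [angle] never passes through a vertical direction. *)
Lemma angle_den x y : Om (x, y) ->
  1 / 2 <= cos (u x 0) * mean (hcos u v) x y + sin (u x 0) * mean (hsin u v) x y.
Proof.
  intros H. apply (mean_direction I eta u v SD); auto.
  intros r Hr. apply (osc_pair I eta u v SD).
  - apply strip_star; auto.
  - apply (strip_axis I eta u v SD). apply H.
Qed.

Lemma smooth_angle : smooth Om (angle u v).
Proof.
  pose proof (sd_open _ _ _ _ SD) as HO.
  assert (A : smooth Om (fun x _ => u x 0)).
  { apply (smooth_comp Om Om u (fun x _ => x) (fun _ _ => 0)); auto using smooth_const.
    - intros s t [H _]. apply (strip_axis I eta u v SD), H.
    - apply (sd_u _ _ _ _ SD).
    - apply smooth_fst; auto. }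
  assert (Mc : smooth Om (mean (hcos u v))).
  { apply smooth_mean; auto; [apply strip_star|apply (smooth_hcos I eta u v SD)]. }
  assert (Ms : smooth Om (mean (hsin u v))).
  { apply smooth_mean; auto; [apply strip_star|apply (smooth_hsin I eta u v SD)]. }
  unfold angle. apply smooth_plus; auto. apply smooth_atan; auto.
  apply (smooth_div Om (fun x y => cos (u x 0) * mean (hsin u v) x y - sin (u x 0) * mean (hcos u v) x y)
    (fun x y => cos (u x 0) * mean (hcos u v) x y + sin (u x 0) * mean (hsin u v) x y)); auto.
  - apply smooth_minus; auto; apply smooth_mult; auto; [apply smooth_cos|apply smooth_sin]; auto.
  - apply smooth_plus; auto; apply smooth_mult; auto; [apply smooth_cos|apply smooth_sin]; auto.
  - intros s t H. pose proof (angle_den s t H). lra.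
Qed.

(** The sign of [radius] absorbs the antipode, so that a single formula covers
    both halves of a slice. *)
Lemma weier_polar x y : Om (x, y) ->
  weier u v x y = (zeta x y * cos (angle u v x y), zeta x y * sin (angle u v x y), x).
Proof.
  intros H. pose proof (angle_den x y H) as Hd.
  unfold angle, zeta, radius, weier.
  set (c := mean (hcos u v) x y) in *. set (s := mean (hsin u v) x y) in *.
  set (A := u x 0) in *.
  set (a := cos A * c + sin A * s) in *. set (b := cos A * s - sin A * c).
  assert (HA : sin A ^ 2 + cos A ^ 2 = 1) by (pose proof (sin2_cos2 A); unfold Rsqr in *; lra).
  assert (N : c ^ 2 + s ^ 2 = a ^ 2 * (1 + (b / a) ^ 2)).
  { replace (a ^ 2 * (1 + (b / a) ^ 2)) with (a ^ 2 + b ^ 2) by (field; lra).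
    replace (a ^ 2 + b ^ 2) with ((c ^ 2 + s ^ 2) * (sin A ^ 2 + cos A ^ 2)) by (unfold a, b; ring).
    rewrite HA; ring. }
  assert (Hq : 0 < 1 + (b / a) ^ 2) by (pose proof (pow2_ge_0 (b / a)); lra).
  assert (Hs : 0 < sqrt (1 + (b / a) ^ 2)) by (apply sqrt_lt_R0; auto).
  rewrite N, sqrt_mult by (try apply pow2_ge_0; lra).
  rewrite sqrt_pow2 by lra.
  assert (Cd : cos (atan (b / a)) = 1 / sqrt (1 + (b / a) ^ 2))
    by (rewrite cos_atan; unfold Rsqr; simpl; rewrite Rmult_1_r; reflexivity).
  assert (Sd : sin (atan (b / a)) = b / a / sqrt (1 + (b / a) ^ 2))
    by (rewrite sin_atan; unfold Rsqr; simpl; rewrite Rmult_1_r; reflexivity).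
  rewrite cos_plus, sin_plus, Cd, Sd.
  apply triple_eq; auto.
  - transitivity (y * (a * cos A - b * sin A)).
    + f_equal. transitivity (c * (sin A ^ 2 + cos A ^ 2)); [rewrite HA; ring|unfold a, b; ring].
    + field. split; lra.
  - transitivity (y * (a * sin A + b * cos A)).
    + f_equal. transitivity (s * (sin A ^ 2 + cos A ^ 2)); [rewrite HA; ring|unfold a, b; ring].
    + field. split; lra.
Qed.

Lemma polar_patch_eq s t : polar_dom (s, t) ->
  X s t = (t * cos (Th s t), t * sin (Th s t), s).
Proof.
  intros H. destruct (root_radius_spec _ _ H) as [D1 D2].
  unfold X, polar_patch. fold psi. rewrite weier_polar by auto. rewrite D2. reflexivity.
Qed.

Lemma smooth_polar_angle : smooth polar_dom Th.
Proof.
  apply (smooth_comp polar_dom Om (angle u v) (fun s _ => s) psi).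
  - apply open_polar_dom.
  - apply (sd_open _ _ _ _ SD).
  - intros s t H. apply root_radius_spec; auto.
  - apply smooth_angle.
  - apply smooth_fst, open_polar_dom.
  - apply root_radius_smooth.
Qed.

(** Off the axis the surface is nowhere vertical: the horizontal components of
    [weier] have Jacobian determinant [- sinh v * cosh v].  Hence circles about
    the axis climb along the surface. *)
Lemma polar_angle_increasing s t : polar_dom (s, t) -> 0 < t -> 0 < pd1 Th s t.
Proof.
  intros H Ht. destruct (root_radius_spec _ _ H) as [D1 D2].
  set (y := psi s t) in *.
  pose proof (sd_open _ _ _ _ SD) as HO.
  destruct root_radius_smooth as [PP PS].
  pose proof (PP s t H) as P. fold y in P.
  assert (Hy : 0 < y).
  { apply Rnot_le_lt. intros N. destruct (Rle_lt_or_eq_dec _ _ N) as [L|L].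
    - pose proof (radius_increasing I eta u v SD s y 0 D1 (strip_axis I eta u v SD s (proj1 H)) L) as K.
      rewrite radius_0 in K. fold zeta in K. lra.
    - rewrite L in D2. unfold zeta in D2. rewrite radius_0 in D2. lra. }
  pose proof (sd_vpos _ _ _ _ SD s y D1 Hy) as Hv.
  pose proof (sinh_pos _ Hv) as HSh. pose proof (cosh_ge_1 (v s y)) as HCh.
  pose proof (radius_pd2_pos I eta u v SD s y D1) as Hz. fold zeta in Hz.
  destruct (weier_has_pds I eta u v SD s y D1) as [WP WQ].
  pose proof (smooth_has_pds _ _ _ _ smooth_angle D1) as DA.
  pose proof (smooth_has_pds _ _ _ _ (smooth_radius I eta u v SD) D1) as DZ. fold zeta in DZ.
  set (al := angle u v) in *.
  assert (DC : has_pds (fun x y => cos (al x y)) s y (- sin (al s y) * pd1 al s y) (- sin (al s y) * pd2 al s y))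
    by (apply (has_pds_comp1 cos); [apply is_derive_cos_R|exact DA]).
  assert (DS : has_pds (fun x y => sin (al x y)) s y (cos (al s y) * pd1 al s y) (cos (al s y) * pd2 al s y))
    by (apply (has_pds_comp1 sin); [apply is_derive_sin_R|exact DA]).
  pose proof (has_pds_mult _ _ _ _ _ _ _ _ DZ DC) as M1.
  pose proof (has_pds_mult _ _ _ _ _ _ _ _ DZ DS) as M2.
  apply (has_pds_ext_loc Om _ (fun x y => y * mean (hcos u v) x y)) in M1; auto.
  2:{ intros a c Hac. symmetry. exact (f_equal x1 (weier_polar a c Hac)). }
  apply (has_pds_ext_loc Om _ (fun x y => y * mean (hsin u v) x y)) in M2; auto.
  2:{ intros a c Hac. symmetry. exact (f_equal x2 (weier_polar a c Hac)). }
  destruct (has_pds_eq _ _ _ _ _ M1) as [A1 A2]. destruct (has_pds_eq _ _ _ _ _ M2) as [B1 B2].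
  destruct (has_pds_eq _ _ _ _ _ WP) as [A1' A2']. destruct (has_pds_eq _ _ _ _ _ WQ) as [B1' B2'].
  rewrite A1' in A1. rewrite A2' in A2. rewrite B1' in B1. rewrite B2' in B2. cbv beta in *.
  unfold hcos in A2. unfold hsin in B2.
  set (C := cosh (v s y)) in *. set (Sh := sinh (v s y)) in *.
  set (z1 := pd1 zeta s y) in *. set (z2 := pd2 zeta s y) in *.
  set (t1 := pd1 al s y) in *. set (t2 := pd2 al s y) in *.
  rewrite D2 in *.
  (* The Jacobian determinant of the horizontal components, up to sign, in polar
     and in Cartesian coordinates. *)
  assert (J : t * (z2 * t1 - z1 * t2) = Sh * C).
  { pose proof (sin2_cos2 (u s y)) as Q1. pose proof (sin2_cos2 (al s y)) as Q2. unfold Rsqr in *.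
    transitivity ((C * cos (u s y)) * (Sh * cos (u s y)) - (- (Sh * sin (u s y))) * (C * sin (u s y))).
    - rewrite A1, A2, B1, B2.
      transitivity (t * (z2 * t1 - z1 * t2) * (sin (al s y) * sin (al s y) + cos (al s y) * cos (al s y))); [rewrite Q2; ring|ring].
    - transitivity (Sh * C * (sin (u s y) * sin (u s y) + cos (u s y) * cos (u s y))); [ring|rewrite Q1; ring]. }
  assert (E : pd1 Th s t = (z2 * t1 - z1 * t2) / z2).
  { assert (D : has_pds Th s t
      (t1 * 1 + t2 * (- z1 / z2)) (t1 * 0 + t2 * / z2)).
    { apply (has_pds_comp al (fun s _ => s) psi).
      - apply (Ck_differentiable 0 Om); auto. apply smooth_angle.
      - split; [apply is_derive_id_R|apply is_derive_const_R].
      - exact P. }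
    rewrite (proj1 (has_pds_eq _ _ _ _ _ D)). field. lra. }
  rewrite E. apply Rdiv_lt_0_compat; auto.
  assert (0 < Sh * C) by nra. rewrite <- J in H0. nra.
Qed.

End Polar.

(** * The two multi-valued graphs *)

(** Connectedness of the unit segment, for relatively open sets. *)
Lemma segment_connected (P Q : R -> Prop) :
  (forall r, 0 <= r <= 1 -> P r \/ Q r) -> P 0 -> Q 1 ->
  (forall r, 0 <= r <= 1 -> P r -> exists d, 0 < d /\
     forall r', 0 <= r' <= 1 -> Rabs (r' - r) < d -> P r') ->
  (forall r, 0 <= r <= 1 -> Q r -> exists d, 0 < d /\
     forall r', 0 <= r' <= 1 -> Rabs (r' - r) < d -> Q r') ->
  exists r, 0 <= r <= 1 /\ P r /\ Q r.
Proof.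
  intros Hc P0 Q1 HP HQ.
  set (E := fun x => 0 <= x <= 1 /\ forall r, 0 <= r <= x -> P r).
  assert (E0 : E 0) by (split; [lra|intros r Hr; replace r with 0 by lra; auto]).
  destruct (completeness E) as [m [Hm1 Hm2]].
  { exists 1. intros x [Hx _]; lra. }
  { exists 0; auto. }
  assert (Hm : 0 <= m <= 1) by (split; [apply Hm1, E0|apply Hm2; intros x [Hx _]; lra]).
  destruct (Hc m Hm) as [Pm|Qm].
  - destruct (HP m Hm Pm) as (d & Hd & H).
    assert (B : forall r, 0 <= r <= 1 -> r < m + d -> P r).
    { intros r Hr Hrd. destruct (Rle_dec r (m - d)) as [L|L].
      - apply NNPP. intros N. assert (m <= r); [|lra].
        apply Hm2. intros x [Hx Hx']. apply Rnot_lt_le. intros L'. apply N, Hx'. lra.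
      - apply H; auto. apply Rabs_def1; lra. }
    exists 1. split; [lra|]. split; auto. apply B; [lra|].
    apply Rnot_le_lt. intros L. assert (m + d / 2 <= m); [|lra].
    apply Hm1. split; [lra|]. intros r Hr. apply B; lra.
  - destruct (HQ m Hm Qm) as (d & Hd & H).
    assert (X : exists x, E x /\ m - d < x).
    { apply NNPP. intros N. assert (m <= m - d); [|lra].
      apply Hm2. intros x Hx. apply Rnot_lt_le. intros L. apply N. exists x; auto. }
    destruct X as (x & [Hx1 Hx2] & Hx3).
    assert (x <= m) by (apply Hm1; split; auto).
    exists x. split; auto. split; [apply Hx2; lra|].
    apply H; auto. apply Rabs_def1; lra.
Qed.

(** The part of the universal cover above which the surface with parameters in [C]
    lies.  The offset [kappa] is 0 for the half [t > 0] of the surface and [PI]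
    for the other one, which is its image under the rotation by [PI]. *)
Definition mv_domain (Th : R -> R -> R) (kappa : R) (C : R2 -> Prop) (q : R2) : Prop :=
  exists s, C (s, fst q) /\ kappa + Th s (fst q) = snd q.

Definition mv_height (Th : R -> R -> R) (kappa : R) (J : R -> Prop) (rho theta : R) : R :=
  epsilon (inhabits 0) (fun s => J s /\ kappa + Th s rho = theta).

Section MultivaluedGraph.
Variables (I : R -> Prop) (eta : R -> R) (u v : R -> R -> R).
Hypothesis SD : spiral_data I eta u v.
Variables (J : R -> Prop) (kappa : R) (C Cint : R2 -> Prop).
Hypotheses (HJo : open J) (HJI : forall s, J s -> I s)
  (HJc : forall a b c, J a -> J b -> a <= c <= b -> J c).
Hypotheses (HC : forall s r, C (s, r) -> J s /\ 0 < r < 2)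
  (HCne : exists q, C q) (HCio : open Cint) (HCi : forall q, Cint q -> C q)
  (HCd : forall s r e, C (s, r) -> 0 < e ->
     exists s' r', Cint (s', r') /\ Rabs (s' - s) < e /\ Rabs (r' - r) < e)
  (HCc : forall s r s' r' l, C (s, r) -> C (s', r') -> 0 <= l <= 1 ->
     C (s + l * (s' - s), r + l * (r' - r))).
Let Th := polar_angle eta u v.
Let D := mv_domain Th kappa C.
Let h := mv_height Th kappa J.

Let Om (q : R2) : Prop := 0 < fst q < 2 /\ J (snd q).
Let W := mv_domain Th kappa (fun q => J (fst q) /\ 0 < snd q < 2).

Lemma polar_dom_J s r : J s -> 0 < r < 2 -> polar_dom I (s, r).
Proof. intros Hs Hr. split; auto. simpl. rewrite Rabs_pos_eq; lra. Qed.

Lemma polar_angle_mono s s' r : J s -> J s' -> 0 < r < 2 -> s < s' -> Th s r < Th s' r.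
Proof.
  intros Hs Hs' Hr L.
  assert (K : forall z, s <= z <= s' -> polar_dom I (z, r))
    by (intros z Hz; apply polar_dom_J; eauto).
  pose proof (smooth_polar_angle I eta u v SD) as S. fold Th in S.
  destruct (MVT_gen (fun z => Th z r) s s' (fun z => pd1 Th z r)) as (c & Hc & E).
  - intros z Hz. rewrite Rmin_left, Rmax_right in Hz by lra.
    apply (smooth_has_pds _ _ z r S). apply K; lra.
  - intros z Hz. rewrite Rmin_left, Rmax_right in Hz by lra.
    apply derivable_continuous_pt. exists (pd1 Th z r).
    apply is_derive_Reals. apply (smooth_has_pds _ _ z r S). apply K; lra.
  - rewrite Rmin_left, Rmax_right in Hc by lra.
    pose proof (polar_angle_increasing I eta u v SD c r (K c Hc) ltac:(lra)) as P.
    fold Th in P. nra.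
Qed.

Lemma mv_height_unique s r : J s -> 0 < r < 2 -> h r (kappa + Th s r) = s.
Proof.
  intros Hs Hr.
  assert (E : exists s', J s' /\ kappa + Th s' r = kappa + Th s r) by eauto.
  pose proof (epsilon_spec (inhabits 0) _ E) as [E1 E2].
  fold (mv_height Th kappa J r (kappa + Th s r)) in E1, E2. fold h in E1, E2.
  destruct (Rtotal_order (h r (kappa + Th s r)) s) as [L|[L|L]]; auto; exfalso.
  - pose proof (polar_angle_mono _ _ r E1 Hs Hr L). lra.
  - pose proof (polar_angle_mono _ _ r Hs E1 Hr L). lra.
Qed.

Lemma polar_angle_cont2 s r : J s -> 0 < r < 2 -> continuity_2d_pt Th s r.
Proof.
  intros Hs Hr. apply smooth_continuity with (polar_dom I).
  - apply (smooth_polar_angle I eta u v SD).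
  - apply polar_dom_J; auto.
Qed.

Lemma lim_kappa_angle {T} (F : (T -> Prop) -> Prop) {FF : Filter F} (S Rr : T -> R) s r :
  J s -> 0 < r < 2 -> filterlim S F (locally s) -> filterlim Rr F (locally r) ->
  filterlim (fun z => kappa + Th (S z) (Rr z)) F (locally (kappa + Th s r)).
Proof.
  intros Hs Hr HS HR. apply lim_plus; [apply lim_const|].
  apply lim_comp2; auto. apply polar_angle_cont2; auto.
Qed.

Lemma open_0_2 : open (fun r : R => 0 < r < 2).
Proof.
  apply (open_and (T := R_UniformSpace)); [apply open_gt|apply open_lt].
Qed.

(** A nearby angle is attained, by the intermediate value theorem, between two
    heights close to the given one. *)
Lemma open_mv_domain : open W.
Proof.
  apply locally_2d_open. intros r t (s & [Hs Hr] & E). simpl in *.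
  destruct (HJo s Hs) as [e He].
  pose proof (cond_pos e) as Hep.
  assert (K : forall z, Rabs (z - s) < e -> J z) by (intros z Hz; apply He, Hz).
  set (a := s - e / 2). set (b := s + e / 2).
  assert (Ja : J a) by (apply K; unfold a; apply Rabs_def1; lra).
  assert (Jb : J b) by (apply K; unfold b; apply Rabs_def1; lra).
  assert (La : kappa + Th a r < t) by (rewrite <- E; apply Rplus_lt_compat_l, polar_angle_mono; auto; unfold a; lra).
  assert (Lb : t < kappa + Th b r) by (rewrite <- E; apply Rplus_lt_compat_l, polar_angle_mono; auto; unfold b; lra).
  assert (A1 := proj1 (filterlim_R (locally (r, t)) _ _)
    (lim_minus _ _ _ _ (lim_kappa_angle (locally (r, t)) (fun _ => a) fst a r Ja Hr (lim_const a) (lim_fst r t)) (lim_snd r t))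
    (t - (kappa + Th a r)) ltac:(lra)).
  assert (A2 := proj1 (filterlim_R (locally (r, t)) _ _)
    (lim_minus _ _ _ _ (lim_kappa_angle (locally (r, t)) (fun _ => b) fst b r Jb Hr (lim_const b) (lim_fst r t)) (lim_snd r t))
    ((kappa + Th b r) - t) ltac:(lra)).
  assert (A3 : locally (r, t) (fun q : R2 => 0 < fst q < 2))
    by (apply (open_fst _ open_0_2 (r, t)); exact Hr).
  apply locally_2d_locally.
  generalize (filter_and _ _ A1 (filter_and _ _ A2 A3)). apply filter_imp.
  intros [r' t'] (B1 & B2 & B3); simpl in *.
  apply Rabs_def2 in B1. apply Rabs_def2 in B2.
  assert (Kab : forall z, a <= z <= b -> J z).
  { intros z Hz. apply K. unfold a, b in Hz. apply Rabs_def1; lra. }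
  destruct (IVT_interv (fun z => kappa + Th z r' - t') a b) as (z & Hz & Ez).
  - intros z Hz. apply continuity_pt_filterlim.
    apply (lim_minus (F := locally z)); [|apply lim_const].
    apply (lim_kappa_angle (locally z) (fun z => z) (fun _ => r') z r'); auto.
    + apply filterlim_id.
    + apply lim_const.
  - unfold a, b; lra.
  - lra.
  - lra.
  - exists z. simpl. repeat split; auto; lra.
Qed.

Lemma mv_height_spec r t : W (r, t) -> 0 < r < 2 /\ J (h r t) /\ kappa + Th (h r t) r = t.
Proof.
  intros (s & [Hs Hr] & E). simpl in *. rewrite <- E.
  rewrite mv_height_unique by auto. auto.
Qed.

(** The heights are roots of the increasing functions [fun s => kappa + Th s rho]. *)
Lemma mv_height_continuity r t : W (r, t) -> continuity_2d_pt h r t.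
Proof.
  intros H. destruct (mv_height_spec r t H) as (Hr & Hs & E).
  apply continuity_2d_pt_filterlim.
  destruct (HJo _ Hs) as [e He].
  apply (lim_root (locally (r, t)) (fun _ y => J y) (fun z y => kappa + Th y (fst z))
    (fun y => kappa + Th y r) _ (fun z => snd z) (h r t) e (cond_pos e)).
  - apply (filter_imp W); [|apply open_mv_domain, H].
    intros [r' t'] Hz. destruct (mv_height_spec r' t' Hz) as (Z1 & Z2 & Z3). simpl.
    split; [exact Z2|split; [exact Z3|]].
    intros y y' Hy Hy' L. apply Rplus_lt_compat_l, polar_angle_mono; auto.
  - intros y Hy. assert (Jy : J y) by (apply He, Hy). split.
    + apply filter_forall; auto.
    + apply (lim_kappa_angle (locally (r, t)) (fun _ => y) fst); auto.
      * apply lim_const.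
      * apply lim_fst.
  - intros y y' Hy Hy' L. apply Rplus_lt_compat_l, polar_angle_mono; auto; apply He; auto.
  - rewrite E. apply lim_snd.
Qed.

Lemma mv_height_smooth : smooth W h.
Proof.
  assert (HOm : open Om).
  { apply open_and_R2; [apply (open_fst (fun r => 0 < r < 2)), open_0_2|apply open_snd, HJo]. }
  assert (HP : forall r s, Om (r, s) -> polar_dom I (s, r)).
  { intros r s [Hr Hs]. apply polar_dom_J; auto. }
  apply (smooth_inverse Om W (fun r s => kappa + Th s r) h); auto.
  - apply open_mv_domain.
  - apply smooth_plus; auto using smooth_const.
    apply (smooth_comp Om (polar_dom I) Th (fun r s => s) (fun r s => r)); auto.
    + apply (open_polar_dom I eta u v SD).
    + apply (smooth_polar_angle I eta u v SD).
    + apply smooth_snd; auto.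
    + apply smooth_fst; auto.
  - intros r s H. apply Rgt_not_eq.
    replace (pd2 (fun r s => kappa + Th s r) r s) with (pd1 Th s r).
    + apply (polar_angle_increasing I eta u v SD); [apply HP, H|apply H].
    + symmetry. apply is_derive_unique.
      replace (pd1 Th s r) with (0 + pd1 Th s r) by ring.
      apply (is_derive_plus_R (fun _ => kappa) (fun s => Th s r)).
      * apply is_derive_const_R.
      * apply (smooth_has_pds (polar_dom I) Th s r); [|apply HP, H].
        apply (smooth_polar_angle I eta u v SD).
  - intros r t H. destruct (mv_height_spec r t H) as (H1 & H2 & H3). repeat split; auto; apply H1.
  - apply mv_height_continuity.
Qed.

Lemma mv_surface_iff p : mv_surface D h p <->
  exists s r, C (s, r) /\ p = (r * cos (kappa + Th s r), r * sin (kappa + Th s r), s).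
Proof.
  split.
  - intros (r & t & (s & Hs & E) & Ep). simpl in *. exists s, r. split; auto.
    rewrite <- Ep. unfold mv_point. destruct (HC _ _ Hs) as [Js Hr].
    rewrite <- E. rewrite mv_height_unique by auto. reflexivity.
  - intros (s & r & Hs & ->). exists r, (kappa + Th s r). split.
    + exists s. auto.
    + destruct (HC _ _ Hs) as [Js Hr]. unfold mv_point. rewrite mv_height_unique; auto.
Qed.

(** [D] is the image of the convex set [C] under a continuous map. *)
Lemma mv_domain_connected : connected2 D.
Proof.
  intros U V HU HV Hc (q0 & (s0 & C0 & E0) & U0) (q1 & (s1 & C1 & E1) & V1).
  destruct q0 as [r0 t0], q1 as [r1 t1]; simpl in *.
  set (g := fun l => (r0 + l * (r1 - r0), kappa + Th (s0 + l * (s1 - s0)) (r0 + l * (r1 - r0)))).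
  assert (Dg : forall l, 0 <= l <= 1 -> D (g l)).
  { intros l Hl. exists (s0 + l * (s1 - s0)). split; [|reflexivity]. apply HCc; auto. }
  assert (L : forall (O : R2 -> Prop) l, open O -> 0 <= l <= 1 -> O (g l) ->
    exists d, 0 < d /\ forall l', 0 <= l' <= 1 -> Rabs (l' - l) < d -> O (g l')).
  { intros O l HO Hl Og. destruct (open_locally_2d O _ _ HO Og) as [e He].
    destruct (HC _ _ (HCc _ _ _ _ l C0 C1 Hl)) as [Js Hr].
    assert (Lr : filterlim (fun l => r0 + l * (r1 - r0)) (locally l) (locally (r0 + l * (r1 - r0)))).
    { apply lim_plus; [apply lim_const|]. apply lim_mult; [apply filterlim_id|apply lim_const]. }
    assert (Ls : filterlim (fun l => s0 + l * (s1 - s0)) (locally l) (locally (s0 + l * (s1 - s0)))).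
    { apply lim_plus; [apply lim_const|]. apply lim_mult; [apply filterlim_id|apply lim_const]. }
    assert (A1 := proj1 (filterlim_R (locally l) _ _) Lr e (cond_pos e)).
    assert (A2 := proj1 (filterlim_R (locally l) _ _)
      (lim_kappa_angle (locally l) _ _ _ _ Js Hr Ls Lr) e (cond_pos e)).
    destruct (filter_and _ _ A1 A2) as [d Hd].
    exists d. split; [apply cond_pos|]. intros l' _ Hl'.
    destruct (Hd l' Hl') as [K1 K2]. apply He; auto. }
  destruct (segment_connected (fun l => U (g l)) (fun l => V (g l))) as (l & Hl & Ul & Vl).
  - intros l Hl. apply Hc, Dg, Hl.
  - unfold g. rewrite !Rmult_0_l, !Rplus_0_r. rewrite E0. exact U0.
  - unfold g. replace (r0 + 1 * (r1 - r0)) with r1 by ring.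
    replace (s0 + 1 * (s1 - s0)) with s1 by ring. rewrite E1. exact V1.
  - intros l Hl. apply L; auto.
  - intros l Hl. apply L; auto.
  - exists (g l). auto.
Qed.

Lemma mv_domain_sub q : D q -> W q.
Proof. intros (s & Hs & E). exists s. auto. Qed.

(** The open set [Cint] is dense in [C]; its image is open because the inverse of
    the parametrization, given by [h], is continuous. *)
Lemma multivalued_graph_polar : multivalued_graph D h.
Proof.
  refine (conj _ (conj _ (conj _ (conj _ (conj _ _))))).
  - destruct HCne as [[s r] H]. exists (r, kappa + Th s r). exists s. auto.
  - apply mv_domain_connected.
  - intros r t (s & Hs & _). apply (HC _ _ Hs).
  - intros [r t] (s & Hs & E) V HV Vq. simpl in *.
    destruct (HC _ _ Hs) as [Js Hr].
    destruct (open_locally_2d V _ _ HV Vq) as [e He].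
    assert (L := proj1 (filterlim_R (locally (s, r)) _ _)
      (lim_kappa_angle (locally (s, r)) fst snd s r Js Hr (lim_fst s r) (lim_snd s r)) e (cond_pos e)).
    apply (locally_2d_locally (fun a b => Rabs (kappa + Th a b - (kappa + Th s r)) < e)) in L.
    destruct L as [d Hd].
    destruct (HCd s r (Rmin d e) Hs (Rmin_pos _ _ (cond_pos d) (cond_pos e))) as (s' & r' & Hi & K1 & K2).
    destruct (HC _ _ (HCi _ Hi)) as [Js' Hr'].
    exists (fun q => W q /\ Cint (h (fst q) (snd q), fst q)). split; [|split].
    + apply locally_2d_open. intros a c [Wac Cac]. simpl in *.
      destruct (open_locally_2d _ _ _ open_mv_domain Wac) as [d1 H1].
      destruct (open_locally_2d _ _ _ HCio Cac) as [d2 H2].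
      destruct (mv_height_continuity _ _ Wac d2) as [d3 H3].
      exists (mkposreal _ (Rmin_pos _ _ (cond_pos d1) (Rmin_pos _ _ (cond_pos d2) (cond_pos d3)))).
      simpl. intros a' c' Ha Hc'.
      pose proof (Rmin_l d1 (Rmin d2 d3)). pose proof (Rmin_r d1 (Rmin d2 d3)).
      pose proof (Rmin_l d2 d3). pose proof (Rmin_r d2 d3).
      split; [apply H1; lra|]. apply H2; [|lra]. apply H3; lra.
    + intros [a c] [Wac Cac]. destruct (mv_height_spec a c Wac) as (B1 & B2 & B3). simpl in *.
      exists (h a c). auto.
    + exists (r', kappa + Th s' r'). split.
      * apply He.
        -- eapply Rlt_le_trans; [exact K2|apply Rmin_r].
        -- rewrite <- E. apply Hd.
           ++ eapply Rlt_le_trans; [exact K1|apply Rmin_l].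
           ++ eapply Rlt_le_trans; [exact K2|apply Rmin_l].
      * simpl. rewrite mv_height_unique by auto. split; auto.
        exists s'. simpl. auto.
  - exists W. split; [apply open_mv_domain|]. split; [apply mv_domain_sub|apply mv_height_smooth].
  - intros r t r' t' Hq Hq' E.
    destruct (mv_height_spec _ _ (mv_domain_sub _ Hq)) as (A1 & A2 & A3).
    destruct (mv_height_spec _ _ (mv_domain_sub _ Hq')) as (B1 & B2 & B3).
    unfold mv_point in E. injection E as E1 E2 E3.
    assert (r = r').
    { assert (r ^ 2 = r' ^ 2).
      { pose proof (sin2_cos2 t) as Q. pose proof (sin2_cos2 t') as Q'. unfold Rsqr in *.
        transitivity ((r * cos t) * (r * cos t) + (r * sin t) * (r * sin t)).
        - transitivity (r ^ 2 * (sin t * sin t + cos t * cos t)); [rewrite Q; ring|ring].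
        - rewrite E1, E2.
          transitivity (r' ^ 2 * (sin t' * sin t' + cos t' * cos t')); [ring|rewrite Q'; ring]. }
      nra. }
    subst r'. split; auto. rewrite <- A3, <- B3, E3. reflexivity.
Qed.

End MultivaluedGraph.

(** The parameters of one of the two halves into which the axis divides the
    surface, with the bounding circle for the compact disks only. *)
Definition half_disk (closed : bool) (lo hi : R) (q : R2) : Prop :=
  lo < fst q < hi /\ 0 < snd q /\
  if closed then fst q ^ 2 + snd q ^ 2 <= 1 else fst q ^ 2 + snd q ^ 2 < 1.

Definition between (lo hi s : R) : Prop := lo < s < hi.

Lemma open_between lo hi : open (between lo hi).
Proof.
  apply (open_and (T := R_UniformSpace)); [apply open_gt|apply open_lt].
Qed.

Lemma sq_convex a b l : 0 <= l <= 1 -> (a + l * (b - a)) ^ 2 <= (1 - l) * a ^ 2 + l * b ^ 2.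
Proof.
  intros Hl.
  assert (E : (1 - l) * a ^ 2 + l * b ^ 2 - (a + l * (b - a)) ^ 2 = l * (1 - l) * (a - b) ^ 2) by ring.
  assert (0 <= l * (1 - l) * (a - b) ^ 2).
  { apply Rmult_le_pos; [nra|apply pow2_ge_0]. }
  lra.
Qed.

Lemma half_disk_sub closed lo hi s r :
  half_disk closed lo hi (s, r) -> between lo hi s /\ 0 < r < 2.
Proof.
  intros (H1 & H2 & H3). simpl in *. split; auto. split; auto.
  destruct closed; pose proof (pow2_ge_0 s); nra.
Qed.

Lemma half_disk_open lo hi : open (half_disk false lo hi).
Proof.
  apply open_and_R2; [apply (open_fst (between lo hi)), open_between|].
  apply open_and_R2; [apply (open_snd (fun t => 0 < t)), open_gt|].
  apply (open_comp (fun q : R2 => fst q ^ 2 + snd q ^ 2) (fun x => x < 1)).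
  - intros [s t] _. apply lim_plus; apply (lim_pow (F := locally (s, t))); [apply lim_fst|apply lim_snd].
  - apply open_lt.
Qed.

Lemma affine_between lo hi x y l : lo < x < hi -> lo < y < hi -> 0 <= l <= 1 ->
  lo < x + l * (y - x) < hi.
Proof.
  intros Hx Hy Hl.
  assert (E : x + l * (y - x) = (1 - l) * x + l * y) by ring. rewrite E.
  destruct (Rle_dec x y); split.
  - apply Rlt_le_trans with x; [lra|]. assert (0 <= l * (y - x)) by (apply Rmult_le_pos; lra). lra.
  - apply Rle_lt_trans with y; [|lra]. assert (0 <= (1 - l) * (y - x)) by (apply Rmult_le_pos; lra). lra.
  - apply Rlt_le_trans with y; [lra|]. assert (0 <= (1 - l) * (x - y)) by (apply Rmult_le_pos; lra). lra.
  - apply Rle_lt_trans with x; [|lra]. assert (0 <= l * (x - y)) by (apply Rmult_le_pos; lra). lra.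
Qed.

Lemma half_disk_convex closed lo hi s r s' r' l :
  half_disk closed lo hi (s, r) -> half_disk closed lo hi (s', r') -> 0 <= l <= 1 ->
  half_disk closed lo hi (s + l * (s' - s), r + l * (r' - r)).
Proof.
  intros (A1 & A2 & A3) (B1 & B2 & B3) Hl. simpl in *.
  pose proof (sq_convex s s' l Hl). pose proof (sq_convex r r' l Hl).
  split; [|split]; simpl.
  - apply affine_between; auto.
  - apply (affine_between 0 (r + r' + 1) r r'); lra.
  - destruct closed.
    + apply Rle_trans with ((1 - l) * (s ^ 2 + r ^ 2) + l * (s' ^ 2 + r' ^ 2)); nra.
    + apply Rle_lt_trans with ((1 - l) * (s ^ 2 + r ^ 2) + l * (s' ^ 2 + r' ^ 2)); [nra|].
      apply (affine_between (-1) 1 (s ^ 2 + r ^ 2) (s' ^ 2 + r' ^ 2)) in Hl; nra.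
Qed.

Lemma half_disk_toward lo hi s r s' r' l :
  half_disk true lo hi (s, r) -> half_disk false lo hi (s', r') -> 0 < l <= 1 ->
  half_disk false lo hi (s + l * (s' - s), r + l * (r' - r)).
Proof.
  intros (A1 & A2 & A3) (B1 & B2 & B3) Hl. simpl in *.
  pose proof (sq_convex s s' l ltac:(lra)). pose proof (sq_convex r r' l ltac:(lra)).
  split; [|split]; simpl.
  - apply affine_between; auto; lra.
  - apply (affine_between 0 (r + r' + 1) r r'); lra.
  - apply Rle_lt_trans with ((1 - l) * (s ^ 2 + r ^ 2) + l * (s' ^ 2 + r' ^ 2)); [nra|].
    assert ((1 - l) * (s ^ 2 + r ^ 2) <= (1 - l) * 1) by (apply Rmult_le_compat_l; lra).
    assert (l * (s' ^ 2 + r' ^ 2) < l * 1) by (apply Rmult_lt_compat_l; lra). lra.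
Qed.

Lemma half_disk_closed closed lo hi q : half_disk closed lo hi q -> half_disk true lo hi q.
Proof. destruct closed; auto. intros (H1 & H2 & H3). repeat split; try apply H1; lra. Qed.

Lemma half_disk_false closed lo hi q : half_disk false lo hi q -> half_disk closed lo hi q.
Proof. destruct closed; auto. intros (H1 & H2 & H3). repeat split; try apply H1; lra. Qed.

Lemma half_disk_nonempty lo hi : lo < hi -> lo < 1 -> -1 < hi ->
  exists q, half_disk false lo hi q.
Proof.
  intros H1 H2 H3. set (s := (Rmax lo (-1) + Rmin hi 1) / 2).
  assert (Hs : lo < s < hi /\ -1 < s < 1).
  { unfold s. pose proof (Rmax_l lo (-1)). pose proof (Rmax_r lo (-1)).
    pose proof (Rmin_l hi 1). pose proof (Rmin_r hi 1).
    assert (Rmax lo (-1) < Rmin hi 1) by (apply Rmin_glb_lt; apply Rmax_lub_lt; lra). lra. }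
  exists (s, (1 - s ^ 2) / 2). split; [|split]; simpl; [lra|nra|].
  assert (0 < 1 - s * s) by nra. nra.
Qed.

Lemma half_disk_dense closed lo hi s r e : lo < hi -> lo < 1 -> -1 < hi ->
  half_disk closed lo hi (s, r) -> 0 < e ->
  exists s' r', half_disk false lo hi (s', r') /\ Rabs (s' - s) < e /\ Rabs (r' - r) < e.
Proof.
  intros L1 L2 L3 H He. apply half_disk_closed in H.
  destruct (half_disk_nonempty lo hi L1 L2 L3) as [[s1 r1] H1].
  set (K := Rabs (s1 - s) + Rabs (r1 - r) + 1).
  pose proof (Rabs_pos (s1 - s)). pose proof (Rabs_pos (r1 - r)).
  assert (HKp : 0 < K) by (unfold K; lra).
  set (l := Rmin 1 (e / K / 2)).
  assert (HK : 0 < e / K) by (apply Rdiv_lt_0_compat; lra).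
  assert (Hl : 0 < l <= 1) by (unfold l; split; [apply Rmin_pos; lra|apply Rmin_l]).
  assert (HlK : l * K < e).
  { assert (l <= e / K / 2) by apply Rmin_r.
    apply Rle_lt_trans with (e / K / 2 * K); [apply Rmult_le_compat_r; lra|].
    replace (e / K / 2 * K) with (e / 2) by (field; lra). lra. }
  exists (s + l * (s1 - s)), (r + l * (r1 - r)). split; [apply half_disk_toward; auto|].
  split.
  - replace (s + l * (s1 - s) - s) with (l * (s1 - s)) by ring.
    rewrite Rabs_mult, (Rabs_pos_eq l) by lra. unfold K in HlK. nra.
  - replace (r + l * (r1 - r) - r) with (l * (r1 - r)) by ring.
    rewrite Rabs_mult, (Rabs_pos_eq l) by lra. unfold K in HlK. nra.
Qed.

Section Graphs.
Variables (I : R -> Prop) (eta : R -> R) (u v : R -> R -> R).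
Hypothesis SD : spiral_data I eta u v.
Variables (lo hi : R) (closed : bool).
Hypotheses (HJI : forall s, lo < s < hi -> I s) (L1 : lo < hi) (L2 : lo < 1) (L3 : -1 < hi).
Let Th := polar_angle eta u v.
Let X := polar_patch eta u v.

Lemma half_disk_graph kappa :
  multivalued_graph (mv_domain Th kappa (half_disk closed lo hi))
    (mv_height Th kappa (between lo hi)).
Proof.
  apply (multivalued_graph_polar I eta u v SD (between lo hi) kappa _ (half_disk false lo hi)).
  - apply open_between.
  - exact HJI.
  - intros a b c Ha Hb Hc. unfold between in *. lra.
  - intros s r H. apply half_disk_sub with closed; auto.
  - destruct (half_disk_nonempty lo hi) as [q Hq]; auto. exists q.
    apply half_disk_false; auto.
  - apply half_disk_open.
  - apply half_disk_false.
  - intros s r e H He. apply half_disk_dense with closed; auto.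
  - intros. apply half_disk_convex; auto.
Qed.

Lemma half_disk_surface kappa p :
  mv_surface (mv_domain Th kappa (half_disk closed lo hi)) (mv_height Th kappa (between lo hi)) p <->
  exists s r, half_disk closed lo hi (s, r) /\
    p = (r * cos (kappa + Th s r), r * sin (kappa + Th s r), s).
Proof.
  apply (mv_surface_iff I eta u v SD).
  - exact HJI.
  - intros a b c Ha Hb Hc. unfold between in *. lra.
  - intros s r H. apply half_disk_sub with closed; auto.
Qed.

(** The half disks [t > 0] and [t < 0] are exchanged by the rotation by [PI]
    about the axis. *)
Lemma two_graphs (S : R3 -> Prop) :
  (forall p, S p <-> exists s t, lo < s < hi /\
     (if closed then s ^ 2 + t ^ 2 <= 1 else s ^ 2 + t ^ 2 < 1) /\ X s t = p) ->
  off_axis_two_graphs S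
    (mv_domain Th 0 (half_disk closed lo hi)) (mv_height Th 0 (between lo hi))
    (mv_domain Th PI (half_disk closed lo hi)) (mv_height Th PI (between lo hi)).
Proof.
  intros HS. split; [apply half_disk_graph|]. split; [apply half_disk_graph|].
  assert (PD : forall s t, lo < s < hi ->
    (if closed then s ^ 2 + t ^ 2 <= 1 else s ^ 2 + t ^ 2 < 1) -> polar_dom I (s, t)).
  { intros s t Hs Ht. split; [apply HJI, Hs|]. simpl. pose proof (pow2_ge_0 s).
    assert (t ^ 2 <= 1) by (destruct closed; lra). apply Rabs_def1; nra. }
  intros p. rewrite !half_disk_surface. rewrite HS. split.
  - intros [(s & t & Hs & Ht & E) Ha]. pose proof (PD s t Hs Ht) as H.
    destruct (Rtotal_order t 0) as [L|[L|L]].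
    + right. exists s, (- t). split.
      * split; [|split]; simpl; auto; [lra|]. destruct closed; nra.
      * assert (H' : polar_dom I (s, - t)).
        { destruct H as [Hi Ht']. split; auto. simpl in *. rewrite Rabs_Ropp. auto. }
        rewrite <- E. unfold X. rewrite <- (Ropp_involutive t) at 1.
        rewrite (polar_patch_odd I eta u v SD) by auto.
        rewrite (polar_patch_eq I eta u v SD) by auto. fold Th.
        unfold x1, x2; cbn [fst snd]. rewrite (Rplus_comm PI), neg_cos, neg_sin.
        apply triple_eq; ring.
    + exfalso. apply Ha. subst t. rewrite <- E. unfold X.
      rewrite (polar_patch_axis I eta u v SD) by (apply HJI, Hs). split; reflexivity.
    + left. exists s, t. split.
      * split; [|split]; simpl; auto.
      * rewrite <- E. rewrite Rplus_0_l. apply (polar_patch_eq I eta u v SD); auto.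
  - intros [(s & r & (Hs & Hr & Hd) & E)|(s & r & (Hs & Hr & Hd) & E)]; simpl in *;
      pose proof (PD s r Hs Hd) as H.
    + rewrite Rplus_0_l in E. split.
      * exists s, r. split; [lra|split; auto]. rewrite E. apply (polar_patch_eq I eta u v SD); auto.
      * rewrite E. unfold x3_axis, x1, x2; cbn [fst snd]. intros [Z1 Z2].
        pose proof (sin2_cos2 (Th s r)). unfold Rsqr in *. nra.
    + split.
      * exists s, (- r). split; [lra|split].
        -- destruct closed; nra.
        -- rewrite E. unfold X. rewrite (polar_patch_odd I eta u v SD) by auto.
           rewrite (polar_patch_eq I eta u v SD) by auto. fold Th.
           unfold x1, x2; cbn [fst snd]. rewrite (Rplus_comm PI), neg_cos, neg_sin.
           apply triple_eq; ring.
      * rewrite E. unfold x3_axis, x1, x2; cbn [fst snd]. intros [Z1 Z2].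
        pose proof (sin2_cos2 (PI + Th s r)). unfold Rsqr in *. nra.
Qed.

End Graphs.

(** * Spiralling *)

Lemma polar_coordinates x y : exists r phi, 0 <= r /\ x = r * cos phi /\ y = r * sin phi.
Proof.
  assert (P : forall x y, 0 < x -> exists r phi, 0 <= r /\ x = r * cos phi /\ y = r * sin phi).
  { clear. intros x y Hx. set (k := sqrt (1 + (y / x)²)).
    assert (Hk : 0 < k) by (apply sqrt_lt_R0; pose proof (Rle_0_sqr (y / x)); lra).
    exists (x * k), (atan (y / x)). rewrite cos_atan, sin_atan. fold k.
    split; [nra|]. split; field; lra. }
  destruct (Rtotal_order x 0) as [L|[->|L]].
  - destruct (P (- x) (- y) ltac:(lra)) as (r & phi & Hr & E1 & E2).
    exists r, (phi + PI). rewrite neg_cos, neg_sin. lra.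
  - destruct (Rle_dec 0 y).
    + exists y, (PI / 2). rewrite cos_PI2, sin_PI2. lra.
    + exists (- y), (- (PI / 2)). rewrite cos_neg, sin_neg, cos_PI2, sin_PI2. lra.
  - apply P; auto.
Qed.

Lemma norm_triangle_R3 (a b c : R) : norm ((a, b, c) : R3) <= Rabs a + Rabs b + Rabs c.
Proof.
  rewrite norm_R3. unfold x1, x2, x3; cbn [fst snd].
  pose proof (Rabs_pos a). pose proof (Rabs_pos b). pose proof (Rabs_pos c).
  rewrite <- (sqrt_pow2 (Rabs a + Rabs b + Rabs c)) by lra.
  apply sqrt_le_1_alt. rewrite <- (pow2_abs a), <- (pow2_abs b), <- (pow2_abs c). nra.
Qed.

Lemma nat_large (x : R) : exists k : nat, x < INR k.
Proof.
  destruct (INR_unbounded x) as [k Hk]. exists k. lra.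
Qed.

Section Spiral.
Variables (I : R -> Prop) (eta : R -> R) (u v : R -> R -> R).
Hypothesis SD : spiral_data I eta u v.
Variables (lo hi : R).
Hypotheses (HJI : forall s, lo < s < hi -> I s).
Variables (kappa c sg : R).
Hypotheses (Hc : Rabs c < 1) (Hsg : sg = 1 \/ sg = -1).
Hypothesis (Hacc : forall e, 0 < e -> exists s, lo < s < hi /\ Rabs (s - c) < e).
Hypothesis (Hdiv : forall M, exists e, 0 < e /\
  forall s, lo < s < hi -> Rabs (s - c) < e -> M < sg * u s 0).
Hypothesis (Hcn : ~ (lo < c < hi)).
Let Th := polar_angle eta u v.
Let D := mv_domain Th kappa (half_disk false lo hi).
Let h := mv_height Th kappa (between lo hi).

Lemma polar_angle_near_axis s r : Rabs (Th s r - u s 0) <= PI / 2.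
Proof.
  unfold Th, polar_angle, angle.
  match goal with |- Rabs (_ + atan ?z - _) <= _ =>
    replace (u s 0 + atan z - u s 0) with (atan z) by ring;
    pose proof (atan_bound z) end.
  apply Rabs_le. lra.
Qed.

Lemma sg_bound x y : Rabs (x - y) <= PI / 2 -> sg * y - PI / 2 <= sg * x <= sg * y + PI / 2.
Proof.
  intros H. apply Rabs_le_between in H. destruct Hsg as [->| ->]; lra.
Qed.

(** The polar angle stays within [PI / 2] of [u s 0], which diverges as [s] tends
    to [c]; by the intermediate value theorem it takes on every circle about the
    axis all values that are large in the direction [sg], at heights close to
    [c]. *)
Lemma spiral_solve e : 0 < e -> exists M, forall r theta, 0 < r < 2 -> M < sg * theta ->
  exists s, lo < s < hi /\ Rabs (s - c) < e /\ kappa + Th s r = theta.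
Proof.
  intros He. destruct (Hacc e He) as (s1 & J1 & K1).
  exists (sg * kappa + sg * u s1 0 + PI / 2). intros r theta Hr HM.
  destruct (Hdiv (sg * theta - sg * kappa + PI / 2)) as (e2 & He2 & H2).
  destruct (Hacc (Rmin e e2) (Rmin_pos _ _ He He2)) as (s2 & J2 & K2).
  specialize (H2 s2 J2 (Rlt_le_trans _ _ _ K2 (Rmin_r _ _))).
  assert (K2' : Rabs (s2 - c) < e) by (eapply Rlt_le_trans; [exact K2|apply Rmin_l]).
  pose proof (sg_bound _ _ (polar_angle_near_axis s1 r)).
  pose proof (sg_bound _ _ (polar_angle_near_axis s2 r)).
  set (z := fun l => s1 + l * (s2 - s1)).
  assert (Jz : forall l, 0 <= l <= 1 -> lo < z l < hi) by (intros l Hl; apply affine_between; auto).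
  destruct (IVT_interv (fun l => sg * (kappa + Th (z l) r - theta)) 0 1) as (l & Hl & E).
  - intros l Hl. apply continuity_pt_filterlim.
    apply (lim_mult (F := locally l)); [apply lim_const|].
    apply lim_minus; [|apply lim_const].
    apply lim_plus; [apply lim_const|].
    apply (lim_comp2 (F := locally l) Th z (fun _ => r)).
    + apply (smooth_continuity (polar_dom I)).
      * apply (smooth_polar_angle I eta u v SD).
      * split; [apply HJI, Jz; auto|]. simpl. rewrite Rabs_pos_eq; lra.
    + unfold z. apply lim_plus; [apply lim_const|].
      apply (lim_mult (F := locally l)); [apply filterlim_id|apply lim_const].
    + apply lim_const.
  - lra.
  - unfold z. rewrite Rmult_0_l, Rplus_0_r. lra.
  - unfold z. replace (s1 + 1 * (s2 - s1)) with s2 by ring. lra.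
  - exists (z l). split; [apply Jz; auto|]. split.
    + apply Rabs_def2 in K1. apply Rabs_def2 in K2'.
      assert (c - e < z l < c + e) by (apply affine_between; auto; lra). apply Rabs_def1; lra.
    + destruct Hsg as [S|S]; rewrite S in E; lra.
Qed.

Lemma spiral_height r theta s : half_disk false lo hi (s, r) ->
  kappa + Th s r = theta -> D (r, theta) /\ h r theta = s.
Proof.
  intros H E. split; [exists s; auto|]. rewrite <- E.
  destruct (half_disk_sub _ _ _ _ _ H) as [Hs Hr].
  apply (mv_height_unique I eta u v SD (between lo hi) kappa); auto.
  intros a b z Ha Hb Hz. unfold between in *. lra.
Qed.

Lemma near_plane_in_ball s r e : 0 <= r -> (Rabs c + e) ^ 2 + r ^ 2 < 1 -> Rabs (s - c) < e ->
  s ^ 2 + r ^ 2 < 1.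
Proof.
  intros Hr H Hs. assert (Rabs s <= Rabs c + e).
  { replace s with (s - c + c) by ring. eapply Rle_trans; [apply Rabs_triang|]. lra. }
  rewrite <- (pow2_abs s). pose proof (Rabs_pos s). nra.
Qed.

(** A point of the plane at polar coordinates [(r, phi)] is approximated by the
    points of the surface at the angles [phi + 2 k PI]. *)
Lemma polar_spirals : spirals_into D h c.
Proof.
  pose proof (Rabs_pos c) as Hc0.
  refine (conj _ (conj _ _)).
  - intros eps Heps N. set (d := (1 - Rabs c) / 4).
    assert (Hd : 0 < d) by (unfold d; lra).
    destruct (spiral_solve (Rmin eps d) (Rmin_pos _ _ Heps Hd)) as [M HM].
    exists d, (2 * d), (sg * (M + 1 + INR N * PI)). split; [lra|].
    intros r theta Hr Ht.
    destruct (HM r theta) as (s & Js & Ks & E).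
    { unfold d in *. lra. }
    { apply Rabs_le_between in Ht. destruct Hsg as [S|S]; rewrite S in *; lra. }
    assert (Hh : half_disk false lo hi (s, r)).
    { split; [exact Js|]. split; simpl; [lra|].
      apply (near_plane_in_ball s r d); [lra| |eapply Rlt_le_trans; [exact Ks|apply Rmin_r]].
      unfold d in *. nra. }
    destruct (spiral_height _ _ _ Hh E) as [K1 K2]. split; auto. rewrite K2. split.
    + apply Rabs_pos_lt. intros Z. apply Hcn. replace c with s by lra. exact Js.
    + eapply Rlt_le_trans; [exact Ks|apply Rmin_l].
  - intros p Hp Ec eps Heps.
    destruct (polar_coordinates (x1 p) (x2 p)) as (r0 & phi & Hr0 & E1 & E2).
    assert (Hn : r0 ^ 2 + c ^ 2 < 1).
    { unfold unit_ball in Hp. rewrite norm_R3 in Hp.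
      rewrite E1, E2, Ec in Hp.
      replace ((r0 * cos phi) ^ 2 + (r0 * sin phi) ^ 2) with (r0 ^ 2) in Hp.
      - apply Rnot_le_lt. intros N. apply sqrt_le_1_alt in N. rewrite sqrt_1 in N. lra.
      - pose proof (sin2_cos2 phi) as Q. unfold Rsqr in Q.
        transitivity (r0 ^ 2 * (sin phi * sin phi + cos phi * cos phi)); [rewrite Q; ring|ring]. }
    set (g := 1 - r0 ^ 2 - c ^ 2). assert (Hg : 0 < g) by (unfold g; lra).
    assert (Hg1 : g <= 1) by (unfold g; pose proof (pow2_ge_0 r0); pose proof (pow2_ge_0 c); lra).
    (* a slightly larger radius is positive even when [p] lies on the axis *)
    set (d := Rmin (eps / 3) (g / 8)).
    assert (Hd : 0 < d) by (unfold d; apply Rmin_pos; lra).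
    assert (Hd1 : d <= eps / 3) by apply Rmin_l. assert (Hd2 : d <= g / 8) by apply Rmin_r.
    assert (Hr1 : r0 < 1) by (pose proof (pow2_ge_0 c); nra).
    destruct (spiral_solve d Hd) as [M HM].
    pose proof PI_RGT_0 as HPI.
    destruct (nat_large ((M - sg * phi) / (2 * PI))) as [k Hk].
    assert (Hk' : M - sg * phi < INR k * (2 * PI)).
    { apply (Rmult_lt_compat_r (2 * PI)) in Hk; [|lra].
      replace ((M - sg * phi) / (2 * PI) * (2 * PI)) with (M - sg * phi) in Hk by (field; lra). lra. }
    destruct (HM (r0 + d) (phi + sg * (2 * INR k * PI))) as (s & Js & Ks & E).
    { lra. }
    { destruct Hsg as [S|S]; rewrite S in *; lra. }
    assert (Hh : half_disk false lo hi (s, r0 + d)).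
    { split; [exact Js|]. split; simpl; [lra|].
      apply (near_plane_in_ball s (r0 + d) d); [lra| |exact Ks].
      assert (c ^ 2 = Rabs c ^ 2) by (symmetry; apply pow2_abs).
      replace ((Rabs c + d) ^ 2 + (r0 + d) ^ 2) with (1 - g + 2 * d * (Rabs c + r0 + d)) by (unfold g; rewrite H; ring).
      nra. }
    destruct (spiral_height _ _ _ Hh E) as [K1 K2].
    assert (TC : cos (phi + sg * (2 * INR k * PI)) = cos phi /\ sin (phi + sg * (2 * INR k * PI)) = sin phi).
    { destruct Hsg as [->| ->].
      - rewrite Rmult_1_l. split; [apply cos_period|apply sin_period].
      - split; [rewrite <- (cos_period _ k)|rewrite <- (sin_period _ k)]; f_equal; ring. }
    destruct TC as [TC TS].
    exists (mv_point h (r0 + d) (phi + sg * (2 * INR k * PI))). split.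
    + exists (r0 + d), (phi + sg * (2 * INR k * PI)). auto.
    + unfold ball3, mv_point. rewrite K2, TC, TS.
      destruct p as [[p1 p2] p3]. unfold x1, x2, x3 in *; simpl in E1, E2, Ec. subst p1 p2 p3.
      replace (minus _ _) with (((d * cos phi, d * sin phi, s - c)) : R3).
      * eapply Rle_lt_trans; [apply norm_triangle_R3|]. rewrite !Rabs_mult, (Rabs_pos_eq d) by lra.
        assert (Rabs (cos phi) <= 1) by (apply Rabs_le; pose proof (COS_bound phi); lra).
        assert (Rabs (sin phi) <= 1) by (apply Rabs_le; pose proof (SIN_bound phi); lra).
        nra.
      * symmetry. change (minus (((r0 + d) * cos phi, (r0 + d) * sin phi, s) : R3) (r0 * cos phi, r0 * sin phi, c))
          with ((((r0 + d) * cos phi - r0 * cos phi, (r0 + d) * sin phi - r0 * sin phi, s - c)) : R3).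
        apply triple_eq; ring.
  - assert (W : forall M, exists eps, 0 < eps /\ forall rho theta, D (rho, theta) ->
      0 < Rabs (h rho theta - c) < eps -> M < sg * theta).
    { intros M. destruct (Hdiv (M + PI / 2 - sg * kappa)) as (e & He & H). exists e. split; auto.
      intros r theta (s & Hs & E) Hh. simpl in *.
      destruct (spiral_height _ _ _ Hs E) as [_ Eh]. rewrite Eh in Hh.
      specialize (H s (proj1 Hs) (proj2 Hh)).
      pose proof (sg_bound _ _ (polar_angle_near_axis s r)). rewrite <- E. lra. }
    destruct Hsg as [S|S]; [left|right]; intros M.
    + destruct (W M) as (e & He & H). exists e. split; auto. intros r t H1 H2.
      specialize (H r t H1 H2). rewrite S in H; lra.
    + destruct (W (- M)) as (e & He & H). exists e. split; auto. intros r t H1 H2.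
      specialize (H r t H1 H2). rewrite S in H; lra.
Qed.

End Spiral.

(** * The holomorphic functions *)

Fixpoint sumj (n : nat) (f : nat -> R) : R :=
  match n with O => 0 | S k => sumj k f + f (S k) end.

Lemma sumj_ext n f g : (forall j, (1 <= j <= n)%nat -> f j = g j) -> sumj n f = sumj n g.
Proof.
  induction n as [|n IH]; intros H; simpl; auto.
  rewrite IH, (H (S n)); auto; [lia|]. intros; apply H; lia.
Qed.

Lemma sumj_le n f g : (forall j, (1 <= j <= n)%nat -> f j <= g j) -> sumj n f <= sumj n g.
Proof.
  induction n as [|n IH]; intros H; simpl; [lra|].
  apply Rplus_le_compat; [apply IH; intros; apply H; lia|apply H; lia].
Qed.

Lemma sumj_scal n k f : sumj n (fun j => k * f j) = k * sumj n f.
Proof. induction n as [|n IH]; simpl; [ring|rewrite IH; ring]. Qed.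

Lemma sumj_abs n f : Rabs (sumj n f) <= sumj n (fun j => Rabs (f j)).
Proof.
  induction n as [|n IH]; simpl; [rewrite Rabs_R0; lra|].
  eapply Rle_trans; [apply Rabs_triang|]. lra.
Qed.

Lemma sumj_nonneg n f : (forall j, (1 <= j <= n)%nat -> 0 <= f j) -> 0 <= sumj n f.
Proof.
  intros H. replace 0 with (sumj n (fun _ => 0)).
  - apply sumj_le; auto.
  - clear. induction n as [|n IH]; simpl; lra.
Qed.

Lemma sumj_ge_term n f k : (forall j, (1 <= j <= n)%nat -> 0 <= f j) ->
  (1 <= k <= n)%nat -> f k <= sumj n f.
Proof.
  induction n as [|n IH]; intros H Hk; [lia|]. simpl.
  destruct (Nat.eq_dec k (S n)) as [->|N].
  - assert (0 <= sumj n f) by (apply sumj_nonneg; intros; apply H; lia). lra.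
  - assert (f k <= sumj n f) by (apply IH; [intros; apply H; lia|lia]).
    assert (0 <= f (S n)) by (apply H; lia). lra.
Qed.

Lemma sumj_lim {T} (F : (T -> Prop) -> Prop) {FF : Filter F} n (f : T -> nat -> R) (l : nat -> R) :
  (forall j, (1 <= j <= n)%nat -> filterlim (fun z => f z j) F (locally (l j))) ->
  filterlim (fun z => sumj n (f z)) F (locally (sumj n l)).
Proof.
  induction n as [|n IH]; intros H; simpl; [apply lim_const|].
  apply lim_plus; [apply IH; intros; apply H; lia|apply H; lia].
Qed.

Lemma sumj_derive n (f : nat -> R -> R) (l : nat -> R) x :
  (forall j, (1 <= j <= n)%nat -> is_derive (f j) x (l j)) ->
  is_derive (fun x => sumj n (fun j => f j x)) x (sumj n l).
Proof.
  induction n as [|n IH]; intros H; simpl; [apply is_derive_const_R|].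
  apply (is_derive_plus_R (fun x => sumj n (fun j => f j x)) (f (S n))).
  - apply IH; intros; apply H; lia.
  - apply H; lia.
Qed.

Lemma sumj_smooth n U (f : nat -> R -> R -> R) : open U ->
  (forall j, (1 <= j <= n)%nat -> smooth U (f j)) ->
  smooth U (fun x y => sumj n (fun j => f j x y)).
Proof.
  intros HU. induction n as [|n IH]; intros H; simpl; [apply smooth_const|].
  apply (smooth_plus U (fun x y => sumj n (fun j => f j x y)) (f (S n))); auto.
  - apply IH; intros; apply H; lia.
  - apply H; lia.
Qed.

Lemma filter_forall_upto {T} (F : (T -> Prop) -> Prop) {FF : Filter F} n (P : nat -> T -> Prop) :
  (forall j, (1 <= j <= n)%nat -> F (P j)) -> F (fun z => forall j, (1 <= j <= n)%nat -> P j z).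
Proof.
  induction n as [|n IH]; intros H.
  - apply filter_forall. intros; lia.
  - assert (H1 : F (fun z => forall j, (1 <= j <= n)%nat -> P j z)) by (apply IH; intros; apply H; lia).
    assert (H2 : F (P (S n))) by (apply H; lia).
    generalize (filter_and _ _ H1 H2). apply filter_imp. intros z [Z1 Z2] j Hj.
    destruct (Nat.eq_dec j (S n)) as [->|N]; auto. apply Z1; lia.
Qed.

Lemma open_forall_upto n (P : nat -> R -> Prop) : (forall j, open (P j)) ->
  open (fun x => forall j, (1 <= j <= n)%nat -> P j x).
Proof.
  intros HP x H. apply (filter_forall_upto (locally x) n). intros j Hj. apply HP, H, Hj.
Qed.

Lemma open_strip I eta : open I -> (forall x, I x -> continuity_pt eta x) ->
  open (strip I eta).
Proof.
  intros HI Hc [x y] [H1 H2]. simpl in *.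
  assert (A1 : locally (x, y) (fun q : R2 => I (fst q))) by (apply (open_fst I HI (x, y)); exact H1).
  assert (L : filterlim (fun q : R2 => eta (fst q) - Rabs (snd q)) (locally (x, y)) (locally (eta x - Rabs y))).
  { apply lim_minus.
    - apply (lim_comp1 eta); [apply Hc, H1|apply lim_fst].
    - apply (lim_comp1 Rabs); [apply Rcontinuity_abs|apply lim_snd]. }
  assert (A2 := proj1 (filterlim_R (locally (x, y)) _ _) L (eta x - Rabs y) ltac:(lra)).
  generalize (filter_and _ _ A1 A2). apply filter_imp. intros [x' y'] [B1 B2].
  split; auto. simpl in *. apply Rabs_def2 in B2. lra.
Qed.

(** ** One pole pair *)

(** Real and imaginary parts of [1 / (z ^ 2 + a ^ 2)] at [z = x + i y]. *)
Definition pole_den a x y := (x ^ 2 - y ^ 2 + a ^ 2) ^ 2 + 4 * x ^ 2 * y ^ 2.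
Definition pole_re a x y := (x ^ 2 - y ^ 2 + a ^ 2) / pole_den a x y.
Definition pole_im a x y := - (2 * x * y) / pole_den a x y.

Section Pole.
Variables a x y : R.
Let d := x ^ 2 + a ^ 2.
Hypotheses (Hd : 0 < d) (Hy : y ^ 2 <= d / 2).

Lemma pole_den_bounds : d ^ 2 / 4 <= pole_den a x y <= 3 * d ^ 2.
Proof.
  unfold pole_den. set (e := x ^ 2 - y ^ 2 + a ^ 2).
  assert (He : d / 2 <= e <= d) by (unfold e, d in *; pose proof (pow2_ge_0 y); lra).
  pose proof (pow2_ge_0 y). pose proof (pow2_ge_0 x). pose proof (pow2_ge_0 a).
  assert (x ^ 2 * y ^ 2 <= d * (d / 2)) by (apply Rmult_le_compat; unfold d in *; lra).
  assert (0 <= x ^ 2 * y ^ 2) by (apply Rmult_le_pos; auto).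
  split; nra.
Qed.

Lemma pole_den_pos : 0 < pole_den a x y.
Proof. pose proof pole_den_bounds. nra. Qed.

Lemma pole_re_bounds : / (6 * d) <= pole_re a x y <= 2 / d.
Proof.
  pose proof pole_den_bounds as B. pose proof pole_den_pos as P.
  unfold pole_re. set (R0 := pole_den a x y) in *.
  set (e := x ^ 2 - y ^ 2 + a ^ 2).
  assert (He : d / 2 <= e <= d) by (unfold e, d in *; pose proof (pow2_ge_0 y); lra).
  assert (Re : e ^ 2 <= R0).
  { unfold R0, pole_den. fold e. assert (0 <= x ^ 2 * y ^ 2) by (apply Rmult_le_pos; apply pow2_ge_0). lra. }
  split.
  - replace (/ (6 * d)) with ((d / 2) * / (3 * d ^ 2)) by (field; lra).
    apply Rmult_le_compat; [lra| |lra|].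
    + left. apply Rinv_0_lt_compat. nra.
    + apply Rinv_le_contravar; lra.
  - apply Rmult_le_reg_r with (R0 * d); [nra|].
    replace (e / R0 * (R0 * d)) with (e * d) by (field; lra).
    replace (2 / d * (R0 * d)) with (2 * R0) by (field; lra). nra.
Qed.

(** The imaginary part vanishes on the real axis.  The factor [y] that is gained
    here keeps [u] nearly constant along the slices. *)
Lemma pole_im_bound_y mu2 : 0 <= mu2 -> / d <= mu2 ^ 2 ->
  Rabs (pole_im a x y) <= 8 * Rabs y * mu2 * / d.
Proof.
  intros Hm Hm2. pose proof pole_den_bounds as B. pose proof pole_den_pos as P.
  unfold pole_im. set (R0 := pole_den a x y) in *.
  rewrite Rabs_div by lra. rewrite (Rabs_pos_eq R0) by lra.
  rewrite Rabs_Ropp, !Rabs_mult, (Rabs_pos_eq 2) by lra.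
  assert (Hx : Rabs x <= d * mu2).
  { apply Rsqr_incr_0_var; [|nra]. rewrite <- Rsqr_abs. unfold Rsqr.
    assert (1 <= d * mu2 ^ 2).
    { apply Rmult_le_compat_l with (r := d) in Hm2; [|lra]. rewrite Rinv_r in Hm2; lra. }
    assert (x * x <= d) by (unfold d; pose proof (pow2_ge_0 a); nra). nra. }
  apply Rmult_le_reg_r with (R0 * d); [nra|].
  pose proof (Rabs_pos y). pose proof (Rabs_pos x).
  replace (2 * Rabs x * Rabs y / R0 * (R0 * d)) with (2 * Rabs y * (Rabs x * d)) by (field; lra).
  replace (8 * Rabs y * mu2 * / d * (R0 * d)) with (2 * Rabs y * (4 * mu2 * R0)) by (field; lra).
  apply Rmult_le_compat_l; [lra|].
  apply Rle_trans with (d * mu2 * d); [apply Rmult_le_compat_r; lra|].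
  apply Rle_trans with (4 * mu2 * (d ^ 2 / 4)); [right; field|apply Rmult_le_compat_l; lra].
Qed.

Lemma pole_im_bound : Rabs (pole_im a x y) <= / d.
Proof.
  pose proof pole_den_bounds as B. pose proof pole_den_pos as P.
  unfold pole_im. set (R0 := pole_den a x y) in *.
  rewrite Rabs_div by lra. rewrite (Rabs_pos_eq R0) by lra.
  rewrite Rabs_Ropp, !Rabs_mult, (Rabs_pos_eq 2) by lra.
  set (e := x ^ 2 - y ^ 2 + a ^ 2).
  assert (He : d / 2 <= e <= d) by (unfold e, d in *; pose proof (pow2_ge_0 y); lra).
  assert (Re : R0 = e ^ 2 + 4 * (Rabs x * Rabs y) ^ 2).
  { unfold R0, pole_den. fold e. rewrite Rpow_mult_distr, !pow2_abs. ring. }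
  set (k := Rabs x * Rabs y) in *.
  assert (0 <= k) by (apply Rmult_le_pos; apply Rabs_pos).
  apply Rmult_le_reg_r with (R0 * d); [nra|].
  replace (2 * Rabs x * Rabs y / R0 * (R0 * d)) with (2 * k * d) by (unfold k; field; lra).
  replace (/ d * (R0 * d)) with R0 by (field; lra).
  pose proof (pow2_ge_0 (e - 2 * k)). nra.
Qed.

(** The Cauchy-Riemann equations for one summand. *)
Lemma pole_has_pds : exists p q,
  has_pds (fun x y => pole_re a x y) x y p q /\ has_pds (fun x y => pole_im a x y) x y (- q) p.
Proof.
  pose proof pole_den_pos as P.
  assert (PN : (x ^ 2 - y ^ 2 + a ^ 2) ^ 2 + 4 * x ^ 2 * y ^ 2 <> 0) by (unfold pole_den in P; lra).
  set (e := x ^ 2 - y ^ 2 + a ^ 2).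
  exists (- 2 * (x * (e ^ 2 - 4 * x ^ 2 * y ^ 2) + 4 * e * x * y ^ 2) / (e ^ 2 + 4 * x ^ 2 * y ^ 2) ^ 2),
    (2 * (y * (e ^ 2 - 4 * x ^ 2 * y ^ 2) - 4 * e * x ^ 2 * y) / (e ^ 2 + 4 * x ^ 2 * y ^ 2) ^ 2).
  unfold e. split; split; unfold pole_re, pole_im, pole_den; auto_derive;
    try (revert PN; simpl; rewrite !Rmult_1_r; intros; assumption);
    field; (revert PN; simpl; rewrite !Rmult_1_r; intros; assumption).
Qed.

End Pole.

(** ** The family *)

(** A power of 2 for which [ell_width], [ell_osc] and [ell_reach] hold. *)
Definition ell : R := 131072.
(** The factor [L] of [h'].  Being an integer, it maps multiples of [2 PI] to
    multiples of [2 PI]. *)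
Definition Lc : R := ell ^ 2.

Lemma ell_pos : 0 < ell.
Proof. unfold ell; lra. Qed.

Lemma Lc_pos : 0 < Lc.
Proof. unfold Lc. pose proof ell_pos. nra. Qed.

Lemma Lc_eq : Lc = IZR 17179869184.
Proof. unfold Lc, ell; ring. Qed.

Lemma ell_width : (/ (8 * ell)) ^ 2 <= 1 / 8.
Proof. unfold ell; lra. Qed.

Lemma ell_osc : 8 * Lc * (/ (8 * ell)) ^ 2 <= 1 / 4.
Proof. unfold Lc, ell; lra. Qed.

Lemma ell_reach : 2 <= (/ (8 * ell)) ^ 4 * Lc ^ 3 / 1492992.
Proof. unfold Lc, ell; lra. Qed.

Global Opaque ell Lc.

Section Family.
Variables (n : nat) (b : nat -> R).

Definition pole_sq (a x : R) (j : nat) : R := (x - b j) ^ 2 + a ^ 2.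
(** In the strip of half-width [width] the function [h'] is of order [Lc * mu ^ 4].
    The power 3 balances two demands: the variation of [u] is of order
    [Lc * mu ^ 6 * width ^ 2], and should be bounded, whereas [v], of order
    [Lc * mu ^ 4 * width], should grow with [mu]. *)
Definition speed (a x : R) : R := sumj n (fun j => / pole_sq a x j).
Definition mu (a x : R) : R := sqrt (sqrt (speed a x)).
Definition width (a x : R) : R := / (8 * ell * mu a x ^ 3).

Definition re_h (a x y : R) : R := Lc * sumj n (fun j => pole_re a (x - b j) y).
Definition im_h (a x y : R) : R := Lc * sumj n (fun j => pole_im a (x - b j) y).

Definition heights (a x : R) : Prop :=
  between (-2) 2 x /\ forall j, (1 <= j <= n)%nat -> 0 < pole_sq a x j.

(** A primitive [u + i v] of [re_h + i im_h] that extends [A]. *)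
Definition prim_u (A : R -> R) (a x y : R) : R := A x - y * mean (im_h a) x y.
Definition prim_v (a x y : R) : R := y * mean (re_h a) x y.

Hypotheses (Hn : (1 <= n)%nat) (Hb : forall j, (1 <= j <= n)%nat -> Rabs (b j) < 1).

Section Fixed.
Variables (a : R) (A : R -> R).
Hypothesis (Ha : 0 <= a <= 1).
Let I := heights a.
Let eta := width a.
Let Om := strip I eta.
Let U := re_h a.
Let V := im_h a.

Lemma speed_ge x : I x -> 1 / 10 <= speed a x.
Proof.
  intros [Hx Hp].
  assert (H1 : (1 <= 1 <= n)%nat) by lia.
  apply Rle_trans with (/ pole_sq a x 1).
  - replace (1 / 10) with (/ 10) by field. apply Rinv_le_contravar; [apply Hp, H1|].
    unfold pole_sq. specialize (Hb 1%nat H1). apply Rabs_def2 in Hb. destruct Hx as [Hx1 Hx2]. nra.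
  - apply (sumj_ge_term n (fun j => / pole_sq a x j)); auto.
    intros j Hj. left. apply Rinv_0_lt_compat, Hp, Hj.
Qed.

Lemma mu_facts x : I x -> 0 < mu a x /\ mu a x ^ 4 = speed a x /\ 1 / 4 <= mu a x ^ 2.
Proof.
  intros H. pose proof (speed_ge x H) as Hm.
  assert (H1 : 0 < sqrt (speed a x)) by (apply sqrt_lt_R0; lra).
  assert (H2 : 0 < mu a x) by (apply sqrt_lt_R0; auto).
  assert (E1 : mu a x ^ 2 = sqrt (speed a x)) by (apply pow2_sqrt; lra).
  assert (E2 : mu a x ^ 4 = speed a x).
  { replace (mu a x ^ 4) with ((mu a x ^ 2) ^ 2) by ring. rewrite E1. apply pow2_sqrt; lra. }
  split; auto. split; auto. rewrite E1.
  rewrite <- (sqrt_pow2 (1 / 4)) by lra. apply sqrt_le_1_alt. lra.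
Qed.

Lemma width_pos x : I x -> 0 < eta x.
Proof.
  intros H. destruct (mu_facts x H) as [H1 _]. unfold eta, width.
  apply Rinv_0_lt_compat. pose proof ell_pos.
  apply Rmult_lt_0_compat; [lra|]. apply pow_lt; auto.
Qed.

Lemma width_eq x : I x -> eta x * mu a x ^ 3 = / (8 * ell).
Proof.
  intros H. destruct (mu_facts x H) as [H1 _]. pose proof ell_pos.
  unfold eta, width. field. split; lra.
Qed.

Lemma inv_pole_le x j : I x -> (1 <= j <= n)%nat -> / pole_sq a x j <= mu a x ^ 4.
Proof.
  intros H Hj. destruct (mu_facts x H) as (_ & -> & _).
  apply (sumj_ge_term n (fun j => / pole_sq a x j)); auto.
  intros i Hi. left. apply Rinv_0_lt_compat, H, Hi.
Qed.

(** The strip stays away from the poles [b j +- i a]. *)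
Lemma strip_narrow x y j : Om (x, y) -> (1 <= j <= n)%nat ->
  0 < pole_sq a x j /\ y ^ 2 <= pole_sq a x j / 2.
Proof.
  intros [H Hy] Hj. simpl in *.
  assert (Hp : 0 < pole_sq a x j) by (apply H; auto). split; auto.
  destruct (mu_facts x H) as (M1 & _ & M2). pose proof (inv_pole_le x j H Hj) as Hi.
  pose proof (width_eq x H) as We. pose proof (width_pos x H) as Wp.
  set (m := mu a x) in *. set (d := pole_sq a x j) in *. set (w := eta x) in *.
  assert (Hd : 1 <= d * m ^ 4).
  { apply Rmult_le_compat_l with (r := d) in Hi; [|lra]. rewrite Rinv_r in Hi; lra. }
  assert (Hw : (w * m ^ 3) ^ 2 <= 1 / 8).
  { rewrite We. exact ell_width. }
  assert (Hyw : y ^ 2 <= w ^ 2).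
  { rewrite <- (pow2_abs y). apply pow_incr. split; [apply Rabs_pos|lra]. }
  apply Rle_trans with (w ^ 2); auto.
  apply Rmult_le_reg_r with (m ^ 6); [apply pow_lt; auto|].
  replace (w ^ 2 * m ^ 6) with ((w * m ^ 3) ^ 2) by ring.
  replace (d / 2 * m ^ 6) with ((d * m ^ 4) * m ^ 2 / 2) by field.
  nra.
Qed.

Lemma re_h_bounds x y : Om (x, y) ->
  Lc / 6 * mu a x ^ 4 <= U x y <= 2 * Lc * mu a x ^ 4.
Proof.
  intros H. destruct (mu_facts x (proj1 H)) as (_ & -> & _). pose proof Lc_pos.
  unfold U, re_h, speed. split.
  - replace (Lc / 6 * _) with (Lc * (1 / 6 * sumj n (fun j => / pole_sq a x j))) by field.
    rewrite <- (sumj_scal n (1 / 6)). apply Rmult_le_compat_l; [lra|]. apply sumj_le. intros j Hj.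
    destruct (strip_narrow x y j H Hj) as [P1 P2].
    destruct (pole_re_bounds a (x - b j) y P1 P2) as [B _].
    eapply Rle_trans; [|exact B]. right. unfold pole_sq. field. unfold pole_sq in P1. lra.
  - replace (2 * Lc * _) with (Lc * (2 * sumj n (fun j => / pole_sq a x j))) by ring.
    rewrite <- (sumj_scal n 2). apply Rmult_le_compat_l; [lra|]. apply sumj_le. intros j Hj.
    destruct (strip_narrow x y j H Hj) as [P1 P2].
    destruct (pole_re_bounds a (x - b j) y P1 P2) as [_ B]. exact B.
Qed.

Lemma im_h_bounds x y : Om (x, y) ->
  Rabs (V x y) <= 8 * Lc * mu a x ^ 6 * Rabs y /\ Rabs (V x y) <= Lc * mu a x ^ 4.
Proof.
  intros H. destruct (mu_facts x (proj1 H)) as (M1 & M2 & _). pose proof Lc_pos.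
  unfold V, im_h. rewrite Rabs_mult, (Rabs_pos_eq Lc) by lra. split.
  - replace (8 * Lc * mu a x ^ 6 * Rabs y) with (Lc * (8 * Rabs y * mu a x ^ 2 * mu a x ^ 4)) by ring.
    apply Rmult_le_compat_l; [lra|]. eapply Rle_trans; [apply sumj_abs|].
    rewrite M2. unfold speed. rewrite <- sumj_scal. apply sumj_le. intros j Hj.
    destruct (strip_narrow x y j H Hj) as [P1 P2].
    apply (pole_im_bound_y a (x - b j) y P1 P2).
    + apply pow2_ge_0.
    + replace ((mu a x ^ 2) ^ 2) with (mu a x ^ 4) by ring. apply inv_pole_le; auto. apply H.
  - apply Rmult_le_compat_l; [lra|]. eapply Rle_trans; [apply sumj_abs|].
    rewrite M2. unfold speed. apply sumj_le. intros j Hj.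
    destruct (strip_narrow x y j H Hj) as [P1 P2].
    apply (pole_im_bound a (x - b j) y P1 P2).
Qed.

Lemma continuity_width x : I x -> continuity_pt eta x.
Proof.
  intros H. apply continuity_pt_filterlim. destruct (mu_facts x H) as (M1 & _ & _).
  pose proof (speed_ge x H) as Hm. pose proof ell_pos.
  apply (lim_inv (F := locally x)).
  - apply Rgt_not_eq. apply Rmult_lt_0_compat; [lra|]. apply pow_lt, M1.
  - apply (lim_mult (F := locally x)); [apply lim_const|]. apply lim_pow.
    apply (lim_comp1 (F := locally x) sqrt).
    { apply continuity_pt_sqrt. apply sqrt_pos. }
    apply (lim_comp1 (F := locally x) sqrt).
    { apply continuity_pt_sqrt. lra. }
    apply sumj_lim; [apply locally_filter|]. intros j Hj. apply (lim_inv (F := locally x)).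
    + apply Rgt_not_eq, H, Hj.
    + apply (lim_plus (F := locally x)); [|apply lim_const]. apply lim_pow.
      apply (lim_minus (F := locally x)); [apply filterlim_id|apply lim_const].
Qed.

Lemma open_heights : open I.
Proof.
  apply (open_and (T := R_UniformSpace)); [apply open_between|].
  apply open_forall_upto. intros j.
  apply (open_comp (fun x => pole_sq a x j) (fun d => 0 < d)); [|apply open_gt].
  intros x _. apply (lim_plus (F := locally x)); [|apply lim_const]. apply lim_pow.
  apply (lim_minus (F := locally x)); [apply filterlim_id|apply lim_const].
Qed.

Lemma open_Om : open Om.
Proof. apply open_strip; [apply open_heights|apply continuity_width]. Qed.

Lemma Om_den x y j : Om (x, y) -> (1 <= j <= n)%nat -> 0 < pole_den a (x - b j) y.
Proof.
  intros H Hj. destruct (strip_narrow x y j H Hj). apply pole_den_pos; auto.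
Qed.

Lemma smooth_h : smooth Om U /\ smooth Om V.
Proof.
  pose proof open_Om as HO.
  assert (Sx : forall j, smooth Om (fun x _ => x - b j)).
  { intros j. apply smooth_minus; auto using smooth_const. apply smooth_fst; auto. }
  assert (Sy : smooth Om (fun _ y => y)) by (apply smooth_snd; auto).
  assert (Sn : forall j, smooth Om (fun x y => (x - b j) ^ 2 - y ^ 2 + a ^ 2)).
  { intros j. apply smooth_plus; auto using smooth_const.
    apply smooth_minus; auto; apply smooth_pow2; auto. }
  assert (Sd : forall j, smooth Om (fun x y => pole_den a (x - b j) y)).
  { intros j. unfold pole_den. apply smooth_plus; auto.
    - apply (smooth_pow2 Om (fun x y => (x - b j) ^ 2 - y ^ 2 + a ^ 2)); auto.
    - apply smooth_mult; auto.
      + apply smooth_mult; auto using smooth_const. apply smooth_pow2; auto.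
      + apply smooth_pow2; auto. }
  split.
  - apply smooth_mult; auto using smooth_const.
    apply (sumj_smooth n Om (fun j x y => pole_re a (x - b j) y)); auto. intros j Hj.
    apply (smooth_div Om (fun x y => (x - b j) ^ 2 - y ^ 2 + a ^ 2) (fun x y => pole_den a (x - b j) y)); auto.
    intros s t Hst. pose proof (Om_den s t j Hst Hj). lra.
  - apply smooth_mult; auto using smooth_const.
    apply (sumj_smooth n Om (fun j x y => pole_im a (x - b j) y)); auto. intros j Hj.
    apply (smooth_div Om (fun x y => - (2 * (x - b j) * y)) (fun x y => pole_den a (x - b j) y)); auto.
    + apply smooth_opp; auto. apply smooth_mult; auto. apply smooth_mult; auto using smooth_const.
    + intros s t Hst. pose proof (Om_den s t j Hst Hj). lra.
Qed.

Lemma has_pds_sumj m (f : nat -> R -> R -> R) x y (l1 l2 : nat -> R) :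
  (forall j, (1 <= j <= m)%nat -> has_pds (f j) x y (l1 j) (l2 j)) ->
  has_pds (fun x y => sumj m (fun j => f j x y)) x y (sumj m l1) (sumj m l2).
Proof.
  intros H. split.
  - apply (sumj_derive m (fun j x => f j x y)). intros j Hj. apply (H j Hj).
  - apply (sumj_derive m (fun j y => f j x y)). intros j Hj. apply (H j Hj).
Qed.

Lemma h_cauchy_riemann x y : Om (x, y) -> pd1 U x y = pd2 V x y /\ pd2 U x y = - pd1 V x y.
Proof.
  intros H.
  set (Q := fun j pq => has_pds (fun x y => pole_re a (x - b j) y) x y (fst pq) (snd pq) /\
    has_pds (fun x y => pole_im a (x - b j) y) x y (- snd pq) (fst pq)).
  assert (E : forall j, (1 <= j <= n)%nat -> exists pq : R2, Q j pq).
  { intros j Hj. destruct (strip_narrow x y j H Hj) as [P1 P2].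
    destruct (pole_has_pds a (x - b j) y P1 P2) as (p & q & [A1 A2] & [B1 B2]).
    assert (S : is_derive (fun x => x - b j) x 1) by (auto_derive; auto).
    exists (p, q). split; split; auto.
    - replace (fst (p, q)) with (scal 1 p) by (unfold scal; simpl; unfold mult; simpl; ring).
      apply (is_derive_comp (K := R_AbsRing) (V := R_NormedModule) (fun x => pole_re a x y) (fun x => x - b j)); auto.
    - replace (- snd (p, q)) with (scal 1 (- q)) by (unfold scal; simpl; unfold mult; simpl; ring).
      apply (is_derive_comp (K := R_AbsRing) (V := R_NormedModule) (fun x => pole_im a x y) (fun x => x - b j)); auto. }
  set (pq := fun j => epsilon (inhabits (0, 0)) (Q j)).
  assert (HQ : forall j, (1 <= j <= n)%nat -> Q j (pq j)) by (intros j Hj; apply epsilon_spec, E, Hj).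
  assert (KL : has_pds (fun _ _ => Lc) x y 0 0) by (split; apply is_derive_const_R).
  pose proof (has_pds_mult _ _ _ _ _ _ _ _ KL
    (has_pds_sumj n (fun j x y => pole_re a (x - b j) y) x y (fun j => fst (pq j)) (fun j => snd (pq j)) (fun j Hj => proj1 (HQ j Hj)))) as D1.
  pose proof (has_pds_mult _ _ _ _ _ _ _ _ KL
    (has_pds_sumj n (fun j x y => pole_im a (x - b j) y) x y (fun j => - snd (pq j)) (fun j => fst (pq j)) (fun j Hj => proj2 (HQ j Hj)))) as D2.
  destruct (has_pds_eq _ _ _ _ _ D1) as [E1 E2]. destruct (has_pds_eq _ _ _ _ _ D2) as [E3 E4].
  change (pd1 U x y = 0 * sumj n (fun j => pole_re a (x - b j) y) + Lc * sumj n (fun j => fst (pq j))) in E1.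
  change (pd2 U x y = 0 * sumj n (fun j => pole_re a (x - b j) y) + Lc * sumj n (fun j => snd (pq j))) in E2.
  change (pd1 V x y = 0 * sumj n (fun j => pole_im a (x - b j) y) + Lc * sumj n (fun j => - snd (pq j))) in E3.
  change (pd2 V x y = 0 * sumj n (fun j => pole_im a (x - b j) y) + Lc * sumj n (fun j => fst (pq j))) in E4.
  rewrite E1, E2, E3, E4. split; [ring|].
  rewrite (sumj_ext n (fun j => - snd (pq j)) (fun j => -1 * snd (pq j))) by (intros; ring).
  rewrite sumj_scal. ring.
Qed.

Lemma re_h_axis x : I x -> U x 0 = Lc * speed a x.
Proof.
  intros H. unfold U, re_h, speed. f_equal. apply sumj_ext. intros j Hj.
  unfold pole_re, pole_den. fold (pole_sq a x j).
  replace ((x - b j) ^ 2 - 0 ^ 2 + a ^ 2) with (pole_sq a x j) by (unfold pole_sq; ring).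
  assert (0 < pole_sq a x j) by (apply H; auto). field. lra.
Qed.

Lemma im_h_axis x : V x 0 = 0.
Proof.
  unfold V, im_h. rewrite (sumj_ext n _ (fun j => 0 * pole_im a (x - b j) 0)).
  - rewrite sumj_scal. ring.
  - intros j _. unfold pole_im. replace (- (2 * (x - b j) * 0)) with 0 by ring.
    unfold Rdiv. ring.
Qed.

Lemma re_h_even x y : U x (- y) = U x y.
Proof.
  unfold U, re_h. f_equal. apply sumj_ext. intros j _. unfold pole_re, pole_den.
  replace ((- y) ^ 2) with (y ^ 2) by ring. reflexivity.
Qed.

Lemma im_h_odd x y : V x (- y) = - V x y.
Proof.
  unfold V, im_h. rewrite (sumj_ext n _ (fun j => -1 * pole_im a (x - b j) y)).
  - rewrite sumj_scal. ring.
  - intros j _. unfold pole_im, pole_den. replace ((- y) ^ 2) with (y ^ 2) by ring.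
    unfold Rdiv. ring.
Qed.

Lemma h_continuity x y : Om (x, y) -> continuity_2d_pt U x y /\ continuity_2d_pt V x y.
Proof.
  intros H. destruct smooth_h. split; apply smooth_continuity with Om; auto.
Qed.

Lemma h_along x y : Om (x, y) ->
  ex_RInt (fun r => U x (y * r)) 0 1 /\ ex_RInt (fun r => V x (y * r)) 0 1.
Proof.
  intros H. split; apply (ex_RInt_along Om (strip_star _ _)); auto;
    intros s t Hst; apply h_continuity; auto.
Qed.

Lemma mean_im_h_odd x y : Om (x, y) -> mean V x (- y) = - mean V x y.
Proof.
  intros H. unfold mean.
  transitivity (RInt (fun r => opp (V x (y * r))) 0 1).
  - apply RInt_ext. intros r _. change (opp (V x (y * r))) with (- V x (y * r)).
    rewrite <- im_h_odd. f_equal. ring.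
  - apply (RInt_opp (V := R_CompleteNormedModule)). exact (proj2 (h_along x y H)).
Qed.

Hypothesis HA : forall x, I x -> is_derive A x (Lc * speed a x).
Let u := prim_u A a.
Let v := prim_v a.

Lemma prim_has_pds x y : Om (x, y) ->
  has_pds u x y (U x y) (- V x y) /\ has_pds v x y (V x y) (U x y).
Proof.
  intros H. destruct smooth_h as [SU SV]. pose proof open_Om as HO.
  assert (S0 : smooth Om (fun x _ => U x 0)).
  { apply (smooth_comp Om Om U (fun x _ => x) (fun _ _ => 0)); auto using smooth_const.
    - intros s t [Hs _]. split; auto. simpl. rewrite Rabs_R0. apply width_pos; auto.
    - apply smooth_fst; auto. }
  assert (S1 : smooth Om (fun x y => U x 0 - U x y)) by (apply smooth_minus; auto).
  split.
  - assert (P : has_pds (fun x y => y * mean V x y) x y (U x 0 - U x y) (V x y)).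
    { apply (has_pds_primitive Om HO (strip_star _ _) V (fun x y => U x 0 - U x y)); auto.
      - intros s t Hst. destruct (h_cauchy_riemann s t Hst) as [_ E].
        destruct (smooth_has_pds _ _ _ _ SU Hst) as [_ P2].
        symmetry. apply is_derive_unique.
        replace (pd1 V s t) with (0 + - pd2 U s t) by (rewrite E; ring).
        apply (is_derive_plus_R (fun _ => U s 0) (fun y => - U s y)); [apply is_derive_const_R|].
        apply (is_derive_opp (K := R_AbsRing) (V := R_NormedModule) (U s)). exact P2.
      - intros; ring. }
    assert (PA : has_pds (fun x _ => A x) x y (U x 0) 0).
    { split; [|apply is_derive_const_R]. rewrite re_h_axis by apply H. apply HA, H. }
    assert (PN : has_pds (fun x y => - (y * mean V x y)) x y (- (U x 0 - U x y)) (- V x y)).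
    { destruct P as [P1 P2]. split.
      - apply (is_derive_opp (K := R_AbsRing) (V := R_NormedModule) (fun x => y * mean V x y)), P1.
      - apply (is_derive_opp (K := R_AbsRing) (V := R_NormedModule) (fun y => y * mean V x y)), P2. }
    eapply has_pds_val; [exact (has_pds_plus _ _ _ _ _ _ _ _ PA PN)| |]; ring.
  - apply (has_pds_primitive Om HO (strip_star _ _) U V); auto.
    + intros s t Hst. exact (proj1 (h_cauchy_riemann s t Hst)).
    + intros; apply im_h_axis.
Qed.

Lemma prim_eqs x y : Om (x, y) ->
  pd1 u x y = U x y /\ pd2 u x y = - V x y /\ pd1 v x y = V x y /\ pd2 v x y = U x y.
Proof.
  intros H. destruct (prim_has_pds x y H) as [P Q].
  destruct (has_pds_eq _ _ _ _ _ P). destruct (has_pds_eq _ _ _ _ _ Q). auto.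
Qed.

Lemma smooth_prim : smooth Om u /\ smooth Om v.
Proof.
  destruct smooth_h as [SU SV]. pose proof open_Om as HO. split.
  - apply (smooth_intro Om u U (fun x y => - V x y)); auto.
    + intros s t H. apply prim_has_pds, H.
    + apply smooth_opp; auto.
  - apply (smooth_intro Om v V U); auto. intros s t H. apply prim_has_pds, H.
Qed.

Lemma prim_u_osc x y : Om (x, y) -> Rabs (u x y - u x 0) <= 1 / 4.
Proof.
  intros H. unfold u, prim_u. rewrite Rmult_0_l.
  replace (A x - y * mean (im_h a) x y - (A x - 0)) with (- (y * mean V x y)) by (unfold V; ring).
  rewrite Rabs_Ropp, Rabs_mult.
  destruct (mu_facts x (proj1 H)) as (M1 & _ & _).
  pose proof (width_eq x (proj1 H)) as We. pose proof (width_pos x (proj1 H)) as Wp.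
  pose proof Lc_pos. pose proof (Rabs_pos y).
  assert (B : Rabs (mean V x y) <= (1 - 0) * (8 * Lc * mu a x ^ 6 * Rabs y)).
  { apply abs_RInt_le_const; [lra|exact (proj2 (h_along x y H))|]. intros r Hr.
    assert (Hr' : Om (x, y * r)) by (apply strip_star; auto).
    destruct (im_h_bounds x (y * r) Hr') as [B _]. eapply Rle_trans; [exact B|].
    apply Rmult_le_compat_l.
    - apply Rmult_le_pos; [lra|]. left. apply pow_lt, M1.
    - rewrite Rabs_mult, (Rabs_pos_eq r) by lra. nra. }
  destruct H as [_ Hy]. simpl in Hy. set (m := mu a x) in *. set (w := eta x) in *.
  apply Rle_trans with (w * (8 * Lc * m ^ 6 * w)).
  - assert (0 < m ^ 6) by (apply pow_lt; auto).
    apply Rmult_le_compat; [lra|apply Rabs_pos|lra|]. eapply Rle_trans; [exact B|].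
    rewrite Rminus_0_r, Rmult_1_l. apply Rmult_le_compat_l; [nra|lra].
  - replace (w * (8 * Lc * m ^ 6 * w)) with (8 * Lc * (w * m ^ 3) ^ 2) by ring.
    rewrite We. exact ell_osc.
Qed.

Lemma mean_re_h_ge x y : Om (x, y) -> Lc / 6 * mu a x ^ 4 <= mean U x y.
Proof.
  intros H. unfold mean.
  replace (Lc / 6 * mu a x ^ 4) with (RInt (fun _ => Lc / 6 * mu a x ^ 4) 0 1)
    by (rewrite RInt_const; unfold scal; simpl; unfold mult; simpl; ring).
  apply RInt_le; [lra|apply ex_RInt_const|exact (proj1 (h_along x y H))|].
  intros r Hr. apply re_h_bounds. apply strip_star; auto. lra.
Qed.

(** The third power is what the width of order [mu ^ -3] requires in [prim_reach]. *)
Lemma cosh_ge_cube x : 0 <= x -> x ^ 3 / 54 <= cosh x.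
Proof.
  intros Hx. unfold cosh. pose proof (exp_pos (- x)).
  assert (E : exp x = exp (x / 3) ^ 3).
  { replace (exp (x / 3) ^ 3) with (exp (x / 3) * exp (x / 3) * exp (x / 3)) by ring.
    rewrite <- !exp_plus. f_equal. field. }
  assert (x / 3 <= exp (x / 3)).
  { pose proof (exp_ineq1_le (x / 3)). lra. }
  assert ((x / 3) ^ 3 <= exp (x / 3) ^ 3) by (apply pow_incr; lra).
  replace (x ^ 3 / 54) with ((x / 3) ^ 3 / 2) by field. lra.
Qed.

Lemma RInt_cube : RInt (fun r => r ^ 3) 0 1 = 1 / 4.
Proof.
  apply is_RInt_unique.
  replace (1 / 4) with (minus (1 ^ 4 / 4) (0 ^ 4 / 4)) by (unfold minus, plus, opp; simpl; field).
  apply (is_RInt_derive (V := R_CompleteNormedModule) (fun r => r ^ 4 / 4) (fun r => r ^ 3)).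
  - intros r _. auto_derive; auto. field.
  - intros r _. apply (ex_derive_continuous (V := R_NormedModule)). auto_derive. auto.
Qed.

(** At half the width of the strip [v] is of order [mu], so that the growth of
    [cosh v] outweighs the width [eta] of order [mu ^ -3]. *)
Lemma prim_reach x : I x -> exists y, 0 < y < eta x /\ 2 <= radius u v x y.
Proof.
  intros H. destruct (mu_facts x H) as (M1 & _ & _).
  pose proof (width_eq x H) as We. pose proof (width_pos x H) as Wp.
  pose proof Lc_pos. set (y := eta x / 2).
  assert (Hy : Om (x, y)).
  { split; auto. simpl. unfold y. rewrite Rabs_pos_eq; lra. }
  exists y. split; [unfold y; lra|].
  destruct smooth_prim as [Su Sv]. pose proof open_Om as HO.
  assert (Sc : smooth Om (hcos u v)).
  { apply smooth_mult; auto; [apply smooth_cosh|apply smooth_cos]; auto. }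
  assert (Ss : smooth Om (hsin u v)).
  { apply smooth_mult; auto; [apply smooth_cosh|apply smooth_sin]; auto. }
  assert (C1 : forall s t, Om (s, t) -> continuity_2d_pt (hcos u v) s t)
    by (intros; apply smooth_continuity with Om; auto).
  assert (C2 : forall s t, Om (s, t) -> continuity_2d_pt (hsin u v) s t)
    by (intros; apply smooth_continuity with Om; auto).
  pose proof (ex_RInt_along Om (strip_star _ _) _ _ _ C1 Hy) as X1.
  pose proof (ex_RInt_along Om (strip_star _ _) _ _ _ C2 Hy) as X2.
  set (al := u x 0). set (k := Lc / 6 * mu a x ^ 4).
  assert (Hk : 0 < k) by (unfold k; apply Rmult_lt_0_compat; [lra|apply pow_lt, M1]).
  assert (Hy0 : 0 < y) by (unfold y; lra).
  (* [432 = 54 * 2 * 4]: the bound of [cosh] by a cube, the factor [1 / 2] from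
     the cosine, and the integral of [r ^ 3]. *)
  assert (B : (k * y) ^ 3 / 432 <= cos al * mean (hcos u v) x y + sin al * mean (hsin u v) x y).
  { unfold mean.
    replace (cos al * _ + sin al * _) with
      (RInt (fun r => cos al * hcos u v x (y * r) + sin al * hsin u v x (y * r)) 0 1).
    - replace ((k * y) ^ 3 / 432) with (RInt (fun r => (k * y) ^ 3 / 108 * r ^ 3) 0 1).
      2:{ rewrite (RInt_scal (V := R_CompleteNormedModule) (fun r => r ^ 3)).
          - rewrite RInt_cube. unfold scal; simpl; unfold mult; simpl. field.
          - apply (ex_RInt_continuous (V := R_CompleteNormedModule)). intros z _.
            apply (ex_derive_continuous (V := R_NormedModule)). auto_derive. auto. }
      apply RInt_le; [lra| | |].
      + apply (ex_RInt_continuous (V := R_CompleteNormedModule)). intros z _.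
        apply (ex_derive_continuous (V := R_NormedModule)). auto_derive. auto.
      + apply (ex_RInt_plus (V := R_NormedModule)); apply (ex_RInt_scal (V := R_NormedModule)); auto.
      + intros r Hr. assert (Hr' : Om (x, y * r)) by (apply strip_star; auto; lra).
        unfold hcos, hsin.
        replace (cos al * _ + _) with (cosh (v x (y * r)) * cos (u x (y * r) - al))
          by (rewrite cos_minus; ring).
        pose proof (prim_u_osc x (y * r) Hr') as O. fold al in O.
        pose proof (cos_ge_half (u x (y * r) - al) ltac:(lra)) as Hc.
        assert (Hv : k * y * r <= v x (y * r)).
        { unfold v, prim_v. replace (k * y * r) with (y * r * k) by ring.
          apply Rmult_le_compat_l; [nra|]. apply mean_re_h_ge, Hr'. }
        assert (0 <= k * y * r) by (repeat apply Rmult_le_pos; lra).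
        pose proof (cosh_ge_cube (v x (y * r)) ltac:(lra)) as Hch.
        assert ((k * y * r) ^ 3 <= v x (y * r) ^ 3) by (apply pow_incr; lra).
        assert ((k * y) ^ 3 / 108 * r ^ 3 = (k * y * r) ^ 3 / 108) by (field; auto).
        assert (0 <= (k * y * r) ^ 3) by (apply pow_le; auto). nra.
    - rewrite (RInt_plus (V := R_CompleteNormedModule)).
      + rewrite !(RInt_scal (V := R_CompleteNormedModule)) by auto. reflexivity.
      + apply (ex_RInt_scal (V := R_NormedModule)); auto.
      + apply (ex_RInt_scal (V := R_NormedModule)); auto. }
  set (c := mean (hcos u v) x y) in *. set (s := mean (hsin u v) x y) in *.
  assert (B2 : cos al * c + sin al * s <= sqrt (c ^ 2 + s ^ 2)).
  { destruct (Rle_dec 0 (cos al * c + sin al * s)) as [P|P].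
    - rewrite <- (sqrt_pow2 _ P). apply sqrt_le_1_alt.
      pose proof (sin2_cos2 al) as Q. unfold Rsqr in Q.
      replace (c ^ 2 + s ^ 2) with ((c ^ 2 + s ^ 2) * (sin al * sin al + cos al * cos al)) by (rewrite Q; ring).
      pose proof (pow2_ge_0 (cos al * s - sin al * c)). nra.
    - pose proof (sqrt_pos (c ^ 2 + s ^ 2)). lra. }
  unfold radius. fold c s.
  apply Rle_trans with (y * ((k * y) ^ 3 / 432)).
  - unfold y, k. set (m := mu a x) in *. set (w := eta x) in *.
    replace (w / 2 * ((Lc / 6 * m ^ 4 * (w / 2)) ^ 3 / 432)) with ((w * m ^ 3) ^ 4 * Lc ^ 3 / 1492992) by field.
    rewrite We. exact ell_reach.
  - apply Rmult_le_compat_l; lra.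
Qed.

Lemma family_data : spiral_data I eta u v.
Proof.
  destruct smooth_prim as [Su Sv].
  constructor; auto.
  - apply open_heights.
  - apply open_Om.
  - apply width_pos.
  - intros x y H. destruct (prim_eqs x y H) as (-> & _ & _ & ->). reflexivity.
  - intros x y H. destruct (prim_eqs x y H) as (_ & -> & -> & _). reflexivity.
  - intros x. unfold v, prim_v. ring.
  - intros x y H. unfold u, prim_u. fold V. rewrite mean_im_h_odd by auto. ring.
  - intros x y H. unfold v, prim_v. fold U.
    replace (mean U x (- y)) with (mean U x y); [ring|].
    apply RInt_ext. intros r _. rewrite <- re_h_even. f_equal. ring.
  - apply prim_u_osc.
  - intros x y H Hy. unfold v, prim_v. apply Rmult_lt_0_compat; auto.
    pose proof (mean_re_h_ge x y H) as B. fold U. pose proof Lc_pos.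
    destruct (mu_facts x (proj1 H)) as (M1 & _ & _).
    assert (0 < mu a x ^ 4) by (apply pow_lt; auto). nra.
  - apply prim_reach.
Qed.

End Fixed.
End Family.

(** ** Primitives on the real axis *)

(** [atan w / w], continuous at 0. *)
Definition atan_quot (w : R) : R := if Req_EM_T w 0 then 1 else atan w / w.

Lemma lim_atan_quot {T} (F : (T -> Prop) -> Prop) {FF : Filter F} (w : T -> R) :
  filterlim w F (locally 0) -> filterlim (fun z => atan_quot (w z)) F (locally 1).
Proof.
  intros H. apply filterlim_R; auto. intros eps Heps.
  pose proof (is_derive_atan_R 0) as D. replace (/ (1 + 0 ^ 2)) with 1 in D by field.
  destruct (proj1 (is_derive_eps _ _ _) D (eps / 2) ltac:(lra)) as (d & Hd & K).
  assert (A := proj1 (filterlim_R F _ _) H d Hd).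
  revert A. apply filter_imp. intros z Hz. unfold atan_quot.
  destruct (Req_EM_T (w z) 0) as [E|E].
  - rewrite Rminus_diag, Rabs_R0. exact Heps.
  - specialize (K (w z) Hz). rewrite atan_0, !Rminus_0_r, Rmult_1_l in K.
    replace (atan (w z) / w z - 1) with ((atan (w z) - w z) / w z) by (field; auto).
    rewrite Rabs_div by auto. apply Rle_lt_trans with (eps / 2); [|lra].
    assert (0 < Rabs (w z)) by (apply Rabs_pos_lt; auto).
    apply Rle_div_l; auto.
Qed.

Definition axis_term (a x : R) : R :=
  if Req_EM_T a 0 then - / x else atan (x / a) / a.

Lemma axis_term_derive a x : 0 <= a -> 0 < x ^ 2 + a ^ 2 ->
  is_derive (axis_term a) x (/ (x ^ 2 + a ^ 2)).
Proof.
  intros Ha H. unfold axis_term. destruct (Req_EM_T a 0) as [->|E].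
  - assert (x <> 0) by (intros ->; lra). auto_derive; auto. field. auto.
  - assert (0 < a) by lra. auto_derive; auto. field. split; nra.
Qed.

(** The values [1 / (4 k)] of [a], and 0: for these the function [atan (x / a) / a]
    is congruent modulo [2 PI] to [- 1 / x + o(1)] on both sides of 0. *)
Definition adm (a : R) : Prop := a = 0 \/ exists k : nat, (1 <= k)%nat /\ a = / (4 * INR k).

Lemma adm_bounds a : adm a -> 0 <= a <= 1.
Proof.
  intros [->|(k & Hk & ->)]; [lra|].
  apply le_INR in Hk. simpl in Hk. split.
  - left. apply Rinv_0_lt_compat. lra.
  - rewrite <- Rinv_1. apply Rinv_le_contravar; lra.
Qed.

Lemma axis_term_mod a x : adm a -> x <> 0 ->
  exists m : Z, axis_term a x = - atan_quot (a / x) / x + 2 * PI * IZR m.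
Proof.
  intros Ha Hx. unfold axis_term, atan_quot. destruct Ha as [->|(k & Hk & Ea)].
  - exists 0%Z. destruct (Req_EM_T 0 0) as [_|N]; [|congruence].
    destruct (Req_EM_T (0 / x) 0) as [_|N]; [field; auto|].
    exfalso; apply N. field; auto.
  - apply le_INR in Hk. simpl in Hk.
    assert (Hap : 0 < a) by (rewrite Ea; apply Rinv_0_lt_compat; lra).
    assert (Hak : / a = 4 * INR k) by (rewrite Ea, Rinv_inv; auto).
    destruct (Req_EM_T a 0) as [N|_]; [lra|].
    destruct (Req_EM_T (a / x) 0) as [N|_].
    { exfalso. assert (a = 0) by (replace a with (a / x * x) by (field; auto); rewrite N; ring). lra. }
    assert (E : forall y, 0 < y -> atan (y / a) = PI / 2 - atan (a / y)).
    { intros y Hy. replace (y / a) with (/ (a / y)) by (field; lra).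
      apply atan_inv. apply Rdiv_lt_0_compat; auto. }
    destruct (Rlt_dec 0 x) as [P|P].
    + exists (Z.of_nat k). rewrite (E x P). rewrite <- INR_IZR_INZ.
      replace ((PI / 2 - atan (a / x)) / a) with (PI / 2 * / a - atan (a / x) / a) by (field; lra).
      rewrite Hak. field. lra.
    + exists (- Z.of_nat k)%Z. rewrite opp_IZR, <- INR_IZR_INZ.
      replace (x / a) with (- ((- x) / a)) by (field; lra).
      rewrite atan_opp, (E (- x)) by lra.
      replace (a / - x) with (- (a / x)) by (field; lra). rewrite atan_opp.
      replace (- (PI / 2 - - atan (a / x)) / a) with (- (PI / 2) * / a - atan (a / x) / a) by (field; lra).
      rewrite Hak. field. lra.
Qed.

Lemma trig_period_Z x m : cos (x + 2 * PI * IZR m) = cos x /\ sin (x + 2 * PI * IZR m) = sin x.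
Proof.
  destruct (Z_le_gt_dec 0 m) as [H|H].
  - replace (2 * PI * IZR m) with (2 * INR (Z.to_nat m) * PI).
    + split; [apply cos_period|apply sin_period].
    + rewrite INR_IZR_INZ, Z2Nat.id by auto. ring.
  - set (y := x + 2 * PI * IZR m).
    replace x with (y + 2 * INR (Z.to_nat (- m)) * PI).
    + split; symmetry; [apply cos_period|apply sin_period].
    + rewrite INR_IZR_INZ, Z2Nat.id by lia. rewrite opp_IZR. unfold y. ring.
Qed.

Section Data.
Variables (n : nat) (b : nat -> R).
Hypotheses (Hn : (1 <= n)%nat) (Hb : forall j, (1 <= j <= n)%nat -> Rabs (b j) < 1).

Definition axis_fun (a x : R) : R := Lc * sumj n (fun j => axis_term a (x - b j)).
(** Unlike [axis_fun] it is continuous in the parameter at 0, off the heights of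
    the poles. *)
Definition axis_cont (a x : R) : R :=
  Lc * sumj n (fun j => - atan_quot (a / (x - b j)) / (x - b j)).

Definition fam_u (a : R) : R -> R -> R := prim_u n b (axis_fun a) a.
Definition fam_v (a : R) : R -> R -> R := prim_v n b a.
Definition fam_I (a : R) : R -> Prop := heights n b a.
Definition fam_eta (a : R) : R -> R := width n b a.

Definition off_heights (x : R) : Prop := forall j, (1 <= j <= n)%nat -> x <> b j.

Lemma axis_fun_derive a x : 0 <= a <= 1 -> fam_I a x ->
  is_derive (axis_fun a) x (Lc * speed n b a x).
Proof.
  intros Ha H. unfold axis_fun.
  apply (is_derive_scal (fun x => sumj n (fun j => axis_term a (x - b j)))).
  apply (sumj_derive n (fun j x => axis_term a (x - b j))). intros j Hj.
  replace (/ pole_sq b a x j) with (scal 1 (/ pole_sq b a x j))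
    by (unfold scal; simpl; unfold mult; simpl; ring).
  apply (is_derive_comp (K := R_AbsRing) (V := R_NormedModule) (axis_term a) (fun x => x - b j)).
  - apply axis_term_derive; [lra|]. apply H, Hj.
  - auto_derive; auto.
Qed.

Lemma fam_data a : 0 <= a <= 1 -> spiral_data (fam_I a) (fam_eta a) (fam_u a) (fam_v a).
Proof.
  intros Ha. apply family_data; auto. intros x Hx. apply axis_fun_derive; auto.
Qed.

Lemma axis_fun_mod a x : adm a -> off_heights x ->
  exists m : Z, axis_fun a x = axis_cont a x + 2 * PI * IZR m.
Proof.
  intros Ha Hx. unfold axis_fun, axis_cont.
  assert (E : exists m : Z, sumj n (fun j => axis_term a (x - b j)) =
    sumj n (fun j => - atan_quot (a / (x - b j)) / (x - b j)) + 2 * PI * IZR m).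
  { clear Hn Hb. unfold off_heights in Hx. induction n as [|k IH]; simpl.
    - exists 0%Z. ring.
    - destruct IH as [m1 E1]; [intros j Hj; apply Hx; lia|].
      destruct (axis_term_mod a (x - b (S k)) Ha) as [m2 E2].
      { specialize (Hx (S k) ltac:(lia)). lra. }
      exists (m1 + m2)%Z. rewrite E1, E2, plus_IZR. ring. }
  destruct E as [m E]. exists (17179869184 * m)%Z. rewrite E, mult_IZR.
  rewrite Lc_eq. ring.
Qed.

(** ** Curvature estimates *)

Lemma sumj_const m c : sumj m (fun _ => c) = INR m * c.
Proof.
  induction m as [|m IH]; [simpl; ring|]. rewrite S_INR. simpl sumj. rewrite IH. ring.
Qed.

Lemma cosh_abs_le x y : Rabs x <= Rabs y -> cosh x <= cosh y.
Proof.
  assert (P : forall x y, 0 <= x <= y -> cosh x <= cosh y).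
  { clear. intros x y [H0 H]. unfold cosh.
    assert (E1 : exp x <= exp y) by (destruct H as [H|H]; [left; apply exp_increasing; auto|subst; lra]).
    assert (E2 : exp (- x) * exp x = 1) by (rewrite <- exp_plus, Rplus_opp_l; apply exp_0).
    assert (E3 : exp (- y) * exp y = 1) by (rewrite <- exp_plus, Rplus_opp_l; apply exp_0).
    assert (1 <= exp x) by (pose proof (exp_ineq1_le x); lra).
    pose proof (exp_pos (- x)). pose proof (exp_pos (- y)).
    assert (exp (- x) * exp (- y) <= 1).
    { assert (exp (- x) <= 1) by nra. assert (exp (- y) <= 1) by nra. nra. }
    assert (exp (- x) - exp (- y) = (exp y - exp x) * (exp (- x) * exp (- y))).
    { transitivity (exp (- x) * (exp (- y) * exp y) - exp (- y) * (exp (- x) * exp x)); [rewrite E2, E3; ring|ring]. }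
    nra. }
  intros H. assert (E : forall z, cosh z = cosh (Rabs z)).
  { intros z. unfold Rabs. destruct (Rcase_abs z); auto.
    unfold cosh. rewrite Ropp_involutive. lra. }
  rewrite (E x), (E y). apply P. split; auto. apply Rabs_pos.
Qed.

Section Bounds.
Variable a : R.
Hypothesis Ha : 0 <= a <= 1.
Let Om := strip (fam_I a) (fam_eta a).
Let u := fam_u a.
Let v := fam_v a.
Let SD := fam_data a Ha.

Lemma fam_v_shrink x y r : Om (x, y) -> 0 <= r <= 1 -> cosh (v x (y * r)) <= cosh (v x y).
Proof.
  intros H Hr. apply cosh_abs_le.
  assert (P : forall y, 0 <= y -> Om (x, y) -> 0 <= v x (y * r) <= v x y).
  { clear y H. intros y Hy H.
    assert (K : forall z, 0 <= z <= y -> Om (x, z)).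
    { intros z Hz. split; [apply H|]. destruct H as [_ H]. simpl in *.
      rewrite Rabs_pos_eq in * by lra. lra. }
    assert (Hyr : 0 <= y * r <= y) by (split; nra).
    split.
    - destruct (proj1 Hyr) as [L|L].
      + left. apply (sd_vpos _ _ _ _ SD); auto. apply strip_star; auto.
      + rewrite <- L. right. symmetry. apply (sd_v0 _ _ _ _ SD).
    - destruct (MVT_gen (v x) (y * r) y (pd2 v x)) as (c & Hc & E).
      + intros z Hz. rewrite Rmin_left, Rmax_right in Hz by lra.
        apply (smooth_has_pds Om v x z (sd_v _ _ _ _ SD)). apply K; lra.
      + intros z Hz. rewrite Rmin_left, Rmax_right in Hz by lra.
        apply continuity_pt_filterlim, continuity_2d_slice.
        apply smooth_continuity with Om; [apply (sd_v _ _ _ _ SD)|apply K; lra].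
      + rewrite Rmin_left, Rmax_right in Hc by lra.
        assert (Hoc : Om (x, c)) by (apply K; lra).
        destruct (prim_eqs n b Hn Hb a (axis_fun a) Ha (fun x Hx => axis_fun_derive a x Ha Hx) x c Hoc) as (_ & _ & _ & E4).
        destruct (re_h_bounds n b Hn Hb a Ha x c Hoc) as [B _].
        destruct (mu_facts n b Hn Hb a Ha x (proj1 H)) as (M1 & _ & _).
        pose proof Lc_pos. assert (0 < mu n b a x ^ 4) by (apply pow_lt; auto).
        change (pd2 v x c = re_h n b a x c) in E4. rewrite E4 in E.
        assert (0 <= re_h n b a x c) by nra. nra. }
  destruct (Rle_dec 0 y) as [Hy|Hy].
  - specialize (P y Hy H). rewrite !Rabs_pos_eq by lra. lra.
  - assert (H' : Om (x, - y)) by (split; [apply H|]; destruct H as [_ H]; simpl in *; rewrite Rabs_Ropp; auto).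
    specialize (P (- y) ltac:(lra) H').
    rewrite (sd_odd _ _ _ _ SD) in P by auto. fold v in P.
    replace (- y * r) with (- (y * r)) in P by ring.
    rewrite (sd_odd _ _ _ _ SD) in P by (apply strip_star; auto). fold v in P.
    rewrite <- (Rabs_Ropp (v x (y * r))), <- (Rabs_Ropp (v x y)), !Rabs_pos_eq by lra. lra.
Qed.

(** The speed of a slice is [cosh v], which is largest at its end. *)
Lemma radius_le_cosh x y : Om (x, y) -> radius u v x y ^ 2 <= 2 * y ^ 2 * cosh (v x y) ^ 2.
Proof.
  intros H.
  assert (B : forall f, (forall s t, Om (s, t) -> continuity_2d_pt f s t) ->
    (forall t, Om (x, t) -> Rabs (f x t) <= cosh (v x t)) -> mean f x y ^ 2 <= cosh (v x y) ^ 2).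
  { intros f Hf Hb'. rewrite <- (pow2_abs (mean f x y)). apply pow_incr. split; [apply Rabs_pos|].
    replace (cosh (v x y)) with ((1 - 0) * cosh (v x y)) by ring.
    apply abs_RInt_le_const; [lra| |].
    - apply (ex_RInt_along Om (strip_star _ _)); auto.
    - intros r Hr. eapply Rle_trans; [apply Hb', strip_star; auto|]. apply fam_v_shrink; auto. }
  rewrite (radius_sq u v), !Rpow_mult_distr.
  assert (B1 : mean (hcos u v) x y ^ 2 <= cosh (v x y) ^ 2).
  { apply B.
    - intros; apply smooth_continuity with Om; auto. apply (smooth_hcos _ _ _ _ SD).
    - intros t _. unfold hcos. pose proof (cosh_ge_1 (v x t)).
      rewrite Rabs_mult, Rabs_pos_eq by lra.
      assert (Rabs (cos (u x t)) <= 1) by (apply Rabs_le; pose proof (COS_bound (u x t)); lra). nra. }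
  assert (B2 : mean (hsin u v) x y ^ 2 <= cosh (v x y) ^ 2).
  { apply B.
    - intros; apply smooth_continuity with Om; auto. apply (smooth_hsin _ _ _ _ SD).
    - intros t _. unfold hsin. pose proof (cosh_ge_1 (v x t)).
      rewrite Rabs_mult, Rabs_pos_eq by lra.
      assert (Rabs (sin (u x t)) <= 1) by (apply Rabs_le; pose proof (SIN_bound (u x t)); lra). nra. }
  pose proof (pow2_ge_0 y). nra.
Qed.

Definition fam_curv x y := 2 * (pd1 u x y ^ 2 + pd2 u x y ^ 2) / cosh (v x y) ^ 4.

Lemma fam_curv_num x y : Om (x, y) ->
  0 <= pd1 u x y ^ 2 + pd2 u x y ^ 2 <= 5 * (Lc * mu n b a x ^ 4) ^ 2.
Proof.
  intros H. destruct (prim_eqs n b Hn Hb a (axis_fun a) Ha (fun x Hx => axis_fun_derive a x Ha Hx) x y H) as (E1 & E2 & _).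
  change (pd1 u x y = re_h n b a x y) in E1. change (pd2 u x y = - im_h n b a x y) in E2.
  rewrite E1, E2.
  destruct (re_h_bounds n b Hn Hb a Ha x y H) as [B1 B2].
  destruct (im_h_bounds n b Hn Hb a Ha x y H) as [_ B3].
  destruct (mu_facts n b Hn Hb a Ha x (proj1 H)) as (M1 & _ & _).
  pose proof Lc_pos. assert (0 < mu n b a x ^ 4) by (apply pow_lt; auto).
  set (k := Lc * mu n b a x ^ 4) in *. assert (0 < k) by (unfold k; nra).
  assert (A1 : re_h n b a x y ^ 2 <= (2 * k) ^ 2) by (apply pow_incr; split; [nra|unfold k; lra]).
  assert (A2 : (- im_h n b a x y) ^ 2 <= k ^ 2).
  { rewrite <- (pow2_abs (- im_h n b a x y)), Rabs_Ropp. apply pow_incr. split; [apply Rabs_pos|auto]. }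
  pose proof (pow2_ge_0 (re_h n b a x y)). pose proof (pow2_ge_0 (- im_h n b a x y)). lra.
Qed.

(** Points of the surface at distance [d] from the axis: there [cosh v] is at
    least of order [d / eta], which beats the factor [|h'|^2 <= C mu^8]. *)
Lemma fam_curv_off_axis x y d : Om (x, y) -> 0 < d -> d <= Rabs (radius u v x y) ->
  fam_curv x y <= 640 * Lc ^ 2 / (8 * ell) ^ 4 / d ^ 4.
Proof.
  intros H Hd Hr. destruct (fam_curv_num x y H) as [N0 N1].
  pose proof (radius_le_cosh x y H) as B.
  destruct (mu_facts n b Hn Hb a Ha x (proj1 H)) as (M1 & _ & M2).
  pose proof (width_eq n b Hn Hb a Ha x (proj1 H)) as We.
  pose proof (width_pos n b Hn Hb a Ha x (proj1 H)) as Wp.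
  pose proof (cosh_ge_1 (v x y)) as HC. pose proof ell_pos as He.
  assert (Hy2 : y ^ 2 <= width n b a x ^ 2).
  { rewrite <- (pow2_abs y). apply pow_incr. split; [apply Rabs_pos|]. destruct H as [_ H]. left. exact H. }
  unfold fam_curv. set (C := cosh (v x y)) in *. set (m := mu n b a x) in *.
  set (w := width n b a x) in *. set (num := pd1 u x y ^ 2 + pd2 u x y ^ 2) in *.
  assert (D : d ^ 2 <= 2 * w ^ 2 * C ^ 2).
  { assert (d ^ 2 <= radius u v x y ^ 2).
    { rewrite <- (pow2_abs (radius u v x y)). apply pow_incr. lra. }
    pose proof (pow2_ge_0 C). nra. }
  assert (D2 : d ^ 4 <= 4 * w ^ 4 * C ^ 4).
  { replace (d ^ 4) with ((d ^ 2) ^ 2) by ring. replace (4 * w ^ 4 * C ^ 4) with ((2 * w ^ 2 * C ^ 2) ^ 2) by ring.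
    apply pow_incr. split; [apply pow2_ge_0|auto]. }
  assert (HC4 : 0 < C ^ 4) by (apply pow_lt; lra).
  assert (Hd4 : 0 < d ^ 4) by (apply pow_lt; lra).
  assert (HP : 0 < (8 * ell) ^ 4) by (apply pow_lt; lra).
  apply Rle_trans with (10 * (Lc * m ^ 4) ^ 2 / C ^ 4).
  { unfold Rdiv. apply Rmult_le_compat_r; [left; apply Rinv_0_lt_compat; auto|lra]. }
  (* [m ^ 4 >= 1 / 16] absorbs the remaining power of [m] *)
  assert (Hm4 : 1 / 16 <= m ^ 4) by (replace (m ^ 4) with ((m ^ 2) ^ 2) by ring; nra).
  assert (Hm8 : m ^ 8 <= 16 * m ^ 12).
  { replace (m ^ 12) with (m ^ 4 * m ^ 8) by ring. assert (0 < m ^ 8) by (apply pow_lt; auto). nra. }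
  apply Rmult_le_reg_r with (C ^ 4 * d ^ 4 * (8 * ell) ^ 4); [apply Rmult_lt_0_compat; auto; apply Rmult_lt_0_compat; auto|].
  replace (10 * (Lc * m ^ 4) ^ 2 / C ^ 4 * (C ^ 4 * d ^ 4 * (8 * ell) ^ 4)) with
    (10 * Lc ^ 2 * (8 * ell) ^ 4 * (m ^ 8 * d ^ 4)) by (field; lra).
  replace (640 * Lc ^ 2 / (8 * ell) ^ 4 / d ^ 4 * (C ^ 4 * d ^ 4 * (8 * ell) ^ 4)) with (10 * Lc ^ 2 * (64 * C ^ 4))
    by (field; lra).
  assert (X : (8 * ell) ^ 4 * (m ^ 8 * d ^ 4) <= 64 * C ^ 4).
  { apply Rle_trans with ((8 * ell) ^ 4 * (16 * m ^ 12 * (4 * w ^ 4 * C ^ 4))).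
    - apply Rmult_le_compat_l; [lra|].
      apply Rmult_le_compat; [left; apply pow_lt; auto|lra|auto|auto].
    - right. replace ((8 * ell) ^ 4 * (16 * m ^ 12 * (4 * w ^ 4 * C ^ 4))) with (64 * C ^ 4 * (8 * ell * (w * m ^ 3)) ^ 4) by ring.
      rewrite We. replace (8 * ell * / (8 * ell)) with 1 by (field; lra). ring. }
  rewrite (Rmult_assoc (10 * Lc ^ 2)).
  apply Rmult_le_compat_l; [|exact X]. pose proof (pow2_ge_0 Lc). lra.
Qed.

(** Away from the heights of the poles [h'] is bounded. *)
Lemma fam_curv_off_heights x y d : Om (x, y) -> 0 < d ->
  (forall j, (1 <= j <= n)%nat -> d <= Rabs (x - b j)) ->
  fam_curv x y <= 10 * (Lc * (INR n * / d ^ 2)) ^ 2.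
Proof.
  intros H Hd Hx. destruct (fam_curv_num x y H) as [N0 N1].
  pose proof (cosh_ge_1 (v x y)) as HC.
  destruct (mu_facts n b Hn Hb a Ha x (proj1 H)) as (M1 & M2 & _). pose proof Lc_pos.
  assert (S : mu n b a x ^ 4 <= INR n * / d ^ 2).
  { rewrite M2. unfold speed. apply Rle_trans with (sumj n (fun _ => / d ^ 2)).
    - apply sumj_le. intros j Hj. apply Rinv_le_contravar; [apply pow_lt; auto|].
      unfold pole_sq. rewrite <- (pow2_abs (x - b j)).
      assert (d ^ 2 <= Rabs (x - b j) ^ 2) by (apply pow_incr; split; [lra|apply Hx, Hj]).
      pose proof (pow2_ge_0 a). lra.
    - right. apply sumj_const. }
  assert (0 < mu n b a x ^ 4) by (apply pow_lt; auto).
  assert (S2 : (Lc * mu n b a x ^ 4) ^ 2 <= (Lc * (INR n * / d ^ 2)) ^ 2) by (apply pow_incr; split; nra).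
  unfold fam_curv. assert (1 <= cosh (v x y) ^ 4) by (apply pow_R1_Rle; auto).
  apply Rle_trans with (2 * (pd1 u x y ^ 2 + pd2 u x y ^ 2)); [|lra].
  apply Rle_div_l; [lra|]. nra.
Qed.

Lemma fam_curv_pole j : 0 < a -> (1 <= j <= n)%nat -> 2 * (Lc * / a ^ 2) ^ 2 <= fam_curv (b j) 0.
Proof.
  intros Hap Hj.
  assert (HI : fam_I a (b j)).
  { split.
    - pose proof (Rabs_def2 _ _ (Hb j Hj)). unfold between. lra.
    - intros i Hi. unfold pole_sq. pose proof (pow2_ge_0 (b j - b i)). assert (0 < a ^ 2) by (apply pow_lt; auto). lra. }
  assert (H : Om (b j, 0)) by (apply (strip_axis _ _ _ _ SD), HI).
  destruct (prim_eqs n b Hn Hb a (axis_fun a) Ha (fun x Hx => axis_fun_derive a x Ha Hx) _ _ H) as (E1 & E2 & _).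
  change (pd1 u (b j) 0 = re_h n b a (b j) 0) in E1. change (pd2 u (b j) 0 = - im_h n b a (b j) 0) in E2.
  unfold fam_curv. rewrite E1, E2, im_h_axis.
  rewrite (re_h_axis n b a) by exact HI.
  unfold v. rewrite (sd_v0 _ _ _ _ SD), cosh_0.
  assert (S : / a ^ 2 <= speed n b a (b j)).
  { replace (/ a ^ 2) with (/ pole_sq b a (b j) j) by (unfold pole_sq; f_equal; ring).
    apply (sumj_ge_term n (fun i => / pole_sq b a (b j) i)); auto.
    intros i Hi. left. apply Rinv_0_lt_compat, HI, Hi. }
  pose proof Lc_pos. assert (0 < / a ^ 2) by (apply Rinv_0_lt_compat, pow_lt; auto).
  assert ((Lc * / a ^ 2) ^ 2 <= (Lc * speed n b a (b j)) ^ 2) by (apply pow_incr; split; nra).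
  replace (2 * _ / 1 ^ 4) with (2 * (Lc * speed n b a (b j)) ^ 2) by field. lra.
Qed.

End Bounds.
End Data.

(** * Convergence of the family *)

Lemma lim_gt {T} (F : (T -> Prop) -> Prop) {FF : Filter F} (f : T -> R) l c :
  filterlim f F (locally l) -> c < l -> F (fun z => c < f z).
Proof.
  intros H Hc. assert (A := proj1 (filterlim_R F _ _) H (l - c) ltac:(lra)).
  revert A. apply filter_imp. intros z Hz. apply Rabs_def2 in Hz. lra.
Qed.

Lemma lim_lt {T} (F : (T -> Prop) -> Prop) {FF : Filter F} (f : T -> R) l c :
  filterlim f F (locally l) -> l < c -> F (fun z => f z < c).
Proof.
  intros H Hc. assert (A := proj1 (filterlim_R F _ _) H (c - l) ltac:(lra)).
  revert A. apply filter_imp. intros z Hz. apply Rabs_def2 in Hz. lra.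
Qed.

Lemma lim_neq {T} (F : (T -> Prop) -> Prop) {FF : Filter F} (f : T -> R) l c :
  filterlim f F (locally l) -> l <> c -> F (fun z => f z <> c).
Proof.
  intros H Hc. assert (0 < Rabs (l - c)) by (apply Rabs_pos_lt; lra).
  assert (A := proj1 (filterlim_R F _ _) H (Rabs (l - c)) ltac:(lra)).
  revert A. apply filter_imp. intros z Hz E. rewrite E, Rabs_minus_sym in Hz. lra.
Qed.

Section Convergence.
Variables (n : nat) (b : nat -> R).
Hypotheses (Hn : (1 <= n)%nat) (Hb : forall j, (1 <= j <= n)%nat -> Rabs (b j) < 1).

Let Om a := strip (fam_I n b a) (fam_eta n b a).
Let u := fam_u n b.
Let v := fam_v n b.
Let SD a (Ha : adm a) := fam_data n b Hn Hb a (adm_bounds a Ha).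

Lemma adm_0 : adm 0.
Proof. left; auto. Qed.

Lemma fam_I_0 s : fam_I n b 0 s <-> -2 < s < 2 /\ off_heights n b s.
Proof.
  unfold fam_I, heights, between, off_heights, pole_sq. split; intros [H1 H2]; split; auto; intros j Hj.
  - intros ->. specialize (H2 j Hj). lra.
  - specialize (H2 j Hj). assert (s - b j <> 0) by lra. pose proof (Rsqr_pos_lt _ H). unfold Rsqr in *. lra.
Qed.

(** The parameter [av] tends to 0 while the point [(X, Y)] tends to a point of
    the domain of the limit; [F] is arbitrary, to cover sequences of parameters,
    neighbourhoods of points, and products of both. *)
Definition conv_heights {T} (F : (T -> Prop) -> Prop) (av X : T -> R) (s : R) : Prop :=
  F (fun z => adm (av z)) /\ filterlim av F (locally 0) /\
  filterlim X F (locally s) /\ fam_I n b 0 s.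

Definition conv {T} (F : (T -> Prop) -> Prop) (av X Y : T -> R) (s y : R) : Prop :=
  conv_heights F av X s /\ filterlim Y F (locally y) /\ Om 0 (s, y).

(** Convergence at moving points.  It is stable under algebraic operations and,
    unlike pointwise convergence, under integration along the slices and
    substitution; it implies uniform convergence on compact sets. *)
Definition tame (f : R -> R -> R -> R) : Prop :=
  forall (T : Type) (F : (T -> Prop) -> Prop) (FF : Filter F) (av X Y : T -> R) s y,
    conv F av X Y s y ->
    filterlim (fun z => f (av z) (X z) (Y z)) F (locally (f 0 s y)).

Lemma conv_shrink {T} (F : (T -> Prop) -> Prop) {FF : Filter F} av X Y s y r :
  conv F av X Y s y -> 0 <= r <= 1 ->
  conv (filter_prod F (locally r)) (fun z => av (fst z)) (fun z => X (fst z))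
    (fun z => Y (fst z) * snd z) s (y * r).
Proof.
  intros ((H1 & H2 & H3 & H4) & H5 & H6) Hr.
  assert (L : filterlim fst (filter_prod F (locally r)) F) by (apply filterlim_fst).
  refine (conj (conj _ (conj _ (conj _ H4))) (conj _ _)).
  - apply (L _ H1).
  - eapply filterlim_comp; [exact L|exact H2].
  - eapply filterlim_comp; [exact L|exact H3].
  - apply (lim_mult (F := filter_prod F (locally r))).
    + eapply filterlim_comp; [exact L|exact H5].
    + apply filterlim_snd.
  - apply (strip_star _ _ s y r H6 Hr).
Qed.

Lemma conv_heights_point s : fam_I n b 0 s ->
  forall T (F : (T -> Prop) -> Prop) (FF : Filter F), conv_heights F (fun _ => 0) (fun _ => s) s.
Proof.
  intros H T F FF. refine (conj _ (conj _ (conj _ H))).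
  - apply filter_forall. intros z; apply adm_0.
  - apply lim_const.
  - apply lim_const.
Qed.

Section Along.
Context {T : Type} (F : (T -> Prop) -> Prop) {FF : Filter F} (av X : T -> R) (s : R).
Hypothesis HC : conv_heights F av X s.

Lemma conv_pole_sq j : filterlim (fun z => pole_sq b (av z) (X z) j) F (locally (pole_sq b 0 s j)).
Proof.
  destruct HC as (_ & H2 & H3 & _). unfold pole_sq.
  apply lim_plus; apply lim_pow; auto. apply lim_minus; auto. apply lim_const.
Qed.

Lemma conv_in_heights :
  F (fun z => adm (av z) /\ fam_I n b (av z) (X z) /\ off_heights n b (X z)).
Proof.
  destruct HC as (H1 & H2 & H3 & H4). apply filter_and; auto. apply filter_and.
  - unfold fam_I, heights, between. apply filter_and.
    + apply filter_and; [apply (lim_gt F X s)|apply (lim_lt F X s)]; auto; apply H4.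
    + apply (filter_forall_upto F n). intros j Hj. apply (lim_gt F _ _ _ (conv_pole_sq j)). apply H4, Hj.
  - apply (filter_forall_upto F n). intros j Hj. apply (lim_neq F X s); auto.
    apply fam_I_0 in H4. apply H4, Hj.
Qed.

Lemma conv_speed : filterlim (fun z => speed n b (av z) (X z)) F (locally (speed n b 0 s)).
Proof.
  apply sumj_lim; auto. intros j Hj. apply lim_inv; [|apply conv_pole_sq].
  destruct HC as (_ & _ & _ & H4). apply Rgt_not_eq, H4, Hj.
Qed.

Lemma conv_width : filterlim (fun z => fam_eta n b (av z) (X z)) F (locally (fam_eta n b 0 s)).
Proof.
  assert (H4 : fam_I n b 0 s) by apply HC.
  destruct (mu_facts n b Hn Hb 0 ltac:(lra) s H4) as (M1 & _ & _).
  pose proof (speed_ge n b Hn Hb 0 ltac:(lra) s H4) as Hm. pose proof ell_pos.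
  unfold fam_eta, width. apply lim_inv.
  - apply Rgt_not_eq. apply Rmult_lt_0_compat; [lra|]. apply pow_lt, M1.
  - apply lim_mult; [apply lim_const|]. apply lim_pow. unfold mu.
    apply (lim_comp1 sqrt). { apply continuity_pt_sqrt. apply sqrt_pos. }
    apply (lim_comp1 sqrt). { apply continuity_pt_sqrt. lra. }
    apply conv_speed.
Qed.

Lemma conv_axis_cont : filterlim (fun z => axis_cont n b (av z) (X z)) F (locally (axis_cont n b 0 s)).
Proof.
  destruct HC as (H1 & H2 & H3 & H4). apply fam_I_0 in H4. destruct H4 as [_ H4].
  apply lim_mult; [apply lim_const|]. apply sumj_lim; auto. intros j Hj.
  assert (Hs : s - b j <> 0) by (specialize (H4 j Hj); lra).
  assert (LX : filterlim (fun z => X z - b j) F (locally (s - b j))) by (apply lim_minus; auto; apply lim_const).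
  apply lim_div; auto. apply lim_opp.
  replace (atan_quot (0 / (s - b j))) with 1.
  - apply lim_atan_quot; auto. replace 0 with (0 / (s - b j)) by (field; auto). apply lim_div; auto.
  - unfold atan_quot. destruct (Req_EM_T (0 / (s - b j)) 0) as [_|N]; auto.
    exfalso; apply N. field; auto.
Qed.

Lemma conv_in_strip Y y : filterlim Y F (locally y) -> Om 0 (s, y) ->
  F (fun z => Om (av z) (X z, Y z)).
Proof.
  intros HY [_ Hy]. simpl in Hy.
  assert (L : filterlim (fun z => fam_eta n b (av z) (X z) - Rabs (Y z)) F (locally (fam_eta n b 0 s - Rabs y))).
  { apply lim_minus; [apply conv_width|]. apply (lim_comp1 Rabs); auto. apply Rcontinuity_abs. }
  generalize (filter_and _ _ conv_in_heights (lim_gt F _ _ 0 L ltac:(lra))).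
  apply filter_imp. intros z [(Z1 & Z2 & _) Z3]. split; auto. simpl. lra.
Qed.

End Along.

Ltac tame_intro := intros T F FF av X Y s y HC; pose proof HC as ((Had & Hav & HX & HI) & HY & HOm).

Lemma tame_y : tame (fun _ _ y => y).
Proof. tame_intro. exact HY. Qed.

Lemma tame_const c : tame (fun _ _ _ => c).
Proof. tame_intro. apply lim_const. Qed.

Lemma tame_plus f g : tame f -> tame g -> tame (fun a x y => f a x y + g a x y).
Proof. intros Hf Hg. tame_intro. apply lim_plus; [apply Hf|apply Hg]; auto. Qed.

Lemma tame_minus f g : tame f -> tame g -> tame (fun a x y => f a x y - g a x y).
Proof. intros Hf Hg. tame_intro. apply lim_minus; [apply Hf|apply Hg]; auto. Qed.

Lemma tame_mult f g : tame f -> tame g -> tame (fun a x y => f a x y * g a x y).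
Proof. intros Hf Hg. tame_intro. apply lim_mult; [apply Hf|apply Hg]; auto. Qed.

Lemma tame_comp phi f : (forall x, continuity_pt phi x) -> tame f -> tame (fun a x y => phi (f a x y)).
Proof. intros Hp Hf. tame_intro. apply (lim_comp1 phi); auto. Qed.

Lemma tame_re_h : tame (fun a => re_h n b a).
Proof.
  tame_intro. apply lim_mult; [apply lim_const|]. apply sumj_lim; auto. intros j Hj.
  assert (LX : filterlim (fun z => X z - b j) F (locally (s - b j))) by (apply lim_minus; auto; apply lim_const).
  apply lim_div.
  - apply Rgt_not_eq. apply (Om_den n b Hn Hb 0 ltac:(lra) s y j); auto.
  - apply lim_plus; [apply lim_minus|]; apply lim_pow; auto.
  - apply lim_plus.
    + apply lim_pow. apply lim_plus; [apply lim_minus|]; apply lim_pow; auto.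
    + apply lim_mult; [apply lim_mult; [apply lim_const|]|]; apply lim_pow; auto.
Qed.

Lemma tame_im_h : tame (fun a => im_h n b a).
Proof.
  tame_intro. apply lim_mult; [apply lim_const|]. apply sumj_lim; auto. intros j Hj.
  assert (LX : filterlim (fun z => X z - b j) F (locally (s - b j))) by (apply lim_minus; auto; apply lim_const).
  apply lim_div.
  - apply Rgt_not_eq. apply (Om_den n b Hn Hb 0 ltac:(lra) s y j); auto.
  - apply lim_opp. apply lim_mult; auto. apply lim_mult; auto. apply lim_const.
  - apply lim_plus.
    + apply lim_pow. apply lim_plus; [apply lim_minus|]; apply lim_pow; auto.
    + apply lim_mult; [apply lim_mult; [apply lim_const|]|]; apply lim_pow; auto.
Qed.

Lemma tame_mean f : tame f ->
  (forall a x y, adm a -> Om a (x, y) -> ex_RInt (fun r => f a x (y * r)) 0 1) ->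
  tame (fun a => mean (f a)).
Proof.
  intros Hf Hi. tame_intro.
  apply (filterlim_RInt_01 F (fun z r => f (av z) (X z) (Y z * r)) (fun r => f 0 s (y * r))).
  - generalize (filter_and _ _ Had (conv_in_strip F av X s (proj1 HC) Y y HY HOm)).
    apply filter_imp. intros z [Z1 Z2]. apply Hi; auto.
  - intros r Hr.
    apply (Hf R (locally r) _ (fun _ => 0) (fun _ => s) (fun r => y * r) s (y * r)).
    split; [apply conv_heights_point; auto; apply locally_filter|]. split.
    + apply (lim_mult (F := locally r)); [apply lim_const|apply filterlim_id].
    + apply strip_star; auto.
  - intros r Hr. apply (Hf (T * R)%type (filter_prod F (locally r)) _ _ _ _ s (y * r)).
    apply (conv_shrink F); auto.
Qed.

Lemma tame_v : tame (fun a => v a).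
Proof.
  apply (tame_mult (fun _ _ y => y) (fun a => mean (re_h n b a))); [apply tame_y|].
  apply tame_mean; [apply tame_re_h|]. intros a x y Ha H.
  exact (proj1 (h_along n b Hn Hb a (adm_bounds a Ha) x y H)).
Qed.

Definition u_cont a x y := axis_cont n b a x - y * mean (im_h n b a) x y.

Lemma tame_u_cont : tame u_cont.
Proof.
  apply tame_minus.
  - tame_intro. apply (conv_axis_cont F av X s (proj1 HC)).
  - apply (tame_mult (fun _ _ y => y) (fun a => mean (im_h n b a))); [apply tame_y|].
    apply tame_mean; [apply tame_im_h|]. intros a x y Ha H.
    exact (proj2 (h_along n b Hn Hb a (adm_bounds a Ha) x y H)).
Qed.

(** This is where the admissible parameters enter: [u] itself has no limit. *)
Lemma u_trig a x y c : adm a -> off_heights n b x ->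
  cos (u a x y - c) = cos (u_cont a x y - c) /\ sin (u a x y - c) = sin (u_cont a x y - c).
Proof.
  intros Ha Hx. destruct (axis_fun_mod n b a x Ha Hx) as [m E].
  replace (u a x y - c) with (u_cont a x y - c + 2 * PI * IZR m).
  - apply trig_period_Z.
  - unfold u, fam_u, prim_u, u_cont. rewrite E. ring.
Qed.

Lemma tame_trig c : tame (fun a x y => cos (u a x y - c)) /\ tame (fun a x y => sin (u a x y - c)).
Proof.
  assert (K : tame (fun a x y => u_cont a x y - c)) by (apply tame_minus; [apply tame_u_cont|apply tame_const]).
  split; tame_intro.
  - rewrite (proj1 (u_trig 0 s y c adm_0 (proj2 (proj1 (fam_I_0 s) HI)))).
    apply (filterlim_ext_loc (fun z => cos (u_cont (av z) (X z) (Y z) - c))).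
    + generalize (conv_in_heights F av X s (proj1 HC)). apply filter_imp.
      intros z (Z1 & Z2 & Z3). symmetry. apply u_trig; auto.
    + apply (tame_comp cos _ continuity_cos K _ _ _ _ _ _ _ _ HC).
  - rewrite (proj2 (u_trig 0 s y c adm_0 (proj2 (proj1 (fam_I_0 s) HI)))).
    apply (filterlim_ext_loc (fun z => sin (u_cont (av z) (X z) (Y z) - c))).
    + generalize (conv_in_heights F av X s (proj1 HC)). apply filter_imp.
      intros z (Z1 & Z2 & Z3). symmetry. apply u_trig; auto.
    + apply (tame_comp sin _ continuity_sin K _ _ _ _ _ _ _ _ HC).
Qed.

Lemma continuity_cosh x : continuity_pt cosh x.
Proof. apply derivable_continuous_pt. exists (sinh x). apply derivable_pt_lim_cosh. Qed.

Lemma continuity_sinh x : continuity_pt sinh x.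
Proof. apply derivable_continuous_pt. exists (cosh x). apply derivable_pt_lim_sinh. Qed.

Lemma tame_hcos_hsin : tame (fun a => hcos (u a) (v a)) /\ tame (fun a => hsin (u a) (v a)).
Proof.
  destruct (tame_trig 0) as [T1 T2]. pose proof (tame_comp cosh _ continuity_cosh tame_v) as T3.
  split.
  - pose proof (tame_mult _ _ T3 T1) as M. intros T F FF av X Y s y HC. specialize (M T F FF av X Y s y HC).
    cbv beta in M. rewrite Rminus_0_r in M. revert M. apply filterlim_ext.
    intros z. rewrite Rminus_0_r. reflexivity.
  - pose proof (tame_mult _ _ T3 T2) as M. intros T F FF av X Y s y HC. specialize (M T F FF av X Y s y HC).
    cbv beta in M. rewrite Rminus_0_r in M. revert M. apply filterlim_ext.
    intros z. rewrite Rminus_0_r. reflexivity.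
Qed.

Lemma tame_mean_h : tame (fun a => mean (hcos (u a) (v a))) /\ tame (fun a => mean (hsin (u a) (v a))).
Proof.
  destruct tame_hcos_hsin as [T1 T2].
  split; apply tame_mean; auto; intros a x y Ha H;
    apply (ex_RInt_along (Om a) (strip_star _ _)); auto;
    intros s t Hst; apply smooth_continuity with (Om a); auto.
  - apply (smooth_hcos _ _ _ _ (SD a Ha)).
  - apply (smooth_hsin _ _ _ _ (SD a Ha)).
Qed.

Lemma tame_weier : tame (fun a x y => x1 (weier (u a) (v a) x y)) /\
  tame (fun a x y => x2 (weier (u a) (v a) x y)).
Proof.
  destruct tame_mean_h as [T1 T2]. split.
  - apply (tame_mult (fun _ _ y => y) (fun a => mean (hcos (u a) (v a)))); auto. apply tame_y.
  - apply (tame_mult (fun _ _ y => y) (fun a => mean (hsin (u a) (v a)))); auto. apply tame_y.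
Qed.

Lemma tame_radius : tame (fun a => radius (u a) (v a)).
Proof.
  destruct tame_mean_h as [T1 T2].
  apply (tame_mult (fun _ _ y => y) (fun a x y => sqrt (mean (hcos (u a) (v a)) x y ^ 2 + mean (hsin (u a) (v a)) x y ^ 2))).
  - apply tame_y.
  - tame_intro. apply (lim_comp1 sqrt).
    + apply continuity_pt_sqrt. apply Rplus_le_le_0_compat; apply pow2_ge_0.
    + apply lim_plus; apply lim_pow; [apply T1|apply T2]; auto.
Qed.

Definition fam_root a := root_radius (fam_eta n b a) (u a) (v a).
Definition fam_patch a := polar_patch (fam_eta n b a) (u a) (v a).

Lemma conv_root {T} (F : (T -> Prop) -> Prop) {FF : Filter F} av X tau s t :
  conv_heights F av X s -> filterlim tau F (locally t) -> Rabs t < 2 ->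
  filterlim (fun z => fam_root (av z) (X z) (tau z)) F (locally (fam_root 0 s t)) /\
  Om 0 (s, fam_root 0 s t).
Proof.
  intros HC Ht Ht2. assert (HI : fam_I n b 0 s) by apply HC.
  assert (PD : polar_dom (fam_I n b 0) (s, t)) by (split; auto).
  destruct (root_radius_spec _ _ _ _ (SD 0 adm_0) s t PD) as [D1 D2].
  split; [|exact D1].
  destruct (open_locally_2d _ _ _ (sd_open _ _ _ _ (SD 0 adm_0)) D1) as [e He].
  assert (K : forall y, Rabs (y - fam_root 0 s t) < e -> Om 0 (s, y)).
  { intros y Hy. apply He; auto. rewrite Rminus_diag, Rabs_R0. apply cond_pos. }
  apply (lim_root F (fun z y => Om (av z) (X z, y)) (fun z y => radius (u (av z)) (v (av z)) (X z) y)
    (radius (u 0) (v 0) s) _ tau (fam_root 0 s t) e (cond_pos e)).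
  - assert (A1 : F (fun z => Rabs (tau z) < 2)).
    { apply (lim_lt F (fun z => Rabs (tau z)) (Rabs t)); auto. apply (lim_comp1 Rabs); auto. apply Rcontinuity_abs. }
    generalize (filter_and _ _ (conv_in_heights F av X s HC) A1). apply filter_imp.
    intros z [(Z1 & Z2 & Z3) Z4].
    assert (PDz : polar_dom (fam_I n b (av z)) (X z, tau z)) by (split; auto).
    destruct (root_radius_spec _ _ _ _ (SD _ Z1) _ _ PDz) as [E1 E2].
    split; [exact E1|split; [exact E2|]].
    intros y y' Hy Hy' L. apply (radius_increasing _ _ _ _ (SD _ Z1)); auto.
  - intros y Hy. split.
    + apply (conv_in_strip F av X s HC (fun _ => y) y); auto. apply lim_const.
    + apply (tame_radius T F FF av X (fun _ => y) s y). split; auto. split; auto. apply lim_const.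
  - intros y y' Hy Hy' L. apply (radius_increasing _ _ _ _ (SD 0 adm_0)); auto; apply K; auto.
  - change (radius (u 0) (v 0) s (fam_root 0 s t) = t) in D2. rewrite D2. exact Ht.
Qed.

Lemma conv_patch {T} (F : (T -> Prop) -> Prop) {FF : Filter F} av X tau s t :
  conv_heights F av X s -> filterlim tau F (locally t) -> Rabs t < 2 ->
  filterlim (fun z => x1 (fam_patch (av z) (X z) (tau z))) F (locally (x1 (fam_patch 0 s t))) /\
  filterlim (fun z => x2 (fam_patch (av z) (X z) (tau z))) F (locally (x2 (fam_patch 0 s t))).
Proof.
  intros HC Ht Ht2. destruct (conv_root F av X tau s t HC Ht Ht2) as [R1 R2].
  destruct tame_weier as [T1 T2].
  split; [apply (T1 T F FF av X (fun z => fam_root (av z) (X z) (tau z)) s (fam_root 0 s t))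
    |apply (T2 T F FF av X (fun z => fam_root (av z) (X z) (tau z)) s (fam_root 0 s t))]; split; auto.
Qed.

End Convergence.

(** * Local graphs *)

(** The admissible parameters tend to 0, the value 0 included: what holds
    eventually for the surfaces then holds for their limit as well. *)
Definition At0 : (R -> Prop) -> Prop := within adm (locally 0).

Instance At0_filter : Filter At0.
Proof. apply within_filter, locally_filter. Qed.

Lemma At0_0 (P : R -> Prop) : At0 P -> P 0.
Proof. intros H. apply (locally_singleton 0 _ H). left; auto. Qed.

Lemma At0_lim {T} (F : (T -> Prop) -> Prop) {FF : Filter F} av P :
  F (fun z => adm (av z)) -> filterlim av F (locally 0) -> At0 P -> F (fun z => P (av z)).
Proof.
  intros H1 H2 H3. pose proof (H2 (fun a => adm a -> P a) H3) as H4. unfold filtermap in H4.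
  generalize (filter_and _ _ H1 H4).
  apply filter_imp. intros z [Z1 Z2]. apply Z2, Z1.
Qed.

Lemma At0_adm : At0 adm.
Proof. unfold At0, within. apply filter_forall. auto. Qed.

Lemma lim_At0 : filterlim (fun a => a) At0 (locally 0).
Proof. intros P HP. unfold filtermap, At0, within. revert HP. apply filter_imp; auto. Qed.

Lemma At0_to_0 {T} (F : (T -> Prop) -> Prop) (f : T -> R) :
  filterlim f F At0 -> filterlim f F (locally 0).
Proof. intros H. exact (filterlim_comp _ _ _ f (fun a => a) F At0 (locally 0) H lim_At0). Qed.

Section Sheets.
Variables (n : nat) (b : nat -> R).
Hypotheses (Hn : (1 <= n)%nat) (Hb : forall j, (1 <= j <= n)%nat -> Rabs (b j) < 1).

Let Om a := strip (fam_I n b a) (fam_eta n b a).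
Let u := fam_u n b.
Let v := fam_v n b.
Let SD a (Ha : adm a) := fam_data n b Hn Hb a (adm_bounds a Ha).

(** The surface for the parameter [a], without the planes through the poles. *)
Definition sheet (a : R) (p : R3) : Prop :=
  exists s y, Om a (s, y) /\ off_heights n b s /\ weier (u a) (v a) s y = p.

Lemma conv_heights_prod {T} (G : (T -> Prop) -> Prop) {GG : Filter G} (X : T -> R) s :
  filterlim X G (locally s) -> fam_I n b 0 s ->
  conv_heights n b (filter_prod At0 G) fst (fun z => X (snd z)) s.
Proof.
  intros HX HI. refine (conj _ (conj _ (conj _ HI))).
  - apply (filterlim_fst (F := At0) (G := G) adm). apply At0_adm.
  - apply (filterlim_comp _ _ _ fst (fun a => a) _ At0 (locally 0)); [apply filterlim_fst|apply lim_At0].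
  - apply (filterlim_comp _ _ _ snd X _ G (locally s)); [apply filterlim_snd|exact HX].
Qed.

Lemma heights_in_ball p : norm p < 1 -> off_heights n b (x3 p) -> fam_I n b 0 (x3 p).
Proof.
  intros Hp Ho. apply fam_I_0. split; auto. rewrite norm_R3 in Hp.
  assert (x1 p ^ 2 + x2 p ^ 2 + x3 p ^ 2 < 1).
  { apply Rnot_le_lt. intros N. apply sqrt_le_1_alt in N. rewrite sqrt_1 in N. lra. }
  pose proof (pow2_ge_0 (x1 p)). pose proof (pow2_ge_0 (x2 p)). nra.
Qed.

Lemma dist_axis_lt p : norm p < 1 -> sqrt (x1 p ^ 2 + x2 p ^ 2) < 1.
Proof.
  intros Hp. rewrite norm_R3 in Hp. eapply Rle_lt_trans; [|exact Hp].
  apply sqrt_le_1_alt. pose proof (pow2_ge_0 (x3 p)). lra.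
Qed.

Lemma sheet_patch a p : adm a -> norm p < 1 -> sheet a p ->
  exists t, Rabs t < 1 /\ (t = sqrt (x1 p ^ 2 + x2 p ^ 2) \/ t = - sqrt (x1 p ^ 2 + x2 p ^ 2)) /\
    fam_patch n b a (x3 p) t = p.
Proof.
  intros Ha Hp (s & y & H & Ho & E). set (t := radius (u a) (v a) s y).
  assert (Es : x3 p = s) by (rewrite <- E; reflexivity).
  assert (Et : t ^ 2 = x1 p ^ 2 + x2 p ^ 2) by (unfold t; rewrite (radius_sq (u a) (v a)), <- E; reflexivity).
  assert (Ht : Rabs t = sqrt (x1 p ^ 2 + x2 p ^ 2)) by (rewrite <- Et, <- (pow2_abs t), sqrt_pow2; auto; apply Rabs_pos).
  assert (Ht1 : Rabs t < 1) by (rewrite Ht; apply dist_axis_lt; auto).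
  exists t. split; auto. split.
  - rewrite <- Ht. unfold Rabs. destruct (Rcase_abs t); [right|left]; lra.
  - rewrite Es, <- E. apply (polar_patch_radius _ _ _ _ (SD a Ha)); auto. change (Rabs t < 2). lra.
Qed.

Lemma x_continuous (p : R3) : filterlim x1 (locally p) (locally (x1 p)) /\
  filterlim x2 (locally p) (locally (x2 p)) /\ filterlim x3 (locally p) (locally (x3 p)).
Proof.
  destruct p as [[p1 p2] p3].
  assert (L : filterlim (fst : R3 -> R2) (locally (p1, p2, p3)) (locally (p1, p2)))
    by (apply (continuous_fst (U := prod_UniformSpace R_UniformSpace R_UniformSpace) (V := R_UniformSpace))).
  repeat split.
  - apply (filterlim_comp _ _ _ (fst : R3 -> R2) fst _ (locally (p1, p2))); auto. apply lim_fst.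
  - apply (filterlim_comp _ _ _ (fst : R3 -> R2) snd _ (locally (p1, p2))); auto. apply lim_snd.
  - apply (continuous_snd (U := prod_UniformSpace R_UniformSpace R_UniformSpace) (V := R_UniformSpace)).
Qed.

(** Away from the limit surface there are no points of nearby surfaces: the two
    candidates at a given height and distance from the axis converge. *)
Lemma empty_near p : norm p < 1 -> off_heights n b (x3 p) -> ~ sheet 0 p ->
  exists U : R3 -> Prop, open U /\ U p /\
    At0 (fun a => forall q, U q -> norm q < 1 -> ~ sheet a q).
Proof.
  intros Hp Ho Hs. pose proof (heights_in_ball p Hp Ho) as HI.
  destruct (x_continuous p) as (L1 & L2 & L3).
  set (r := fun q => sqrt (x1 q ^ 2 + x2 q ^ 2)).
  assert (Lr : filterlim r (locally p) (locally (r p))).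
  { apply (lim_comp1 (F := locally p) sqrt).
    - apply continuity_pt_sqrt. apply Rplus_le_le_0_compat; apply pow2_ge_0.
    - apply (lim_plus (F := locally p)); apply (lim_pow (F := locally p)); auto. }
  set (F := filter_prod At0 (locally p)).
  pose proof (conv_heights_prod (locally p) x3 (x3 p) L3 HI) as HC. fold F in HC.
  assert (K : forall (sg : R), sg = 1 \/ sg = -1 ->
    F (fun z => fam_patch n b (fst z) (x3 (snd z)) (sg * r (snd z)) <> snd z)).
  { intros sg Hsg.
    assert (Lt : filterlim (fun z : R * R3 => sg * r (snd z)) F (locally (sg * r p))).
    { apply (lim_mult (F := F)); [apply lim_const|].
      apply (filterlim_comp _ _ _ snd r _ (locally p)); [apply filterlim_snd|exact Lr]. }
    assert (Hr : Rabs (sg * r p) < 2).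
    { rewrite Rabs_mult. assert (E : Rabs sg = 1) by (destruct Hsg as [->| ->]; [apply Rabs_R1|rewrite Rabs_left; lra]).
      rewrite E, Rabs_pos_eq by apply sqrt_pos. pose proof (dist_axis_lt p Hp). unfold r. lra. }
    destruct (conv_patch n b Hn Hb F _ _ _ _ _ HC Lt Hr) as [C1 C2].
    set (p' := fam_patch n b 0 (x3 p) (sg * r p)) in *.
    assert (N : x1 p' <> x1 p \/ x2 p' <> x2 p).
    { apply NNPP. intros N. apply not_or_and in N. destruct N as [N1 N2].
      apply NNPP in N1. apply NNPP in N2. apply Hs.
      assert (PD : polar_dom (fam_I n b 0) (x3 p, sg * r p)) by (split; auto).
      destruct (root_radius_spec _ _ _ _ (SD 0 adm_0) _ _ PD) as [D1 D2].
      exists (x3 p), (fam_root n b 0 (x3 p) (sg * r p)). split; [exact D1|]. split; auto.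
      change (p' = p). destruct p' as [[q1 q2] q3] eqn:Ep.
      assert (q3 = x3 p) by (change q3 with (x3 (q1, q2, q3)); rewrite <- Ep; reflexivity).
      unfold x1, x2 in N1, N2. simpl in N1, N2. subst. destruct p as [[? ?] ?]; reflexivity. }
    destruct N as [N|N].
    - assert (M := lim_neq F _ _ 0 (lim_minus (F := F) _ _ _ _ C1
        (filterlim_comp _ _ _ snd x1 F (locally p) (locally (x1 p)) filterlim_snd L1)) ltac:(lra)).
      revert M. apply filter_imp. intros z Hz E. apply Hz. apply Rminus_diag_eq. exact (f_equal x1 E).
    - assert (M := lim_neq F _ _ 0 (lim_minus (F := F) _ _ _ _ C2
        (filterlim_comp _ _ _ snd x2 F (locally p) (locally (x2 p)) filterlim_snd L2)) ltac:(lra)).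
      revert M. apply filter_imp. intros z Hz E. apply Hz. apply Rminus_diag_eq. exact (f_equal x2 E). }
  destruct (filter_and _ _ (K 1 (or_introl eq_refl)) (K (-1) (or_intror eq_refl))) as [QA R0 HQ HR HK].
  exists (fun q => locally q R0). split; [|split].
  - intros q Hq. apply locally_locally, Hq.
  - exact HR.
  - generalize (filter_and _ _ HQ At0_adm). apply filter_imp. intros a [Ha Had] q Hq Hqn Hsq.
    destruct (HK a q Ha (locally_singleton _ _ Hq)) as [K1 K2]. simpl in K1, K2.
    destruct (sheet_patch a q Had Hqn Hsq) as (t & _ & [Et|Et] & E).
    + apply K1. rewrite Rmult_1_l. unfold r. rewrite <- Et. exact E.
    + apply K2. replace (-1 * r q) with t by (rewrite Et; unfold r; ring). exact E.
Qed.

(** ** The sheet near one of its points *)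

Section Near.
Variables s0 y0 : R.
Hypothesis H0 : Om 0 (s0, y0).
Let al := u 0 s0 0.
Let ca := cos al.
Let sa := sin al.

(** Horizontal coordinates along the tangent at the axis of the slice at height
    [s0] of the limit surface, and across it. *)
Definition along a s y := ca * x1 (weier (u a) (v a) s y) + sa * x2 (weier (u a) (v a) s y).
Definition across a s y := - sa * x1 (weier (u a) (v a) s y) + ca * x2 (weier (u a) (v a) s y).
Let tau0 := along 0 s0 y0.
Let w0 := across 0 s0 y0.

Let cu a s y := cos (u a s y - al).
Let su a s y := sin (u a s y - al).
Let ch a s y := cosh (v a s y).
Let sh a s y := sinh (v a s y).
Let re a := re_h n b a.
Let im a := im_h n b a.

Lemma tame_along : tame n b along /\ tame n b across.
Proof.
  destruct (tame_weier n b Hn Hb) as [T1 T2].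
  split; apply tame_plus; auto; apply (tame_mult n b (fun _ _ _ => _)); auto; apply tame_const.
Qed.

Lemma along_has_pds a s y : adm a -> Om a (s, y) ->
  has_pds (along a) s y (- (sh a s y * su a s y)) (ch a s y * cu a s y) /\
  has_pds (across a) s y (sh a s y * cu a s y) (ch a s y * su a s y).
Proof.
  intros Ha H. destruct (weier_has_pds _ _ _ _ (SD a Ha) s y H) as [P Q].
  assert (KC : forall c : R, has_pds (fun _ _ => c) s y 0 0) by (intros; split; apply is_derive_const_R).
  split.
  - eapply has_pds_val; [exact (has_pds_plus _ _ _ _ _ _ _ _ (has_pds_mult _ _ _ _ _ _ _ _ (KC ca) P)
      (has_pds_mult _ _ _ _ _ _ _ _ (KC sa) Q))| |];
    unfold sh, su, ch, cu, hcos, hsin, ca, sa; fold u v; rewrite ?sin_minus, ?cos_minus; ring.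
  - eapply has_pds_val; [exact (has_pds_plus _ _ _ _ _ _ _ _ (has_pds_mult _ _ _ _ _ _ _ _ (KC (- sa)) P)
      (has_pds_mult _ _ _ _ _ _ _ _ (KC ca) Q))| |];
    unfold sh, su, ch, cu, hcos, hsin, ca, sa; fold u v; rewrite ?sin_minus, ?cos_minus; ring.
Qed.

(** The direction of the limit slice at the axis is [al]; the directions at nearby
    heights are close to it at the axis, hence along the whole slice. *)
Lemma conv_direction {T} (F : (T -> Prop) -> Prop) {FF : Filter F} av X :
  conv_heights n b F av X s0 ->
  F (fun z => forall y, Om (av z) (X z, y) -> 1 / 2 <= cu (av z) (X z) y).
Proof.
  intros HC. pose proof (conv_axis_cont n b F av X s0 HC) as L.
  assert (A := proj1 (filterlim_R F _ _) L (1 / 2) ltac:(lra)).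
  generalize (filter_and _ _ (conv_in_heights n b F av X s0 HC) A).
  apply filter_imp. intros z [(Z1 & Z2 & Z3) Z4] y Hy.
  destruct (axis_fun_mod n b 0 s0 adm_0) as [m E]; [apply fam_I_0, H0|].
  assert (Eal : al = axis_cont n b 0 s0 + 2 * PI * IZR m).
  { unfold al, u, fam_u, prim_u. rewrite E. ring. }
  change (1 / 2 <= cos (fam_u n b (av z) (X z) y - al)). rewrite (proj1 (u_trig n b (av z) (X z) y al Z1 Z3)), Eal.
  replace (u_cont n b (av z) (X z) y - (axis_cont n b 0 s0 + 2 * PI * IZR m))
    with (u_cont n b (av z) (X z) y - axis_cont n b 0 s0 + 2 * PI * IZR (- m)) by (rewrite opp_IZR; ring).
  rewrite (proj1 (trig_period_Z _ (- m))). apply cos_ge_half.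
  pose proof (sd_osc _ _ _ _ (SD _ Z1) _ _ Hy) as O. unfold fam_u, prim_u in O.
  rewrite Rmult_0_l, Rminus_0_r in O. unfold u_cont.
  replace (axis_cont n b (av z) (X z) - y * mean (im_h n b (av z)) (X z) y - axis_cont n b 0 s0)
    with ((axis_cont n b (av z) (X z) - axis_cont n b 0 s0) +
          (axis_fun n b (av z) (X z) - y * mean (im_h n b (av z)) (X z) y - axis_fun n b (av z) (X z))) by ring.
  eapply Rle_trans; [apply Rabs_triang|]. lra.
Qed.

Lemma along_increasing a s y y' : adm a ->
  (forall z, Om a (s, z) -> 1 / 2 <= cu a s z) ->
  Om a (s, y) -> Om a (s, y') -> y < y' -> along a s y < along a s y'.
Proof.
  intros Ha Hcu H H' L.
  assert (K : forall z, y <= z <= y' -> Om a (s, z)).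
  { intros z Hz. split; [apply H|]. destruct H as [_ H], H' as [_ H']. simpl in *.
    apply Rabs_def2 in H. apply Rabs_def2 in H'. apply Rabs_def1; lra. }
  destruct (MVT_gen (along a s) y y' (fun z => ch a s z * cu a s z)) as (c & Hc & E).
  - intros z Hz. rewrite Rmin_left, Rmax_right in Hz by lra.
    apply (along_has_pds a s z Ha). apply K; lra.
  - intros z Hz. rewrite Rmin_left, Rmax_right in Hz by lra.
    apply derivable_continuous_pt. exists (ch a s z * cu a s z). apply is_derive_Reals.
    apply (along_has_pds a s z Ha). apply K; lra.
  - rewrite Rmin_left, Rmax_right in Hc by lra.
    pose proof (Hcu c (K c ltac:(lra))). pose proof (cosh_ge_1 (v a s c)) as HC.
    assert (0 < ch a s c * cu a s c) by (unfold ch; nra). nra.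
Qed.

(** The slice at height [s0 + t] of the sheet for [a] passes over the abscissa
    [tau0 + sg], at a parameter [y] within [e] of [y0], and all its directions
    are close to [al]. *)
Definition good (e a t sg : R) : Prop :=
  adm a /\ off_heights n b (s0 + t) /\
  (forall y, Om a (s0 + t, y) -> 1 / 2 <= cu a (s0 + t) y) /\
  Om a (s0 + t, y0 - e) /\ Om a (s0 + t, y0 + e) /\
  along a (s0 + t) (y0 - e) < tau0 + sg < along a (s0 + t) (y0 + e).

Definition sol (a t sg : R) : R :=
  epsilon (inhabits 0) (fun y => Om a (s0 + t, y) /\ along a (s0 + t) y = tau0 + sg).

Lemma sol_spec e a t sg : 0 < e -> good e a t sg ->
  Om a (s0 + t, sol a t sg) /\ along a (s0 + t) (sol a t sg) = tau0 + sg.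
Proof.
  intros He (Ha & _ & Hc & D1 & D2 & L1 & L2).
  assert (E : exists y, Om a (s0 + t, y) /\ along a (s0 + t) y = tau0 + sg).
  { assert (K : forall z, y0 - e <= z <= y0 + e -> Om a (s0 + t, z)).
    { intros z Hz. split; [apply D1|]. destruct D1 as [_ D1], D2 as [_ D2]. simpl in *.
      apply Rabs_def2 in D1. apply Rabs_def2 in D2. apply Rabs_def1; lra. }
    destruct (IVT_interv (fun y => along a (s0 + t) y - (tau0 + sg)) (y0 - e) (y0 + e)) as (y & Hy & E).
    - intros z Hz. apply continuity_pt_minus; [|apply continuity_pt_const; intros ? ?; reflexivity].
      apply derivable_continuous_pt. exists (ch a (s0 + t) z * cu a (s0 + t) z). apply is_derive_Reals.
      apply (along_has_pds a (s0 + t) z Ha). apply K; auto.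
    - lra.
    - lra.
    - lra.
    - exists y. split; [apply K; auto|lra]. }
  exact (epsilon_spec (inhabits 0) _ E).
Qed.

Lemma sol_unique e a t sg y : 0 < e -> good e a t sg -> Om a (s0 + t, y) ->
  along a (s0 + t) y = tau0 + sg -> sol a t sg = y.
Proof.
  intros He G H E. destruct (sol_spec e a t sg He G) as [S1 S2].
  destruct G as (Ha & _ & Hc & _).
  destruct (Rtotal_order (sol a t sg) y) as [L|[L|L]]; auto; exfalso.
  - pose proof (along_increasing a _ _ _ Ha Hc S1 H L). lra.
  - pose proof (along_increasing a _ _ _ Ha Hc H S1 L). lra.
Qed.

Lemma good_near : exists e, 0 < e /\ exists (P : R -> Prop) d, At0 P /\ 0 < d /\
  forall a t sg, P a -> Rabs t < d -> Rabs sg < d -> good e a t sg.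
Proof.
  destruct (open_locally_2d _ _ _ (sd_open _ _ _ _ (SD 0 adm_0)) H0) as [e1 He1].
  pose proof (cond_pos e1) as He1p. set (e := e1 / 2). assert (He : 0 < e) by (unfold e; lra).
  assert (K : forall y, Rabs (y - y0) < e1 -> Om 0 (s0, y)).
  { intros y Hy. apply He1; auto. rewrite Rminus_diag, Rabs_R0. exact He1p. }
  assert (K1 : Om 0 (s0, y0 - e)) by (apply K; unfold e; apply Rabs_def1; lra).
  assert (K2 : Om 0 (s0, y0 + e)) by (apply K; unfold e; apply Rabs_def1; lra).
  exists e. split; auto.
  set (F := filter_prod At0 (locally (0, 0))).
  assert (LX : filterlim (fun q : R2 => s0 + fst q) (locally (0, 0)) (locally (s0 + 0))).
  { apply (lim_plus (F := locally (0, 0))); [apply lim_const|apply lim_fst]. }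
  rewrite Rplus_0_r in LX.
  pose proof (conv_heights_prod (locally (0, 0)) _ s0 LX (proj1 H0)) as HC. fold F in HC.
  assert (Hc0 : forall y, Om 0 (s0, y) -> 1 / 2 <= cu 0 s0 y).
  { assert (HC0 := conv_direction At0 (fun a => a) (fun _ => s0)
      (conj At0_adm (conj lim_At0 (conj (lim_const s0) (proj1 H0))))).
    apply (At0_0 _ HC0). }
  assert (LT : filterlim (fun z : R * R2 => tau0 + snd (snd z)) F (locally (tau0 + 0))).
  { apply (lim_plus (F := F)); [apply lim_const|].
    apply (filterlim_comp _ _ _ snd snd F (locally (0, 0))); [apply filterlim_snd|apply lim_snd]. }
  rewrite Rplus_0_r in LT.
  assert (B : forall y, Om 0 (s0, y) ->
     filterlim (fun z : R * R2 => along (fst z) (s0 + fst (snd z)) y - (tau0 + snd (snd z))) F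
       (locally (along 0 s0 y - tau0))).
  { intros y Hy. apply (lim_minus (F := F)); [|exact LT].
    apply (proj1 tame_along _ F _ fst (fun z => s0 + fst (snd z)) (fun _ => y) s0 y).
    split; auto. split; auto. apply lim_const. }
  assert (B1 := lim_lt F _ _ 0 (B _ K1) ltac:(unfold tau0; pose proof (along_increasing 0 s0 _ _ adm_0 Hc0 K1 H0 ltac:(lra)); lra)).
  assert (B2 := lim_gt F _ _ 0 (B _ K2) ltac:(unfold tau0; pose proof (along_increasing 0 s0 _ _ adm_0 Hc0 H0 K2 ltac:(lra)); lra)).
  assert (B3 := conv_in_strip n b Hn Hb F _ _ _ HC (fun _ => y0 - e) (y0 - e) (lim_const _) K1).
  assert (B4 := conv_in_strip n b Hn Hb F _ _ _ HC (fun _ => y0 + e) (y0 + e) (lim_const _) K2).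
  destruct (filter_and _ _ (filter_and _ _ (conv_in_heights n b F _ _ _ HC) (conv_direction F _ _ HC))
    (filter_and _ _ (filter_and _ _ B3 B4) (filter_and _ _ B1 B2))) as [P R0 HP HR HK].
  assert (HR' : locally_2d (fun x y => R0 (x, y)) 0 0).
  { apply locally_2d_locally. revert HR. apply filter_imp. intros [? ?]; auto. }
  destruct HR' as [d Hd]. exists P, d. split; auto. split; [apply cond_pos|].
  intros a t sg Pa Ht Hsg.
  destruct (HK a (t, sg) Pa) as [[(G1 & G2 & G3) G4] [[G5 G6] [G7 G8]]].
  { apply Hd; rewrite Rminus_0_r; auto. }
  simpl in *. refine (conj G1 (conj G3 (conj G4 (conj G5 (conj G6 _))))). lra.
Qed.

Section Fixed_size.
Variables (e d : R) (P : R -> Prop).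
Hypotheses (He : 0 < e) (Hd : 0 < d) (HP : At0 P).
Hypothesis HG : forall a t sg, P a -> Rabs t < d -> Rabs sg < d -> good e a t sg.

Let D a (q : R2) : Prop := Rabs (fst q) < d /\ Om a (s0 + fst q, snd q).
Let W (q : R2) : Prop := Rabs (fst q) < d /\ Rabs (snd q) < d.

Lemma P_adm a : P a -> adm a.
Proof. intros H. apply (HG a 0 0 H); rewrite Rabs_R0; auto. Qed.

Lemma open_W : open W.
Proof.
  apply open_and_R2; [apply (open_fst (fun t => Rabs t < d))|apply (open_snd (fun t => Rabs t < d))];
    apply open_Rabs_lt.
Qed.

Lemma shift_lim {T} (F : (T -> Prop) -> Prop) {FF : Filter F} (X : T -> R) t :
  filterlim X F (locally t) -> filterlim (fun z => s0 + X z) F (locally (s0 + t)).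
Proof. intros H. apply lim_plus; auto. apply lim_const. Qed.

Lemma open_D a : P a -> open (D a).
Proof.
  intros Ha. apply open_and_R2; [apply (open_fst (fun t => Rabs t < d)), open_Rabs_lt|].
  intros [t y] H. simpl in H.
  destruct (open_locally_2d _ _ _ (sd_open _ _ _ _ (SD a (P_adm a Ha))) H) as [k Hk].
  apply (locally_2d_locally (fun t y => Om a (s0 + t, y))). exists k.
  intros t' y' Ht Hy. apply Hk; auto. replace (s0 + t' - (s0 + t)) with (t' - t) by ring. auto.
Qed.

Lemma has_pds_shift f t y l1 l2 : has_pds f (s0 + t) y l1 l2 ->
  has_pds (fun t y => f (s0 + t) y) t y l1 l2.
Proof.
  intros [H1 H2]. split; auto.
  replace l1 with (scal 1 l1) by (unfold scal; simpl; unfold mult; simpl; ring).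
  apply (is_derive_comp (K := R_AbsRing) (V := R_NormedModule) (fun x => f x y) (fun t => s0 + t)); auto.
  auto_derive; auto.
Qed.

Lemma smooth_shift a f : P a -> smooth (Om a) f -> smooth (D a) (fun t y => f (s0 + t) y).
Proof.
  intros Ha Hf. pose proof (open_D a Ha) as HO.
  apply (smooth_comp (D a) (Om a) f (fun t _ => s0 + t) (fun _ y => y)); auto.
  - apply (sd_open _ _ _ _ (SD a (P_adm a Ha))).
  - intros t y [_ H]. exact H.
  - apply smooth_plus; auto using smooth_const. apply smooth_fst; auto.
  - apply smooth_snd; auto.
Qed.

Lemma smooth_along a : P a -> smooth (Om a) (along a) /\ smooth (Om a) (across a).
Proof.
  intros Ha. destruct (smooth_weier _ _ _ _ (SD a (P_adm a Ha))) as (S1 & S2 & _).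
  pose proof (sd_open _ _ _ _ (SD a (P_adm a Ha))) as HO.
  split; apply smooth_plus; auto; apply smooth_mult; auto using smooth_const.
Qed.

Lemma cu_pos a t y : P a -> D a (t, y) -> 1 / 2 <= cu a (s0 + t) y.
Proof.
  intros Ha [Ht H]. destruct (HG a t 0 Ha Ht) as (_ & _ & G & _); [rewrite Rabs_R0; auto|].
  apply G, H.
Qed.

Lemma sol_continuity a t sg : P a -> W (t, sg) -> continuity_2d_pt (sol a) t sg.
Proof.
  intros Ha [Ht Hs]. simpl in *. apply continuity_2d_pt_filterlim.
  destruct (sol_spec e a t sg He (HG a t sg Ha Ht Hs)) as [S1 S2].
  destruct (open_locally_2d _ _ _ (open_D a Ha) (conj Ht S1 : D a (t, sol a t sg))) as [k Hk].
  assert (K : forall y, Rabs (y - sol a t sg) < k -> D a (t, y)).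
  { intros y Hy. apply Hk; auto. rewrite Rminus_diag, Rabs_R0. apply cond_pos. }
  apply (lim_root (locally (t, sg)) (fun z y => D a (fst z, y)) (fun z y => along a (s0 + fst z) y)
    (along a (s0 + t)) _ (fun z => tau0 + snd z) (sol a t sg) k (cond_pos k)).
  - apply (filter_imp W); [|apply open_W; split; auto].
    intros [t' sg'] [Ht' Hs']. simpl in *. pose proof (HG a t' sg' Ha Ht' Hs') as G.
    destruct (sol_spec e a t' sg' He G) as [E1 E2].
    refine (conj (conj Ht' E1) (conj E2 _)).
    intros y y' [_ Hy] [_ Hy'] L. simpl in Hy, Hy'. destruct G as (G1 & _ & G2 & _).
    apply along_increasing; auto.
  - intros y Hy. split.
    + pose proof (locally_2d_1d_const_y _ _ _ (open_locally_2d _ _ _ (open_D a Ha) (K y Hy))) as [k' Hk'].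
      exists k'. intros [t' sg'] [Ht' _]. apply Hk', Ht'.
    + apply (lim_comp2 (F := locally (t, sg)) (along a)).
      * apply smooth_continuity with (Om a); [apply smooth_along; auto|apply (K y Hy)].
      * apply (shift_lim (locally (t, sg))). apply lim_fst.
      * apply lim_const.
  - intros y y' Hy Hy' L. destruct (HG a t sg Ha Ht Hs) as (G1 & _ & G2 & _).
    apply along_increasing; auto; [apply (K y Hy)|apply (K y' Hy')].
  - rewrite S2. apply (lim_plus (F := locally (t, sg))); [apply lim_const|apply lim_snd].
Qed.

Definition graph (a t sg : R) : R := across a (s0 + t) (sol a t sg) - w0.

(** The partial derivatives of [graph] and of [sol], as functions of the height
    and of the parameter [y] on the sheet: [slope_s] is the slope of the slice,
    the others follow from the chain rule. *)
Definition slope_t a s y := sh a s y / cu a s y.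
Definition slope_s a s y := su a s y / cu a s y.
Definition sol_t a s y := sh a s y * su a s y / (ch a s y * cu a s y).
Definition sol_s a s y := / (ch a s y * cu a s y).
Definition jet_tt a s y :=
  (ch a s y * im a s y * cu a s y + sh a s y * su a s y * re a s y) / cu a s y ^ 2 +
  (ch a s y * re a s y * cu a s y - sh a s y * su a s y * im a s y) / cu a s y ^ 2 * sol_t a s y.
Definition jet_ts a s y := re a s y / cu a s y ^ 2 + - im a s y / cu a s y ^ 2 * sol_t a s y.
Definition jet_ss a s y := - im a s y / cu a s y ^ 2 * sol_s a s y.

Lemma prim_pds a s y : P a -> Om a (s, y) ->
  has_pds (u a) s y (re a s y) (- im a s y) /\ has_pds (v a) s y (im a s y) (re a s y).
Proof.
  intros Ha H. pose proof (adm_bounds a (P_adm a Ha)) as Hb'.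
  exact (prim_has_pds n b Hn Hb a (axis_fun n b a) Hb'
    (fun x Hx => axis_fun_derive n b a x Hb' Hx) s y H).
Qed.

Lemma slope_pds a s y : P a -> Om a (s, y) -> cu a s y <> 0 ->
  has_pds (slope_t a) s y
    ((ch a s y * im a s y * cu a s y + sh a s y * su a s y * re a s y) / cu a s y ^ 2)
    ((ch a s y * re a s y * cu a s y - sh a s y * su a s y * im a s y) / cu a s y ^ 2) /\
  has_pds (slope_s a) s y (re a s y / cu a s y ^ 2) (- im a s y / cu a s y ^ 2).
Proof.
  intros Ha H Hc. destruct (prim_pds a s y Ha H) as [Pu Pv].
  assert (Pu' : has_pds (fun s y => u a s y - al) s y (re a s y) (- im a s y)).
  { eapply has_pds_val; [exact (has_pds_plus _ _ _ _ _ _ _ _ Pu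
      (conj (is_derive_const_R (- al) s) (is_derive_const_R (- al) y)))| |]; ring. }
  pose proof (has_pds_comp1 cos (fun s y => u a s y - al) s y _ _ _ (is_derive_cos_R _) Pu') as DC.
  pose proof (has_pds_comp1 sin (fun s y => u a s y - al) s y _ _ _ (is_derive_sin_R _) Pu') as DS.
  pose proof (has_pds_comp1 sinh (v a) s y _ _ _ (is_derive_sinh_R _) Pv) as DH.
  assert (DI : has_pds (fun s y => / cos (u a s y - al)) s y
    (- / cu a s y ^ 2 * (- sin (u a s y - al) * re a s y))
    (- / cu a s y ^ 2 * (- sin (u a s y - al) * - im a s y))).
  { apply (has_pds_comp1 Rinv (fun s y => cos (u a s y - al))); auto.
    replace (- / cu a s y ^ 2) with (- 1 / (cos (u a s y - al)) ^ 2) by (unfold cu; field; exact Hc).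
    apply (is_derive_inv (fun x => x)); [apply is_derive_id_R|exact Hc]. }
  assert (TR : su a s y ^ 2 + cu a s y ^ 2 = 1).
  { pose proof (sin2_cos2 (u a s y - al)) as Q. unfold Rsqr in Q. unfold su, cu. lra. }
  split.
  - eapply has_pds_val; [exact (has_pds_mult _ _ _ _ _ _ _ _ DH DI)| |];
      unfold ch, sh, su, cu in *; field; exact Hc.
  - eapply has_pds_val; [exact (has_pds_mult _ _ _ _ _ _ _ _ DS DI)| |]; cbv beta.
    + change (cu a s y * re a s y * / cu a s y + su a s y * (- / cu a s y ^ 2 * (- su a s y * re a s y)) = re a s y / cu a s y ^ 2).
      transitivity (re a s y * (su a s y ^ 2 + cu a s y ^ 2) / cu a s y ^ 2); [field; auto|rewrite TR; field; auto].
    + change (cu a s y * - im a s y * / cu a s y + su a s y * (- / cu a s y ^ 2 * (- su a s y * - im a s y)) = - im a s y / cu a s y ^ 2).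
      transitivity (- im a s y * (su a s y ^ 2 + cu a s y ^ 2) / cu a s y ^ 2); [field; auto|rewrite TR; field; auto].
Qed.

Lemma sol_pds a : P a ->
  (forall t sg, W (t, sg) -> has_pds (sol a) t sg
     (sol_t a (s0 + t) (sol a t sg)) (sol_s a (s0 + t) (sol a t sg))) /\
  smooth W (sol a).
Proof.
  intros Ha. pose proof (open_D a Ha) as HO.
  assert (PD : forall t y, D a (t, y) ->
    pd1 (fun t y => along a (s0 + t) y - tau0) t y = - (sh a (s0 + t) y * su a (s0 + t) y) /\
    pd2 (fun t y => along a (s0 + t) y - tau0) t y = ch a (s0 + t) y * cu a (s0 + t) y).
  { intros t y [_ H]. apply has_pds_eq.
    destruct (along_has_pds a (s0 + t) y (P_adm a Ha) H) as [K _].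
    eapply has_pds_val; [exact (has_pds_plus _ _ _ _ _ _ _ _ (has_pds_shift _ _ _ _ _ K)
      (conj (is_derive_const_R (- tau0) t) (is_derive_const_R (- tau0) y)))| |]; ring. }
  assert (NZ : forall t y, D a (t, y) -> 0 < ch a (s0 + t) y * cu a (s0 + t) y).
  { intros t y H. pose proof (cu_pos a t y Ha H). pose proof (cosh_ge_1 (v a (s0 + t) y)).
    unfold ch. nra. }
  assert (SP : forall t sg, W (t, sg) -> D a (t, sol a t sg) /\ along a (s0 + t) (sol a t sg) - tau0 = sg).
  { intros t sg [Ht Hs]. destruct (sol_spec e a t sg He (HG a t sg Ha Ht Hs)) as [S1 S2].
    split; [split; auto|lra]. }
  destruct (smooth_inverse (D a) W (fun t y => along a (s0 + t) y - tau0) (sol a) HO open_W) as [Q1 Q2].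
  - apply smooth_minus; auto using smooth_const. apply smooth_shift; auto. apply smooth_along; auto.
  - intros t y H. rewrite (proj2 (PD t y H)). apply Rgt_not_eq, NZ, H.
  - exact SP.
  - intros t sg H. apply sol_continuity; auto.
  - split; auto. intros t sg H. destruct (SP t sg H) as [SD1 _].
    pose proof (NZ _ _ SD1) as NZ1.
    eapply has_pds_val; [exact (Q1 t sg H)| |].
    + rewrite (proj1 (PD _ _ SD1)), (proj2 (PD _ _ SD1)). unfold sol_t. rewrite Ropp_involutive. reflexivity.
    + rewrite (proj2 (PD _ _ SD1)). reflexivity.
Qed.

Lemma smooth_slopes a : P a ->
  smooth (D a) (fun t y => slope_t a (s0 + t) y) /\ smooth (D a) (fun t y => slope_s a (s0 + t) y).
Proof.
  intros Ha. pose proof (open_D a Ha) as HO.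
  assert (Su : smooth (D a) (fun t y => u a (s0 + t) y)) by (apply smooth_shift; auto; apply (sd_u _ _ _ _ (SD a (P_adm a Ha)))).
  assert (Sv : smooth (D a) (fun t y => v a (s0 + t) y)) by (apply smooth_shift; auto; apply (sd_v _ _ _ _ (SD a (P_adm a Ha)))).
  assert (Sm : smooth (D a) (fun t y => u a (s0 + t) y - al)) by (apply smooth_minus; auto using smooth_const).
  split; apply smooth_div; auto.
  - apply smooth_sinh; auto.
  - apply (smooth_cos (D a) (fun t y => u a (s0 + t) y - al)); auto.
  - intros t y H. pose proof (cu_pos a t y Ha H). unfold cu in *. lra.
  - apply (smooth_sin (D a) (fun t y => u a (s0 + t) y - al)); auto.
  - apply (smooth_cos (D a) (fun t y => u a (s0 + t) y - al)); auto.
  - intros t y H. pose proof (cu_pos a t y Ha H). unfold cu in *. lra.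
Qed.

Lemma sol_D a t sg : P a -> W (t, sg) -> D a (t, sol a t sg).
Proof.
  intros Ha [Ht Hs]. split; auto. apply (sol_spec e a t sg He), HG; auto.
Qed.

Lemma sol_comp_pds a (f : R -> R -> R) f1 f2 t sg : P a -> W (t, sg) ->
  smooth (D a) (fun t y => f (s0 + t) y) ->
  has_pds f (s0 + t) (sol a t sg) f1 f2 ->
  has_pds (fun t sg => f (s0 + t) (sol a t sg)) t sg
    (f1 + f2 * sol_t a (s0 + t) (sol a t sg)) (f2 * sol_s a (s0 + t) (sol a t sg)).
Proof.
  intros Ha H Hf Hp. destruct (sol_pds a Ha) as [Q1 _]. specialize (Q1 t sg H).
  pose proof (Ck_differentiable 0 (D a) _ _ _ (open_D a Ha) (Hf 1%nat) (sol_D a t sg Ha H)) as Df.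
  destruct (has_pds_eq _ _ _ _ _ (has_pds_shift _ _ _ _ _ Hp)) as [E1 E2]. rewrite E1, E2 in Df.
  eapply has_pds_val.
  - exact (has_pds_comp (fun t y => f (s0 + t) y) (fun t _ => t) (sol a) t sg f1 f2 1 0 _ _ Df
      (conj (is_derive_id_R t) (is_derive_const_R t sg)) Q1).
  - ring.
  - ring.
Qed.

Lemma graph_smooth a : P a -> smooth W (graph a).
Proof.
  intros Ha. pose proof open_W as HW. apply smooth_minus; auto using smooth_const.
  apply (smooth_comp W (D a) (fun t y => across a (s0 + t) y) (fun t _ => t) (sol a)); auto.
  - apply open_D; auto.
  - intros t sg H. apply sol_D; auto.
  - apply smooth_shift; auto. apply smooth_along; auto.
  - apply smooth_fst; auto.
  - apply sol_pds; auto.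
Qed.

Lemma graph_first a t sg : P a -> W (t, sg) ->
  has_pds (graph a) t sg (slope_t a (s0 + t) (sol a t sg)) (slope_s a (s0 + t) (sol a t sg)).
Proof.
  intros Ha H. pose proof (sol_D a t sg Ha H) as [_ H']. simpl in H'.
  destruct (along_has_pds a _ _ (P_adm a Ha) H') as [_ K].
  assert (S : smooth (D a) (fun t y => across a (s0 + t) y)) by (apply smooth_shift; auto; apply smooth_along; auto).
  pose proof (sol_comp_pds a (across a) _ _ t sg Ha H S K) as Q.
  pose proof (cu_pos a t _ Ha (sol_D a t sg Ha H)) as HC.
  pose proof (cosh_ge_1 (v a (s0 + t) (sol a t sg))) as HCh.
  assert (TR : su a (s0 + t) (sol a t sg) ^ 2 + cu a (s0 + t) (sol a t sg) ^ 2 = 1).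
  { pose proof (sin2_cos2 (u a (s0 + t) (sol a t sg) - al)) as Q'. unfold Rsqr in Q'. unfold su, cu. lra. }
  eapply has_pds_val; [exact (has_pds_plus _ _ _ _ _ _ _ _ Q
      (conj (is_derive_const_R (- w0) t) (is_derive_const_R (- w0) sg)))| |].
  - unfold sol_t, slope_t. set (c := cu a (s0 + t) (sol a t sg)) in *. set (s := su a (s0 + t) (sol a t sg)) in *.
    unfold ch. set (C := cosh (v a (s0 + t) (sol a t sg))) in *. set (S' := sh a (s0 + t) (sol a t sg)).
    transitivity (S' * (s ^ 2 + c ^ 2) / c); [field; split; lra|rewrite TR; field; lra].
  - unfold sol_s, slope_s, ch. field. split; lra.
Qed.

Lemma graph_pds a t sg : P a -> W (t, sg) ->
  pd1 (graph a) t sg = slope_t a (s0 + t) (sol a t sg) /\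
  pd2 (graph a) t sg = slope_s a (s0 + t) (sol a t sg) /\
  pd1 (pd1 (graph a)) t sg = jet_tt a (s0 + t) (sol a t sg) /\
  pd1 (pd2 (graph a)) t sg = jet_ts a (s0 + t) (sol a t sg) /\
  pd2 (pd2 (graph a)) t sg = jet_ss a (s0 + t) (sol a t sg).
Proof.
  intros Ha H. destruct (has_pds_eq _ _ _ _ _ (graph_first a t sg Ha H)) as [E1 E2].
  pose proof (sol_D a t sg Ha H) as HD. pose proof (cu_pos a t _ Ha HD) as HC.
  destruct (smooth_slopes a Ha) as [S1 S2].
  destruct (slope_pds a _ _ Ha (proj2 HD) ltac:(simpl; lra)) as [K1 K2]. simpl in K1, K2.
  pose proof (sol_comp_pds a (slope_t a) _ _ t sg Ha H S1 K1) as Q1.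
  pose proof (sol_comp_pds a (slope_s a) _ _ t sg Ha H S2 K2) as Q2.
  apply (has_pds_ext_loc W _ (pd1 (graph a))) in Q1; auto using open_W.
  2:{ intros x y Hxy. symmetry. apply (has_pds_eq _ _ _ _ _ (graph_first a x y Ha Hxy)). }
  apply (has_pds_ext_loc W _ (pd2 (graph a))) in Q2; auto using open_W.
  2:{ intros x y Hxy. symmetry. apply (has_pds_eq _ _ _ _ _ (graph_first a x y Ha Hxy)). }
  destruct (has_pds_eq _ _ _ _ _ Q1) as [E11 _]. destruct (has_pds_eq _ _ _ _ _ Q2) as [E12 E22].
  refine (conj E1 (conj E2 (conj E11 (conj E12 E22)))).
Qed.

Lemma sheet_lim f {T} (F : (T -> Prop) -> Prop) {FF : Filter F} av X Z t sg :
  tame n b f -> F (fun z => adm (av z)) -> filterlim av F (locally 0) ->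
  filterlim X F (locally t) -> filterlim Z F (locally sg) -> W (t, sg) ->
  filterlim (fun z => f (av z) (s0 + X z) (sol (av z) (X z) (Z z))) F (locally (f 0 (s0 + t) (sol 0 t sg))).
Proof.
  intros Hf Had Hav HX HZ HW. destruct HW as [Ht Hs]. simpl in *.
  pose proof (At0_0 _ HP) as P0.
  pose proof (sol_D 0 t sg P0 (conj Ht Hs)) as [_ HD]. simpl in HD.
  assert (HC : conv_heights n b F av (fun z => s0 + X z) (s0 + t)).
  { refine (conj Had (conj Hav (conj _ (proj1 HD)))). apply shift_lim; auto. }
  assert (LY : filterlim (fun z => sol (av z) (X z) (Z z)) F (locally (sol 0 t sg))).
  { destruct (sol_spec e 0 t sg He (HG 0 t sg P0 Ht Hs)) as [S1 S2].
    destruct (open_locally_2d _ _ _ (sd_open _ _ _ _ (SD 0 adm_0)) HD) as [k Hk].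
    assert (K : forall y, Rabs (y - sol 0 t sg) < k -> Om 0 (s0 + t, y)).
    { intros y Hy. apply Hk; auto. rewrite Rminus_diag, Rabs_R0. apply cond_pos. }
    apply (lim_root F (fun z y => Om (av z) (s0 + X z, y)) (fun z y => along (av z) (s0 + X z) y)
      (along 0 (s0 + t)) _ (fun z => tau0 + Z z) (sol 0 t sg) k (cond_pos k)).
    - assert (A1 := lim_lt F _ _ d (lim_comp1 Rabs X t (Rcontinuity_abs t) HX) Ht).
      assert (A2 := lim_lt F _ _ d (lim_comp1 Rabs Z sg (Rcontinuity_abs sg) HZ) Hs).
      generalize (filter_and _ _ (At0_lim F av P Had Hav HP) (filter_and _ _ A1 A2)).
      apply filter_imp. intros z (Z1 & Z2 & Z3).
      pose proof (HG _ _ _ Z1 Z2 Z3) as G. destruct (sol_spec e _ _ _ He G) as [Q1 Q2].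
      refine (conj Q1 (conj Q2 _)). intros y y' Hy Hy' L.
      destruct G as (G1 & _ & G2 & _). apply along_increasing; auto.
    - intros y Hy. split.
      + apply (conv_in_strip n b Hn Hb F av _ _ HC (fun _ => y) y (lim_const y) (K y Hy)).
      + apply (proj1 tame_along T F FF av (fun z => s0 + X z) (fun _ => y) (s0 + t) y).
        exact (conj HC (conj (lim_const y) (K y Hy))).
    - intros y y' Hy Hy' L. destruct (HG 0 t sg P0 Ht Hs) as (G1 & _ & G2 & _).
      apply along_increasing; auto.
    - rewrite S2. apply lim_plus; auto. apply lim_const. }
  apply (Hf T F FF av (fun z => s0 + X z) (fun z => sol (av z) (X z) (Z z)) (s0 + t) (sol 0 t sg)).
  split; auto.
Qed.

(** The analogue of [tame] for functions on the square [W]. *)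
Definition graph_lim (f : R -> R -> R -> R) : Prop :=
  forall (T : Type) (F : (T -> Prop) -> Prop) (FF : Filter F) (av X Z : T -> R) t sg,
    F (fun z => adm (av z)) -> filterlim av F (locally 0) ->
    filterlim X F (locally t) -> filterlim Z F (locally sg) -> W (t, sg) ->
    filterlim (fun z => f (av z) (X z) (Z z)) F (locally (f 0 t sg)).

(** Compactness is used twice, for the two coordinates of the square. *)
Lemma graph_lim_unif f k eps : graph_lim f -> k < d -> 0 < eps ->
  At0 (fun a => forall t, - k <= t <= k -> forall sg, - k <= sg <= k ->
    Rabs (f a t sg - f 0 t sg) < eps).
Proof.
  intros Hf Hk Heps. apply (filter_forall_segment At0). intros t Ht.
  set (F := filter_prod At0 (locally t)).
  apply (filter_forall_segment F (fun z sg => Rabs (f (fst z) (snd z) sg - f 0 (snd z) sg) < eps)).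
  intros sg Hs. set (F' := filter_prod F (locally sg)).
  assert (HW : W (t, sg)) by (split; simpl; apply Rabs_def1; lra).
  assert (L0 : filterlim (fun z : (R * R) * R => fst z) F' F) by apply filterlim_fst.
  assert (L1 : filterlim (fun z : (R * R) * R => fst (fst z)) F' At0)
    by (eapply filterlim_comp; [exact L0|apply filterlim_fst]).
  assert (L1' : filterlim (fun z : (R * R) * R => fst (fst z)) F' (locally 0))
    by (apply At0_to_0, L1).
  assert (L2 : filterlim (fun z : (R * R) * R => snd (fst z)) F' (locally t))
    by (eapply filterlim_comp; [exact L0|apply filterlim_snd]).
  assert (L3 : filterlim (fun z : (R * R) * R => snd z) F' (locally sg)) by apply filterlim_snd.
  assert (A0 : F' (fun z => adm 0)) by (apply filter_forall; intros; apply adm_0).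
  pose proof (Hf _ F' _ _ _ _ t sg (L1 _ At0_adm) L1' L2 L3 HW) as M1.
  pose proof (Hf _ F' _ (fun _ => 0) _ _ t sg A0 (lim_const 0) L2 L3 HW) as M2.
  pose proof (lim_minus (F := F') _ _ _ _ M1 M2) as M. rewrite Rminus_diag in M.
  assert (Q := proj1 (filterlim_R F' _ _) M eps Heps). revert Q. apply filter_imp.
  intros [[a x] y] Hz. rewrite Rminus_0_r in Hz. exact Hz.
Qed.

Lemma graph_lims :
  graph_lim graph /\
  graph_lim (fun a t sg => slope_t a (s0 + t) (sol a t sg)) /\
  graph_lim (fun a t sg => slope_s a (s0 + t) (sol a t sg)) /\
  graph_lim (fun a t sg => jet_tt a (s0 + t) (sol a t sg)) /\
  graph_lim (fun a t sg => jet_ts a (s0 + t) (sol a t sg)) /\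
  graph_lim (fun a t sg => jet_ss a (s0 + t) (sol a t sg)).
Proof.
  destruct (tame_trig n b Hn Hb al) as [Tc Ts].
  pose proof (tame_comp n b cosh _ continuity_cosh (tame_v n b Hn Hb)) as Tch.
  pose proof (tame_comp n b sinh _ continuity_sinh (tame_v n b Hn Hb)) as Tsh.
  pose proof (tame_re_h n b Hn Hb) as Tre. pose proof (tame_im_h n b Hn Hb) as Tim.
  assert (G : forall f, tame n b f -> graph_lim (fun a t sg => f a (s0 + t) (sol a t sg))).
  { intros f Hf T F FF av X Z t sg H1 H2 H3 H4 H5. apply sheet_lim; auto. }
  apply G in Tc. apply G in Ts. apply G in Tch. apply G in Tsh. apply G in Tre. apply G in Tim.
  assert (NZ : forall t sg, W (t, sg) -> cu 0 (s0 + t) (sol 0 t sg) <> 0 /\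
     ch 0 (s0 + t) (sol 0 t sg) * cu 0 (s0 + t) (sol 0 t sg) <> 0).
  { intros t sg H. pose proof (At0_0 _ HP) as P0.
    pose proof (cu_pos 0 t _ P0 (sol_D 0 t sg P0 H)).
    pose proof (cosh_ge_1 (v 0 (s0 + t) (sol 0 t sg))). unfold ch. split; nra. }
  refine (conj _ (conj _ (conj _ (conj _ (conj _ _))))); intros T F FF av X Z t sg H1 H2 H3 H4 H5;
    destruct (NZ t sg H5) as [N1 N2];
    specialize (Tc T F FF av X Z t sg H1 H2 H3 H4 H5); specialize (Ts T F FF av X Z t sg H1 H2 H3 H4 H5);
    specialize (Tch T F FF av X Z t sg H1 H2 H3 H4 H5); specialize (Tsh T F FF av X Z t sg H1 H2 H3 H4 H5);
    specialize (Tre T F FF av X Z t sg H1 H2 H3 H4 H5); specialize (Tim T F FF av X Z t sg H1 H2 H3 H4 H5).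
  - apply lim_minus; [|apply lim_const]. apply (sheet_lim across); auto. apply tame_along.
  - apply lim_div; auto.
  - apply lim_div; auto.
  - assert (LS : filterlim (fun z => sol_t (av z) (s0 + X z) (sol (av z) (X z) (Z z))) F
      (locally (sol_t 0 (s0 + t) (sol 0 t sg)))).
    { apply lim_div; [exact N2|apply lim_mult; auto|apply lim_mult; auto]. }
    apply lim_plus.
    + apply lim_div; [apply pow_nonzero; exact N1| |apply lim_pow; exact Tc].
      apply lim_plus; apply lim_mult; auto; apply lim_mult; auto.
    + apply lim_mult; [|exact LS]. apply lim_div; [apply pow_nonzero; exact N1| |apply lim_pow; exact Tc].
      apply lim_minus; apply lim_mult; auto; apply lim_mult; auto.
  - assert (LS : filterlim (fun z => sol_t (av z) (s0 + X z) (sol (av z) (X z) (Z z))) F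
      (locally (sol_t 0 (s0 + t) (sol 0 t sg)))).
    { apply lim_div; [exact N2|apply lim_mult; auto|apply lim_mult; auto]. }
    apply lim_plus.
    + apply lim_div; [apply pow_nonzero; exact N1|exact Tre|apply lim_pow; exact Tc].
    + apply lim_mult; [|exact LS]. apply lim_div; [apply pow_nonzero; exact N1| |apply lim_pow; exact Tc].
      apply lim_opp; exact Tim.
  - apply lim_mult.
    + apply lim_div; [apply pow_nonzero; exact N1| |apply lim_pow; exact Tc]. apply lim_opp; exact Tim.
    + apply lim_inv; [exact N2|]. apply lim_mult; auto.
Qed.

Lemma norm_le_R3 (p q : R3) : norm (plus p q) <= norm p + norm q.
Proof. apply (norm_triangle (K := R_AbsRing) (V := prod_NormedModule _ (prod_NormedModule _ R_NormedModule R_NormedModule) R_NormedModule)). Qed.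

Let p := weier (u 0) (v 0) s0 y0.
Hypothesis Hp : norm p < 1.

(** The box has the vertical direction as its first axis, the tangent of the slice
    as its second, and the height of the graph is measured across the slice. *)
Definition sheet_frame (wid hei : posreal) : box := Box p (0, 0, 1) (ca, sa, 0) (- sa, ca, 0) wid hei.

Lemma trig_al : sa ^ 2 + ca ^ 2 = 1.
Proof. pose proof (sin2_cos2 al) as Q. unfold Rsqr in Q. unfold sa, ca. lra. Qed.

Lemma sheet_frame_orthonormal wid hei : orthonormal_box (sheet_frame wid hei).
Proof.
  pose proof trig_al as Q. unfold orthonormal_box, sheet_frame, dot, x1, x2, x3; simpl.
  repeat split; try ring; rewrite <- Q; ring.
Qed.

Lemma sheet_frame_point wid hei t sg z : box_point (sheet_frame wid hei) t sg z =
  (x1 p + sg * ca - z * sa, x2 p + sg * sa + z * ca, x3 p + t).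
Proof.
  transitivity (x1 p + (t * 0 + (sg * ca + z * - sa)), x2 p + (t * 0 + (sg * sa + z * ca)), x3 p + (t * 1 + (sg * 0 + z * 0))).
  - unfold box_point, sheet_frame; cbn [ctr ax1 ax2 ax3]. generalize p. intros [[p1 p2] p3]. reflexivity.
  - apply triple_eq; ring.
Qed.

Lemma sheet_frame_iff a wid hei t sg z : P a -> W (t, sg) ->
  sheet a (box_point (sheet_frame wid hei) t sg z) <-> z = graph a t sg.
Proof.
  intros Ha H. pose proof trig_al as Q. rewrite sheet_frame_point.
  assert (E3 : x3 p = s0) by reflexivity. rewrite E3.
  pose proof (HG a t sg Ha (proj1 H) (proj2 H)) as G.
  destruct (sol_spec e a t sg He G) as [S1 S2].
  assert (T0 : tau0 = ca * x1 p + sa * x2 p) by reflexivity.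
  assert (W0 : w0 = - sa * x1 p + ca * x2 p) by reflexivity.
  split.
  - intros (s & y & Hy & _ & E).
    assert (Es : s = s0 + t) by (apply (f_equal x3) in E; exact E). subst s.
    pose proof (f_equal x1 E) as E1. pose proof (f_equal x2 E) as E2.
    unfold x1 at 2 in E1. unfold x2 at 2 in E2. cbn [fst snd] in E1, E2.
    assert (Ey : sol a t sg = y).
    { apply (sol_unique e); auto. unfold along. rewrite E1, E2, T0.
      transitivity (ca * x1 p + sa * x2 p + sg * (sa ^ 2 + ca ^ 2)); [ring|rewrite Q; ring]. }
    unfold graph. rewrite Ey. unfold across. rewrite E1, E2, W0.
    transitivity (z * (sa ^ 2 + ca ^ 2)); [rewrite Q; ring|ring].
  - intros ->. exists (s0 + t), (sol a t sg). split; [exact S1|]. split; [apply G|].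
    unfold graph. rewrite W0. unfold along in S2. unfold across. rewrite T0 in S2.
    set (q1 := x1 (weier (u a) (v a) (s0 + t) (sol a t sg))) in *.
    set (q2 := x2 (weier (u a) (v a) (s0 + t) (sol a t sg))) in *.
    transitivity (q1, q2, s0 + t); [reflexivity|].
    assert (Esg : sg = ca * (q1 - x1 p) + sa * (q2 - x2 p)) by lra.
    apply triple_eq; auto.
    + rewrite Esg. transitivity (x1 p + (q1 - x1 p) * (sa ^ 2 + ca ^ 2)); [rewrite Q; ring|ring].
    + rewrite Esg. transitivity (x2 p + (q2 - x2 p) * (sa ^ 2 + ca ^ 2)); [rewrite Q; ring|ring].
Qed.

Lemma sheet_frame_near wid hei t sg z : norm p + (Rabs t + Rabs sg + Rabs z) < 1 ->
  norm (box_point (sheet_frame wid hei) t sg z) < 1.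
Proof.
  intros H. eapply Rle_lt_trans; [|exact H]. unfold box_point, sheet_frame; simpl.
  assert (N : forall k (q : R3), dot q q = 1 -> norm (scal k q) <= Rabs k).
  { intros k q Hq. rewrite norm_dot. right.
    replace (dot (scal k q) (scal k q)) with (Rsqr k); [apply sqrt_Rsqr_abs|].
    rewrite scal_R3. unfold dot, x1, x2, x3, Rsqr in *; cbn [fst snd].
    transitivity (k * k * 1); [ring|]. rewrite <- Hq. ring. }
  pose proof (sheet_frame_orthonormal wid hei) as (O1 & O2 & O3 & _). simpl in O1, O2, O3.
  eapply Rle_trans; [apply norm_le_R3|]. apply Rplus_le_compat_l.
  eapply Rle_trans; [apply norm_le_R3|]. rewrite Rplus_assoc. apply Rplus_le_compat; [apply N; auto|].
  eapply Rle_trans; [apply norm_le_R3|]. apply Rplus_le_compat; apply N; auto.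
Qed.

Lemma graph_0 : graph 0 0 0 = 0.
Proof.
  pose proof (At0_0 _ HP) as P0.
  assert (E : sol 0 0 0 = y0).
  { apply (sol_unique e); auto.
    - apply HG; auto; rewrite Rabs_R0; auto.
    - rewrite Rplus_0_r. exact H0.
    - rewrite !Rplus_0_r. reflexivity. }
  unfold graph. rewrite E, Rplus_0_r. unfold w0. ring.
Qed.

(** The box is so small that it stays inside the ball, that its square lies in [W]
    with its closure, and that the graphs do not leave it through the top or the
    bottom. *)
Lemma sheet_graphs : exists wid hei : posreal,
  (forall q, in_box (sheet_frame wid hei) q -> norm q < 1 /\ off_heights n b (x3 q)) /\
  (At0 (fun a => forall S : R3 -> Prop,
     (forall q, norm q < 1 -> off_heights n b (x3 q) -> (S q <-> sheet a q)) ->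
     C2_graph_in_box (sheet_frame wid hei) S (graph a))) /\
  (forall eps, 0 < eps -> At0 (fun a => C2_close (sheet_frame wid hei) eps (graph a) (graph 0))).
Proof.
  destruct graph_lims as (L0 & L1 & L2 & L11 & L12 & L22).
  set (k0 := 1 - norm p). assert (Hk0 : 0 < k0) by (unfold k0; lra).
  assert (Hh : 0 < k0 / 4) by lra.
  set (F := filter_prod At0 (locally (0, 0))).
  assert (W00 : W (0, 0)) by (split; simpl; rewrite Rabs_R0; auto).
  assert (LF : filterlim (fun z : R * R2 => fst z) F At0) by apply filterlim_fst.
  assert (LS : filterlim (fun z : R * R2 => snd z) F (locally (0, 0))) by apply filterlim_snd.
  assert (M : filterlim (fun z : R * R2 => graph (fst z) (fst (snd z)) (snd (snd z))) F (locally 0)).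
  { rewrite <- graph_0. apply (L0 _ F _ fst (fun z => fst (snd z)) (fun z => snd (snd z))); auto.
    - apply (LF _ At0_adm).
    - apply At0_to_0, LF.
    - eapply filterlim_comp; [exact LS|apply lim_fst].
    - eapply filterlim_comp; [exact LS|apply lim_snd]. }
  destruct (proj1 (filterlim_R F _ _) M (k0 / 4) Hh) as [Q R0 HQ HR HK].
  assert (HR' : locally_2d (fun x y => R0 (x, y)) 0 0).
  { apply locally_2d_locally. revert HR. apply filter_imp. intros [? ?]; auto. }
  destruct HR' as [d1 Hd1].
  set (w := Rmin (k0 / 4) (Rmin (d / 2) d1)).
  assert (Hw : 0 < w) by (unfold w; repeat apply Rmin_pos; try lra; apply cond_pos).
  assert (Hw1 : w <= k0 / 4) by apply Rmin_l.
  assert (Hw2 : w <= d / 2) by (eapply Rle_trans; [apply Rmin_r|apply Rmin_l]).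
  assert (Hw3 : w <= d1) by (eapply Rle_trans; [apply Rmin_r|apply Rmin_r]).
  set (wid := mkposreal w Hw). set (hei := mkposreal _ Hh).
  pose proof (At0_0 _ HP) as P0.
  assert (BW : forall t sg, base (sheet_frame wid hei) (t, sg) -> W (t, sg)).
  { intros t sg [B1 B2]. simpl in B1, B2. split; simpl; lra. }
  assert (OPEN : open (base (sheet_frame wid hei))).
  { apply open_and_R2; [apply (open_fst (fun t => Rabs t < w))|apply (open_snd (fun t => Rabs t < w))];
      apply open_Rabs_lt. }
  assert (NB : forall t sg z, base (sheet_frame wid hei) (t, sg) -> Rabs z < hei ->
     norm (box_point (sheet_frame wid hei) t sg z) < 1 /\
     off_heights n b (x3 (box_point (sheet_frame wid hei) t sg z))).
  { intros t sg z B Hz. split.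
    - apply sheet_frame_near. destruct B as [B1 B2]. simpl in B1, B2, Hz. unfold k0 in *. lra.
    - rewrite sheet_frame_point. change (off_heights n b (s0 + t)).
      destruct (BW t sg B). simpl in *. apply (HG 0 t sg); auto. }
  exists wid, hei. split; [|split].
  - intros q (t & sg & z & B & Hz & ->). apply NB; auto.
  - generalize (filter_and _ _ HP HQ). apply filter_imp. intros a [Ha Qa] S HS.
    split; [|split].
    + apply Ck_sub with W; [intros [t sg]; apply BW|]. apply graph_smooth; auto.
    + intros t sg [B1 B2]. simpl in B1, B2 |- *.
      assert (Z : Rabs (graph a t sg - 0) < k0 / 4).
      { apply (HK a (t, sg) Qa). apply Hd1; rewrite Rminus_0_r; lra. }
      rewrite Rminus_0_r in Z. exact Z.
    + intros t sg z B Hz. destruct (NB t sg z B Hz) as [N1 N2].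
      rewrite (HS _ N1 N2). apply sheet_frame_iff; auto.
  - intros eps Heps.
    assert (Hwd : w < d) by lra.
    generalize (filter_and _ _ HP (filter_and _ _ (graph_lim_unif _ w eps L0 Hwd Heps)
      (filter_and _ _ (filter_and _ _ (graph_lim_unif _ w eps L1 Hwd Heps) (graph_lim_unif _ w eps L2 Hwd Heps))
      (filter_and _ _ (graph_lim_unif _ w eps L11 Hwd Heps)
        (filter_and _ _ (graph_lim_unif _ w eps L12 Hwd Heps) (graph_lim_unif _ w eps L22 Hwd Heps)))))).
    apply filter_imp. intros a (Ha & K0 & (K1 & K2) & K11 & K12 & K22) t sg B.
    destruct (graph_pds a t sg Ha (BW t sg B)) as (E1 & E2 & E11 & E12 & E22).
    destruct (graph_pds 0 t sg P0 (BW t sg B)) as (F1 & F2 & F11 & F12 & F22).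
    destruct B as [B1 B2]. simpl in B1, B2.
    apply Rabs_def2 in B1. apply Rabs_def2 in B2.
    assert (B1' : - w <= t <= w) by lra. assert (B2' : - w <= sg <= w) by lra.
    rewrite E1, E2, E11, E12, E22, F1, F2, F11, F12, F22.
    exact (conj (K0 t B1' sg B2') (conj (K1 t B1' sg B2') (conj (K2 t B1' sg B2')
      (conj (K11 t B1' sg B2') (conj (K12 t B1' sg B2') (K22 t B1' sg B2')))))).
Qed.

End Fixed_size.
End Near.
End Sheets.

(** * The limit disks *)

Lemma R3_eq (p q : R3) : x1 p = x1 q -> x2 p = x2 q -> x3 p = x3 q -> p = q.
Proof.
  destruct p as [[? ?] ?], q as [[? ?] ?]. unfold x1, x2, x3; simpl. intros -> -> ->; reflexivity.
Qed.

Lemma coord_le_norm (p : R3) : Rabs (x1 p) <= norm p /\ Rabs (x2 p) <= norm p /\ Rabs (x3 p) <= norm p.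
Proof.
  rewrite norm_R3.
  assert (K : forall a c, 0 <= c -> Rabs a <= sqrt (a ^ 2 + c)).
  { intros a c Hc. rewrite <- sqrt_Rsqr_abs. apply sqrt_le_1_alt. unfold Rsqr. lra. }
  pose proof (pow2_ge_0 (x1 p)). pose proof (pow2_ge_0 (x2 p)). pose proof (pow2_ge_0 (x3 p)).
  repeat split.
  - rewrite Rplus_assoc. apply K; lra.
  - replace (x1 p ^ 2 + x2 p ^ 2 + x3 p ^ 2) with (x2 p ^ 2 + (x1 p ^ 2 + x3 p ^ 2)) by ring. apply K; lra.
  - rewrite Rplus_comm. apply K; lra.
Qed.

Lemma minus_coords (p q : R3) : x1 (minus p q) = x1 p - x1 q /\
  x2 (minus p q) = x2 p - x2 q /\ x3 (minus p q) = x3 p - x3 q.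
Proof. destruct p as [[? ?] ?], q as [[? ?] ?]. repeat split. Qed.

Lemma norm_lt_1_R3 (p : R3) : norm p < 1 <-> x1 p ^ 2 + x2 p ^ 2 + x3 p ^ 2 < 1.
Proof.
  rewrite norm_R3. split; intros H.
  - apply Rnot_le_lt. intros N. apply sqrt_le_1_alt in N. rewrite sqrt_1 in N. lra.
  - rewrite <- sqrt_1. apply sqrt_lt_1_alt. split; auto.
    pose proof (pow2_ge_0 (x1 p)). pose proof (pow2_ge_0 (x2 p)). pose proof (pow2_ge_0 (x3 p)). lra.
Qed.

Lemma open_disk_iff s t : open_disk (s, t) <-> s ^ 2 + t ^ 2 < 1.
Proof.
  unfold open_disk. rewrite norm_R2. simpl fst; simpl snd. split; intros H.
  - apply Rnot_le_lt. intros N. apply sqrt_le_1_alt in N. rewrite sqrt_1 in N. lra.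
  - rewrite <- sqrt_1. apply sqrt_lt_1_alt. split; auto.
    pose proof (pow2_ge_0 s). pose proof (pow2_ge_0 t). lra.
Qed.

Lemma closed_disk_iff s t : closed_disk (s, t) <-> s ^ 2 + t ^ 2 <= 1.
Proof.
  unfold closed_disk. rewrite norm_R2. simpl fst; simpl snd. split; intros H.
  - apply Rnot_lt_le. intros N. pose proof (sqrt_lt_1_alt 1 _ (conj Rle_0_1 N)) as N1. rewrite sqrt_1 in N1. lra.
  - rewrite <- sqrt_1. apply sqrt_le_1_alt; auto.
Qed.

Lemma open_open_disk : open open_disk.
Proof.
  assert (O : open (fun q : R2 => fst q ^ 2 + snd q ^ 2 < 1)).
  { apply (open_comp (fun q : R2 => fst q ^ 2 + snd q ^ 2) (fun x => x < 1)); [|apply open_lt].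
    intros [s t] _. apply lim_plus; apply (lim_pow (F := locally (s, t))); [apply lim_fst|apply lim_snd]. }
  intros [s t] H. apply open_disk_iff in H. generalize (O (s, t) H). apply filter_imp.
  intros [x y] Hxy. apply open_disk_iff, Hxy.
Qed.

(** An affine change of the first coordinate maps the open disk to the range
    [lo < s < hi]; each chord is then scaled to the chord of the disk at its new
    place.  So [(lens_s, lens_t)] is a diffeomorphism onto the part of the open
    disk between the two heights. *)
Definition lens_s (lo hi p q : R) : R := (lo + hi) / 2 + (hi - lo) / 2 * p.
Definition lens_t (lo hi p q : R) : R := q * (sqrt (1 - lens_s lo hi p q ^ 2) / sqrt (1 - p ^ 2)).

Section Lens.
Variables lo hi : R.
Hypotheses (Hl : -1 <= lo) (Hlh : lo < hi) (Hh : hi <= 1).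

Lemma lens_pos p q : open_disk (p, q) ->
  lo < lens_s lo hi p q < hi /\ 0 < 1 - lens_s lo hi p q ^ 2 /\ 0 < 1 - p ^ 2.
Proof.
  intros H. apply open_disk_iff in H. pose proof (pow2_ge_0 q).
  assert (Hp : -1 < p < 1) by nra.
  assert (lo < lens_s lo hi p q < hi) by (unfold lens_s; nra).
  split; [auto|]. split; nra.
Qed.

Lemma lens_in p q : open_disk (p, q) ->
  lo < lens_s lo hi p q < hi /\ lens_s lo hi p q ^ 2 + lens_t lo hi p q ^ 2 < 1.
Proof.
  intros H. destruct (lens_pos p q H) as (H1 & H2 & H3). apply open_disk_iff in H.
  split; auto. set (s := lens_s lo hi p q) in *. unfold lens_t. fold s.
  rewrite Rpow_mult_distr. unfold Rdiv. rewrite Rpow_mult_distr, pow_inv, !pow2_sqrt by lra.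
  assert (q ^ 2 * ((1 - s ^ 2) * / (1 - p ^ 2)) < 1 - s ^ 2); [|lra].
  apply Rmult_lt_reg_r with (1 - p ^ 2); auto.
  replace (q ^ 2 * ((1 - s ^ 2) * / (1 - p ^ 2)) * (1 - p ^ 2)) with (q ^ 2 * (1 - s ^ 2)) by (field; lra).
  nra.
Qed.

Lemma lens_inj p q p' q' : open_disk (p, q) -> open_disk (p', q') ->
  lens_s lo hi p q = lens_s lo hi p' q' -> lens_t lo hi p q = lens_t lo hi p' q' -> p = p' /\ q = q'.
Proof.
  intros H H' E1 E2. destruct (lens_pos p q H) as (H1 & H2 & H3).
  assert (p = p') by (unfold lens_s in E1; nra). subst p'. split; auto.
  unfold lens_t in E2. rewrite <- E1 in E2.
  apply Rmult_eq_reg_r in E2; auto. apply Rgt_not_eq.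
  apply Rdiv_lt_0_compat; apply sqrt_lt_R0; auto.
Qed.

Lemma lens_surj s t : lo < s < hi -> s ^ 2 + t ^ 2 < 1 ->
  exists p q, open_disk (p, q) /\ lens_s lo hi p q = s /\ lens_t lo hi p q = t.
Proof.
  intros Hs Ht. set (p := (s - (lo + hi) / 2) / ((hi - lo) / 2)).
  assert (Ep : (hi - lo) / 2 * p = s - (lo + hi) / 2) by (unfold p; field; lra).
  assert (Hp : -1 < p < 1) by (split; nra).
  assert (H1 : 0 < 1 - p ^ 2) by nra.
  assert (H2 : 0 < 1 - s ^ 2) by (pose proof (pow2_ge_0 t); lra).
  assert (K1 : 0 < sqrt (1 - p ^ 2)) by (apply sqrt_lt_R0; auto).
  assert (K2 : 0 < sqrt (1 - s ^ 2)) by (apply sqrt_lt_R0; auto).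
  assert (Es : forall q, lens_s lo hi p q = s) by (intros; unfold lens_s; rewrite Ep; ring).
  exists p, (t * (sqrt (1 - p ^ 2) / sqrt (1 - s ^ 2))). split; [|split]; auto.
  - apply open_disk_iff. rewrite Rpow_mult_distr. unfold Rdiv. rewrite Rpow_mult_distr, pow_inv, !pow2_sqrt by lra.
    assert (t ^ 2 * ((1 - p ^ 2) * / (1 - s ^ 2)) < 1 - p ^ 2); [|lra].
    apply Rmult_lt_reg_r with (1 - s ^ 2); auto.
    replace (t ^ 2 * ((1 - p ^ 2) * / (1 - s ^ 2)) * (1 - s ^ 2)) with (t ^ 2 * (1 - p ^ 2)) by (field; lra).
    nra.
  - unfold lens_t. rewrite Es. field. split; lra.
Qed.

Lemma smooth_lens : smooth open_disk (lens_s lo hi) /\ smooth open_disk (lens_t lo hi).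
Proof.
  pose proof open_open_disk as HO.
  assert (S1 : smooth open_disk (lens_s lo hi)).
  { apply smooth_plus; auto using smooth_const. apply smooth_mult; auto using smooth_const. apply smooth_fst; auto. }
  split; auto. apply smooth_mult; auto using smooth_snd. apply smooth_div; auto.
  - apply (smooth_sqrt open_disk (fun p q => 1 - lens_s lo hi p q ^ 2)); auto.
    + apply smooth_minus; auto using smooth_const. apply smooth_pow2; auto.
    + intros s t H. apply (lens_pos s t H).
  - apply (smooth_sqrt open_disk (fun p q => 1 - p ^ 2)); auto.
    + apply smooth_minus; auto using smooth_const. apply smooth_pow2; auto. apply smooth_fst; auto.
    + intros s t H. apply (lens_pos s t H).
  - intros s t H. apply Rgt_not_eq, sqrt_lt_R0, (lens_pos s t H).
Qed.

Lemma lens_jacobian p q : open_disk (p, q) ->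
  pd1 (lens_s lo hi) p q * pd2 (lens_t lo hi) p q - pd2 (lens_s lo hi) p q * pd1 (lens_t lo hi) p q <> 0.
Proof.
  intros H. destruct (lens_pos p q H) as (H1 & H2 & H3).
  assert (E1 : pd1 (lens_s lo hi) p q = (hi - lo) / 2).
  { apply is_derive_unique. unfold lens_s. auto_derive; auto. ring. }
  assert (E2 : pd2 (lens_s lo hi) p q = 0).
  { apply is_derive_unique. unfold lens_s. apply is_derive_const_R. }
  assert (E3 : pd2 (lens_t lo hi) p q = sqrt (1 - lens_s lo hi p q ^ 2) / sqrt (1 - p ^ 2)).
  { apply is_derive_unique.
    change (is_derive (fun q0 => q0 * (sqrt (1 - lens_s lo hi p q ^ 2) / sqrt (1 - p ^ 2))) q
      (sqrt (1 - lens_s lo hi p q ^ 2) / sqrt (1 - p ^ 2))).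
    generalize (sqrt (1 - lens_s lo hi p q ^ 2) / sqrt (1 - p ^ 2)). intros k.
    pose proof (is_derive_mult_R (fun q => q) (fun _ => k) q 1 0 (is_derive_id_R q) (is_derive_const_R k q)) as D.
    cbv beta in D. replace (1 * k + q * 0) with k in D by ring. exact D. }
  rewrite E1, E2, E3, Rmult_0_l, Rminus_0_r. apply Rgt_not_eq.
  apply Rmult_lt_0_compat; [lra|]. apply Rdiv_lt_0_compat; apply sqrt_lt_R0; auto.
Qed.

End Lens.

(** ** Recovering the parameters from the point *)

Section PolarInverse.
Variables (I : R -> Prop) (eta : R -> R) (u v : R -> R -> R).
Hypothesis SD : spiral_data I eta u v.
Let X := polar_patch eta u v.

(* The component of [p] along the slice at the axis; its sign is that of [t]. *)
Let side s p := cos (u s 0) * x1 p + sin (u s 0) * x2 p.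

Lemma side_sign s t : polar_dom I (s, t) -> exists k, 0 < k /\ side s (X s t) = k * t.
Proof.
  intros H. destruct (root_radius_spec I eta u v SD s t H) as [D1 D2].
  set (y := root_radius eta u v s t) in *.
  pose proof (angle_den I eta u v SD s y D1) as Hd.
  pose proof (n2_pos I eta u v SD s y D1) as Hn.
  set (nn := sqrt (mean (hcos u v) s y ^ 2 + mean (hsin u v) s y ^ 2)).
  assert (Hnn : 0 < nn) by (apply sqrt_lt_R0; exact Hn).
  assert (Et : t = y * nn) by (rewrite <- D2; reflexivity).
  set (m := cos (u s 0) * mean (hcos u v) s y + sin (u s 0) * mean (hsin u v) s y) in *.
  exists (m / nn). split; [apply Rdiv_lt_0_compat; lra|].
  transitivity (y * m); [|rewrite Et; field; lra].
  change (cos (u s 0) * (y * mean (hcos u v) s y) + sin (u s 0) * (y * mean (hsin u v) s y) = y * m).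
  unfold m. ring.
Qed.

(** The distance to the axis gives [|t|] in the limit, and the side of the axis
    gives its sign. *)
Lemma polar_inverse_lim {T} (F : (T -> Prop) -> Prop) {FF : Filter F} (S Z : T -> R) s t :
  polar_dom I (s, t) -> F (fun z => polar_dom I (S z, Z z)) ->
  filterlim (fun z => x1 (X (S z) (Z z))) F (locally (x1 (X s t))) ->
  filterlim (fun z => x2 (X (S z) (Z z))) F (locally (x2 (X s t))) ->
  filterlim S F (locally s) -> filterlim Z F (locally t).
Proof.
  intros H HF L1 L2 LS.
  pose proof (strip_axis I eta u v SD s (proj1 H)) as H0.
  assert (LA : filterlim (fun z => u (S z) 0) F (locally (u s 0))).
  { apply (lim_comp2 u S (fun _ => 0) s 0); auto; [|apply lim_const].
    apply smooth_continuity with (strip I eta); auto. apply (sd_u _ _ _ _ SD). }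
  assert (LF : filterlim (fun z => side (S z) (X (S z) (Z z))) F (locally (side s (X s t)))).
  { apply lim_plus; apply lim_mult; auto; [apply (lim_comp1 cos)|apply (lim_comp1 sin)]; auto.
    - apply continuity_cos.
    - apply continuity_sin. }
  assert (LR : filterlim (fun z => sqrt (x1 (X (S z) (Z z)) ^ 2 + x2 (X (S z) (Z z)) ^ 2)) F
    (locally (sqrt (x1 (X s t) ^ 2 + x2 (X s t) ^ 2)))).
  { apply (lim_comp1 sqrt).
    - apply continuity_pt_sqrt. apply Rplus_le_le_0_compat; apply pow2_ge_0.
    - apply lim_plus; apply lim_pow; auto. }
  assert (LZ : filterlim (fun z => Rabs (Z z)) F (locally (Rabs t))).
  { replace (Rabs t) with (sqrt (x1 (X s t) ^ 2 + x2 (X s t) ^ 2)).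
    - apply (filterlim_ext_loc (fun z => sqrt (x1 (X (S z) (Z z)) ^ 2 + x2 (X (S z) (Z z)) ^ 2))); auto.
      revert HF. apply filter_imp. intros z Hz.
      destruct (polar_patch_dist I eta u v SD _ _ Hz) as [E _]. fold X in E. rewrite E.
      rewrite <- pow2_abs. apply sqrt_pow2, Rabs_pos.
    - destruct (polar_patch_dist I eta u v SD _ _ H) as [E _]. fold X in E. rewrite E.
      rewrite <- pow2_abs. apply sqrt_pow2, Rabs_pos. }
  destruct (side_sign s t H) as (k & Hk & Ek).
  apply filterlim_R; auto. intros eps Heps.
  assert (A1 := proj1 (filterlim_R F _ _) LZ eps Heps).
  destruct (Req_dec t 0) as [E0|E0].
  { revert A1. apply filter_imp. intros z Hz. rewrite E0, Rabs_R0, Rminus_0_r, Rabs_Rabsolu in Hz.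
    rewrite E0, Rminus_0_r. exact Hz. }
  assert (LFS : filterlim (fun z => side (S z) (X (S z) (Z z)) * t) F (locally (side s (X s t) * t)))
    by (apply lim_mult; auto; apply lim_const).
  assert (Htt : 0 < t * t) by (apply Rsqr_pos_lt; auto).
  assert (HP : 0 < side s (X s t) * t) by (rewrite Ek; nra).
  assert (A2 := lim_gt F _ _ 0 LFS HP).
  generalize (filter_and _ _ HF (filter_and _ _ A1 A2)). apply filter_imp.
  intros z (Z1 & Z2 & Z3). destruct (side_sign _ _ Z1) as (k' & Hk' & Ek').
  rewrite Ek' in Z3. assert (0 < Z z * t) by nra.
  destruct (Rdichotomy _ _ E0) as [N|N].
  - assert (Z z < 0) by nra. rewrite (Rabs_left t), (Rabs_left (Z z)) in Z2 by lra.
    replace (- Z z - - t) with (- (Z z - t)) in Z2 by ring. rewrite Rabs_Ropp in Z2. exact Z2.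
  - assert (0 < Z z) by nra. rewrite (Rabs_pos_eq t), (Rabs_pos_eq (Z z)) in Z2 by lra. exact Z2.
Qed.

End PolarInverse.

(** * The disks of the theorem *)

Definition aseq (i : nat) : R := / (4 * INR (S i)).

Lemma aseq_adm i : adm (aseq i).
Proof. right. exists (S i). split; [lia|reflexivity]. Qed.

Lemma aseq_pos i : 0 < aseq i.
Proof. apply Rinv_0_lt_compat. pose proof (lt_0_INR (S i) ltac:(lia)). lra. Qed.

Lemma aseq_lim : filterlim aseq eventually At0.
Proof.
  intros P HP. unfold filtermap.
  assert (L : is_lim_seq aseq 0).
  { apply (is_lim_seq_inv (fun i => 4 * INR (S i)) p_infty); [|discriminate].
    replace p_infty with (Rbar_mult 4 p_infty).
    - apply is_lim_seq_scal_l. apply (is_lim_seq_incr_1 INR). apply is_lim_seq_INR.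
    - simpl. destruct (Rle_dec 0 4) as [H|H]; [|lra].
      destruct (Rle_lt_or_eq_dec 0 4 H); [reflexivity|lra]. }
  pose proof (L _ HP) as E. unfold filtermap in E. revert E. apply filter_imp.
  intros i Hi. apply Hi, aseq_adm.
Qed.

Lemma disk_bounds s t : s ^ 2 + t ^ 2 <= 1 -> -1 <= s <= 1 /\ Rabs t <= 1.
Proof.
  intros H. pose proof (pow2_ge_0 s). pose proof (pow2_ge_0 t).
  split; [split; nra|]. apply Rabs_le. split; nra.
Qed.

Section Assembly.
Variables (n : nat) (b : nat -> R).
Hypotheses (Hn : (1 <= n)%nat) (Hb : forall j, (1 <= j <= n)%nat -> Rabs (b j) < 1)
  (Hord : forall j k, (1 <= j)%nat -> (j < k)%nat -> (k <= n)%nat -> b j < b k).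

Let SD a (Ha : adm a) := fam_data n b Hn Hb a (adm_bounds a Ha).
Let fp := fam_patch n b.

(** ** The slabs between consecutive planes *)

(** The outermost slabs end at the heights -1 and 1 of the ball. *)
Definition slab_lo (k : nat) : R := if le_lt_dec k 1 then -1 else b (k - 1)%nat.
Definition slab_hi (k : nat) : R := if le_lt_dec k n then b k else 1.

Lemma b_bounds j : (1 <= j <= n)%nat -> -1 < b j < 1.
Proof. intros H. pose proof (Rabs_def2 _ _ (Hb j H)). lra. Qed.

Lemma b_mono i j : (1 <= i)%nat -> (i <= j)%nat -> (j <= n)%nat -> b i <= b j.
Proof.
  intros H1 H2 H3. destruct (Nat.eq_dec i j) as [->|N]; [lra|].
  left. apply Hord; lia.
Qed.

Lemma slab_bounds k : (1 <= k <= n + 1)%nat ->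
  -1 <= slab_lo k /\ slab_lo k < slab_hi k /\ slab_hi k <= 1.
Proof.
  intros Hk. unfold slab_lo, slab_hi.
  destruct (le_lt_dec k 1) as [H1|H1], (le_lt_dec k n) as [H2|H2]; try lra.
  - pose proof (b_bounds k ltac:(lia)). lra.
  - pose proof (b_bounds k ltac:(lia)). pose proof (b_bounds (k - 1) ltac:(lia)).
    pose proof (Hord (k - 1) k ltac:(lia) ltac:(lia) H2). lra.
  - pose proof (b_bounds (k - 1) ltac:(lia)). lra.
Qed.

Lemma slab_heights k s : (1 <= k <= n + 1)%nat -> slab_lo k < s < slab_hi k -> fam_I n b 0 s.
Proof.
  intros Hk Hs. destruct (slab_bounds k Hk) as (B1 & B2 & B3).
  apply fam_I_0. split; [lra|]. intros j Hj E. subst s.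
  unfold slab_lo, slab_hi in Hs.
  destruct (le_lt_dec k j) as [H|H].
  - destruct (le_lt_dec k n) as [H2|H2]; [|lia].
    pose proof (b_mono k j ltac:(lia) H ltac:(lia)). lra.
  - destruct (le_lt_dec k 1) as [H1|H1]; [lia|].
    pose proof (b_mono j (k - 1) ltac:(lia) ltac:(lia) ltac:(lia)). lra.
Qed.

Lemma slab_cover s : -1 < s < 1 -> off_heights n b s ->
  exists k, (1 <= k <= n + 1)%nat /\ slab_lo k < s < slab_hi k.
Proof.
  intros Hs Ho.
  assert (P : forall m, (m <= n)%nat -> (exists k, (1 <= k <= m)%nat /\ slab_lo k < s < slab_hi k) \/
    slab_lo (S m) < s).
  { induction m as [|m IH]; intros Hm.
    - right. unfold slab_lo. simpl. lra.
    - destruct (IH ltac:(lia)) as [(k & Hk & K)|L].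
      + left. exists k. split; auto; lia.
      + destruct (Rlt_dec s (b (S m))) as [Q|Q].
        * left. exists (S m). split; [lia|]. split; auto. unfold slab_hi.
          destruct (le_lt_dec (S m) n); [auto|lia].
        * right. unfold slab_lo. destruct (le_lt_dec (S (S m)) 1); [lia|].
          replace (S (S m) - 1)%nat with (S m) by lia.
          pose proof (Ho (S m) ltac:(lia)). lra. }
  destruct (P n ltac:(lia)) as [(k & Hk & K)|L].
  - exists k. split; auto; lia.
  - exists (S n). split; [lia|]. split; auto. unfold slab_hi.
    destruct (le_lt_dec (S n) n); [lia|lra].
Qed.

Lemma slab_end k c : (1 <= k <= n + 1)%nat -> -1 < c < 1 ->
  bounding_height n b k c <-> c = slab_hi k \/ c = slab_lo k.
Proof.
  intros Hk Hc. unfold bounding_height, slab_hi, slab_lo.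
  destruct (le_lt_dec k n) as [H2|H2], (le_lt_dec k 1) as [H1|H1];
    (split; [intros [[? ?]|[? ?]]; (lia || auto)|intros [?|?]; try lra; auto]).
Qed.

Lemma bounding_height_range k c : (1 <= k <= n + 1)%nat -> bounding_height n b k c -> -1 < c < 1.
Proof. intros Hk [[H ->]|[H ->]]; apply b_bounds; lia. Qed.

(** ** The compact disks *)

Lemma fam_I_pos a s : 0 < a -> -2 < s < 2 -> fam_I n b a s.
Proof.
  intros Ha Hs. split; auto. intros j _. unfold pole_sq.
  pose proof (pow2_ge_0 (s - b j)). assert (0 < a ^ 2) by (apply pow_lt; auto). lra.
Qed.

Lemma disk_polar_dom i s t : closed_disk (s, t) -> polar_dom (fam_I n b (aseq i)) (s, t).
Proof.
  intros H. apply closed_disk_iff in H. destruct (disk_bounds s t H).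
  split; simpl; [|lra]. apply fam_I_pos; [apply aseq_pos|lra].
Qed.

Lemma compact_disk i : compact_embedded_minimal_disk (fp (aseq i)).
Proof.
  split; [|split].
  - exists (polar_dom (fam_I n b (aseq i))). split; [|split].
    + apply (open_polar_dom _ _ _ _ (SD _ (aseq_adm i))).
    + intros [s t]; apply disk_polar_dom.
    + apply (polar_patch_smooth _ _ _ _ (SD _ (aseq_adm i))).
  - intros s t H.
    destruct (polar_patch_curvature _ _ _ _ (SD _ (aseq_adm i)) s t (disk_polar_dom i s t H)) as (R1 & R2 & _).
    split; auto.
  - intros s t s' t' H H' E.
    apply (polar_patch_inj _ _ _ _ (SD _ (aseq_adm i)) s t s' t'); auto; apply disk_polar_dom; auto.
Qed.

Lemma fp_norm a s t : adm a -> polar_dom (fam_I n b a) (s, t) -> norm (fp a s t) = norm ((s, t) : R2).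
Proof.
  intros Ha H. rewrite norm_R2. apply (polar_patch_norm _ _ _ _ (SD a Ha)), H.
Qed.

Lemma disk_axis i t : -1 <= t <= 1 -> image closed_disk (fp (aseq i)) (0, 0, t).
Proof.
  intros Ht. exists t, 0. split.
  - apply closed_disk_iff. nra.
  - apply (polar_patch_axis _ _ _ _ (SD _ (aseq_adm i))). apply fam_I_pos; [apply aseq_pos|lra].
Qed.

Lemma disk_sqnorm i s t : closed_disk (s, t) ->
  sqnorm_A_at (fp (aseq i)) (fp (aseq i) s t) = fam_curv n b (aseq i) s (fam_root n b (aseq i) s t).
Proof.
  intros H. unfold sqnorm_A_at.
  set (Q := fun q : R2 => closed_disk q /\ fp (aseq i) (fst q) (snd q) = fp (aseq i) s t).
  assert (E : exists q, Q q) by (exists (s, t); split; auto).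
  pose proof (epsilon_spec (inhabits (0, 0)) Q E) as [E1 E2].
  set (q := epsilon (inhabits (0, 0)) Q) in *. destruct q as [s' t'] eqn:Eq. simpl in E2.
  destruct (compact_disk i) as (_ & _ & Inj).
  destruct (Inj _ _ _ _ E1 H E2) as [-> ->]. simpl.
  apply (polar_patch_curvature _ _ _ _ (SD _ (aseq_adm i)) s t (disk_polar_dom i s t H)).
Qed.

(** ** Blow-up and bounds of the curvature *)

Lemma curvature_blowup j : (1 <= j <= n)%nat ->
  is_lim_seq (fun i => sqnorm_A_at (fp (aseq i)) (0, 0, b j)) p_infty.
Proof.
  intros Hj. pose proof (b_bounds j Hj) as Bj.
  apply (is_lim_seq_le_p_loc INR); [|apply is_lim_seq_INR].
  exists 0%nat. intros i _.
  assert (HI : fam_I n b (aseq i) (b j)) by (apply fam_I_pos; [apply aseq_pos|lra]).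
  assert (E : (0, 0, b j) = fp (aseq i) (b j) 0)
    by (symmetry; apply (polar_patch_axis _ _ _ _ (SD _ (aseq_adm i))), HI).
  assert (CD : closed_disk (b j, 0)) by (apply closed_disk_iff; nra).
  rewrite E, disk_sqnorm by auto.
  assert (R0 : fam_root n b (aseq i) (b j) 0 = 0).
  { pose proof (root_radius_unique _ _ _ _ (SD _ (aseq_adm i)) (b j) 0
      (strip_axis _ _ _ _ (SD _ (aseq_adm i)) _ HI)) as U.
    rewrite radius_0 in U. apply U. rewrite Rabs_R0. lra. }
  rewrite R0.
  eapply Rle_trans; [|apply (fam_curv_pole n b Hn Hb (aseq i) (adm_bounds _ (aseq_adm i)) j (aseq_pos i) Hj)].
  unfold aseq. rewrite S_INR. set (x := INR i). pose proof (pos_INR i) as Hx. fold x in Hx.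
  replace (/ (/ (4 * (x + 1))) ^ 2) with ((4 * (x + 1)) ^ 2) by (field; lra).
  rewrite Lc_eq.
  assert (1 <= (4 * (x + 1)) ^ 2 /\ x <= (4 * (x + 1)) ^ 2) by (split; nra). nra.
Qed.

Lemma min_radius (delta : nat -> R) : (forall j, (1 <= j <= n)%nat -> 0 < delta j) ->
  exists d, 0 < d /\ forall j, (1 <= j <= n)%nat -> d <= delta j.
Proof.
  clear. induction n as [|m IH]; intros H.
  - exists 1. split; [lra|]. intros; lia.
  - destruct IH as (d & Hd & K); [intros; apply H; lia|].
    exists (Rmin d (delta (S m))). split; [apply Rmin_pos; auto; apply H; lia|].
    intros j Hj. destruct (Nat.eq_dec j (S m)) as [->|N]; [apply Rmin_r|].
    eapply Rle_trans; [apply Rmin_l|apply K; lia].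
Qed.

(** A point at distance [d] from all the singular points is at distance at least
    [d / 2] from the axis, or its height differs by at least [d / 2] from all the
    heights [b j]. *)
Lemma curvature_bound (delta : nat -> R) : (forall j, (1 <= j <= n)%nat -> 0 < delta j) ->
  exists C : R, forall (i : nat) (p : R3), image closed_disk (fp (aseq i)) p ->
    (forall j, (1 <= j <= n)%nat -> ~ ball3 (delta j) (0, 0, b j) p) ->
    sqnorm_A_at (fp (aseq i)) p <= C.
Proof.
  intros Hd. destruct (min_radius delta Hd) as (d & Hd0 & Hdj).
  set (C1 := 640 * Lc ^ 2 / (8 * ell) ^ 4 / (d / 2) ^ 4).
  set (C2 := 10 * (Lc * (INR n * / (d / 2) ^ 2)) ^ 2).
  exists (Rmax C1 C2). intros i p (s & t & Hq & E) Hp. rewrite <- E, disk_sqnorm by auto.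
  pose proof (disk_polar_dom i s t Hq) as PD.
  destruct (root_radius_spec _ _ _ _ (SD _ (aseq_adm i)) s t PD) as [D1 D2].
  destruct (Rle_dec (d / 2) (Rabs t)) as [L|L].
  - eapply Rle_trans; [|apply Rmax_l].
    apply (fam_curv_off_axis n b Hn Hb (aseq i) (adm_bounds _ (aseq_adm i))); [exact D1|lra|].
    unfold fam_root. rewrite D2. exact L.
  - eapply Rle_trans; [|apply Rmax_r].
    apply (fam_curv_off_heights n b Hn Hb (aseq i) (adm_bounds _ (aseq_adm i))); [exact D1|lra|].
    intros j Hj. apply Rnot_lt_le. intros N. apply (Hp j Hj). unfold ball3.
    apply Rlt_le_trans with d; [|apply Hdj, Hj].
    destruct (minus_coords p (0, 0, b j)) as (M1 & M2 & M3).
    rewrite norm_R3, M1, M2, M3. unfold x1 at 2, x2 at 2, x3 at 2; cbn [fst snd]. rewrite !Rminus_0_r.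
    destruct (polar_patch_dist _ _ _ _ (SD _ (aseq_adm i)) s t PD) as [P1 P2].
    rewrite <- E. change (x3 (fp (aseq i) s t)) with s.
    change (x1 (fp (aseq i) s t) ^ 2 + x2 (fp (aseq i) s t) ^ 2 = t ^ 2) in P1. rewrite P1.
    rewrite <- (sqrt_pow2 d) by lra. apply sqrt_lt_1_alt.
    pose proof (pow2_ge_0 t). pose proof (pow2_ge_0 (s - b j)). split; [lra|].
    rewrite <- (pow2_abs t), <- (pow2_abs (s - b j)).
    pose proof (Rabs_pos t). pose proof (Rabs_pos (s - b j)). nra.
Qed.

Lemma compact_graphs i : exists E1 u1 E2 u2,
  off_axis_two_graphs (image closed_disk (fp (aseq i))) E1 u1 E2 u2.
Proof.
  do 4 eexists. apply (two_graphs _ _ _ _ (SD _ (aseq_adm i)) (-2) 2 true); try lra.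
  - intros s Hs. apply fam_I_pos; auto. apply aseq_pos.
  - intros p. split.
    + intros (s & t & H & E). apply closed_disk_iff in H. destruct (disk_bounds s t H).
      exists s, t. split; [lra|]. split; auto.
    + intros (s & t & _ & H & E). exists s, t. split; auto. apply closed_disk_iff; auto.
Qed.

(** ** The limit disks *)

Definition limit_disk (k : nat) : patch := fun p q =>
  fp 0 (lens_s (slab_lo k) (slab_hi k) p q) (lens_t (slab_lo k) (slab_hi k) p q).

Lemma slab_polar_dom k s t : (1 <= k <= n + 1)%nat -> slab_lo k < s < slab_hi k -> s ^ 2 + t ^ 2 < 1 ->
  polar_dom (fam_I n b 0) (s, t).
Proof.
  intros Hk Hs Ht. destruct (disk_bounds s t ltac:(lra)). split; simpl; [|lra].
  apply slab_heights with k; auto.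
Qed.

Lemma limit_disk_iff k p : (1 <= k <= n + 1)%nat ->
  image open_disk (limit_disk k) p <->
  exists s t, slab_lo k < s < slab_hi k /\ s ^ 2 + t ^ 2 < 1 /\ fp 0 s t = p.
Proof.
  intros Hk. destruct (slab_bounds k Hk) as (B1 & B2 & B3). split.
  - intros (x & y & H & E). destruct (lens_in _ _ B1 B2 B3 x y H).
    exists (lens_s (slab_lo k) (slab_hi k) x y), (lens_t (slab_lo k) (slab_hi k) x y). auto.
  - intros (s & t & Hs & Ht & E). destruct (lens_surj _ _ B2 s t Hs Ht) as (x & y & H & E1 & E2).
    exists x, y. split; auto. unfold limit_disk. rewrite E1, E2. exact E.
Qed.

Lemma limit_disk_in_ball k p : (1 <= k <= n + 1)%nat -> image open_disk (limit_disk k) p ->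
  norm p < 1 /\ slab_lo k < x3 p < slab_hi k.
Proof.
  intros Hk H. apply limit_disk_iff in H; auto. destruct H as (s & t & Hs & Ht & <-).
  rewrite (fp_norm 0 s t adm_0) by (apply slab_polar_dom with k; auto).
  split; [apply open_disk_iff; auto|exact Hs].
Qed.

Lemma sheet_limit_disk k p : (1 <= k <= n + 1)%nat -> norm p < 1 ->
  slab_lo k < x3 p < slab_hi k -> sheet n b 0 p -> image open_disk (limit_disk k) p.
Proof.
  intros Hk Hp Hs H. destruct (sheet_patch n b Hn Hb 0 p adm_0 Hp H) as (t & Ht & _ & E).
  apply norm_lt_1_R3 in Hp. apply limit_disk_iff; auto.
  exists (x3 p), t. split; auto. split; auto.
  destruct (polar_patch_dist _ _ _ _ (SD 0 adm_0) (x3 p) t) as [P1 _].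
  { split; simpl; [apply slab_heights with k; auto|lra]. }
  change (x1 (fp 0 (x3 p) t) ^ 2 + x2 (fp 0 (x3 p) t) ^ 2 = t ^ 2) in P1.
  change (fp 0 (x3 p) t = p) in E. rewrite E in P1. lra.
Qed.

Lemma limit_disk_sheet p : norm p < 1 -> off_heights n b (x3 p) ->
  (exists k, (1 <= k <= n + 1)%nat /\ image open_disk (limit_disk k) p) <-> sheet n b 0 p.
Proof.
  intros Hp Ho. split.
  - intros (k & Hk & H). apply limit_disk_iff in H; auto. destruct H as (s & t & Hs & Ht & <-).
    destruct (root_radius_spec _ _ _ _ (SD 0 adm_0) s t (slab_polar_dom k s t Hk Hs Ht)) as [D1 _].
    exists s, (fam_root n b 0 s t). split; [exact D1|]. split; auto.
  - intros H. destruct (slab_cover (x3 p)) as (k & Hk & Hs); auto.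
    + apply norm_lt_1_R3 in Hp. pose proof (pow2_ge_0 (x1 p)). pose proof (pow2_ge_0 (x2 p)).
      split; nra.
    + exists k. split; auto. apply sheet_limit_disk; auto.
Qed.

(** The inverse is continuous because the height, the distance to the axis and the
    side of the axis determine the parameters continuously. *)
Lemma limit_disk_minimal k : (1 <= k <= n + 1)%nat -> open_embedded_minimal_disk (limit_disk k).
Proof.
  intros Hk. destruct (slab_bounds k Hk) as (B1 & B2 & B3).
  set (lo := slab_lo k) in *. set (hi := slab_hi k) in *.
  destruct (smooth_lens lo hi B1 B2 B3) as [S1 S2].
  pose proof (open_polar_dom _ _ _ _ (SD 0 adm_0)) as HO. pose proof open_open_disk as HD.
  assert (Hmap : forall x y, open_disk (x, y) -> polar_dom (fam_I n b 0) (lens_s lo hi x y, lens_t lo hi x y)).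
  { intros x y H. destruct (lens_in _ _ B1 B2 B3 x y H). apply slab_polar_dom with k; auto. }
  pose proof (polar_patch_smooth _ _ _ _ (SD 0 adm_0)) as SP.
  refine (conj _ (conj _ (conj _ _))).
  - exact (smooth_patch_reparam _ _ _ _ HO HD S1 S2 Hmap _ SP).
  - intros x y H.
    destruct (polar_patch_curvature _ _ _ _ (SD 0 adm_0) _ _ (Hmap x y H)) as (R1 & R2 & _).
    destruct (reparam_curvature _ _ _ _ _ x y HO HD S1 S2 Hmap SP H
      (lens_jacobian lo hi B1 B2 B3 x y H) R1) as (Q1 & Q2 & _).
    split; [exact Q1|apply Q2, R2].
  - intros x y x' y' H H' E.
    destruct (polar_patch_inj _ _ _ _ (SD 0 adm_0) _ _ _ _ (Hmap _ _ H) (Hmap _ _ H') E) as [E1 E2].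
    apply (lens_inj lo hi B1 B2 B3); auto.
  - intros x y H eps Heps.
    set (Y := limit_disk k).
    (* the filter of parameters whose points tend to [Y x y] *)
    set (F := fun P : R2 -> Prop => exists de, 0 < de /\ forall x' y', open_disk (x', y') ->
      norm (minus (Y x' y') (Y x y)) < de -> P (x', y')).
    assert (FF : Filter F).
    { constructor.
      - exists 1. split; [lra|auto].
      - intros P1 P2 (d1 & Hd1 & K1) (d2 & Hd2 & K2). exists (Rmin d1 d2). split; [apply Rmin_pos; auto|].
        intros x' y' Hx' Hd. split; [apply K1|apply K2]; auto; eapply Rlt_le_trans; eauto; [apply Rmin_l|apply Rmin_r].
      - intros P1 P2 HP (d1 & Hd1 & K1). exists d1. split; auto. }
    assert (LY : forall f, (forall p, Rabs (f p) <= norm p) -> (forall p q, f (minus p q) = f p - f q) ->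
       filterlim (fun q : R2 => f (Y (fst q) (snd q))) F (locally (f (Y x y)))).
    { intros f Hf1 Hf2. apply filterlim_R; auto. intros e He. exists e. split; auto.
      intros x' y' _ Hd. simpl. rewrite <- Hf2. eapply Rle_lt_trans; [apply Hf1|exact Hd]. }
    assert (L1 := LY x1 (fun p => proj1 (coord_le_norm p)) (fun p q => proj1 (minus_coords p q))).
    assert (L2 := LY x2 (fun p => proj1 (proj2 (coord_le_norm p))) (fun p q => proj1 (proj2 (minus_coords p q)))).
    assert (L3 := LY x3 (fun p => proj2 (proj2 (coord_le_norm p))) (fun p q => proj2 (proj2 (minus_coords p q)))).
    assert (LD : F open_disk) by (exists 1; split; [lra|auto]).
    set (s := fun q : R2 => lens_s lo hi (fst q) (snd q)).
    set (t := fun q : R2 => lens_t lo hi (fst q) (snd q)).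
    assert (Ls : filterlim s F (locally (lens_s lo hi x y))) by exact L3.
    assert (Lt : filterlim t F (locally (lens_t lo hi x y))).
    { apply (polar_inverse_lim _ _ _ _ (SD 0 adm_0) F s t (lens_s lo hi x y) (lens_t lo hi x y)); auto.
      revert LD. apply filter_imp. intros [x' y']; apply Hmap. }
    assert (Lx : filterlim (fun q : R2 => fst q) F (locally x)).
    { apply (filterlim_ext (fun q => (s q - (lo + hi) / 2) / ((hi - lo) / 2))).
      - intros q. unfold s, lens_s. field. lra.
      - replace x with ((lens_s lo hi x y - (lo + hi) / 2) / ((hi - lo) / 2)) by (unfold lens_s; field; lra).
        apply lim_div; [lra| |apply lim_const]. apply lim_minus; auto. apply lim_const. }
    destruct (lens_pos lo hi B1 B2 B3 x y H) as (P1 & P2 & P3).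
    assert (Q2 : 0 < sqrt (1 - lens_s lo hi x y ^ 2)) by (apply sqrt_lt_R0; auto).
    assert (Q3 : 0 < sqrt (1 - x ^ 2)) by (apply sqrt_lt_R0; auto).
    assert (Ly : filterlim (fun q : R2 => snd q) F (locally y)).
    { apply (filterlim_ext_loc (fun q => t q * (sqrt (1 - fst q ^ 2) / sqrt (1 - s q ^ 2)))).
      - revert LD. apply filter_imp. intros [x' y'] H'. cbn [fst snd].
        destruct (lens_pos lo hi B1 B2 B3 x' y' H') as (P1' & P2' & P3').
        assert (0 < sqrt (1 - lens_s lo hi x' y' ^ 2)) by (apply sqrt_lt_R0; auto).
        assert (0 < sqrt (1 - x' ^ 2)) by (apply sqrt_lt_R0; auto).
        unfold t, s, lens_t. cbn [fst snd]. field. split; lra.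
      - replace y with (lens_t lo hi x y * (sqrt (1 - x ^ 2) / sqrt (1 - lens_s lo hi x y ^ 2)))
          by (unfold lens_t; field; split; lra).
        apply lim_mult; auto. apply lim_div; [lra| |].
        + apply (lim_comp1 sqrt); [apply continuity_pt_sqrt; lra|].
          apply lim_minus; [apply lim_const|apply lim_pow; auto].
        + apply (lim_comp1 sqrt); [apply continuity_pt_sqrt; lra|].
          apply lim_minus; [apply lim_const|apply lim_pow; auto]. }
    assert (A1 := proj1 (filterlim_R F _ _) Lx (eps / 2) ltac:(lra)).
    assert (A2 := proj1 (filterlim_R F _ _) Ly (eps / 2) ltac:(lra)).
    destruct (filter_and _ _ A1 A2) as (de & Hde & K). exists de. split; auto.
    intros x' y' Hx' Hd'. destruct (K x' y' Hx' Hd') as [K1 K2]. simpl in K1, K2.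
    rewrite norm_R2. change (fst (minus (x', y') (x, y))) with (x' - x).
    change (snd (minus (x', y') (x, y))) with (y' - y).
    rewrite <- (pow2_abs (x' - x)), <- (pow2_abs (y' - y)).
    rewrite <- (sqrt_pow2 eps) by lra. apply sqrt_lt_1_alt.
    pose proof (Rabs_pos (x' - x)). pose proof (Rabs_pos (y' - y)).
    split; [apply Rplus_le_le_0_compat; apply pow2_ge_0|]. nra.
Qed.

End Assembly.

(** ** Convergence of the disks *)

Lemma frame_nbhd (p : R3) (c s : R) (wid hei : posreal) : s ^ 2 + c ^ 2 = 1 ->
  locally p (in_box (Box p (0, 0, 1) (c, s, 0) (- s, c, 0) wid hei)).
Proof.
  intros Hcs. destruct (x_continuous p) as (L1 & L2 & L3).
  assert (K : forall g h : R, filterlim (fun q => g * (x1 q - x1 p) + h * (x2 q - x2 p)) (locally p) (locally 0)).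
  { intros g h. replace 0 with (g * (x1 p - x1 p) + h * (x2 p - x2 p)) by ring.
    apply (lim_plus (F := locally p)); apply (lim_mult (F := locally p)); try apply lim_const;
      apply (lim_minus (F := locally p)); auto; apply lim_const. }
  pose proof (proj1 (filterlim_R (locally p) _ _) L3 wid (cond_pos wid)) as A1.
  pose proof (proj1 (filterlim_R (locally p) _ _) (K c s) wid (cond_pos wid)) as A2.
  pose proof (proj1 (filterlim_R (locally p) _ _) (K (- s) c) hei (cond_pos hei)) as A3.
  generalize (filter_and _ _ A1 (filter_and _ _ A2 A3)). apply filter_imp.
  intros q (B1 & B2 & B3). rewrite Rminus_0_r in B2, B3.
  exists (x3 q - x3 p), (c * (x1 q - x1 p) + s * (x2 q - x2 p)), (- s * (x1 q - x1 p) + c * (x2 q - x2 p)).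
  split; [split; simpl; auto|]. split; [simpl; auto|].
  set (t := x3 q - x3 p). set (y := c * (x1 q - x1 p) + s * (x2 q - x2 p)).
  set (z := - s * (x1 q - x1 p) + c * (x2 q - x2 p)).
  apply R3_eq.
  - change (x1 q = x1 p + (t * 0 + (y * c + z * - s))). unfold y, z.
    transitivity (x1 p + (s ^ 2 + c ^ 2) * (x1 q - x1 p)); [rewrite Hcs; ring|ring].
  - change (x2 q = x2 p + (t * 0 + (y * s + z * c))). unfold y, z.
    transitivity (x2 p + (s ^ 2 + c ^ 2) * (x2 q - x2 p)); [rewrite Hcs; ring|ring].
  - change (x3 q = x3 p + (t * 1 + (y * 0 + z * 0))). unfold t. ring.
Qed.

Section Convergence.
Variables (n : nat) (b : nat -> R).
Hypotheses (Hn : (1 <= n)%nat) (Hb : forall j, (1 <= j <= n)%nat -> Rabs (b j) < 1)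
  (Hord : forall j k, (1 <= j)%nat -> (j < k)%nat -> (k <= n)%nat -> b j < b k).

Let SD a (Ha : adm a) := fam_data n b Hn Hb a (adm_bounds a Ha).
Let Sg i p := image closed_disk (fam_patch n b (aseq i)) p /\ off_planes n b p.
Let Sl p := exists k, (1 <= k <= n + 1)%nat /\ image open_disk (limit_disk n b k) p.

Lemma disk_sheet i p : norm p < 1 -> off_heights n b (x3 p) ->
  (Sg i p <-> sheet n b (aseq i) p).
Proof.
  intros Hp Ho. split.
  - intros [(s & t & H & E) _].
    destruct (root_radius_spec _ _ _ _ (SD _ (aseq_adm i)) s t (disk_polar_dom n b i s t H)) as [D1 _].
    exists s, (fam_root n b (aseq i) s t). split; [exact D1|]. split; [|exact E].
    rewrite <- E in Ho. exact Ho.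
  - intros H. split; [|exact Ho].
    destruct (sheet_patch n b Hn Hb _ p (aseq_adm i) Hp H) as (t & Ht & Et & E).
    exists (x3 p), t. split; auto. apply closed_disk_iff. apply norm_lt_1_R3 in Hp.
    assert (t ^ 2 = x1 p ^ 2 + x2 p ^ 2).
    { pose proof (pow2_ge_0 (x1 p)). pose proof (pow2_ge_0 (x2 p)).
      destruct Et as [->| ->]; [|replace ((- sqrt (x1 p ^ 2 + x2 p ^ 2)) ^ 2) with (sqrt (x1 p ^ 2 + x2 p ^ 2) ^ 2) by ring];
        apply pow2_sqrt; lra. }
    lra.
Qed.

(** The sets by which a compact set is covered: each lies in a box of graphs, or is
    eventually disjoint from all the surfaces. *)
Definition charted (U : R3 -> Prop) : Prop :=
  (exists Q, orthonormal_box Q /\ C2_converges_in_box Q Sg Sl /\ forall q, U q -> in_box Q q) \/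
  eventually (fun i => forall q, U q -> norm q < 1 -> off_heights n b (x3 q) -> ~ (Sl q \/ Sg i q)).

Lemma charted_near p : norm p < 1 -> off_heights n b (x3 p) ->
  exists U : R3 -> Prop, charted U /\ open U /\ U p.
Proof.
  intros Hp Ho. destruct (classic (sheet n b 0 p)) as [S|S].
  - destruct S as (s0 & y0 & H0 & _ & E).
    destruct (good_near n b Hn Hb s0 y0 H0) as (e & He & P & d & HP & Hd & HG).
    assert (Hw : norm (weier (fam_u n b 0) (fam_v n b 0) s0 y0) < 1) by (rewrite E; exact Hp).
    destruct (sheet_graphs n b Hn Hb s0 y0 H0 e d P He Hd HP HG Hw) as (wid & hei & G1 & G2 & G3).
    set (Q := sheet_frame n b s0 y0 wid hei) in *.
    exists (fun q => locally q (in_box Q)). split; [left; exists Q; split; [|split]|split].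
    + exact (sheet_frame_orthonormal n b s0 y0 wid hei).
    + exists (fun i => graph n b s0 y0 (aseq i)), (graph n b s0 y0 0). split; [|split].
      * apply (At0_0 _ G2). intros q Hq Hoq. apply (limit_disk_sheet n b Hn Hb Hord q Hq Hoq).
      * pose proof (aseq_lim _ G2) as G2'. unfold filtermap in G2'. revert G2'. apply filter_imp. intros i Hi. apply Hi.
        intros q Hq Hoq. apply disk_sheet; auto.
      * intros eps Heps. exact (aseq_lim _ (G3 eps Heps)).
    + intros q Hq. apply (locally_singleton _ _ Hq).
    + intros q Hq. apply locally_locally, Hq.
    + rewrite <- E. apply frame_nbhd. exact (trig_al n b s0).
  - destruct (empty_near n b Hn Hb p Hp Ho S) as (U & OU & Up & HU).
    exists U. split; [right|auto].
    pose proof (At0_0 _ HU) as HU0.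
    pose proof (aseq_lim _ HU) as HU'. unfold filtermap in HU'. revert HU'. apply filter_imp. intros i Hi q Uq Hq Hoq [H|H].
    + apply (HU0 q Uq Hq). apply (limit_disk_sheet n b Hn Hb Hord q Hq Hoq). exact H.
    + apply (Hi q Uq Hq). apply disk_sheet; auto.
Qed.

Lemma charted_list (l : list (R3 -> Prop)) : (forall U, In U l -> charted U) ->
  exists lb : list box,
    (forall Q, In Q lb -> orthonormal_box Q /\ C2_converges_in_box Q Sg Sl) /\
    eventually (fun i => forall p, norm p < 1 -> off_heights n b (x3 p) ->
      (exists U, In U l /\ U p) -> Sl p \/ Sg i p -> exists Q, In Q lb /\ in_box Q p).
Proof.
  induction l as [|U l IH]; intros H.
  - exists nil. split; [intros Q []|]. exists 0%nat. intros i _ p _ _ (U & [] & _).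
  - destruct IH as (lb & B1 & B2); [intros V HV; apply H; right; auto|].
    destruct (H U (or_introl eq_refl)) as [(Q & O & C & HQ)|HU].
    + exists (Q :: lb). split.
      * intros Q' [<-|HQ']; auto.
      * revert B2. apply filter_imp. intros i B p Hp Ho (V & [<-|HV] & Vp) HS.
        -- exists Q. split; [left; auto|auto].
        -- destruct (B p Hp Ho) as (Q' & I1 & I2); eauto. exists Q'. split; [right; auto|auto].
    + exists lb. split; auto. generalize (filter_and _ _ B2 HU). apply filter_imp.
      intros i [B B'] p Hp Ho (V & [<-|HV] & Vp) HS.
      * exfalso. apply (B' p Vp Hp Ho HS).
      * apply B; eauto.
Qed.

Lemma disks_converge : C2_converges_on_compacts (fun p => unit_ball p /\ off_planes n b p) Sg Sl.
Proof.
  intros K HK HO. destruct (HK (fun U => charted U /\ open U)) as (l & L1 & L2).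
  - intros U [_ H]; auto.
  - intros p Hp. destruct (HO p Hp) as [H1 H2]. destruct (charted_near p H1 H2) as (U & C & O & Up).
    exists U; auto.
  - destruct (charted_list l) as (lb & B1 & B2); [intros U HU; apply (L1 U HU)|].
    exists lb. split; auto. revert B2. apply filter_imp. intros i B p Hp HS.
    destruct (HO p Hp) as [H1 H2]. apply B; auto.
Qed.

End Convergence.

(** ** Spiralling of the limit disks *)

Lemma sumj_split n f k : (1 <= k <= n)%nat ->
  sumj n f = f k + sumj n (fun j => if Nat.eqb j k then 0 else f j).
Proof.
  induction n as [|n IH]; intros Hk; [lia|]. cbn [sumj].
  destruct (Nat.eq_dec k (S n)) as [->|N].
  - rewrite Nat.eqb_refl.
    rewrite (sumj_ext n (fun j => if Nat.eqb j (S n) then 0 else f j) f); [ring|].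
    intros j Hj. destruct (Nat.eqb_spec j (S n)); [lia|auto].
  - rewrite IH by lia. destruct (Nat.eqb_spec (S n) k) as [E|_]; [congruence|]. ring.
Qed.

Section Spiralling.
Variables (n : nat) (b : nat -> R).
Hypotheses (Hn : (1 <= n)%nat) (Hb : forall j, (1 <= j <= n)%nat -> Rabs (b j) < 1)
  (Hord : forall j k, (1 <= j)%nat -> (j < k)%nat -> (k <= n)%nat -> b j < b k).

Let SD := fam_data n b Hn Hb 0 (adm_bounds 0 adm_0).

(** Near the height of one pole, its term dominates the sum. *)
Lemma axis_angle_diverges k sg M : (1 <= k <= n)%nat -> sg = 1 \/ sg = -1 ->
  exists e, 0 < e /\ forall s, Rabs (s - b k) < e -> 0 < sg * (b k - s) -> M < sg * fam_u n b 0 s 0.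
Proof.
  intros Hk Hsg.
  set (r := fun s => sumj n (fun j => if Nat.eqb j k then 0 else axis_term 0 (s - b j))).
  assert (L : exists l, filterlim r (locally (b k)) (locally l)).
  { exists (sumj n (fun j => if Nat.eqb j k then 0 else axis_term 0 (b k - b j))).
    apply (sumj_lim (locally (b k)) n (fun s j => if Nat.eqb j k then 0 else axis_term 0 (s - b j))
      (fun j => if Nat.eqb j k then 0 else axis_term 0 (b k - b j))).
    intros j Hj. destruct (Nat.eqb_spec j k) as [E|N]; [apply lim_const|].
    assert (b k - b j <> 0).
    { destruct (Nat.lt_total j k) as [Q|[Q|Q]]; [|congruence|].
      - pose proof (Hord j k ltac:(lia) Q ltac:(lia)). lra.
      - pose proof (Hord k j ltac:(lia) Q ltac:(lia)). lra. }
    apply (ex_derive_continuous (fun s => axis_term 0 (s - b j)) (b k)).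
    exists (scal 1 (/ ((b k - b j) ^ 2 + 0 ^ 2))).
    apply (is_derive_comp (K := R_AbsRing) (V := R_NormedModule) (axis_term 0) (fun s => s - b j)).
    - apply axis_term_derive; [lra|]. pose proof (pow2_gt_0 _ H). lra.
    - auto_derive; auto. }
  destruct L as [l L].
  destruct (proj1 (filterlim_R (locally (b k)) _ _) L 1 Rlt_0_1) as [e1 He1].
  (* Within [/ B] of [b k] the term of this pole exceeds [B]. *)
  set (B := Rabs M + Rabs l + 1).
  assert (HB : 0 < B) by (unfold B; pose proof (Rabs_pos M); pose proof (Rabs_pos l); lra).
  exists (Rmin e1 (/ B)). split; [apply Rmin_pos; [apply cond_pos|apply Rinv_0_lt_compat, HB]|].
  intros s Hs Hd.
  assert (Rl : Rabs (r s - l) < 1) by (apply He1; eapply Rlt_le_trans; [exact Hs|apply Rmin_l]).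
  assert (E : fam_u n b 0 s 0 = Lc * (- / (s - b k) + r s)).
  { unfold fam_u, prim_u. rewrite Rmult_0_l, Rminus_0_r. unfold axis_fun. f_equal.
    rewrite (sumj_split n _ k Hk). f_equal. unfold axis_term.
    destruct (Req_EM_T 0 0); [reflexivity|congruence]. }
  set (d := sg * (b k - s)) in *.
  assert (Ed : Rabs (s - b k) = d).
  { unfold d in *. destruct Hsg as [->| ->].
    - rewrite Rabs_left; lra.
    - rewrite Rabs_pos_eq; lra. }
  assert (Hi : B < / d).
  { rewrite <- (Rinv_inv B). apply Rinv_lt_contravar.
    - exact (Rmult_lt_0_compat _ _ Hd (Rinv_0_lt_compat _ HB)).
    - rewrite <- Ed. eapply Rlt_le_trans; [exact Hs|apply Rmin_r]. }
  assert (Ei : sg * - / (s - b k) = / d).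
  { unfold d in *. destruct Hsg as [->| ->]; field; lra. }
  rewrite E. replace (sg * (Lc * (- / (s - b k) + r s))) with (Lc * (sg * - / (s - b k) + sg * r s)) by ring.
  rewrite Ei.
  assert (Hr : Rabs (sg * r s) <= Rabs l + 1).
  { rewrite Rabs_mult. replace (Rabs sg) with 1 by (destruct Hsg as [->| ->]; [rewrite Rabs_R1|rewrite Rabs_left]; lra).
    rewrite Rmult_1_l. replace (r s) with (r s - l + l) by ring.
    eapply Rle_trans; [apply Rabs_triang|]. lra. }
  apply Rabs_le_between in Hr. pose proof (Rle_abs M). pose proof (Rabs_pos M).
  assert (1 <= Lc) by (rewrite Lc_eq; lra).
  unfold B in Hi. nra.
Qed.

Lemma limit_graphs k : (1 <= k <= n + 1)%nat -> exists E1 u1 E2 u2,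
  off_axis_two_graphs (image open_disk (limit_disk n b k)) E1 u1 E2 u2 /\
  forall c, bounding_height n b k c -> spirals_into E1 u1 c /\ spirals_into E2 u2 c.
Proof.
  intros Hk. destruct (slab_bounds n b Hn Hb Hord k Hk) as (B1 & B2 & B3).
  set (lo := slab_lo b k) in *. set (hi := slab_hi n b k) in *.
  assert (HI : forall s, lo < s < hi -> fam_I n b 0 s) by (intros s; apply (slab_heights n b Hn Hb Hord k s Hk)).
  do 4 eexists. split.
  - apply (two_graphs _ _ _ _ SD lo hi false HI); try lra.
    intros p. apply (limit_disk_iff n b Hn Hb Hord k p Hk).
  - intros c Hc. pose proof (Rabs_def1 c 1) as Hc1.
    destruct (bounding_height_range n b Hn Hb k c Hk Hc) as [C1 C2]. specialize (Hc1 C2 C1).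
    assert (S : forall kappa, spirals_into
      (mv_domain (polar_angle (fam_eta n b 0) (fam_u n b 0) (fam_v n b 0)) kappa (half_disk false lo hi))
      (mv_height (polar_angle (fam_eta n b 0) (fam_u n b 0) (fam_v n b 0)) kappa (between lo hi)) c); [|split; apply S].
    intros kappa. destruct Hc as [[Hkn Ec]|[Hk2 Ec]].
    + assert (Eh : hi = c) by (unfold hi, slab_hi; destruct (le_lt_dec k n); [congruence|lia]).
      apply (polar_spirals _ _ _ _ SD lo hi HI kappa c 1 Hc1).
      * left; reflexivity.
      * intros e He. exists (hi - Rmin (e / 2) ((hi - lo) / 2)).
        assert (0 < Rmin (e / 2) ((hi - lo) / 2)) by (apply Rmin_pos; lra).
        pose proof (Rmin_l (e / 2) ((hi - lo) / 2)). pose proof (Rmin_r (e / 2) ((hi - lo) / 2)).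
        split; [lra|]. rewrite <- Eh. apply Rabs_def1; lra.
      * intros M. destruct (axis_angle_diverges k 1 M ltac:(lia) (or_introl eq_refl)) as (e & He & K).
        exists e. split; auto. intros s Hs He'. rewrite Ec in He'. apply K; auto. lra.
      * lra.
    + assert (Eh : lo = c) by (unfold lo, slab_lo; destruct (le_lt_dec k 1); [lia|congruence]).
      apply (polar_spirals _ _ _ _ SD lo hi HI kappa c (-1) Hc1).
      * right; reflexivity.
      * intros e He. exists (lo + Rmin (e / 2) ((hi - lo) / 2)).
        assert (0 < Rmin (e / 2) ((hi - lo) / 2)) by (apply Rmin_pos; lra).
        pose proof (Rmin_l (e / 2) ((hi - lo) / 2)). pose proof (Rmin_r (e / 2) ((hi - lo) / 2)).
        split; [lra|]. rewrite <- Eh. apply Rabs_def1; lra.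
      * intros M. destruct (axis_angle_diverges (k - 1) (-1) M ltac:(lia) (or_intror eq_refl)) as (e & He & K).
        exists e. split; auto. intros s Hs He'. rewrite Ec in He'. apply K; auto. lra.
      * lra.
Qed.

(** Strictly between its planes the limit disk is relatively closed, by
    [empty_near]; the planes are accumulated because the surface spirals into
    them. *)
Lemma limit_closure k p : (1 <= k <= n + 1)%nat ->
  (unit_ball p /\ closure3 (image open_disk (limit_disk n b k)) p /\ ~ image open_disk (limit_disk n b k) p) <->
  (unit_ball p /\ bounding_height n b k (x3 p)).
Proof.
  intros Hk. destruct (slab_bounds n b Hn Hb Hord k Hk) as (B1 & B2 & B3). split.
  - intros (Hp & Hc & Hno). split; auto.
    assert (R3p : -1 < x3 p < 1).
    { apply norm_lt_1_R3 in Hp. pose proof (pow2_ge_0 (x1 p)). pose proof (pow2_ge_0 (x2 p)). split; nra. }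
    assert (C : forall e, 0 < e -> slab_lo b k - e < x3 p < slab_hi n b k + e).
    { intros e He. destruct (Hc e He) as (q & Hq & Hb'). unfold ball3 in Hb'.
      destruct (limit_disk_in_ball n b Hn Hb Hord k q Hk Hq) as [_ Hs].
      pose proof (proj2 (proj2 (coord_le_norm (minus q p)))) as Q.
      rewrite (proj2 (proj2 (minus_coords q p))) in Q.
      assert (Q' : Rabs (x3 q - x3 p) < e) by lra. apply Rabs_def2 in Q'. lra. }
    apply (slab_end n b Hn k (x3 p) Hk R3p). apply NNPP. intros N.
    assert (Hs : slab_lo b k < x3 p < slab_hi n b k).
    { apply not_or_and in N. destruct N as [N1 N2]. split.
      - destruct (Rtotal_order (slab_lo b k) (x3 p)) as [L|[L|L]]; [auto|congruence|].
        specialize (C (slab_lo b k - x3 p) ltac:(lra)). lra.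
      - destruct (Rtotal_order (x3 p) (slab_hi n b k)) as [L|[L|L]]; [auto|congruence|].
        specialize (C (x3 p - slab_hi n b k) ltac:(lra)). lra. }
    assert (Off : forall q : R3, slab_lo b k < x3 q < slab_hi n b k -> off_heights n b (x3 q)).
    { intros q Hq. apply fam_I_0. apply (slab_heights n b Hn Hb Hord k _ Hk Hq). }
    apply Hno. apply (sheet_limit_disk n b Hn Hb Hord k p Hk Hp Hs). apply NNPP. intros NS.
    destruct (empty_near n b Hn Hb p Hp (Off p Hs) NS) as (U & OU & Up & HU).
    destruct (locally_norm_le_locally p U (OU p Up)) as [e He].
    destruct (Hc e (cond_pos e)) as (q & Hq & Hqb).
    destruct (limit_disk_in_ball n b Hn Hb Hord k q Hk Hq) as [Hq1 Hqs].
    apply (At0_0 _ HU q (He q Hqb) Hq1).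
    apply (limit_disk_sheet n b Hn Hb Hord q Hq1 (Off q Hqs)). exists k; auto.
  - intros [Hp Hc]. split; auto. split.
    + destruct (limit_graphs k Hk) as (E1 & u1 & E2 & u2 & (_ & _ & G) & Sp).
      destruct (Sp _ Hc) as [(_ & Cl & _) _].
      intros e He. destruct (Cl p Hp eq_refl e He) as (q & Hq & Hqb). exists q. split; auto.
      apply (G q). left; auto.
    + intros H. destruct (limit_disk_in_ball n b Hn Hb Hord k p Hk H) as [_ Hs].
      apply (slab_end n b Hn k (x3 p) Hk (bounding_height_range n b Hn Hb k _ Hk Hc)) in Hc. lra.
Qed.

End Spiralling.

Theorem theorem2 (n : nat) (b : nat -> R) :
  (1 <= n)%nat ->
  (forall j : nat, (1 <= j <= n)%nat -> unit_ball (0, 0, b j)) ->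
  (forall j k : nat, (1 <= j)%nat -> (j < k)%nat -> (k <= n)%nat -> b j < b k) ->
  exists X : nat -> patch,
    let Sigma := fun i : nat => image closed_disk (X i) in
    (forall i : nat,
       compact_embedded_minimal_disk (X i) /\
       (forall p : R3, image open_disk (X i) p -> unit_ball p) /\
       (forall p : R3, image circle (X i) p -> norm p = 1) /\
       Sigma i (0, 0, 0) /\
       (forall t : R, Rabs t < 1 -> Sigma i (0, 0, t))) /\
    (* (i) *)
    (forall j : nat, (1 <= j <= n)%nat ->
       is_lim_seq (fun i => sqnorm_A_at (X i) (0, 0, b j)) p_infty) /\
    (* (ii) *)
    (forall delta : nat -> R,
       (forall j : nat, (1 <= j <= n)%nat -> 0 < delta j) ->
       exists C : R, forall (i : nat) (p : R3),
         Sigma i p ->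
         (forall j : nat, (1 <= j <= n)%nat -> ~ ball3 (delta j) (0, 0, b j) p) ->
         sqnorm_A_at (X i) p <= C) /\
    (* (iii) *)
    (forall i : nat, exists E1 u1 E2 u2,
       off_axis_two_graphs (Sigma i) E1 u1 E2 u2) /\
    (* (iv) *)
    exists Y : nat -> patch,
      let Slim := fun k : nat => image open_disk (Y k) in
      (forall k : nat, (1 <= k <= n + 1)%nat ->
         open_embedded_minimal_disk (Y k) /\
         (forall p : R3, Slim k p -> unit_ball p)) /\
      C2_converges_on_compacts
        (fun p => unit_ball p /\ off_planes n b p)
        (fun i p => Sigma i p /\ off_planes n b p)
        (fun p => exists k : nat, (1 <= k <= n + 1)%nat /\ Slim k p) /\
      (* (a) *)
      (forall k : nat, (1 <= k <= n)%nat ->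
         forall p : R3, Slim k p -> x3 p < b k) /\
      (forall p : R3, Slim (n + 1)%nat p -> x3 p > b n) /\
      (* (b) *)
      (forall k : nat, (1 <= k <= n + 1)%nat ->
         forall p : R3,
           (unit_ball p /\ closure3 (Slim k) p /\ ~ Slim k p) <->
           (unit_ball p /\ bounding_height n b k (x3 p))) /\
      (* (c) *)
      (forall k : nat, (1 <= k <= n + 1)%nat ->
         exists E1 u1 E2 u2,
           off_axis_two_graphs (Slim k) E1 u1 E2 u2 /\
           forall c : R, bounding_height n b k c ->
             spirals_into E1 u1 c /\ spirals_into E2 u2 c).
Proof.
  intros Hn Hball Hord.
  assert (Hb : forall j, (1 <= j <= n)%nat -> Rabs (b j) < 1).
  { intros j Hj. pose proof (Hball j Hj) as H. unfold unit_ball in H.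
    eapply Rle_lt_trans; [|exact H]. apply (coord_le_norm (0, 0, b j)). }
  exists (fun i => fam_patch n b (aseq i)). cbv zeta.
  split; [|split; [|split; [|split]]].
  - intros i. split; [exact (compact_disk n b Hn Hb i)|].
    assert (N : forall s t, closed_disk (s, t) -> norm (fam_patch n b (aseq i) s t) = norm ((s, t) : R2)).
    { intros s t H. apply (fp_norm n b Hn Hb _ s t (aseq_adm i)). apply disk_polar_dom, H. }
    split; [|split; [|split]].
    + intros p (s & t & H & <-). unfold unit_ball. rewrite N; [exact H|]. left. exact H.
    + intros p (s & t & H & <-). rewrite N; [exact H|]. right. exact H.
    + apply (disk_axis n b Hn Hb i 0). lra.
    + intros t Ht. apply Rabs_def2 in Ht. apply (disk_axis n b Hn Hb i t). lra.
  - intros j Hj. exact (curvature_blowup n b Hn Hb j Hj).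
  - intros delta Hd. exact (curvature_bound n b Hn Hb delta Hd).
  - intros i. exact (compact_graphs n b Hn Hb i).
  - exists (limit_disk n b). split; [|split; [|split; [|split; [|split]]]].
    + intros k Hk. split; [exact (limit_disk_minimal n b Hn Hb Hord k Hk)|].
      intros p Hp. apply (limit_disk_in_ball n b Hn Hb Hord k p Hk Hp).
    + exact (disks_converge n b Hn Hb Hord).
    + intros k Hk p Hp. destruct (limit_disk_in_ball n b Hn Hb Hord k p ltac:(lia) Hp) as [_ Hs].
      unfold slab_hi in Hs. destruct (le_lt_dec k n); [lra|lia].
    + intros p Hp. destruct (limit_disk_in_ball n b Hn Hb Hord (n + 1) p ltac:(lia) Hp) as [_ Hs].
      unfold slab_lo in Hs. destruct (le_lt_dec (n + 1) 1); [lia|].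
      replace (n + 1 - 1)%nat with n in Hs by lia. lra.
    + intros k Hk p. exact (limit_closure n b Hn Hb Hord k p Hk).
    + intros k Hk. exact (limit_graphs n b Hn Hb Hord k Hk).
Qed.
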